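(* Let $Z=(Z^+,Z^-)$, $Z^{\pm}=(X^{\pm},Y^{\pm})$, be a planar Filippov system with switching line $\Sigma=\{y=0\}$ and $Z^{\pm}$ analytic near the origin. Assume that $Z$ has a $(2k^+,2k^-)$-monodromic tangential singularity at the origin. Let $V_{2\ell}$ be its first non-vanishing Lyapunov coefficient, and let $\delta=\mathrm{sign}(X^+(0,0))$. Consider the 1-parameter family of Filippov systems $$Z_b(x,y)=\begin{cases}Z^+(x-b,y), & y>0,\\ Z^-(x,y), & y<0.\end{cases}$$ Then, given a neighborhood $U\subset\mathbb{R}^2$ of $(0,0)$, there exists a neighborhood $I\subset\mathbb{R}$ of $0$ such that the following statements hold for every $b\in I$: (i) If $\mathrm{sign}(b)=-\mathrm{sign}(\delta V_{2\ell})$, then $Z_b$ has a hyperbolic limit cycle in $U$ surrounding a sliding segment. In addition, the hyperbolic limit cycle is stable (resp. unstable) provided that $V_{2\ell}<0$ (resp. $V_{2\ell}>0$). (ii) If $\mathrm{sign}(b)=\mathrm{sign}(\delta V_{2\ell})$, then $Z_b$ does not have limit cycles in $U$.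
   Context: **Filippov system.** A planar piecewise smooth vector field $Z(x,y)=Z^+(x,y)=(X^+(x,y),Y^+(x,y))$ for $y>0$ and $Z(x,y)=Z^-(x,y)=(X^-(x,y),Y^-(x,y))$ for $y<0$, with trajectories defined by Filippov's convention. The switching line is $\Sigma=\{(x,y)\in\mathbb{R}^2: y=0\}$. At points of $\Sigma$ where $Y^+Y^->0$ (crossing region) trajectories of $Z^+$ and $Z^-$ are concatenated. Points of $\Sigma$ where $Y^+Y^-<0$ form the sliding region (attracting or repelling); a sliding segment is a maximal open interval of $\Sigma$ contained in the sliding region. **Monodromic tangential singularity.** For positive integers $k^+,k^-$, $Z$ has a $(2k^+,2k^-)$-monodromic tangential singularity at the origin if: (C1) $X^{\pm}(0,0)\neq 0$, $Y^{\pm}(0,0)=0$, $\frac{\partial^i Y^{\pm}}{\partial x^i}(0,0)=0$ for $i\in\{1,\ldots,2k^{\pm}-2\}$, and $\frac{\partial^{2k^{\pm}-1}Y^{\pm}}{\partial x^{2k^{\pm}-1}}(0,0)\neq 0$; (C2) $X^+(0,0)\frac{\partial^{2k^+-1}Y^+}{\partial x^{2k^+-1}}(0,0)<0$ and $X^-(0,0)\frac{\partial^{2k^--1}Y^-}{\partial x^{2k^--1}}(0,0)>0$; (C3) $X^+(0,0)X^-(0,0)<0$. **Lyapunov coefficients.** Under (C1)-(C3), for $x\ne0$ near $0$ the trajectory of $Z^{+}$ (resp. $Z^-$) through $(x,0)$, followed in $\{y\ge 0\}$ (resp. $\{y\le 0\}$) forward or backward in time as appropriate, returns to $\Sigma$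 at a nearby point $(\varphi^{+}(x),0)$ (resp. $(\varphi^-(x),0)$) on the other side of the origin. With $\varphi^{\pm}(0)=0$, the half-return maps $\varphi^{\pm}$ are involutions near $0$, analytic when $Z^{\pm}$ are analytic. With $\delta=\mathrm{sign}(X^+(0,0))=-\mathrm{sign}(X^-(0,0))$, the displacement function is $\Delta(x)=\delta(\varphi^+(x)-\varphi^-(x))$ and the Lyapunov coefficients $V_i$ are defined by $\Delta(x)=\sum_{i\ge1}V_ix^i$. The index of the first non-vanishing Lyapunov coefficient, if there is one, is always even (a known fact), hence the notation $V_{2\ell}$, $\ell\geq 1$. **Limit cycles.** A limit cycle is an isolated periodic orbit of the Filippov system. A limit cycle meeting $\Sigma$ only at crossing points is hyperbolic if it corresponds to a simple zero of the displacement function of the system (equivalently, the derivative of the first-return map on $\Sigma$ at the corresponding fixed point is different from $1$). ''Stable'' means asymptotically stable, and ''unstable'' means repelling.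
   Formalization: Statement (ii) is claimed only for neighborhoods U contained in some neighborhood U0 of the origin depending only on Z, since for large U other hyperbolic limit cycles of Z persist for small b; (i) is for every U. *)

(* Defs.v *)
From Stdlib Require Import Reals.
From Coquelicot Require Import Coquelicot.
Open Scope R_scope.

Record vfield := VField { vX : R -> R -> R; vY : R -> R -> R }.

(* Zp governs y > 0 and Zm governs y < 0; both fields are total, so that their
   values on the switching line y = 0 are also available. *)
Record filippov := Filippov { Zp : vfield; Zm : vfield }.

(* Absolute convergence makes the diagonal order of summation immaterial. *)
Definition analytic_at (f : R -> R -> R) (x0 y0 : R) : Prop :=
  exists (a : nat -> nat -> R) (r : posreal),
    forall h k : R, Rabs h < r -> Rabs k < r ->
      ex_series (fun n => sum_f_R0
        (fun i => Rabs (a i (n - i)%nat * h ^ i * k ^ (n - i))) n) /\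
      is_series (fun n => sum_f_R0
        (fun i => a i (n - i)%nat * h ^ i * k ^ (n - i)) n) (f (x0 + h) (y0 + k)).

Definition analytic_near_origin (Z : vfield) : Prop :=
  locally ((0, 0) : R * R) (fun p =>
    analytic_at (vX Z) (fst p) (snd p) /\ analytic_at (vY Z) (fst p) (snd p)).

(* The i-th partial derivative of vY Z in x at the origin. *)
Definition dxY (Z : vfield) (i : nat) : R := Derive_n (fun x => vY Z x 0) i 0.

Definition tangency_order (Z : vfield) (k : nat) : Prop :=
  vX Z 0 0 <> 0 /\ vY Z 0 0 = 0 /\
  (forall i : nat, (1 <= i <= 2 * k - 2)%nat -> dxY Z i = 0) /\
  dxY Z (2 * k - 1) <> 0.

Definition monodromic_tangential (Z : filippov) (kp km : nat) : Prop :=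
  (1 <= kp)%nat /\ (1 <= km)%nat /\
  (tangency_order (Zp Z) kp /\ tangency_order (Zm Z) km) /\
  (vX (Zp Z) 0 0 * dxY (Zp Z) (2 * kp - 1) < 0 /\
   vX (Zm Z) 0 0 * dxY (Zm Z) (2 * km - 1) > 0) /\
  vX (Zp Z) 0 0 * vX (Zm Z) 0 0 < 0.

Definition between (T t : R) : Prop := Rmin 0 T <= t <= Rmax 0 T.

(* (u, v) runs from (x, 0) to (x', 0) along Z, inside s * y > 0 except at its two
   end points, where s is 1 or -1. A negative T means backward in time. *)
Definition return_arc (s : R) (Z : vfield) (x x' T : R) (u v : R -> R) : Prop :=
  T <> 0 /\
  (forall t, between T t ->
     is_derive u t (vX Z (u t) (v t)) /\ is_derive v t (vY Z (u t) (v t))) /\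
  u 0 = x /\ v 0 = 0 /\ u T = x' /\ v T = 0 /\
  (forall t, Rmin 0 T < t < Rmax 0 T -> 0 < s * v t).

(* phi is (a representative of the germ at 0 of) the half-return map of Z in
   s * y >= 0; the bound by eps says that the return is to a nearby point,
   through points near the origin. *)
Definition half_return_map (s : R) (Z : vfield) (phi : R -> R) : Prop :=
  phi 0 = 0 /\
  forall eps : posreal, exists r : posreal, forall x : R, 0 < Rabs x < r ->
    x * phi x < 0 /\
    exists (T : R) (u v : R -> R),
      return_arc s Z x (phi x) T u v /\
      (forall t, between T t -> Rabs (u t) < eps /\ Rabs (v t) < eps).

Definition delta (Z : filippov) : R := sign (vX (Zp Z) 0 0).

Definition displacement (Z : filippov) (phip phim : R -> R) (x : R) : R :=
  delta Z * (phip x - phim x).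

(* The displacement vanishes at 0, which forces V 0 = 0. *)
Definition lyapunov_coefficients (Z : filippov) (V : nat -> R) : Prop :=
  exists phip phim : R -> R,
    half_return_map 1 (Zp Z) phip /\ half_return_map (-1) (Zm Z) phim /\
    exists r : posreal, forall x : R, Rabs x < r ->
      is_pseries V x (displacement Z phip phim x).

Definition first_nonvanishing (V : nat -> R) (n : nat) : Prop :=
  (forall i : nat, (1 <= i < n)%nat -> V i = 0) /\ V n <> 0.

Definition shift_family (Z : filippov) (b : R) : filippov :=
  Filippov (VField (fun x y => vX (Zp Z) (x - b) y) (fun x y => vY (Zp Z) (x - b) y))
           (Zm Z).

(* Filippov's convention: trajectories are the absolutely continuous solutions of
   the differential inclusion whose right-hand side on y = 0 is the segment
   joining the two one-sided values of the field. *)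
Definition filippov_rhs (Z : filippov) (x y p q : R) : Prop :=
  (0 < y -> p = vX (Zp Z) x y /\ q = vY (Zp Z) x y) /\
  (y < 0 -> p = vX (Zm Z) x y /\ q = vY (Zm Z) x y) /\
  (y = 0 -> exists l : R, 0 <= l <= 1 /\
     p = l * vX (Zp Z) x y + (1 - l) * vX (Zm Z) x y /\
     q = l * vY (Zp Z) x y + (1 - l) * vY (Zm Z) x y).

Definition lebesgue_null (N : R -> Prop) : Prop :=
  forall eps : posreal, exists (a b : nat -> R) (l : R),
    (forall n, a n <= b n) /\
    (forall t, N t -> exists n, a n < t < b n) /\
    is_series (fun n => b n - a n) l /\ l < eps.

(* Finite families of non-overlapping intervals are listed from left to right. *)
Definition abs_continuous_on (f : R -> R) (a b : R) : Prop :=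
  forall eps : posreal, exists d : posreal, forall (n : nat) (s t : nat -> R),
    (forall i, (i <= n)%nat -> a <= s i /\ s i <= t i /\ t i <= b) ->
    (forall i, (i < n)%nat -> t i <= s (S i)) ->
    sum_f_R0 (fun i => t i - s i) n < d ->
    sum_f_R0 (fun i => Rabs (f (t i) - f (s i))) n < eps.

Definition trajectory_on (Z : filippov) (u v : R -> R) (a b : R) : Prop :=
  abs_continuous_on u a b /\ abs_continuous_on v a b /\
  lebesgue_null (fun t => a < t < b /\
    ~ (exists p q : R, is_derive u t p /\ is_derive v t q /\
         filippov_rhs Z (u t) (v t) p q)).

Definition periodic_orbit (Z : filippov) (G : R * R -> Prop) : Prop :=
  exists (u v : R -> R) (T : R),
    0 < T /\
    (forall a b : R, a < b -> trajectory_on Z u v a b) /\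
    (forall t, u (t + T) = u t /\ v (t + T) = v t) /\
    (exists t, (u t, v t) <> (u 0, v 0)) /\
    (forall p, G p <-> exists t, p = (u t, v t)).

Definition tube (G : R * R -> Prop) (eps : R) (p : R * R) : Prop :=
  exists q : R * R, G q /\ ball q eps p.

Definition limit_cycle (Z : filippov) (G : R * R -> Prop) : Prop :=
  periodic_orbit Z G /\
  exists eps : posreal, forall G' : R * R -> Prop,
    periodic_orbit Z G' -> (forall p, G' p -> tube G eps p) ->
    forall p, G' p <-> G p.

Definition crossing (Z : filippov) (x : R) : Prop := vY (Zp Z) x 0 * vY (Zm Z) x 0 > 0.

Definition sliding (Z : filippov) (x : R) : Prop := vY (Zp Z) x 0 * vY (Zm Z) x 0 < 0.

(* The sliding segment is { (x, 0) | a < x < c }. *)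
Definition sliding_segment (Z : filippov) (a c : R) : Prop :=
  a < c /\ (forall x, a < x < c -> sliding Z x) /\
  (forall a' c', a' <= a -> c <= c' ->
     (forall x, a' < x < c' -> sliding Z x) -> a' = a /\ c' = c).

(* p lies in a bounded (path-)component of the complement of G. *)
Definition encloses (G : R * R -> Prop) (p : R * R) : Prop :=
  ~ G p /\
  exists M : R, forall c : R -> R * R,
    (forall t, continuous c t) -> c 0 = p ->
    (forall t, 0 <= t <= 1 -> ~ G (c t)) -> ball ((0, 0) : R * R) M (c 1).

Definition surrounds_sliding_segment (Z : filippov) (G : R * R -> Prop) : Prop :=
  exists a c : R, sliding_segment Z a c /\
    forall x, a < x < c -> encloses G (x, 0).

(* G is the union of the two arcs issuing from the crossing point (x0, 0), which
   close up; phip and phim are the half-return maps near x0, and x0 is a simple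
   zero of the displacement function they define. *)
Definition hyperbolic (Z : filippov) (G : R * R -> Prop) : Prop :=
  (forall x, G (x, 0) -> crossing Z x) /\
  exists (x0 : R) (phip phim : R -> R) (r : posreal),
    (forall x, Rabs (x - x0) < r ->
       (exists T u v, return_arc 1 (Zp Z) x (phip x) T u v) /\
       (exists T u v, return_arc (-1) (Zm Z) x (phim x) T u v)) /\
    (exists Tp up vp Tm um vm,
       return_arc 1 (Zp Z) x0 (phip x0) Tp up vp /\
       return_arc (-1) (Zm Z) x0 (phim x0) Tm um vm /\
       forall p, G p <->
         (exists t, between Tp t /\ p = (up t, vp t)) \/
         (exists t, between Tm t /\ p = (um t, vm t))) /\
    displacement Z phip phim x0 = 0 /\
    exists d : R, is_derive (displacement Z phip phim) x0 d /\ d <> 0.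

Definition asymptotically_stable (Z : filippov) (G : R * R -> Prop) : Prop :=
  (forall eps : posreal, exists d : posreal, forall (u v : R -> R) (T : R),
     0 < T -> trajectory_on Z u v 0 T -> tube G d (u 0, v 0) ->
     forall t, 0 <= t <= T -> tube G eps (u t, v t)) /\
  (exists d : posreal, forall u v : R -> R,
     (forall T, 0 < T -> trajectory_on Z u v 0 T) -> tube G d (u 0, v 0) ->
     forall eps : posreal, exists t0 : R, forall t, t0 <= t -> 0 <= t ->
       tube G eps (u t, v t)).

Definition opposite_field (Z : vfield) : vfield :=
  VField (fun x y => - vX Z x y) (fun x y => - vY Z x y).

Definition time_reversal (Z : filippov) : filippov :=
  Filippov (opposite_field (Zp Z)) (opposite_field (Zm Z)).

Definition repelling (Z : filippov) (G : R * R -> Prop) : Prop :=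
  asymptotically_stable (time_reversal Z) G.

(* Main.v *)
From Stdlib Require Import Reals Lra Lia ZArith Compare_dec ClassicalEpsilon FunctionalExtensionality PropExtensionality.
From Coquelicot Require Import Coquelicot.
Require Import Defs.
Open Scope R_scope.

(** Write phip and phim for the half-return maps of Z, delta for the common direction sign, D = phip - phim
    and v = delta V_(2 l), so that D = v x^(2 l) + ... by the definition of the Lyapunov coefficients. The
    half-return maps of the shifted system are x -> phip (x - b) + b and phim, with folds at b and 0; so a
    closed curve made of two arcs, one on each side, corresponds to a zero x < min (0, b) of
<<
      shifted b x = D x + (phip (x - b) + b - phip x).
>>
    As phip is decreasing, the correction in parentheses has the sign of b and is at least |b| in absolute
    value; and D has the sign of v to the left of 0, as 2 l is even. If b v > 0 there is no zero
    (shifted_same_sign). If b v < 0, D dominates away from 0 and the correction dominates at distance 2 |b|, so there is a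
    zero (shifted_zero_exists). At every zero |b| <= 2 |v| |x|^(2 l); since the derivative of phip varies by at most
    |b| / (4 |x|) between x - b and x, the derivative of D, of size |x|^(2 l - 1), prevails, and the zero is
    simple and unique (shifted_zero_unique).

    The estimate on the derivative of phip (dphi_modulus) is the quantitative heart. On each side the orbits are
    graphs of solutions of dy / dx = F (x, y), with F (x, 0) of odd order n at the fold. Comparing neighbouring
    arcs to first order (first_variation) gives phip' (a) = F (a, 0) e^E / F (phip a, 0), where E is the integral of
    the y-derivative of F along the arc. This is (a / phip a)^n times a Lipschitz factor, and phip a / a tends to - 1
    (ratio_limit), because to leading order the arcs are level lines of y + c x^(n + 1). Only a Lipschitz derivative of
    F in y is used apart from its form on the line; both come from analyticity (analytic_lip_deriv).

    It remains to relate zeros of the displacement to limit cycles in the sense of Filippov, where trajectories are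
    merely absolutely continuous and may slide. A trajectory solves the classical equation off the line and
    crosses the line at crossing points (traj_motion), where it is therefore unique (follow_return). A small
    periodic orbit cannot lie in the line (leaves_line), so its leftmost and rightmost points lie on the line beyond
    both folds, and nesting of arcs shows that both half-return maps take one to the other
    (periodic_returns). Hence it comes from a zero, and is the loop formed by the two arcs (orbit_is_loop): this yields
    (ii), and in (i) the isolation of the loop. Conversely the loop at the zero of the displacement is a periodic
    orbit (loop_periodic), hyperbolic as the zero is simple, and encloses the segment between the folds 0 and b, which
    is the sliding segment (loop_surrounds).

    For stability (loop_stable), the points near the loop are labelled by the left ends of the arcs through them; a
    trajectory turns around the loop along such arcs, and after each turn its label is closer to the zero, as the
    displacement has opposite signs on the two sides of the zero. The case V_(2 l) > 0 is the same statement for the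
    reversed system, whose half-return maps are the same. *)

(** * Calculus on segments *)

Ltac Rmin_bounds a b := pose proof (Rmin_l a b); pose proof (Rmin_r a b).

Lemma Rmin_pair a b : 0 < a -> 0 < b -> 0 < Rmin a b /\ Rmin a b <= a /\ Rmin a b <= b.
Proof. intros. split; [apply Rmin_pos; auto|]. split; [apply Rmin_l|apply Rmin_r]. Qed.

Lemma Rmin_triple a b c : 0 < a -> 0 < b -> 0 < c ->
  0 < Rmin a (Rmin b c) /\ Rmin a (Rmin b c) <= a /\ Rmin a (Rmin b c) <= b /\ Rmin a (Rmin b c) <= c.
Proof.
  intros. destruct (Rmin_pair b c) as (? & ? & ?); auto.
  destruct (Rmin_pair a (Rmin b c)) as (? & ? & ?); auto. repeat split; lra.
Qed.

(** One-sided at the end points: a trajectory given on [a, b] is only continuous in this sense. *)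
Definition cont_seg (f : R -> R) (a b : R) : Prop :=
  forall t, a <= t <= b -> forall eps, 0 < eps -> exists d, 0 < d /\
    forall t', a <= t' <= b -> Rabs (t' - t) < d -> Rabs (f t' - f t) < eps.

Lemma is_derive_eq (f : R -> R) (x l l' : R) : is_derive f x l -> l = l' -> is_derive f x l'.
Proof. intros H <-; exact H. Qed.

Lemma is_derive_Rmult (f g : R -> R) (x a b : R) : is_derive f x a -> is_derive g x b ->
  is_derive (fun t => f t * g t) x (a * g x + f x * b).
Proof.
  intros Hf Hg. apply is_derive_Reals in Hf. apply is_derive_Reals in Hg. apply is_derive_Reals.
  apply (derivable_pt_lim_mult f g x a b); assumption.
Qed.

Lemma is_derive_Rplus (f g : R -> R) (x a b : R) : is_derive f x a -> is_derive g x b ->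
  is_derive (fun t => f t + g t) x (a + b).
Proof. exact (is_derive_plus f g x a b). Qed.

Lemma is_derive_Rminus (f g : R -> R) (x a b : R) : is_derive f x a -> is_derive g x b ->
  is_derive (fun t => f t - g t) x (a - b).
Proof. exact (is_derive_minus f g x a b). Qed.

Lemma is_derive_Rscal (c : R) (f : R -> R) (x a : R) : is_derive f x a ->
  is_derive (fun t => c * f t) x (c * a).
Proof. exact (is_derive_scal f x c a). Qed.

Lemma is_derive_Rcomp (f g : R -> R) (x a b : R) : is_derive f (g x) a -> is_derive g x b ->
  is_derive (fun t => f (g t)) x (a * b).
Proof.
  intros Hf Hg. apply is_derive_Reals in Hf. apply is_derive_Reals in Hg. apply is_derive_Reals.
  apply (derivable_pt_lim_comp g f x b a); assumption.
Qed.

Lemma is_derive_exp_lin (k x : R) : is_derive (fun t => exp (k * t)) x (k * exp (k * x)).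
Proof. auto_derive; auto; ring. Qed.

Definition clamp (a b x : R) : R := Rmax a (Rmin b x).

Lemma clamp_in a b x : a <= b -> a <= clamp a b x <= b.
Proof. intros; unfold clamp, Rmax, Rmin; repeat destruct (Rle_dec _ _); lra. Qed.

Lemma clamp_id a b x : a <= x <= b -> clamp a b x = x.
Proof. intros; unfold clamp, Rmax, Rmin; repeat destruct (Rle_dec _ _); lra. Qed.

Lemma clamp_lip a b x y : Rabs (clamp a b x - clamp a b y) <= Rabs (x - y).
Proof.
  unfold clamp, Rmax, Rmin, Rabs; repeat destruct (Rle_dec _ _);
  repeat destruct (Rcase_abs _); lra.
Qed.

Lemma continuity_pt_eps (f : R -> R) x :
  continuity_pt f x <->
  (forall eps, 0 < eps -> exists d, 0 < d /\
     forall y, Rabs (y - x) < d -> Rabs (f y - f x) < eps).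
Proof.
  split.
  - intros H eps He. destruct (H eps He) as [d [Hd H']]. exists d; split; [exact Hd|].
    intros y Hy. destruct (Req_dec y x) as [->|Hn].
    + unfold Rminus; rewrite Rplus_opp_r, Rabs_R0; exact He.
    + apply H'. split; [split; [exact I|auto]|exact Hy].
  - intros H eps He. destruct (H eps He) as [d [Hd H']]. exists d; split; [exact Hd|].
    intros y [_ Hy]. apply H', Hy.
Qed.

Lemma continuity_pt_seg (f : R -> R) a b :
  (forall x, a <= x <= b -> continuity_pt f x) -> cont_seg f a b.
Proof.
  intros H t Ht eps He. destruct (proj1 (continuity_pt_eps f t) (H t Ht) eps He) as [d [Hd H']].
  exists d; split; auto.
Qed.

Lemma derive_seg (f : R -> R) a b :
  (forall x, a <= x <= b -> exists l : R, is_derive f x l) -> cont_seg f a b.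
Proof.
  intros H. apply continuity_pt_seg. intros x Hx. destruct (H x Hx) as [l Hl].
  apply continuity_pt_filterlim. apply (ex_derive_continuous (K:=R_AbsRing) (V:=R_NormedModule) f x). exists l; exact Hl.
Qed.

(** Precomposition with the projection onto [a, b] extends a function continuous on the segment to a
    function continuous on the line, to which the usual theorems apply. *)
Lemma seg_clamp f a b : a <= b -> cont_seg f a b ->
  forall x, continuity_pt (fun t => f (clamp a b t)) x.
Proof.
  intros Hab H x. apply continuity_pt_eps. intros eps He.
  destruct (H (clamp a b x) (clamp_in a b x Hab) eps He) as [d [Hd H']].
  exists d; split; auto. intros y Hy. apply H'; [apply clamp_in; auto|].
  eapply Rle_lt_trans; [apply clamp_lip|exact Hy].
Qed.

Lemma cont_seg_sub f a b a' b' : a <= a' -> b' <= b -> cont_seg f a b -> cont_seg f a' b'.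
Proof.
  intros Ha Hb H t Ht eps He. destruct (H t ltac:(lra) eps He) as [d [Hd H']].
  exists d; split; auto. intros; apply H'; auto; lra.
Qed.

Lemma cont_seg_ext f g a b : (forall t, a <= t <= b -> f t = g t) -> cont_seg f a b -> cont_seg g a b.
Proof.
  intros E H t Ht eps He. destruct (H t Ht eps He) as [d [Hd H']].
  exists d; split; auto. intros. rewrite <- !E; auto.
Qed.

Lemma cont_seg_of_clamp f a b : a <= b ->
  (forall x, continuity_pt (fun t => f (clamp a b t)) x) -> cont_seg f a b.
Proof.
  intros Hab H. apply cont_seg_ext with (fun t => f (clamp a b t)).
  - intros; rewrite clamp_id; auto.
  - apply continuity_pt_seg; auto.
Qed.

Lemma lip_continuity_pt f K x : 0 <= K -> (forall y, Rabs (f y - f x) <= K * Rabs (y - x)) -> continuity_pt f x.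
Proof.
  intros HK H. apply continuity_pt_eps. intros e He. exists (e / (K + 1)).
  split; [apply Rdiv_lt_0_compat; lra|]. intros y Hy. eapply Rle_lt_trans; [apply H|].
  assert (E : (K + 1) * (e / (K + 1)) = e) by (field; lra). pose proof (Rabs_pos (y - x)).
  apply Rle_lt_trans with ((K + 1) * Rabs (y - x)); [nra|]. rewrite <- E. apply Rmult_lt_compat_l; lra.
Qed.

Lemma lip_cont_seg f K a b : 0 <= K -> a <= b ->
  (forall x y, a <= x <= b -> a <= y <= b -> Rabs (f x - f y) <= K * Rabs (x - y)) -> cont_seg f a b.
Proof.
  intros HK Hab H. apply cont_seg_of_clamp; auto. intros x. apply lip_continuity_pt with K; auto. intros y.
  eapply Rle_trans; [apply H; apply clamp_in; auto|]. apply Rmult_le_compat_l; [auto|apply clamp_lip].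
Qed.

Lemma cont_seg_plus f g a b : a <= b -> cont_seg f a b -> cont_seg g a b ->
  cont_seg (fun t => f t + g t) a b.
Proof.
  intros Hab Hf Hg. apply cont_seg_of_clamp; auto. intros x.
  apply (continuity_pt_plus (fun t => f (clamp a b t)) (fun t => g (clamp a b t)));
  apply seg_clamp; auto.
Qed.

Lemma cont_seg_minus f g a b : a <= b -> cont_seg f a b -> cont_seg g a b ->
  cont_seg (fun t => f t - g t) a b.
Proof.
  intros Hab Hf Hg. apply cont_seg_of_clamp; auto. intros x.
  apply (continuity_pt_minus (fun t => f (clamp a b t)) (fun t => g (clamp a b t)));
  apply seg_clamp; auto.
Qed.

Lemma cont_seg_mult f g a b : a <= b -> cont_seg f a b -> cont_seg g a b ->
  cont_seg (fun t => f t * g t) a b.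
Proof.
  intros Hab Hf Hg. apply cont_seg_of_clamp; auto. intros x.
  apply (continuity_pt_mult (fun t => f (clamp a b t)) (fun t => g (clamp a b t)));
  apply seg_clamp; auto.
Qed.

Lemma cont_seg_const c a b : cont_seg (fun _ => c) a b.
Proof.
  intros t Ht eps He. exists 1; split; [lra|]. intros.
  unfold Rminus; rewrite Rplus_opp_r, Rabs_R0; auto.
Qed.

Lemma seg_IVT f a b y : a <= b -> cont_seg f a b -> Rmin (f a) (f b) <= y <= Rmax (f a) (f b) ->
  exists x, a <= x <= b /\ f x = y.
Proof.
  intros Hab H Hy.
  destruct (IVT_gen (fun t => f (clamp a b t)) a b y) as [x [Hx E]].
  - intro x; apply seg_clamp; auto.
  - rewrite !clamp_id by lra. exact Hy.
  - exists (clamp a b x). split; auto. apply clamp_in; auto.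
Qed.

(** The mean value theorem with continuity up to the end points and differentiability inside only. *)
Lemma seg_MVT f df a b : a < b -> cont_seg f a b ->
  (forall x, a < x < b -> is_derive f x (df x)) ->
  exists c, a < c < b /\ f b - f a = df c * (b - a).
Proof.
  intros Hab Hc Hd.
  set (sel := fun x => if Rlt_dec a x then (if Rlt_dec x b then x else (a + b) / 2) else (a+b)/2).
  destruct (MVT_gen (fun t => f (clamp a b t)) a b (fun x => df (sel x))) as [c [Hc' E]].
  - intros x. rewrite Rmin_left, Rmax_right by lra. intros Hx.
    unfold sel. destruct (Rlt_dec a x); [|lra]. destruct (Rlt_dec x b); [|lra].
    apply is_derive_ext_loc with f; [|apply Hd; lra].
    assert (He : 0 < Rmin (x - a) (b - x)) by (apply Rmin_pos; lra).
    exists (mkposreal _ He). intros y Hy.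
    assert (Hy' : Rabs (y - x) < Rmin (x - a) (b - x)) by exact Hy.
    Rmin_bounds (x - a) (b - x).
    apply Rabs_def2 in Hy'. rewrite clamp_id; auto; lra.
  - intros x _. apply seg_clamp; auto; lra.
  - exists (sel c). split.
    + unfold sel. repeat destruct (Rlt_dec _ _); lra.
    + rewrite !clamp_id in E by lra. exact E.
Qed.

Lemma seg_ge f m a b : a <= b -> cont_seg f a b ->
  (forall x, a < x < b -> exists l : R, is_derive f x l /\ m <= l) ->
  m * (b - a) <= f b - f a.
Proof.
  intros Hab Hc Hd. destruct (Req_dec a b) as [<-|Hn]; [lra|].
  destruct (seg_MVT f (Derive f) a b) as [c [Hc' E]]; auto; [lra| |].
  - intros x Hx. destruct (Hd x Hx) as [l [Hl _]]. apply Derive_correct. exists l; auto.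
  - rewrite E. destruct (Hd c Hc') as [l [Hl Hm]]. rewrite (is_derive_unique _ _ _ Hl).
    apply Rmult_le_compat_r; lra.
Qed.

Lemma seg_le f m a b : a <= b -> cont_seg f a b ->
  (forall x, a < x < b -> exists l : R, is_derive f x l /\ l <= m) ->
  f b - f a <= m * (b - a).
Proof.
  intros Hab Hc Hd. destruct (Req_dec a b) as [<-|Hn]; [lra|].
  destruct (seg_MVT f (Derive f) a b) as [c [Hc' E]]; auto; [lra| |].
  - intros x Hx. destruct (Hd x Hx) as [l [Hl _]]. apply Derive_correct. exists l; auto.
  - rewrite E. destruct (Hd c Hc') as [l [Hl Hm]]. rewrite (is_derive_unique _ _ _ Hl).
    apply Rmult_le_compat_r; lra.
Qed.

Lemma seg_abs f m a b : a <= b -> cont_seg f a b ->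
  (forall x, a < x < b -> exists l : R, is_derive f x l /\ Rabs l <= m) ->
  Rabs (f b - f a) <= m * (b - a).
Proof.
  intros Hab Hc Hd. apply Rabs_le. split.
  - replace (- (m * (b - a))) with ((- m) * (b - a)) by ring. apply seg_ge; auto.
    intros x Hx. destruct (Hd x Hx) as [l [Hl Hm]]. exists l; split; auto.
    apply Rabs_le_between in Hm; lra.
  - apply seg_le; auto. intros x Hx. destruct (Hd x Hx) as [l [Hl Hm]]. exists l; split; auto.
    apply Rabs_le_between in Hm; lra.
Qed.

Lemma derive_lip f K x y :
  (forall z, Rmin x y <= z <= Rmax x y -> exists l : R, is_derive f z l /\ Rabs l <= K) ->
  Rabs (f x - f y) <= K * Rabs (x - y).
Proof.
  assert (Hgen : forall x y, x <= y -> (forall z, x <= z <= y -> exists l : R, is_derive f z l /\ Rabs l <= K) ->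
    Rabs (f y - f x) <= K * (y - x)).
  { clear x y. intros x y Hxy H. apply seg_abs; auto.
    - apply derive_seg. intros z Hz. destruct (H z Hz) as [l [Hl _]]. exists l; auto.
    - intros z Hz. apply H; lra. }
  intros H. destruct (Rle_dec x y).
  - rewrite Rmin_left, Rmax_right in H by lra.
    rewrite (Rabs_minus_sym (f x)), (Rabs_minus_sym x), (Rabs_pos_eq (y - x)) by lra. auto.
  - rewrite Rmin_right, Rmax_left in H by lra. rewrite (Rabs_pos_eq (x - y)) by lra. apply Hgen; auto; lra.
Qed.

Lemma cont_seg_exp k a b : cont_seg (fun t => exp (k * t)) a b.
Proof. apply derive_seg. intros x _. eexists. auto_derive; auto. Qed.

Lemma cont_seg_rev f a b : cont_seg f a b -> cont_seg (fun t => f (- t)) (- b) (- a).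
Proof.
  intros H t Ht eps He. destruct (H (- t) ltac:(lra) eps He) as [d [Hd H']].
  exists d; split; auto. intros t' Ht' Hd'. apply H'; [lra|].
  replace (- t' - - t) with (- (t' - t)) by ring. rewrite Rabs_Ropp; auto.
Qed.

Lemma is_derive_rev (f : R -> R) (t l : R) : is_derive f (- t) l -> is_derive (fun t => f (- t)) t (- l).
Proof.
  intros H. eapply is_derive_eq.
  - apply (is_derive_Rcomp f (fun t => - t) t l (-1) H). auto_derive; auto.
  - simpl; ring.
Qed.

(** Gronwall: D (t) exp (- K t) is nonincreasing. *)
Lemma growth D K a b : a <= b -> cont_seg D a b ->
  (forall t, a < t < b -> exists l : R, is_derive D t l /\ l <= K * D t) ->
  D b <= D a * exp (K * (b - a)).
Proof.
  intros Hab Hc Hd.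
  assert (H : (fun t => D t * exp (- K * t)) b - (fun t => D t * exp (- K * t)) a <= 0 * (b - a)).
  { apply (seg_le (fun t => D t * exp (- K * t))); auto.
    - apply (cont_seg_mult D (fun t => exp (- K * t))); auto. apply cont_seg_exp.
    - intros t Ht. destruct (Hd t Ht) as [l [Hl Hm]].
      exists ((l - K * D t) * exp (- K * t)). split.
      + eapply is_derive_eq. { apply is_derive_Rmult; [exact Hl|apply is_derive_exp_lin]. }
        simpl; ring.
      + pose proof (exp_pos (- K * t)). nra. }
  simpl in H. rewrite Rmult_0_l in H.
  pose proof (exp_pos (K * b)).
  assert (E1 : exp (- K * b) * exp (K * b) = 1).
  { rewrite <- exp_plus. replace (- K * b + K * b) with 0 by ring. apply exp_0. }
  assert (E2 : exp (- K * a) * exp (K * b) = exp (K * (b - a))).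
  { rewrite <- exp_plus. f_equal; ring. }
  rewrite <- E2. replace (D b) with (D b * (exp (- K * b) * exp (K * b))) by (rewrite E1; ring).
  nra.
Qed.

Lemma growth_rev D K a b : a <= b -> cont_seg D a b ->
  (forall t, a < t < b -> exists l : R, is_derive D t l /\ - K * D t <= l) ->
  D a <= D b * exp (K * (b - a)).
Proof.
  intros Hab Hc Hd.
  assert (H := growth (fun t => D (- t)) K (- b) (- a) ltac:(lra) (cont_seg_rev D a b Hc)).
  cbv beta in H. rewrite !Ropp_involutive in H. replace (b - a) with (- a - - b) by ring. apply H.
  intros t Ht. destruct (Hd (- t) ltac:(lra)) as [l [Hl Hm]]. exists (- l). split; [|lra].
  apply is_derive_rev; auto.
Qed.

(** A quantity w with |w'| <= L |w| varies by a factor at most exp (L (b - a)), in both directions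
    of time: apply Gronwall to the differentiable function w w. *)
Lemma abs_growth w L a b : 0 <= L -> a <= b -> cont_seg w a b ->
  (forall t, a < t < b -> exists l : R, is_derive w t l /\ Rabs l <= L * Rabs (w t)) ->
  Rabs (w b) <= Rabs (w a) * exp (L * (b - a)) /\
  Rabs (w a) <= Rabs (w b) * exp (L * (b - a)).
Proof.
  intros HL Hab Hc Hd.
  assert (Hsq : forall t, a < t < b -> exists l : R, is_derive (fun t => w t * w t) t l /\
             Rabs l <= 2 * L * (w t * w t)).
  { intros t Ht. destruct (Hd t Ht) as [l [Hl Hm]]. exists (2 * w t * l). split.
    - eapply is_derive_eq. { apply is_derive_Rmult; exact Hl. } simpl; ring.
    - rewrite !Rabs_mult, (Rabs_pos_eq 2) by lra.
      replace (w t * w t) with (Rabs (w t) * Rabs (w t))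
        by (rewrite <- Rabs_mult; apply Rabs_pos_eq; apply Rle_0_sqr).
      pose proof (Rabs_pos (w t)). nra. }
  assert (Hcc := cont_seg_mult w w a b Hab Hc Hc).
  assert (E : exp (2 * L * (b - a)) = exp (L * (b - a)) * exp (L * (b - a))).
  { rewrite <- exp_plus. f_equal; ring. }
  pose proof (exp_pos (L * (b - a))) as Hp.
  split; apply Rsqr_incr_0_var; try (apply Rmult_le_pos; [apply Rabs_pos|lra]);
    unfold Rsqr.
  - assert (H := growth (fun t => w t * w t) (2 * L) a b Hab Hcc).
    rewrite E in H. rewrite <- !Rabs_mult. rewrite Rabs_pos_eq by apply Rle_0_sqr.
    replace (Rabs (w a) * exp (L * (b - a)) * (Rabs (w a) * exp (L * (b - a))))
      with (w a * w a * (exp (L * (b - a)) * exp (L * (b - a)))).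
    + apply H. intros t Ht. destruct (Hsq t Ht) as [l [Hl Hm]]. exists l; split; auto.
      apply Rabs_le_between in Hm; lra.
    + replace (w a * w a) with (Rabs (w a) * Rabs (w a)); [ring|].
      rewrite <- Rabs_mult; apply Rabs_pos_eq; apply Rle_0_sqr.
  - assert (H := growth_rev (fun t => w t * w t) (2 * L) a b Hab Hcc).
    rewrite E in H. rewrite <- !Rabs_mult. rewrite Rabs_pos_eq by apply Rle_0_sqr.
    replace (Rabs (w b) * exp (L * (b - a)) * (Rabs (w b) * exp (L * (b - a))))
      with (w b * w b * (exp (L * (b - a)) * exp (L * (b - a)))).
    + apply H. intros t Ht. destruct (Hsq t Ht) as [l [Hl Hm]]. exists l; split; auto.
      apply Rabs_le_between in Hm; lra.
    + replace (w b * w b) with (Rabs (w b) * Rabs (w b)); [ring|].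
      rewrite <- Rabs_mult; apply Rabs_pos_eq; apply Rle_0_sqr.
Qed.

(** A solution of such a differential inequality cannot reach 0, since from 0 it could never come
    back. *)
Lemma pos_persist w L a b : 0 <= L -> a <= b -> cont_seg w a b ->
  (forall t, a < t < b -> exists l : R, is_derive w t l /\ Rabs l <= L * Rabs (w t)) ->
  0 < w a -> 0 < w b.
Proof.
  intros HL Hab Hc Hd Ha. destruct (Rlt_le_dec 0 (w b)) as [|Hb]; auto. exfalso.
  destruct (seg_IVT w a b 0 Hab Hc) as [x [Hx E]].
  { rewrite Rmin_right, Rmax_left by lra. lra. }
  destruct (abs_growth w L a x HL (proj1 Hx)) as [_ H].
  - apply cont_seg_sub with a b; auto; lra.
  - intros t Ht; apply Hd; lra.
  - rewrite E, Rabs_R0, Rmult_0_l in H. rewrite Rabs_pos_eq in H; lra.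
Qed.

(** Induction along a segment: the supremum of the points up to which P holds is itself one of them,
    and cannot be interior. *)
Lemma real_induct (P : R -> Prop) a b : a <= b -> P a ->
  (forall t, a <= t < b -> (forall t', a <= t' <= t -> P t') ->
     exists d, 0 < d /\ forall t', t < t' < t + d -> t' <= b -> P t') ->
  (forall t, a < t <= b -> (forall t', a <= t' < t -> P t') -> P t) ->
  forall t, a <= t <= b -> P t.
Proof.
  intros Hab Ha Hr Hl.
  destruct (completeness (fun s => a <= s <= b /\ forall t', a <= t' <= s -> P t')) as [m [Hm1 Hm2]].
  - exists b. intros s [Hs _]; lra.
  - exists a. split; [lra|]. intros t' Ht'. replace t' with a by lra; auto.
  - assert (Ham : a <= m). { apply Hm1. split; [lra|]. intros t' Ht'. replace t' with a by lra; auto. }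
    assert (Hmb : m <= b). { apply Hm2. intros s [Hs _]; lra. }
    assert (Hbelow : forall t', a <= t' < m -> P t').
    { intros t' Ht'. destruct (excluded_middle_informative (P t')) as [|Hn]; auto. exfalso.
      assert (m <= t'); [|lra]. apply Hm2. intros s [Hs1 Hs2].
      destruct (Rle_lt_dec s t'); auto. exfalso. apply Hn, Hs2. lra. }
    assert (HPm : P m).
    { destruct (Req_dec a m) as [<-|Hn]; auto. apply Hl; auto; lra. }
    assert (Hall : forall t', a <= t' <= m -> P t').
    { intros t' Ht'. destruct (Req_dec t' m) as [->|Hn]; auto. apply Hbelow; lra. }
    destruct (Req_dec m b) as [<-|Hn]; auto.
    destruct (Hr m ltac:(lra) Hall) as [d [Hd H]].
    set (s := Rmin b (m + d / 2)).
    assert (Hs : m < s <= b /\ s < m + d).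
    { unfold s, Rmin. destruct (Rle_dec _ _); lra. }
    assert (s <= m); [|lra]. apply Hm1. split; [lra|].
    intros t' Ht'. destruct (Rle_lt_dec t' m). { apply Hall; lra. } apply H; lra.
Qed.

Lemma seg_max f a b : a <= b -> cont_seg f a b ->
  exists x, a <= x <= b /\ forall y, a <= y <= b -> f y <= f x.
Proof.
  intros Hab Hc.
  destruct (continuity_ab_maj (fun t => f (clamp a b t)) a b Hab) as [x [Hx1 Hx2]].
  { intros; apply seg_clamp; auto. }
  exists x; split; auto. intros y Hy. specialize (Hx1 y Hy).
  rewrite !clamp_id in Hx1; auto.
Qed.

Lemma seg_min f a b : a <= b -> cont_seg f a b ->
  exists x, a <= x <= b /\ forall y, a <= y <= b -> f x <= f y.
Proof.
  intros Hab Hc.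
  destruct (continuity_ab_min (fun t => f (clamp a b t)) a b Hab) as [x [Hx1 Hx2]].
  { intros; apply seg_clamp; auto. }
  exists x; split; auto. intros y Hy. specialize (Hx1 y Hy).
  rewrite !clamp_id in Hx1; auto.
Qed.

Lemma pos_lower_bound f a b : a <= b -> cont_seg f a b -> (forall x, a <= x <= b -> 0 < f x) ->
  exists m, 0 < m /\ forall x, a <= x <= b -> m <= f x.
Proof.
  intros Hab Hc Hp. destruct (seg_min f a b Hab Hc) as [x [Hx H]]. exists (f x). auto.
Qed.

(** * Absolutely continuous functions *)

Lemma is_derive_eps (f : R -> R) (x l : R) :
  is_derive f x l <->
  (forall eps, 0 < eps -> exists d, 0 < d /\
     forall y, Rabs (y - x) < d -> Rabs (f y - f x - l * (y - x)) <= eps * Rabs (y - x)).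
Proof.
  split.
  - intros H eps He. apply is_derive_Reals in H. destruct (H eps He) as [d Hd].
    exists d; split; [apply cond_pos|]. intros y Hy.
    destruct (Req_dec y x) as [->|Hn].
    + replace (f x - f x - l * (x - x)) with 0 by ring. replace (x - x) with 0 by ring.
      rewrite Rabs_R0; lra.
    + specialize (Hd (y - x) ltac:(lra) Hy). replace (x + (y - x)) with y in Hd by ring.
      replace (f y - f x - l * (y - x)) with (((f y - f x) / (y - x) - l) * (y - x)) by (field; lra).
      rewrite Rabs_mult. apply Rmult_le_compat_r; [apply Rabs_pos|lra].
  - intros H. apply is_derive_Reals. intros eps He. destruct (H (eps / 2) ltac:(lra)) as [d [Hd H']].
    exists (mkposreal d Hd). intros h Hh Hlt. simpl in Hlt.
    specialize (H' (x + h)). replace (x + h - x) with h in H' by ring. specialize (H' Hlt).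
    replace ((f (x + h) - f x) / h - l) with ((f (x + h) - f x - l * h) / h) by (field; auto).
    unfold Rdiv. rewrite Rabs_mult, Rabs_inv. pose proof (Rabs_pos_lt h Hh).
    apply Rle_lt_trans with (eps / 2 * Rabs h * / Rabs h).
    + apply Rmult_le_compat_r; auto. left; apply Rinv_0_lt_compat; auto.
    + rewrite Rmult_assoc, Rinv_r; lra.
Qed.

Lemma ac_cont_seg f a b : abs_continuous_on f a b -> cont_seg f a b.
Proof.
  intros H t Ht eps He. destruct (H (mkposreal eps He)) as [d Hd].
  exists d; split; [apply cond_pos|]. intros t' Ht' Hlt.
  specialize (Hd 0%nat (fun _ => Rmin t t') (fun _ => Rmax t t')). simpl in Hd.
  unfold Rmin, Rmax in Hd. destruct (Rle_dec t t').
  - apply Hd; [intros; lra|intros; lia|]. rewrite Rabs_pos_eq in Hlt; lra.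
  - rewrite Rabs_minus_sym. apply Hd; [intros; lra|intros; lia|].
    rewrite Rabs_minus_sym, Rabs_pos_eq in Hlt; lra.
Qed.

Lemma ac_sub f a b a' b' : a <= a' -> b' <= b -> abs_continuous_on f a b -> abs_continuous_on f a' b'.
Proof.
  intros Ha Hb H eps. destruct (H eps) as [d Hd]. exists d. intros n s t Hs Ht Hl.
  apply Hd; auto. intros i Hi. specialize (Hs i Hi). lra.
Qed.

Section CoverMeasure.
Variables (A B : nat -> R) (len : R).
Hypothesis HAB : forall n, A n <= B n.
Hypothesis Hlen : is_series (fun n => B n - A n) len.

Let term (t : R) (n : nat) : R := clamp (A n) (B n) t - A n.
(** The total length, overlaps counted, of the parts of the intervals ]A n, B n[ that lie to the
    left of t. It is the clock of the proof of ac_ge_closed: it advances at least as fast as t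
    inside the cover, and by at most len in total. *)
Definition cover_measure (t : R) : R := Series (fun n => clamp (A n) (B n) t - A n).

Lemma term_bound t n : 0 <= term t n <= B n - A n.
Proof. unfold term. pose proof (clamp_in (A n) (B n) t (HAB n)). lra. Qed.

Lemma term_ex t : ex_series (term t).
Proof.
  apply (ex_series_le (K:=R_AbsRing) (V:=R_CompleteNormedModule) _ (fun n => B n - A n)).
  - intros n. unfold norm; simpl. unfold abs; simpl. pose proof (term_bound t n).
    rewrite Rabs_pos_eq; lra.
  - exists len; auto.
Qed.

Lemma series_ge_term u n : (forall k, 0 <= u k) -> ex_series u -> u n <= Series u.
Proof.
  intros Hu He.
  apply Rle_trans with (sum_f_R0 u n).
  - destruct n; simpl; [lra|]. pose proof (cond_pos_sum u n Hu). lra.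
  - rewrite <- sum_n_Reals.
    assert (Hl := Series_correct u He).
    apply (is_lim_seq_incr_compare (sum_n u)); auto.
    intros k. rewrite sum_Sn. unfold plus; simpl. specialize (Hu (S k)). lra.
Qed.

Lemma cover_measure_bounds t : 0 <= cover_measure t <= len.
Proof.
  unfold cover_measure. split.
  - apply Rle_trans with (term t 0); [apply term_bound|].
    apply (series_ge_term (term t)); [apply term_bound|apply term_ex].
  - rewrite <- (is_series_unique _ _ Hlen). apply Series_le.
    + intros n. apply term_bound.
    + exists len; auto.
Qed.

Lemma cover_measure_diff s t : Series (fun n => term t n - term s n) = cover_measure t - cover_measure s.
Proof. apply Series_minus; apply term_ex. Qed.

Lemma term_mono s t n : s <= t -> 0 <= term t n - term s n.
Proof.
  intros H. unfold term, clamp, Rmax, Rmin. specialize (HAB n).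
  repeat destruct (Rle_dec _ _); lra.
Qed.

Lemma ex_series_diff s t : ex_series (fun n => term t n - term s n).
Proof. apply (ex_series_minus (term t) (term s)); apply term_ex. Qed.

Lemma cover_measure_incr s t : s <= t -> cover_measure s <= cover_measure t.
Proof.
  intros H. cut (0 <= cover_measure t - cover_measure s); [lra|]. rewrite <- cover_measure_diff.
  apply Rle_trans with (term t 0 - term s 0); [apply term_mono; auto|].
  apply (series_ge_term (fun n => term t n - term s n)).
  - intros; apply term_mono; auto.
  - apply ex_series_diff.
Qed.

Lemma cover_measure_inside s t k : s <= t -> A k < s -> t < B k ->
  t - s <= cover_measure t - cover_measure s.
Proof.
  intros H Hs Ht. rewrite <- cover_measure_diff.
  apply Rle_trans with (term t k - term s k).
  - unfold term. rewrite !clamp_id by lra. lra.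
  - apply (series_ge_term (fun n => term t n - term s n)).
    + intros; apply term_mono; auto.
    + apply ex_series_diff.
Qed.
End CoverMeasure.

(** A lower bound on the derivative outside a null set integrates, for absolutely continuous f. Walk
    from a to b and keep a finite family of non-overlapping intervals [s i, tau i]: across a
    point where the derivative exists, f grows by at least m - e times the step; across a point
    of the null set, the step lies in an interval of the cover and is added to the family. The
    family has total length at most that of the cover, so absolute continuity bounds what f
    loses on it. Real induction replaces the integral. *)
Lemma ac_ge_closed f m a b (N : R -> Prop) : a <= b -> abs_continuous_on f a b -> lebesgue_null N ->
  (forall t, a <= t <= b -> N t \/ exists l : R, is_derive f t l /\ m <= l) ->
  m * (b - a) <= f b - f a.
Proof.
  intros Hab Hac Hnull Hd.
  apply le_epsilon. intros e0 He0.
  (* K bounds the total loss per unit of e. *)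
  set (K := (b - a) + Rabs m + 3).
  assert (HK : 0 < K). { unfold K. pose proof (Rabs_pos m). lra. }
  set (e := Rmin 1 (e0 / K)).
  assert (He : 0 < e <= 1 /\ e * K <= e0).
  { assert (0 < e0 / K) by (apply Rdiv_lt_0_compat; lra).
    unfold e. split; [split|].
    - apply Rmin_pos; lra.
    - apply Rmin_l.
    - apply Rle_trans with (e0 / K * K); [apply Rmult_le_compat_r; [lra|apply Rmin_r]|].
      right; field; lra. }
  destruct (Hac (mkposreal e (proj1 (proj1 He)))) as [d Hacd]. simpl in Hacd.
  assert (Hde : 0 < Rmin d e) by (apply Rmin_pos; [apply cond_pos|lra]).
  destruct (Hnull (mkposreal _ Hde)) as (A & B & len & HAB & Hcov & Hlen & Hlt). simpl in Hlt.
  set (mu := cover_measure A B).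
  set (Inv := fun t => exists (n : nat) (s tau : nat -> R),
    (forall i, (i <= n)%nat -> a <= s i /\ s i <= tau i /\ tau i <= t) /\
    (forall i, (i < n)%nat -> tau i <= s (S i)) /\
    sum_f_R0 (fun i => tau i - s i) n <= mu t - mu a /\
    (m - e) * (t - a) - Rabs (m - e) * sum_f_R0 (fun i => tau i - s i) n
      - sum_f_R0 (fun i => Rabs (f (tau i) - f (s i))) n <= f t - f a).
  assert (Hstep : forall t1 t2, t1 <= t2 -> Inv t1 -> a <= t1 ->
     ((m - e) * (t2 - t1) <= f t2 - f t1 \/ exists k, A k < t1 /\ t2 < B k) -> Inv t2).
  { intros t1 t2 H12 (n & s & tau & H1 & H2 & H3 & H4) Ha1 [Hg|[k [Hk1 Hk2]]].
    - exists n, s, tau. split; [|split; [|split]]; auto.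
      + intros i Hi. specialize (H1 i Hi). lra.
      + pose proof (cover_measure_incr A B len HAB Hlen t1 t2 H12) as Hmu. fold mu in Hmu. lra.
      + lra.
    - set (s' := fun i => if le_dec i n then s i else t1).
      set (tau' := fun i => if le_dec i n then tau i else t2).
      assert (Es : forall i, (i <= n)%nat -> s' i = s i).
      { intros i Hi. unfold s'. destruct (le_dec i n); [auto|lia]. }
      assert (Et : forall i, (i <= n)%nat -> tau' i = tau i).
      { intros i Hi. unfold tau'. destruct (le_dec i n); [auto|lia]. }
      assert (Es1 : s' (S n) = t1). { unfold s'. destruct (le_dec (S n) n); [lia|auto]. }
      assert (Et1 : tau' (S n) = t2). { unfold tau'. destruct (le_dec (S n) n); [lia|auto]. }
      assert (E1 : sum_f_R0 (fun i => tau' i - s' i) (S n) =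
                   sum_f_R0 (fun i => tau i - s i) n + (t2 - t1)).
      { simpl. rewrite Es1, Et1. f_equal. apply sum_eq. intros i Hi. rewrite Es, Et; auto. }
      assert (E2 : sum_f_R0 (fun i => Rabs (f (tau' i) - f (s' i))) (S n) =
                   sum_f_R0 (fun i => Rabs (f (tau i) - f (s i))) n + Rabs (f t2 - f t1)).
      { simpl. rewrite Es1, Et1. f_equal. apply sum_eq. intros i Hi. rewrite Es, Et; auto. }
      exists (S n), s', tau'. rewrite E1, E2. split; [|split; [|split]].
      + intros i Hi. destruct (Nat.eq_dec i (S n)) as [->|Hn].
        * rewrite Es1, Et1. lra.
        * rewrite Es, Et by lia. specialize (H1 i ltac:(lia)). lra.
      + intros i Hi. rewrite Et by lia. destruct (Nat.eq_dec i n) as [->|Hn].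
        * rewrite Es1. specialize (H1 n ltac:(lia)). lra.
        * rewrite Es by lia. apply H2. lia.
      + pose proof (cover_measure_inside A B len HAB Hlen t1 t2 k H12 Hk1 Hk2) as Hmu. fold mu in Hmu. lra.
      + pose proof (Rle_abs (m - e)). pose proof (Rle_abs (- (f t2 - f t1))) as Hf.
        rewrite Rabs_Ropp in Hf.
        assert ((m - e) * (t2 - t1) <= Rabs (m - e) * (t2 - t1)) by (apply Rmult_le_compat_r; lra).
        lra. }
  assert (Hloc : forall t, a <= t <= b -> exists dl, 0 < dl /\ forall t1 t2, t - dl < t1 -> t2 < t + dl ->
     t1 <= t2 -> (t1 = t \/ t2 = t) ->
     ((m - e) * (t2 - t1) <= f t2 - f t1 \/ exists k, A k < t1 /\ t2 < B k)).
  { intros t Ht. destruct (Hd t Ht) as [HN|[l [Hl Hm]]].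
    - destruct (Hcov t HN) as [k Hk]. exists (Rmin (t - A k) (B k - t)).
      split; [apply Rmin_pos; lra|]. intros t1 t2 Ht1 Ht2 _ _. right. exists k.
      Rmin_bounds (t - A k) (B k - t). lra.
    - destruct (proj1 (is_derive_eps f t l) Hl e (proj1 (proj1 He))) as [dl [Hdl H]].
      exists dl; split; auto. intros t1 t2 Ht1 Ht2 H12 [->| ->]; left.
      + specialize (H t2). rewrite (Rabs_pos_eq (t2 - t)) in H by lra. specialize (H ltac:(lra)).
        apply Rabs_le_between in H. nra.
      + specialize (H t1). rewrite (Rabs_minus_sym t1 t), (Rabs_pos_eq (t - t1)) in H by lra.
        specialize (H ltac:(lra)). apply Rabs_le_between in H. nra. }
  assert (HInv : Inv b).
  { apply (real_induct Inv a b); auto; [| | |lra].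
    - exists 0%nat, (fun _ => a), (fun _ => a). split; [intros; lra|]. split; [intros; lia|].
      simpl. unfold Rminus; rewrite !Rplus_opp_r, Rabs_R0. split; lra.
    - intros t Ht HP. destruct (Hloc t ltac:(lra)) as [dl [Hdl H]]. exists dl; split; auto.
      intros t' Ht' _. apply Hstep with t; [lra|apply HP; lra|lra|]. apply H; auto; lra.
    - intros t Ht HP. destruct (Hloc t ltac:(lra)) as [dl [Hdl H]].
      pose proof (Rmax_l a (t - dl / 2)). pose proof (Rmax_r a (t - dl / 2)).
      assert (Rmax a (t - dl / 2) < t) by (apply Rmax_lub_lt; lra).
      apply Hstep with (Rmax a (t - dl/2)); [lra|apply HP; lra|lra|]. apply H; auto; lra. }
  destruct HInv as (n & s & tau & H1 & H2 & H3 & H4).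
  pose proof (cover_measure_bounds A B len HAB Hlen a) as M1.
  pose proof (cover_measure_bounds A B len HAB Hlen b) as M2. fold mu in M1, M2.
  Rmin_bounds d e.
  assert (Hsum : sum_f_R0 (fun i => Rabs (f (tau i) - f (s i))) n < e) by (apply Hacd; auto; lra).
  assert (Hs0 : 0 <= sum_f_R0 (fun i => tau i - s i) n).
  { clear - H1. induction n; simpl.
    - specialize (H1 0%nat ltac:(lia)); lra.
    - assert (0 <= sum_f_R0 (fun i => tau i - s i) n) by (apply IHn; intros; apply H1; lia).
      specialize (H1 (S n) ltac:(lia)); lra. }
  assert (Hab' : Rabs (m - e) <= Rabs m + 1).
  { eapply Rle_trans; [apply Rabs_triang|]. rewrite Rabs_Ropp, (Rabs_pos_eq e); lra. }
  pose proof (Rabs_pos (m - e)).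
  assert (Rabs (m - e) * sum_f_R0 (fun i => tau i - s i) n <= (Rabs m + 1) * e).
  { apply Rmult_le_compat; lra. }
  unfold K in He. nra.
Qed.

(** The end points carry no information, and are reached by continuity from smaller segments. *)
Lemma ac_ge f m a b (N : R -> Prop) : a <= b -> abs_continuous_on f a b -> lebesgue_null N ->
  (forall t, a < t < b -> N t \/ exists l : R, is_derive f t l /\ m <= l) ->
  m * (b - a) <= f b - f a.
Proof.
  intros Hab Hac Hnull Hd. destruct (Req_dec a b) as [<-|Hn]; [lra|].
  apply le_epsilon. intros e He.
  pose proof (ac_cont_seg f a b Hac) as Hc.
  destruct (Hc a ltac:(lra) (e / 4) ltac:(lra)) as [d1 [Hd1 H1]].
  destruct (Hc b ltac:(lra) (e / 4) ltac:(lra)) as [d2 [Hd2 H2]].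
  pose proof (Rabs_pos m).
  set (h := Rmin (Rmin (d1 / 2) (d2 / 2)) (Rmin ((b - a) / 3) (e / (4 * (Rabs m + 1))))).
  assert (Hh : 0 < h /\ h <= d1 / 2 /\ h <= d2 / 2 /\ h <= (b - a) / 3 /\ h * (4 * (Rabs m + 1)) <= e).
  { assert (0 < e / (4 * (Rabs m + 1))) by (apply Rdiv_lt_0_compat; lra).
    assert (h <= e / (4 * (Rabs m + 1))).
    { unfold h; eapply Rle_trans; [apply Rmin_r|apply Rmin_r]. }
    split; [|split; [|split; [|split]]].
    - unfold h; repeat apply Rmin_pos; lra.
    - unfold h; eapply Rle_trans; [apply Rmin_l|apply Rmin_l].
    - unfold h; eapply Rle_trans; [apply Rmin_l|apply Rmin_r].
    - unfold h; eapply Rle_trans; [apply Rmin_r|apply Rmin_l].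
    - apply Rle_trans with (e / (4 * (Rabs m + 1)) * (4 * (Rabs m + 1))).
      + apply Rmult_le_compat_r; lra.
      + right; field; lra. }
  assert (Hcl := ac_ge_closed f m (a + h) (b - h) N ltac:(lra)
     (ac_sub f a b (a + h) (b - h) ltac:(lra) ltac:(lra) Hac) Hnull).
  assert (H' : m * (b - h - (a + h)) <= f (b - h) - f (a + h)).
  { apply Hcl. intros; apply Hd; lra. }
  specialize (H1 (a + h) ltac:(lra)). specialize (H2 (b - h) ltac:(lra)).
  replace (a + h - a) with h in H1 by ring. replace (b - h - b) with (- h) in H2 by ring.
  rewrite Rabs_Ropp in H2. rewrite Rabs_pos_eq in H1, H2 by lra.
  specialize (H1 ltac:(lra)). specialize (H2 ltac:(lra)).
  apply Rabs_def2 in H1. apply Rabs_def2 in H2.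
  assert (m * h <= Rabs m * h) by (apply Rmult_le_compat_r; [lra|apply Rle_abs]).
  nra.
Qed.

Lemma ac_opp f a b : abs_continuous_on f a b -> abs_continuous_on (fun t => - f t) a b.
Proof.
  intros H eps. destruct (H eps) as [d Hd]. exists d. intros n s t H1 H2 H3.
  rewrite (sum_eq _ (fun i => Rabs (f (t i) - f (s i)))); [apply Hd; auto|].
  intros i _. replace (- f (t i) - - f (s i)) with (- (f (t i) - f (s i))) by ring. apply Rabs_Ropp.
Qed.

Lemma ac_le f m a b (N : R -> Prop) : a <= b -> abs_continuous_on f a b -> lebesgue_null N ->
  (forall t, a < t < b -> N t \/ exists l : R, is_derive f t l /\ l <= m) ->
  f b - f a <= m * (b - a).
Proof.
  intros Hab Hac Hn Hd.
  assert (H := ac_ge (fun t => - f t) (- m) a b N Hab (ac_opp f a b Hac) Hn).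
  cut (- m * (b - a) <= - f b - - f a); [lra|]. apply H.
  intros t Ht. destruct (Hd t Ht) as [HN|[l [Hl Hm]]]; [left; auto|right].
  exists (- l). split; [|lra].
  eapply is_derive_eq; [apply (is_derive_Rscal (-1) f t l) in Hl|].
  - eapply is_derive_ext; [|exact Hl]. intros; simpl; ring.
  - simpl; ring.
Qed.

Lemma ac_lip_comp (G f : R -> R) L a b : 0 <= L ->
  (forall t t', a <= t <= b -> a <= t' <= b -> Rabs (G t - G t') <= L * Rabs (f t - f t')) ->
  abs_continuous_on f a b -> abs_continuous_on G a b.
Proof.
  intros HL HG H eps.
  assert (He : 0 < eps / (L + 1)) by (apply Rdiv_lt_0_compat; [apply cond_pos|lra]).
  destruct (H (mkposreal _ He)) as [d Hd]. simpl in Hd. exists d. intros n s t H1 H2 H3.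
  specialize (Hd n s t H1 H2 H3).
  assert (Hle : sum_f_R0 (fun i => Rabs (G (t i) - G (s i))) n <=
                L * sum_f_R0 (fun i => Rabs (f (t i) - f (s i))) n).
  { rewrite scal_sum. apply sum_Rle. intros i Hi. specialize (H1 i Hi). rewrite Rmult_comm.
    apply HG; lra. }
  assert (0 <= sum_f_R0 (fun i => Rabs (f (t i) - f (s i))) n) by (apply cond_pos_sum; intros; apply Rabs_pos).
  assert (E : eps / (L + 1) * (L + 1) = eps) by (field; lra).
  nra.
Qed.

Lemma ac_id a b : abs_continuous_on (fun t => t) a b.
Proof.
  intros eps. exists eps. intros n s t H1 H2 H3.
  rewrite (sum_eq _ (fun i => t i - s i)); auto.
  intros i Hi. specialize (H1 i Hi). apply Rabs_pos_eq. lra.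
Qed.

Lemma ac_lip (f : R -> R) L a b : 0 <= L ->
  (forall t t', a <= t <= b -> a <= t' <= b -> Rabs (f t - f t') <= L * Rabs (t - t')) ->
  abs_continuous_on f a b.
Proof. intros HL H. apply ac_lip_comp with (fun t => t) L; auto. apply ac_id. Qed.

(** * Trajectories away from sliding *)

Definition side (s : R) : Prop := s = 1 \/ s = -1.

Lemma side_p : side 1.
Proof. left; auto. Qed.

Lemma side_m : side (-1).
Proof. right; auto. Qed.

Lemma side_sq s : side s -> s * s = 1.
Proof. intros [-> | ->]; ring. Qed.

Lemma side_opp s : side s -> side (- s).
Proof. intros [-> | ->]; [right|left]; ring. Qed.

Lemma side_mult s s' : side s -> side s' -> side (s * s').
Proof. intros [-> | ->] [-> | ->]; (left; ring) || (right; ring). Qed.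

Lemma side_abs s x : side s -> Rabs (s * x) = Rabs x.
Proof. intros [-> | ->]; rewrite Rabs_mult; [rewrite Rabs_R1|rewrite Rabs_left by lra]; ring. Qed.

(** The sides of the line are numbered by s = 1 and s = -1, as in return_arc, so that both half-planes
    are treated at once. *)
Definition fld (W : filippov) (s : R) : vfield := if Rlt_dec 0 s then Zp W else Zm W.

Lemma fld_p W : fld W 1 = Zp W.
Proof. unfold fld; destruct (Rlt_dec 0 1); [auto|lra]. Qed.

Lemma fld_m W : fld W (-1) = Zm W.
Proof. unfold fld; destruct (Rlt_dec 0 (-1)); [lra|auto]. Qed.

Lemma fld_rev W s : fld (time_reversal W) s = opposite_field (fld W s).
Proof. unfold fld; destruct (Rlt_dec 0 s); auto. Qed.

Definition in_box (r x y : R) : Prop := Rabs x < r /\ Rabs y < r.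

Definition lip_on (r L : R) (f : R -> R -> R) : Prop := forall x y x' y',
  in_box r x y -> in_box r x' y' -> Rabs (f x y - f x' y') <= L * (Rabs (x - x') + Rabs (y - y')).

Definition lip_fields (W : filippov) (r L : R) : Prop := 0 < r /\ 0 <= L /\
  forall s, side s -> lip_on r L (vX (fld W s)) /\ lip_on r L (vY (fld W s)).

(** Both fields cross the line at (x, 0), in the vertical direction q. *)
Definition same_sign_at (W : filippov) (q x : R) : Prop :=
  side q /\ forall s, side s -> 0 < q * vY (fld W s) x 0.

(** The part of the notion of trajectory on which all later arguments rest: inside the box r it solves
    the classical equation away from the line, and passes a crossing point from the side - q to
    the side q. Unlike the definition of trajectories, this one is manifestly invariant under time
    reversal and needs no measure theory. Motions along the line are left unconstrained: in a
    sliding region they occur, and are not unique. *)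
Record motion (W : filippov) (r : R) (u v : R -> R) (a b : R) : Prop := {
  mo_u : cont_seg u a b;
  mo_v : cont_seg v a b;
  mo_side : forall s t, side s -> a < t < b -> in_box r (u t) (v t) -> 0 < s * v t ->
    is_derive u t (vX (fld W s) (u t) (v t)) /\ is_derive v t (vY (fld W s) (u t) (v t));
  mo_cross : forall q t, a <= t <= b -> Rabs (u t) < r -> v t = 0 -> same_sign_at W q (u t) ->
    exists d, 0 < d /\ forall t', a <= t' <= b -> Rabs (t' - t) < d -> t' <> t ->
      0 < q * v t' * (t' - t) }.
Arguments mo_u {W r u v a b}.
Arguments mo_v {W r u v a b}.
Arguments mo_side {W r u v a b}.
Arguments mo_cross {W r u v a b}.

Lemma rhs_side W s x y p q : side s -> 0 < s * y -> filippov_rhs W x y p q ->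
  p = vX (fld W s) x y /\ q = vY (fld W s) x y.
Proof.
  intros [-> | ->] H (Hp & Hm & _).
  - rewrite fld_p. apply Hp; lra.
  - rewrite fld_m. apply Hm; lra.
Qed.

(** On the line the velocity is a convex combination of the two fields. *)
Lemma rhs_bound W g m x y p q : side g -> filippov_rhs W x y p q ->
  (forall s, side s -> m <= g * vY (fld W s) x y) -> m <= g * q.
Proof.
  intros Hg H Hb. pose proof (Hb 1 side_p) as H1.
  pose proof (Hb (-1) side_m) as H2. rewrite fld_p in H1. rewrite fld_m in H2.
  destruct H as (Hp & Hm & H0). destruct (Rtotal_order y 0) as [Hy|[Hy|Hy]].
  - destruct (Hm Hy) as [_ ->]. auto.
  - destruct (H0 Hy) as (l & Hl & _ & ->).
    replace (g * (l * vY (Zp W) x y + (1 - l) * vY (Zm W) x y)) with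
      (l * (g * vY (Zp W) x y) + (1 - l) * (g * vY (Zm W) x y)) by ring. nra.
  - destruct (Hp Hy) as [_ ->]. auto.
Qed.

Lemma box_near W r L u v a b t eps : lip_fields W r L -> cont_seg u a b -> cont_seg v a b ->
  a <= t <= b -> in_box r (u t) (v t) -> 0 < eps ->
  exists d, 0 < d /\ forall t', a <= t' <= b -> Rabs (t' - t) < d ->
    in_box r (u t') (v t') /\ Rabs (v t' - v t) < eps /\
    forall s, side s ->
      Rabs (vX (fld W s) (u t') (v t') - vX (fld W s) (u t) (v t)) <= eps /\
      Rabs (vY (fld W s) (u t') (v t') - vY (fld W s) (u t) (v t)) <= eps.
Proof.
  intros (Hr & HL & Hlip) Hu Hv Ht [Bu Bv] He.
  set (e := Rmin (Rmin (r - Rabs (u t)) (r - Rabs (v t))) (Rmin eps (eps / (2 * (L + 1))))).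
  assert (He' : 0 < e /\ e <= r - Rabs (u t) /\ e <= r - Rabs (v t) /\ e <= eps /\ e * (2 * (L + 1)) <= eps).
  { assert (0 < eps / (2 * (L + 1))) by (apply Rdiv_lt_0_compat; lra).
    split; [|split; [|split; [|split]]].
    - unfold e; repeat apply Rmin_pos; lra.
    - unfold e; eapply Rle_trans; [apply Rmin_l|apply Rmin_l].
    - unfold e; eapply Rle_trans; [apply Rmin_l|apply Rmin_r].
    - unfold e; eapply Rle_trans; [apply Rmin_r|apply Rmin_l].
    - apply Rle_trans with (eps / (2 * (L + 1)) * (2 * (L + 1))); [|right; field; lra].
      apply Rmult_le_compat_r; [lra|]. unfold e; eapply Rle_trans; [apply Rmin_r|apply Rmin_r]. }
  destruct (Hu t Ht e (proj1 He')) as [d1 [Hd1 H1]].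
  destruct (Hv t Ht e (proj1 He')) as [d2 [Hd2 H2]].
  exists (Rmin d1 d2). split; [apply Rmin_pos; auto|]. intros t' Ht' Hd.
  Rmin_bounds d1 d2.
  specialize (H1 t' Ht' ltac:(lra)). specialize (H2 t' Ht' ltac:(lra)).
  assert (Bt : in_box r (u t') (v t')).
  { pose proof (Rabs_triang_inv (u t') (u t)). pose proof (Rabs_triang_inv (v t') (v t)).
    split; lra. }
  split; [exact Bt|]. split; [lra|].
  intros s Hs. destruct (Hlip s Hs) as [HX HY].
  specialize (HX _ _ (u t) (v t) Bt (conj Bu Bv)). specialize (HY _ _ (u t) (v t) Bt (conj Bu Bv)).
  assert (L * (Rabs (u t' - u t) + Rabs (v t' - v t)) <= eps).
  { apply Rle_trans with (L * (e + e)); [apply Rmult_le_compat_l; lra|]. nra. }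
  split; lra.
Qed.

Lemma traj_alt W u v a b : trajectory_on W u v a b ->
  exists N, lebesgue_null N /\ forall t, a < t < b -> N t \/ exists p q : R,
    is_derive u t p /\ is_derive v t q /\ filippov_rhs W (u t) (v t) p q.
Proof.
  intros (_ & _ & H). eexists; split; [exact H|]. intros t Ht.
  destruct (excluded_middle_informative (exists p q : R, is_derive u t p /\ is_derive v t q /\
      filippov_rhs W (u t) (v t) p q)); [right; auto|left; auto].
Qed.

(** If the derivative of f, where it exists, is close to g t at almost all times near t, then the
    increments of f are, by integration, and f is differentiable at t itself. This is how
    absolutely continuous trajectories become classical solutions where the field is continuous. *)
Lemma derive_of_close (f g : R -> R) a b t (N : R -> Prop) : a < t < b -> abs_continuous_on f a b ->
  lebesgue_null N ->
  (forall eps, 0 < eps -> exists d, 0 < d /\ forall t', a < t' < b -> Rabs (t' - t) < d ->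
     N t' \/ exists l : R, is_derive f t' l /\ Rabs (l - g t) <= eps) ->
  is_derive f t (g t).
Proof.
  intros Ht Hac HN H. apply is_derive_eps. intros eps He. destruct (H eps He) as [d [Hd Hd']].
  exists (Rmin d (Rmin (t - a) (b - t))). split; [repeat apply Rmin_pos; lra|]. intros y Hy.
  Rmin_bounds d (Rmin (t - a) (b - t)).
  Rmin_bounds (t - a) (b - t).
  apply Rabs_def2 in Hy.
  assert (Hgen : forall t1 t2, a < t1 -> t1 <= t2 -> t2 < b -> t - d < t1 -> t2 < t + d ->
      Rabs (f t2 - f t1 - g t * (t2 - t1)) <= eps * (t2 - t1)).
  { intros t1 t2 A1 A2 A3 A4 A5.
    assert (Hac' := ac_sub f a b t1 t2 ltac:(lra) ltac:(lra) Hac).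
    assert (B1 := ac_ge f (g t - eps) t1 t2 N A2 Hac' HN).
    assert (B2 := ac_le f (g t + eps) t1 t2 N A2 Hac' HN).
    assert (B1' : (g t - eps) * (t2 - t1) <= f t2 - f t1).
    { apply B1. intros t' Ht'. destruct (Hd' t' ltac:(lra)) as [|[l [Hl Hb]]]; [apply Rabs_def1; lra|left; auto|right].
      exists l; split; auto. apply Rabs_le_between in Hb; lra. }
    assert (B2' : f t2 - f t1 <= (g t + eps) * (t2 - t1)).
    { apply B2. intros t' Ht'. destruct (Hd' t' ltac:(lra)) as [|[l [Hl Hb]]]; [apply Rabs_def1; lra|left; auto|right].
      exists l; split; auto. apply Rabs_le_between in Hb; lra. }
    apply Rabs_le. lra. }
  destruct (Rle_dec t y) as [Hty|Hty].
  - rewrite (Rabs_pos_eq (y - t)) by lra. apply Hgen; lra.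
  - rewrite (Rabs_minus_sym y t), (Rabs_pos_eq (t - y)) by lra.
    replace (f y - f t - g t * (y - t)) with (- (f t - f y - g t * (t - y))) by ring.
    rewrite Rabs_Ropp. apply Hgen; lra.
Qed.

(** Off the line the velocity is almost everywhere the continuous field of one side, so
    derive_of_close applies. At a crossing point q v grows at a positive rate almost everywhere
    nearby, whichever convex combination is chosen on the line. *)
Lemma traj_motion W r L u v a b : lip_fields W r L -> trajectory_on W u v a b -> motion W r u v a b.
Proof.
  intros HL HT. destruct (traj_alt _ _ _ _ _ HT) as (N & HN & Halt).
  destruct HT as (Hacu & Hacv & _).
  pose proof (ac_cont_seg _ _ _ Hacu) as Hcu. pose proof (ac_cont_seg _ _ _ Hacv) as Hcv.
  constructor; auto.
  - intros s t Hs Ht Hb Hv.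
    assert (Hnear : forall eps, 0 < eps -> exists d, 0 < d /\ forall t', a < t' < b -> Rabs (t' - t) < d ->
      N t' \/ exists p q : R, is_derive u t' p /\ is_derive v t' q /\
        Rabs (p - vX (fld W s) (u t) (v t)) <= eps /\ Rabs (q - vY (fld W s) (u t) (v t)) <= eps).
    { intros eps He. destruct (box_near W r L u v a b t (Rmin eps (s * v t)) HL Hcu Hcv ltac:(lra) Hb) as [d [Hd H]].
      { apply Rmin_pos; auto. }
      exists d; split; auto. intros t' Ht' Hd'. destruct (H t' ltac:(lra) Hd') as (_ & Hv' & HXY).
      Rmin_bounds eps (s * v t).
      destruct (Halt t' Ht') as [|(p & q & Hp & Hq & Hr)]; [left; auto|right].
      assert (Hpos : 0 < s * v t').
      { apply Rabs_def2 in Hv'. destruct Hs as [-> | ->]; lra. }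
      destruct (rhs_side W s _ _ _ _ Hs Hpos Hr) as [-> ->].
      destruct (HXY s Hs). eexists; eexists; split; [exact Hp|]. split; [exact Hq|]. lra. }
    split.
    + apply (derive_of_close u (fun t => vX (fld W s) (u t) (v t)) a b t N Ht Hacu HN).
      intros eps He. destruct (Hnear eps He) as [d [Hd H]]. exists d; split; auto.
      intros t' Ht' Hd'. destruct (H t' Ht' Hd') as [|(p & q & Hp & Hq & H1 & H2)]; [left; auto|right].
      exists p; auto.
    + apply (derive_of_close v (fun t => vY (fld W s) (u t) (v t)) a b t N Ht Hacv HN).
      intros eps He. destruct (Hnear eps He) as [d [Hd H]]. exists d; split; auto.
      intros t' Ht' Hd'. destruct (H t' Ht' Hd') as [|(p & q & Hp & Hq & H1 & H2)]; [left; auto|right].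
      exists q; auto.
  - intros q t Ht Hb Hv0 [Hq Hs].
    pose proof (Hs 1 side_p) as P1. pose proof (Hs (-1) side_m) as P2.
    set (m := Rmin (q * vY (fld W 1) (u t) 0) (q * vY (fld W (-1)) (u t) 0)) in *.
    assert (Hm : 0 < m) by (apply Rmin_pos; auto).
    assert (Hms : forall s, side s -> m <= q * vY (fld W s) (u t) 0).
    { intros s [-> | ->]; [apply Rmin_l|apply Rmin_r]. }
    destruct (box_near W r L u v a b t (m / 2) HL Hcu Hcv Ht) as [d [Hd H]]; [|lra|].
    { split; auto. rewrite Hv0, Rabs_R0. apply HL. }
    assert (Hgen : forall t1 t2, a <= t1 -> t1 <= t2 -> t2 <= b -> t - d < t1 -> t2 < t + d ->
        m / 2 * (t2 - t1) <= q * v t2 - q * v t1).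
    { intros t1 t2 A1 A2 A3 A4 A5.
      apply (ac_ge (fun t => q * v t) (m / 2) t1 t2 N A2); auto.
      - apply ac_lip_comp with v 1; [lra| |eapply ac_sub; [exact A1|exact A3|exact Hacv]].
        intros. replace (q * v t0 - q * v t') with (q * (v t0 - v t')) by ring.
        rewrite Rabs_mult. destruct Hq as [-> | ->]; [rewrite Rabs_R1|rewrite Rabs_left by lra]; lra.
      - intros t' Ht'. destruct (Halt t' ltac:(lra)) as [|(p & w & Hp & Hw & Hr)]; [left; auto|right].
        exists (q * w). split; [apply is_derive_Rscal; exact Hw|].
        apply (rhs_bound W q (m / 2) _ _ _ _ Hq Hr). intros s Hs'.
        destruct (H t' ltac:(lra) ltac:(apply Rabs_def1; lra)) as (_ & _ & HXY).
        destruct (HXY s Hs') as [_ HY]. rewrite Hv0 in HY. specialize (Hms s Hs').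
        apply Rabs_le_between in HY. destruct Hq as [-> | ->]; lra. }
    exists d; split; auto. intros t' Ht' Hd' Hne. apply Rabs_def2 in Hd'.
    destruct (Rlt_le_dec t t') as [Hlt|Hle].
    + specialize (Hgen t t' ltac:(lra) ltac:(lra) ltac:(lra) ltac:(lra) ltac:(lra)).
      rewrite Hv0 in Hgen. apply Rmult_lt_0_compat; nra.
    + specialize (Hgen t' t ltac:(lra) ltac:(lra) ltac:(lra) ltac:(lra) ltac:(lra)).
      rewrite Hv0 in Hgen. assert (t' < t) by lra.
      replace (q * v t' * (t' - t)) with ((- (q * v t')) * (t - t')) by ring.
      apply Rmult_lt_0_compat; nra.
Qed.

Lemma motion_rev W r u v a b : motion W r u v a b ->
  motion (time_reversal W) r (fun t => u (- t)) (fun t => v (- t)) (- b) (- a).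
Proof.
  intros [H1 H2 H3 H4]. constructor.
  - apply cont_seg_rev; auto.
  - apply cont_seg_rev; auto.
  - intros s t Hs Ht Hb Hv. rewrite fld_rev. destruct (H3 s (- t) Hs ltac:(lra) Hb Hv).
    split; apply is_derive_rev; assumption.
  - intros q t Ht Hu Hv [Hq Hs].
    destruct (H4 (- q) (- t) ltac:(lra) Hu Hv) as [d [Hd H]].
    { split; [apply side_opp; auto|]. intros s Hs'. specialize (Hs s Hs'). rewrite fld_rev in Hs.
      simpl in Hs. lra. }
    exists d; split; auto. intros t' Ht' Hd' Hne.
    replace (q * v (- t') * (t' - t)) with (- q * v (- t') * (- t' - - t)) by ring.
    apply H; [lra| |lra]. replace (- t' - - t) with (- (t' - t)) by ring. rewrite Rabs_Ropp; auto.
Qed.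

(** Gronwall for the squared distance of two solutions. *)
Lemma uniq2D (f : vfield) r L u1 v1 u2 v2 a b : 0 <= L -> a <= b ->
  lip_on r L (vX f) -> lip_on r L (vY f) ->
  cont_seg u1 a b -> cont_seg v1 a b -> cont_seg u2 a b -> cont_seg v2 a b ->
  (forall t, a < t < b -> in_box r (u1 t) (v1 t) /\
     is_derive u1 t (vX f (u1 t) (v1 t)) /\ is_derive v1 t (vY f (u1 t) (v1 t))) ->
  (forall t, a < t < b -> in_box r (u2 t) (v2 t) /\
     is_derive u2 t (vX f (u2 t) (v2 t)) /\ is_derive v2 t (vY f (u2 t) (v2 t))) ->
  u1 a = u2 a -> v1 a = v2 a -> u1 b = u2 b /\ v1 b = v2 b.
Proof.
  intros HL Hab HX HY C1 C2 C3 C4 D1 D2 E1 E2.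
  set (D := fun t => (u1 t - u2 t) * (u1 t - u2 t) + (v1 t - v2 t) * (v1 t - v2 t)).
  assert (HD : D b <= D a * exp (4 * L * (b - a))).
  { apply growth; auto.
    - apply (cont_seg_plus (fun t => (u1 t - u2 t) * (u1 t - u2 t)) (fun t => (v1 t - v2 t) * (v1 t - v2 t))); auto;
      [apply (cont_seg_mult (fun t => u1 t - u2 t) (fun t => u1 t - u2 t))|
       apply (cont_seg_mult (fun t => v1 t - v2 t) (fun t => v1 t - v2 t))]; auto;
      apply cont_seg_minus; auto.
    - intros t Ht. destruct (D1 t Ht) as (B1 & Du1 & Dv1). destruct (D2 t Ht) as (B2 & Du2 & Dv2).
      set (X := vX f (u1 t) (v1 t) - vX f (u2 t) (v2 t)).
      set (Y := vY f (u1 t) (v1 t) - vY f (u2 t) (v2 t)).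
      exists (2 * (u1 t - u2 t) * X + 2 * (v1 t - v2 t) * Y). split.
      + pose proof (is_derive_Rminus _ _ _ _ _ Du1 Du2) as Du. pose proof (is_derive_Rminus _ _ _ _ _ Dv1 Dv2) as Dv.
        eapply is_derive_eq.
        * apply (is_derive_Rplus _ _ _ _ _ (is_derive_Rmult _ _ _ _ _ Du Du) (is_derive_Rmult _ _ _ _ _ Dv Dv)).
        * unfold X, Y; simpl; ring.
      + specialize (HX _ _ _ _ B1 B2). specialize (HY _ _ _ _ B1 B2). fold X in HX. fold Y in HY.
        unfold D. set (p := u1 t - u2 t) in *. set (q := v1 t - v2 t) in *.
        assert (p * X <= Rabs p * Rabs X) by (rewrite <- Rabs_mult; apply Rle_abs).
        assert (q * Y <= Rabs q * Rabs Y) by (rewrite <- Rabs_mult; apply Rle_abs).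
        assert (p * p = Rabs p * Rabs p) by (rewrite <- Rabs_mult, Rabs_pos_eq; auto; apply Rle_0_sqr).
        assert (q * q = Rabs q * Rabs q) by (rewrite <- Rabs_mult, Rabs_pos_eq; auto; apply Rle_0_sqr).
        pose proof (Rabs_pos p). pose proof (Rabs_pos q).
        assert (Rabs p * Rabs X <= Rabs p * (L * (Rabs p + Rabs q))) by (apply Rmult_le_compat_l; auto).
        assert (Rabs q * Rabs Y <= Rabs q * (L * (Rabs p + Rabs q))) by (apply Rmult_le_compat_l; auto).
        assert (0 <= L * ((Rabs p - Rabs q) * (Rabs p - Rabs q))) by (apply Rmult_le_pos; [auto|apply Rle_0_sqr]).
        nra. }
  assert (Da : D a = 0) by (unfold D; rewrite E1, E2; ring).
  rewrite Da, Rmult_0_l in HD. unfold D in HD.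
  pose proof (Rle_0_sqr (u1 b - u2 b)) as S1. pose proof (Rle_0_sqr (v1 b - v2 b)) as S2.
  unfold Rsqr in S1, S2.
  assert (u1 b - u2 b = 0) by (apply Rsqr_0_uniq; unfold Rsqr; lra).
  assert (v1 b - v2 b = 0) by (apply Rsqr_0_uniq; unfold Rsqr; lra). lra.
Qed.

Lemma cont_seg_limit_eq f g a b : a < b -> cont_seg f a b -> cont_seg g a b ->
  (forall t, a <= t < b -> f t = g t) -> f b = g b.
Proof.
  intros Hab Hf Hg E. destruct (Req_dec (f b) (g b)) as [|Hn]; auto. exfalso.
  assert (Hp : 0 < Rabs (f b - g b)) by (apply Rabs_pos_lt; lra).
  destruct (Hf b ltac:(lra) (Rabs (f b - g b) / 2) ltac:(lra)) as [d1 [Hd1 H1]].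
  destruct (Hg b ltac:(lra) (Rabs (f b - g b) / 2) ltac:(lra)) as [d2 [Hd2 H2]].
  set (h := Rmin (b - a) (Rmin (d1 / 2) (d2 / 2))).
  assert (Hh : 0 < h /\ h <= b - a /\ h <= d1 / 2 /\ h <= d2 / 2).
  { apply Rmin_triple; lra. }
  assert (Hb : Rabs (b - h - b) = h).
  { replace (b - h - b) with (- h) by ring. rewrite Rabs_Ropp, Rabs_pos_eq; lra. }
  specialize (H1 (b - h) ltac:(lra) ltac:(lra)). specialize (H2 (b - h) ltac:(lra) ltac:(lra)).
  rewrite (E (b - h)) in H1 by lra.
  pose proof (Rabs_triang (f b - g (b - h)) (g (b - h) - g b)).
  rewrite (Rabs_minus_sym (f b)) in H.
  replace (f b - g (b - h) + (g (b - h) - g b)) with (f b - g b) in H by ring. lra.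
Qed.

Lemma cont_seg_shift f c a b : cont_seg f (a + c) (b + c) -> cont_seg (fun t => f (t + c)) a b.
Proof.
  intros H t Ht eps He. destruct (H (t + c) ltac:(lra) eps He) as [d [Hd H']].
  exists d; split; auto. intros t' Ht' Hd'. apply H'; [lra|].
  replace (t' + c - (t + c)) with (t' - t) by ring. auto.
Qed.

Lemma is_derive_shift (f : R -> R) (c t l : R) : is_derive f (t + c) l -> is_derive (fun t => f (t + c)) t l.
Proof.
  intros H. eapply is_derive_eq.
  - apply (is_derive_Rcomp f (fun t => t + c) t l 1 H). auto_derive; auto.
  - simpl; ring.
Qed.

(** The end points are left out of fa_ode because they lie on the line. *)
Record forward_arc (r s : R) (f : vfield) (T : R) (U V : R -> R) : Prop := {
  fa_T : 0 < T;
  fa_U : cont_seg U 0 T;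
  fa_V : cont_seg V 0 T;
  fa_box : forall t, 0 <= t <= T -> in_box r (U t) (V t);
  fa_ode : forall t, 0 < t < T -> 0 < s * V t /\
     is_derive U t (vX f (U t) (V t)) /\ is_derive V t (vY f (U t) (V t)) }.

(** Uniqueness of motions in forward time along an arc, including from a crossing point: the motion
    has to enter the half-plane of the arc there, and then the two solve the same Lipschitz
    equation. *)
Lemma follow W r L s T U V u v a b t0 tau0 : lip_fields W r L -> side s ->
  forward_arc r s (fld W s) T U V -> motion W r u v a b ->
  a <= t0 <= b -> 0 <= tau0 < T -> u t0 = U tau0 -> v t0 = V tau0 ->
  (tau0 = 0 -> v t0 = 0 /\ same_sign_at W s (u t0)) ->
  forall t, t0 <= t <= b -> t - t0 + tau0 <= T ->
    u t = U (t + (tau0 - t0)) /\ v t = V (t + (tau0 - t0)).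
Proof.
  intros HL Hs HA HM Ht0 Htau Eu Ev Hstart.
  destruct HA as [HT CU CV HB HO]. destruct HM as [Cu Cv Hside Hcross].
  intros t1 Ht1 HT1.
  set (c := tau0 - t0).
  set (P := fun t => u t = U (t + c) /\ v t = V (t + c)).
  set (e := Rmin b (T - c)).
  assert (He : t0 <= t1 <= e). { split; [lra|]. unfold e; apply Rmin_glb; unfold c; lra. }
  assert (Heb : e <= b) by apply Rmin_l. assert (HeT : e <= T - c) by apply Rmin_r.
  assert (CU' : cont_seg (fun t => U (t + c)) t0 e).
  { apply cont_seg_shift. apply cont_seg_sub with 0 T; auto; unfold c in *; lra. }
  assert (CV' : cont_seg (fun t => V (t + c)) t0 e).
  { apply cont_seg_shift. apply cont_seg_sub with 0 T; auto; unfold c in *; lra. }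
  apply (real_induct P t0 e); [lra| | | |lra].
  - split; unfold c; replace (t0 + (tau0 - t0)) with tau0 by ring; auto.
  - intros t Ht HP. destruct (HP t ltac:(lra)) as [Pu Pv].
    assert (Htc : 0 <= t + c < T) by (unfold c in *; lra).
    assert (Bt : in_box r (u t) (v t)) by (rewrite Pu, Pv; apply HB; lra).
    assert (Hpos : exists d, 0 < d /\ forall t', t < t' < t + d -> t' <= e -> 0 < s * v t').
    { destruct (Req_dec (t + c) 0) as [Hz|Hz].
      - assert (t = t0) by (unfold c in *; lra). subst t. assert (tau0 = 0) by (unfold c in *; lra).
        destruct (Hstart H) as [Hv0 Hsame].
        destruct (Hcross s t0 ltac:(lra) (proj1 Bt) Hv0 Hsame) as [d [Hd H']].
        exists d; split; auto. intros t' Ht' Hle.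
        specialize (H' t' ltac:(lra) ltac:(apply Rabs_def1; lra) ltac:(lra)).
        apply Rmult_lt_reg_r with (t' - t0); lra.
      - destruct (HO (t + c) ltac:(lra)) as [Hp _]. rewrite <- Pv in Hp.
        destruct (Cv t ltac:(lra) (s * v t) Hp) as [d [Hd H']].
        exists d; split; auto. intros t' Ht' Hle.
        specialize (H' t' ltac:(lra) ltac:(apply Rabs_def1; lra)). apply Rabs_def2 in H'.
        destruct Hs as [-> | ->]; lra. }
    destruct Hpos as [d1 [Hd1 H1]].
    destruct (box_near W r L u v a b t 1 HL Cu Cv ltac:(lra) Bt ltac:(lra)) as [d2 [Hd2 H2]].
    exists (Rmin d1 d2). split; [apply Rmin_pos; auto|]. intros t' Ht' Hte.
    Rmin_bounds d1 d2.
    apply (uniq2D (fld W s) r L u v (fun t => U (t + c)) (fun t => V (t + c)) t t'); auto; try lra.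
    + apply HL.
    + apply HL; auto.
    + apply HL; auto.
    + eapply cont_seg_sub; [| |exact Cu]; lra.
    + eapply cont_seg_sub; [| |exact Cv]; lra.
    + eapply cont_seg_sub; [| |exact CU']; lra.
    + eapply cont_seg_sub; [| |exact CV']; lra.
    + intros z Hz. destruct (H2 z ltac:(lra) ltac:(apply Rabs_def1; lra)) as [Bz _].
      split; auto. apply Hside; auto; [lra|]. apply H1; lra.
    + intros z Hz. destruct (HO (z + c) ltac:(lra)) as (Hp & Du & Dv).
      split; [apply HB; lra|]. split; apply is_derive_shift; assumption.
  - intros t Ht HP. split.
    + apply (cont_seg_limit_eq u (fun t => U (t + c)) t0 t); [lra| | |intros; apply HP; auto].
      * eapply cont_seg_sub; [| |exact Cu]; lra.
      * eapply cont_seg_sub; [| |exact CU']; lra.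
    + apply (cont_seg_limit_eq v (fun t => V (t + c)) t0 t); [lra| | |intros; apply HP; auto].
      * eapply cont_seg_sub; [| |exact Cv]; lra.
      * eapply cont_seg_sub; [| |exact CV']; lra.
Qed.

(** * Local form of the system, and return arcs *)

(** Local form of both fields: on the side s the motion is horizontally in the direction s d, with
    speed at least c, and the vertical component changes sign exactly at the fold beta s, in the
    sense that makes the fold invisible (the orbits through nearby points of the line return to
    it). For the shifted family the folds are b and 0. The value d is the sign delta, and time
    reversal turns d into - d. *)
Record chart (W : filippov) (d r L c : R) (beta : R -> R) : Prop := {
  ch_side : side d;
  ch_lip : lip_fields W r L;
  ch_c : 0 < c;
  ch_dir : forall s x y, side s -> in_box r x y -> c <= s * d * vX (fld W s) x y;
  ch_fold0 : forall s, side s -> Rabs (beta s) < r /\ vY (fld W s) (beta s) 0 = 0;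
  ch_fold : forall s x, side s -> Rabs x < r -> x <> beta s ->
    d * vY (fld W s) x 0 * (x - beta s) < 0 }.
Arguments ch_side {W d r L c beta}.
Arguments ch_lip {W d r L c beta}.
Arguments ch_c {W d r L c beta}.
Arguments ch_dir {W d r L c beta}.
Arguments ch_fold0 {W d r L c beta}.
Arguments ch_fold {W d r L c beta}.

Lemma lip_fields_rev W r L : lip_fields W r L -> lip_fields (time_reversal W) r L.
Proof.
  intros (Hr & HL & H). split; [auto|split; auto]. intros s Hs. rewrite fld_rev.
  destruct (H s Hs) as [HX HY]. split; intros x y x' y' B B'; simpl.
  - replace (- vX (fld W s) x y - - vX (fld W s) x' y') with (- (vX (fld W s) x y - vX (fld W s) x' y')) by ring.
    rewrite Rabs_Ropp. apply HX; auto.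
  - replace (- vY (fld W s) x y - - vY (fld W s) x' y') with (- (vY (fld W s) x y - vY (fld W s) x' y')) by ring.
    rewrite Rabs_Ropp. apply HY; auto.
Qed.

Lemma chart_rev W d r L c beta : chart W d r L c beta -> chart (time_reversal W) (- d) r L c beta.
Proof.
  intros [H1 H2 H3 H4 H5 H6]. constructor; auto.
  - apply side_opp; auto.
  - apply lip_fields_rev; auto.
  - intros s x y Hs B. rewrite fld_rev. simpl. specialize (H4 s x y Hs B). lra.
  - intros s Hs. rewrite fld_rev. simpl. destruct (H5 s Hs). split; auto. lra.
  - intros s x Hs B Hn. rewrite fld_rev. simpl. specialize (H6 s x Hs B Hn). lra.
Qed.

Lemma same_sign_left W d r L c beta x : chart W d r L c beta -> Rabs x < r ->
  (forall s, side s -> x < beta s) -> same_sign_at W d x.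
Proof.
  intros HC Hx Hb. split; [apply HC|]. intros s Hs.
  pose proof (ch_fold HC s x Hs Hx ltac:(specialize (Hb s Hs); lra)) as H.
  specialize (Hb s Hs). nra.
Qed.

Lemma same_sign_right W d r L c beta x : chart W d r L c beta -> Rabs x < r ->
  (forall s, side s -> beta s < x) -> same_sign_at W (- d) x.
Proof.
  intros HC Hx Hb. split; [apply side_opp, HC|]. intros s Hs.
  pose proof (ch_fold HC s x Hs Hx ltac:(specialize (Hb s Hs); lra)) as H.
  specialize (Hb s Hs). nra.
Qed.

Lemma between_pos T t : 0 < T -> between T t <-> 0 <= t <= T.
Proof. intros H. unfold between. rewrite Rmin_left, Rmax_right by lra. tauto. Qed.

Lemma between_neg T t : T < 0 -> between T t <-> T <= t <= 0.
Proof. intros H. unfold between. rewrite Rmin_right, Rmax_left by lra. tauto. Qed.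

Lemma between_opp T t : between (- T) t <-> between T (- t).
Proof. unfold between, Rmin, Rmax. repeat destruct (Rle_dec _ _); split; lra. Qed.

Lemma between_swap T t : between (- T) t <-> between T (T + t).
Proof. unfold between, Rmin, Rmax. repeat destruct (Rle_dec _ _); split; lra. Qed.

Lemma between_ends T : between T 0 /\ between T T.
Proof. unfold between, Rmin, Rmax. repeat destruct (Rle_dec _ _); split; lra. Qed.

Definition arc_in_box (r T : R) (U V : R -> R) : Prop := forall t, between T t -> in_box r (U t) (V t).

Lemma return_arc_rev s f x x' T U V : return_arc s f x x' T U V ->
  return_arc s (opposite_field f) x x' (- T) (fun t => U (- t)) (fun t => V (- t)).
Proof.
  intros (HT & HO & H1 & H2 & H3 & H4 & H5). split; [lra|]. split; [|repeat split].
  - intros t Ht. apply between_opp in Ht. destruct (HO _ Ht). simpl.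
    split; apply is_derive_rev; assumption.
  - rewrite Ropp_0; auto.
  - rewrite Ropp_0; auto.
  - rewrite Ropp_involutive; auto.
  - rewrite Ropp_involutive; auto.
  - intros t Ht. apply H5. revert Ht. unfold Rmin, Rmax. repeat destruct (Rle_dec _ _); lra.
Qed.

Lemma return_arc_swap s f x x' T U V : return_arc s f x x' T U V ->
  return_arc s f x' x (- T) (fun t => U (t + T)) (fun t => V (t + T)).
Proof.
  intros (HT & HO & H1 & H2 & H3 & H4 & H5). split; [lra|]. split; [|repeat split].
  - intros t Ht. apply between_swap in Ht. rewrite Rplus_comm in Ht. destruct (HO _ Ht).
    split; apply is_derive_shift; assumption.
  - rewrite Rplus_0_l; auto.
  - rewrite Rplus_0_l; auto.
  - rewrite Rplus_opp_l; auto.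
  - rewrite Rplus_opp_l; auto.
  - intros t Ht. apply H5. revert Ht. unfold Rmin, Rmax. repeat destruct (Rle_dec _ _); lra.
Qed.

Lemma arc_in_box_rev r T U V : arc_in_box r T U V -> arc_in_box r (- T) (fun t => U (- t)) (fun t => V (- t)).
Proof. intros H t Ht. apply H. apply between_opp; auto. Qed.

Lemma arc_in_box_swap r T U V : arc_in_box r T U V -> arc_in_box r (- T) (fun t => U (t + T)) (fun t => V (t + T)).
Proof. intros H t Ht. apply H. apply between_swap in Ht. rewrite Rplus_comm; auto. Qed.

Lemma return_arc_cont s f x x' T U V a b : return_arc s f x x' T U V -> between T a -> between T b ->
  cont_seg U a b /\ cont_seg V a b.
Proof.
  intros (HT & HO & _) Ha Hb. unfold between in *.
  split; apply derive_seg; intros t Ht; eexists; apply HO; unfold between; lra.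
Qed.

Lemma return_forward r s f x x' T U V : 0 < T -> return_arc s f x x' T U V -> arc_in_box r T U V ->
  forward_arc r s f T U V.
Proof.
  intros HT HA HB. destruct (return_arc_cont _ _ _ _ _ _ _ 0 T HA (proj1 (between_ends T)) (proj2 (between_ends T))).
  destruct HA as (_ & HO & _ & _ & _ & _ & H5). constructor; auto.
  - intros t Ht. apply HB. apply between_pos; auto.
  - intros t Ht. split; [apply H5; rewrite Rmin_left, Rmax_right; lra|]. apply HO. apply between_pos; auto; lra.
Qed.

(** An arc that starts by entering the half-plane s cannot start where the field points to the other
    side. *)
Lemma arc_start_sign s f x x' T U V q : return_arc s f x x' T U V -> 0 < T -> side s -> side q ->
  0 < q * vY f x 0 -> q = s.
Proof.
  intros (HT & HO & H1 & H2 & H3 & H4 & H5) HTp Hs Hq Hpos.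
  assert (Hy : 0 <= s * vY f x 0).
  { destruct (HO 0 (proj1 (between_ends T))) as [_ HV]. rewrite H1, H2 in HV.
    destruct (Rle_lt_dec 0 (s * vY f x 0)) as [|Hneg]; auto. exfalso.
    destruct (proj1 (is_derive_eps V 0 _) HV (- (s * vY f x 0) / 2) ltac:(lra)) as [dl [Hdl H]].
    set (h := Rmin (dl / 2) (T / 2)).
    assert (Hh : 0 < h /\ h <= dl / 2 /\ h <= T / 2).
    { apply Rmin_pair; lra. }
    specialize (H h). rewrite Rminus_0_r, (Rabs_pos_eq h), H2 in H by lra. specialize (H ltac:(lra)).
    specialize (H5 h). rewrite Rmin_left, Rmax_right in H5 by lra. specialize (H5 ltac:(lra)).
    apply Rabs_le_between in H. destruct Hs as [-> | ->]; nra. }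
  destruct Hs as [-> | ->], Hq as [-> | ->]; auto; lra.
Qed.

Lemma follow_return_pos W r L s x x' T U V u v a b t0 q : lip_fields W r L -> side s -> 0 < T ->
  return_arc s (fld W s) x x' T U V -> arc_in_box r T U V -> same_sign_at W q x ->
  motion W r u v a b -> a <= t0 -> u t0 = x -> v t0 = 0 ->
  forall tau, between T tau -> t0 + tau <= b -> u (t0 + tau) = U tau /\ v (t0 + tau) = V tau.
Proof.
  intros HL Hs HT HA HB Hq HM Ht0 Eu Ev tau Htau Hb. apply between_pos in Htau; auto.
  assert (q = s) by (apply (arc_start_sign _ _ _ _ _ _ _ q HA); auto; apply Hq; auto). subst q.
  destruct (follow W r L s T U V u v a b t0 0 HL Hs (return_forward _ _ _ _ _ _ _ _ HT HA HB) HM) with (t := t0 + tau)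
    as [E1 E2]; try lra.
  - destruct HA as (_ & _ & H1 & _). rewrite H1; auto.
  - destruct HA as (_ & _ & _ & H2 & _). rewrite H2; auto.
  - intros _. split; auto. rewrite Eu. exact Hq.
  - replace (t0 + tau + (0 - t0)) with tau in * by ring. auto.
Qed.

Lemma same_sign_rev W q x : same_sign_at W q x -> same_sign_at (time_reversal W) (- q) x.
Proof.
  intros [Hq H]. split; [apply side_opp; auto|]. intros s Hs. rewrite fld_rev. simpl.
  specialize (H s Hs). lra.
Qed.

(** From a crossing point a motion follows the arcs on both sides, one in the future and the other
    in the past; the latter is the former for the reversed system. *)
Lemma follow_return W r L s x x' T U V u v a b t0 q : lip_fields W r L -> side s ->
  return_arc s (fld W s) x x' T U V -> arc_in_box r T U V -> same_sign_at W q x ->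
  motion W r u v a b -> a <= t0 <= b -> u t0 = x -> v t0 = 0 ->
  forall tau, between T tau -> a <= t0 + tau <= b -> u (t0 + tau) = U tau /\ v (t0 + tau) = V tau.
Proof.
  intros HL Hs HA HB Hq HM Ht0 Eu Ev tau Htau Hb.
  destruct (Rlt_le_dec 0 T) as [HT|HT].
  - apply (follow_return_pos W r L s x x' T U V u v a b t0 q); auto; lra.
  - assert (T < 0) by (destruct HA; lra).
    destruct (follow_return_pos (time_reversal W) r L s x x' (- T) (fun t => U (- t)) (fun t => V (- t))
      (fun t => u (- t)) (fun t => v (- t)) (- b) (- a) (- t0) (- q)) with (tau := - tau) as [E1 E2]; auto; try lra.
    + apply lip_fields_rev; auto.
    + rewrite fld_rev. apply return_arc_rev; auto.
    + apply arc_in_box_rev; auto.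
    + apply same_sign_rev; auto.
    + apply motion_rev; auto.
    + rewrite Ropp_involutive; auto.
    + rewrite Ropp_involutive; auto.
    + apply between_opp. rewrite Ropp_involutive; auto.
    + replace (- (- t0 + - tau)) with (t0 + tau) in * by ring. rewrite Ropp_involutive in *. auto.
Qed.

(** Real induction for a strict inequality. *)
Lemma first_zero g a b : a <= b -> cont_seg g a b -> 0 < g a ->
  (forall t, a <= t <= b -> 0 < g t) \/
  (exists t1, a < t1 <= b /\ g t1 = 0 /\ forall t, a <= t < t1 -> 0 < g t).
Proof.
  intros Hab Hc Ha.
  destruct (excluded_middle_informative (exists t1, a < t1 <= b /\ g t1 = 0 /\ forall t, a <= t < t1 -> 0 < g t))
    as [H|H]; [right; auto|left].
  apply (real_induct (fun t => 0 < g t)); auto.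
  - intros t Ht HP. specialize (HP t ltac:(lra)). destruct (Hc t ltac:(lra) (g t) HP) as [d [Hd H']].
    exists d; split; auto. intros t' Ht' Hb. specialize (H' t' ltac:(lra) ltac:(apply Rabs_def1; lra)).
    apply Rabs_def2 in H'. lra.
  - intros t Ht HP. destruct (Rtotal_order (g t) 0) as [Hlt|[He|Hgt]]; [| |auto].
    + exfalso. destruct (Hc t ltac:(lra) (- g t) ltac:(lra)) as [d [Hd H']].
      set (h := Rmin (d / 2) (t - a)).
      assert (Hh : 0 < h /\ h <= d / 2 /\ h <= t - a).
      { apply Rmin_pair; lra. }
      specialize (H' (t - h) ltac:(lra)). replace (t - h - t) with (- h) in H' by ring.
      rewrite Rabs_Ropp, Rabs_pos_eq in H' by lra. specialize (H' ltac:(lra)). apply Rabs_def2 in H'.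
      specialize (HP (t - h) ltac:(lra)). lra.
    + exfalso. apply H. exists t. auto.
Qed.

Lemma cont_seg_scal k f a b : a <= b -> cont_seg f a b -> cont_seg (fun t => k * f t) a b.
Proof. intros Hab H. apply (cont_seg_mult (fun _ => k) f); auto. apply cont_seg_const. Qed.

(** The horizontal speed keeps a motion from staying in a half-plane of the box for longer than 2 r
    / c. It leaves past the fold: before the fold the field at height 0 points into the
    half-plane, so by Gronwall s v could not decrease to 0. *)
Lemma exit_forward W d r L c beta s u v a b t0 : chart W d r L c beta -> side s ->
  motion W r u v a b -> (forall t, a <= t <= b -> in_box r (u t) (v t)) ->
  a <= t0 -> t0 + 2 * r / c < b -> 0 < s * v t0 ->
  exists t1, t0 < t1 <= b /\ v t1 = 0 /\ 0 < s * d * (u t1 - beta s).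
Proof.
  intros HC Hs HM HB Ha Hb Hv.
  destruct (ch_lip HC) as (Hr & HL & Hlip). pose proof (ch_c HC) as Hc.
  pose proof (ch_side HC) as Hd.
  assert (Hrc : 0 < 2 * r / c) by (apply Rdiv_lt_0_compat; lra).
  destruct HM as [Cu Cv Hside _].
  assert (Cu' : cont_seg u t0 b) by (eapply cont_seg_sub; [| |exact Cu]; lra).
  assert (Cv' : cont_seg v t0 b) by (eapply cont_seg_sub; [| |exact Cv]; lra).
  assert (Hincr : forall t1 t2, t0 <= t1 -> t1 <= t2 -> t2 <= b -> (forall t, t1 < t < t2 -> 0 < s * v t) ->
      c * (t2 - t1) <= s * d * u t2 - s * d * u t1).
  { intros t1 t2 H1 H12 H2 Hp. apply (seg_ge (fun t => s * d * u t)); auto.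
    - apply cont_seg_scal; auto. eapply cont_seg_sub; [| |exact Cu]; lra.
    - intros t Ht. destruct (Hside s t Hs ltac:(lra) (HB t ltac:(lra)) (Hp t Ht)) as [Du _].
      exists (s * d * vX (fld W s) (u t) (v t)). split; [apply is_derive_Rscal; exact Du|].
      apply (ch_dir HC); auto. apply HB; lra. }
  assert (Hsd : side (s * d)) by (apply side_mult; auto).
  destruct (first_zero (fun t => s * v t) t0 b) as [Hall|(t1 & Ht1 & Hz & Hp)]; try lra; auto.
  - apply cont_seg_scal; auto; lra.
  - exfalso. specialize (Hincr t0 b ltac:(lra) ltac:(lra) ltac:(lra)).
    assert (c * (b - t0) <= s * d * u b - s * d * u t0) by (apply Hincr; intros; apply Hall; lra).
    destruct (HB b ltac:(lra)) as [B1 _]. destruct (HB t0 ltac:(lra)) as [B2 _].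
    apply Rabs_def2 in B1. apply Rabs_def2 in B2.
    assert (c * (2 * r / c) < c * (b - t0)) by (apply Rmult_lt_compat_l; lra).
    replace (c * (2 * r / c)) with (2 * r) in H0 by (field; lra).
    destruct Hsd as [E|E]; rewrite E in *; lra.
  - exists t1. split; [lra|]. split; [destruct Hs as [-> | ->]; lra|].
    destruct (Rlt_le_dec 0 (s * d * (u t1 - beta s))) as [|Hle]; auto. exfalso.
    assert (Hgr : s * v t0 <= s * v t1 * exp (L * (t1 - t0))).
    { apply (growth_rev (fun t => s * v t)); [lra| |].
      - apply cont_seg_scal; [lra|]. eapply cont_seg_sub; [| |exact Cv]; lra.
      - intros t Ht. assert (Hvt := Hp t ltac:(lra)).
        destruct (Hside s t Hs ltac:(lra) (HB t ltac:(lra)) Hvt) as [_ Dv].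
        exists (s * vY (fld W s) (u t) (v t)). split; [apply is_derive_Rscal; exact Dv|].
        assert (Hu : s * d * (u t - beta s) <= 0).
        { specialize (Hincr t t1 ltac:(lra) ltac:(lra) ltac:(lra)).
          assert (c * (t1 - t) <= s * d * u t1 - s * d * u t) by (apply Hincr; intros; apply Hp; lra).
          assert (0 <= c * (t1 - t)) by (apply Rmult_le_pos; lra). nra. }
        destruct (HB t ltac:(lra)) as [B1 B2].
        assert (HY0 : 0 <= s * vY (fld W s) (u t) 0).
        { destruct (Req_dec (u t) (beta s)) as [->|Hn].
          - rewrite (proj2 (ch_fold0 HC s Hs)). lra.
          - pose proof (ch_fold HC s (u t) Hs B1 Hn) as HF.
            destruct Hs as [-> | ->], Hd as [-> | ->]; nra. }
        destruct (Hlip s Hs) as [_ HY].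
        specialize (HY (u t) (v t) (u t) 0 (conj B1 B2)).
        assert (B0 : in_box r (u t) 0) by (split; [auto|rewrite Rabs_R0; auto]).
        specialize (HY B0). unfold Rminus in HY at 2 3. rewrite Rplus_opp_r, Rabs_R0, Rplus_0_l, Ropp_0, Rplus_0_r in HY.
        assert (Hav : Rabs (v t) = s * v t).
        { destruct Hs as [-> | ->]; [rewrite Rabs_pos_eq; lra|rewrite Rabs_left1; lra]. }
        rewrite Hav in HY. apply Rabs_le_between in HY. destruct Hs as [-> | ->]; lra. }
    rewrite Hz, Rmult_0_l in Hgr. lra.
Qed.

Lemma exit_backward W d r L c beta s u v a b t0 : chart W d r L c beta -> side s ->
  motion W r u v a b -> (forall t, a <= t <= b -> in_box r (u t) (v t)) ->
  t0 <= b -> a < t0 - 2 * r / c -> 0 < s * v t0 ->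
  exists t1, a <= t1 < t0 /\ v t1 = 0 /\ s * d * (u t1 - beta s) < 0.
Proof.
  intros HC Hs HM HB Hb Ha Hv.
  destruct (exit_forward (time_reversal W) (- d) r L c beta s (fun t => u (- t)) (fun t => v (- t)) (- b) (- a) (- t0))
    as (t1 & H1 & H2 & H3); auto.
  - apply chart_rev; auto.
  - apply motion_rev; auto.
  - intros t Ht. apply HB; lra.
  - lra.
  - lra.
  - rewrite Ropp_involutive; auto.
  - exists (- t1). split; [lra|]. split; auto. lra.
Qed.

(** * Return arcs as graphs *)

(** dy / dx along the orbits of the side s, in the coordinates (x, s y), in which both sides become
    the upper half-plane. The direction of time disappears. *)
Definition slope (s : R) (f : vfield) (x y : R) : R := s * vY f x (s * y) / vX f x (s * y).

(** A return arc as a graph over the line; eta is continued by 0 outside [lo, hi], so that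
    continuity needs no restriction. *)
Record graph_arc (F : R -> R -> R) (r lo hi : R) (eta : R -> R) : Prop := {
  ga_lt : lo < hi;
  ga_lo : - r < lo;
  ga_hi : hi < r;
  ga_cont : forall x, continuity_pt eta x;
  ga_pos : forall x, lo < x < hi -> 0 < eta x < r;
  ga_ode : forall x, lo < x < hi -> is_derive eta x (F x (eta x));
  ga_left : forall x, x <= lo -> eta x = 0;
  ga_right : forall x, hi <= x -> eta x = 0 }.
Arguments ga_lt {F r lo hi eta}.
Arguments ga_lo {F r lo hi eta}.
Arguments ga_hi {F r lo hi eta}.
Arguments ga_cont {F r lo hi eta}.
Arguments ga_pos {F r lo hi eta}.
Arguments ga_ode {F r lo hi eta}.
Arguments ga_left {F r lo hi eta}.
Arguments ga_right {F r lo hi eta}.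

(** U is strictly monotone with speed at least c, so it has an inverse theta, with Lipschitz
    constant 1 / c, and eta is s V o theta. The equation for eta is the quotient of those for V
    and U. *)
Lemma arc_graph_pos s g f r c M x x' T U V :
  side s -> side g -> 0 < c -> 0 <= M ->
  (forall a b, in_box r a b -> c <= g * vX f a b /\ Rabs (vY f a b) <= M) ->
  0 < T -> return_arc s f x x' T U V -> arc_in_box r T U V ->
  exists eta, graph_arc (slope s f) r (Rmin x x') (Rmax x x') eta /\
    (forall t, 0 <= t <= T -> Rmin x x' <= U t <= Rmax x x' /\ s * V t = eta (U t)) /\
    (forall z, Rmin x x' <= z <= Rmax x x' -> exists t, 0 <= t <= T /\ U t = z) /\
    c * T <= g * (x' - x).
Proof.
  intros Hs Hg Hc HM HXY HT HA HB.
  destruct (return_arc_cont _ _ _ _ _ _ _ 0 T HA (proj1 (between_ends T)) (proj2 (between_ends T))) as [CU CV].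
  destruct HA as (_ & HO & U0 & V0 & UT & VT & Hpos).
  rewrite Rmin_left, Rmax_right in Hpos by lra.
  assert (HO' : forall t, 0 <= t <= T -> is_derive U t (vX f (U t) (V t)) /\ is_derive V t (vY f (U t) (V t)))
    by (intros; apply HO, between_pos; auto).
  assert (HB' : forall t, 0 <= t <= T -> in_box r (U t) (V t)) by (intros; apply HB, between_pos; auto).
  clear HO HB.
  assert (Hinc : forall t1 t2, 0 <= t1 -> t1 <= t2 -> t2 <= T -> c * (t2 - t1) <= g * U t2 - g * U t1).
  { intros t1 t2 H1 H12 H2. apply (seg_ge (fun t => g * U t)); auto.
    - apply cont_seg_scal; auto. eapply cont_seg_sub; [| |exact CU]; lra.
    - intros t Ht. exists (g * vX f (U t) (V t)). split; [apply is_derive_Rscal, HO'; lra|].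
      apply HXY, HB'; lra. }
  assert (Hinj : forall t1 t2, 0 <= t1 <= T -> 0 <= t2 <= T -> c * Rabs (t2 - t1) <= Rabs (U t2 - U t1)).
  { intros t1 t2 H1 H2.
    assert (H := fun z => side_abs g z Hg).
    destruct (Rle_dec t1 t2).
    - specialize (Hinc t1 t2 ltac:(lra) ltac:(lra) ltac:(lra)). rewrite (Rabs_pos_eq (t2 - t1)) by lra.
      rewrite <- (H (U t2 - U t1)). eapply Rle_trans; [|apply Rle_abs]. lra.
    - specialize (Hinc t2 t1 ltac:(lra) ltac:(lra) ltac:(lra)). rewrite (Rabs_minus_sym t2), (Rabs_minus_sym (U t2)).
      rewrite (Rabs_pos_eq (t1 - t2)) by lra.
      rewrite <- (H (U t1 - U t2)). eapply Rle_trans; [|apply Rle_abs]. lra. }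
  assert (HVlip : forall t1 t2, 0 <= t1 <= T -> 0 <= t2 <= T -> Rabs (V t2 - V t1) <= M * Rabs (t2 - t1)).
  { intros t1 t2 H1 H2. apply derive_lip. intros z Hz.
    assert (0 <= z <= T) by (revert Hz; unfold Rmin, Rmax; destruct (Rle_dec _ _); lra).
    eexists; split; [apply HO'; auto|]. apply HXY, HB'; auto. }
  assert (Hend : c * T <= g * (x' - x)).
  { specialize (Hinc 0 T ltac:(lra) ltac:(lra) ltac:(lra)). rewrite U0, UT in Hinc. lra. }
  assert (HcT : 0 < c * T) by (apply Rmult_lt_0_compat; auto).
  set (lo := Rmin x x') in *. set (hi := Rmax x x') in *.
  assert (Hlh : lo < hi).
  { unfold lo, hi, Rmin, Rmax. destruct (Rle_dec x x'); destruct Hg as [-> | ->]; lra. }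
  assert (Hrange : forall t, 0 <= t <= T -> lo <= U t <= hi).
  { intros t Ht. pose proof (Hinc 0 t ltac:(lra) ltac:(lra) ltac:(lra)) as H1.
    pose proof (Hinc t T ltac:(lra) ltac:(lra) ltac:(lra)) as H2. rewrite U0 in H1. rewrite UT in H2.
    assert (0 <= c * t) by (apply Rmult_le_pos; lra). assert (0 <= c * (T - t)) by (apply Rmult_le_pos; lra).
    unfold lo, hi, Rmin, Rmax. destruct (Rle_dec x x'); destruct Hg as [-> | ->]; lra. }
  assert (Hsurj : forall z, lo <= z <= hi -> exists t, 0 <= t <= T /\ U t = z).
  { intros z Hz. apply seg_IVT; auto; [lra|]. rewrite U0, UT. exact Hz. }
  set (theta := fun z => epsilon (inhabits 0) (fun t => 0 <= t <= T /\ U t = z)).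
  assert (Htheta : forall z, lo <= z <= hi -> 0 <= theta z <= T /\ U (theta z) = z).
  { intros z Hz. apply (epsilon_spec (inhabits 0) (fun t => 0 <= t <= T /\ U t = z)). auto. }
  assert (Hthl : forall z z', lo <= z <= hi -> lo <= z' <= hi -> Rabs (theta z' - theta z) <= Rabs (z' - z) / c).
  { intros z z' Hz Hz'. destruct (Htheta z Hz) as [H1 E1]. destruct (Htheta z' Hz') as [H2 E2].
    specialize (Hinj _ _ H1 H2). rewrite E1, E2 in Hinj.
    apply Rmult_le_reg_l with c; auto. replace (c * (Rabs (z' - z) / c)) with (Rabs (z' - z)) by (field; lra). auto. }
  assert (HthU : forall t, 0 <= t <= T -> theta (U t) = t).
  { intros t Ht. destruct (Htheta (U t) (Hrange t Ht)) as [H1 E1].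
    specialize (Hinj _ _ H1 Ht). rewrite E1 in Hinj. unfold Rminus in Hinj at 2.
    rewrite Rplus_opp_r, Rabs_R0 in Hinj.
    destruct (Req_dec (t - theta (U t)) 0); [lra|].
    pose proof (Rabs_pos_lt _ H). nra. }
  set (eta := fun z => s * V (theta (clamp lo hi z))).
  assert (Hsabs := fun z => side_abs s z Hs).
  assert (Hetal : forall z z', Rabs (eta z' - eta z) <= M / c * Rabs (z' - z)).
  { intros z z'. unfold eta. rewrite <- Rmult_minus_distr_l, Hsabs.
    pose proof (clamp_in lo hi z ltac:(lra)) as K1. pose proof (clamp_in lo hi z' ltac:(lra)) as K2.
    eapply Rle_trans; [apply HVlip; apply Htheta; auto|].
    unfold Rdiv. rewrite Rmult_assoc. apply Rmult_le_compat_l; auto.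
    eapply Rle_trans; [apply Hthl; auto|]. unfold Rdiv. rewrite Rmult_comm.
    apply Rmult_le_compat_l; [left; apply Rinv_0_lt_compat; auto|apply clamp_lip]. }
  assert (Hmc : 0 <= M / c) by (apply Rmult_le_pos; [auto|left; apply Rinv_0_lt_compat; auto]).
  assert (Heta : forall t, 0 <= t <= T -> s * V t = eta (U t)).
  { intros t Ht. unfold eta. rewrite clamp_id by auto. rewrite HthU; auto. }
  assert (Hth0 : lo = U 0 /\ hi = U T \/ lo = U T /\ hi = U 0).
  { rewrite U0, UT. unfold lo, hi, Rmin, Rmax. destruct (Rle_dec x x'); auto. }
  assert (Hlo0 : eta lo = 0 /\ eta hi = 0).
  { destruct Hth0 as [[-> ->]|[-> ->]]; rewrite <- !Heta by lra; rewrite V0, VT; lra. }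
  assert (Hint : forall z, lo < z < hi -> 0 < theta z < T).
  { intros z Hz. destruct (Htheta z ltac:(lra)) as [H1 E1].
    assert (theta z <> 0 /\ theta z <> T) as [N1 N2]; [|lra].
    split; intro E; rewrite E in E1; destruct Hth0 as [[K1 K2]|[K1 K2]]; lra. }
  exists eta. split; [|split; [|split]]; auto.
  constructor; auto.
  - destruct (HB' 0 ltac:(lra)) as [B _]. destruct (HB' T ltac:(lra)) as [B' _].
    apply Rabs_def2 in B, B'. destruct Hth0 as [[-> _]|[-> _]]; lra.
  - destruct (HB' 0 ltac:(lra)) as [B _]. destruct (HB' T ltac:(lra)) as [B' _].
    apply Rabs_def2 in B, B'. destruct Hth0 as [[_ ->]|[_ ->]]; lra.
  - intros z. apply lip_continuity_pt with (M / c); auto.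
  - intros z Hz. pose proof (Hint z Hz) as Ht. destruct (Htheta z ltac:(lra)) as [H1 E1].
    unfold eta. rewrite clamp_id by lra. pose proof (Hpos _ Ht). split; auto.
    destruct (HB' _ H1) as [_ B]. rewrite <- Hsabs in B. rewrite Rabs_pos_eq in B; lra.
  - intros z Hz. pose proof (Hint z Hz) as Ht. destruct (Htheta z ltac:(lra)) as [H1 E1].
    set (t := theta z) in *.
    assert (Ez : eta z = s * V t) by (unfold eta; rewrite clamp_id by lra; auto).
    assert (Es : s * (s * V t) = V t) by (rewrite <- Rmult_assoc, side_sq; auto; ring).
    unfold slope. rewrite Ez, Es. rewrite <- E1.
    set (X := vX f (U t) (V t)). set (Y := vY f (U t) (V t)).
    destruct (HO' t H1) as [DU DV]. fold X in DU. fold Y in DV.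
    destruct (HXY _ _ (HB' t H1)) as [HX HY]. fold X in HX. fold Y in HY.
    assert (HX0 : X <> 0) by (intro E; rewrite E in HX; lra).
    assert (HXa : c <= Rabs X).
    { destruct Hg as [-> | ->]; [rewrite Rabs_pos_eq|rewrite Rabs_left1]; lra. }
    assert (HYX : Rabs (s * Y / X) <= M / c).
    { unfold Rdiv. rewrite Rabs_mult, Hsabs, Rabs_inv. apply Rmult_le_compat; auto; try apply Rabs_pos.
      - left; apply Rinv_0_lt_compat; lra.
      - apply Rinv_le_contravar; auto. }
    apply is_derive_eps. intros eps He.
    (* e1 makes the two errors of first order, of U and of V, add up to eps after the change of
       variable. *)
    set (e1 := eps * c / (1 + M / c)).
    assert (He1 : 0 < e1) by (apply Rdiv_lt_0_compat; [apply Rmult_lt_0_compat; auto|lra]).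
    destruct (proj1 (is_derive_eps U t X) DU e1 He1) as [d1 [Hd1 K1]].
    destruct (proj1 (is_derive_eps V t Y) DV e1 He1) as [d2 [Hd2 K2]].
    set (d := Rmin (c * Rmin d1 d2) (Rmin (z - lo) (hi - z))).
    assert (Hd : 0 < d /\ d <= c * d1 /\ d <= c * d2 /\ d <= z - lo /\ d <= hi - z).
    { assert (0 < Rmin d1 d2) by (apply Rmin_pos; auto).
      Rmin_bounds d1 d2.
      assert (d <= c * Rmin d1 d2) by apply Rmin_l.
      split; [unfold d; repeat apply Rmin_pos; try lra; apply Rmult_lt_0_compat; auto|].
      split; [nra|]. split; [nra|]. split; (eapply Rle_trans; [apply Rmin_r|]); [apply Rmin_l|apply Rmin_r]. }
    exists d. split; [lra|]. intros z' Hz'. rewrite E1 in Hz' |- *.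
    assert (Hz'' : lo <= z' <= hi) by (apply Rabs_def2 in Hz'; lra).
    destruct (Htheta z' Hz'') as [H1' E1']. set (t' := theta z') in *.
    assert (Hdt : c * Rabs (t' - t) <= Rabs (z' - z)).
    { specialize (Hinj t t' H1 H1'). rewrite E1, E1' in Hinj. auto. }
    assert (Hdt1 : Rabs (t' - t) < d1) by (apply Rmult_lt_reg_l with c; lra).
    assert (Hdt2 : Rabs (t' - t) < d2) by (apply Rmult_lt_reg_l with c; lra).
    specialize (K1 t' Hdt1). specialize (K2 t' Hdt2). rewrite E1, E1' in K1.
    assert (Ez' : eta z' = s * V t') by (unfold eta; rewrite clamp_id by lra; auto).
    rewrite Ez, Ez'.
    replace (s * V t' - s * V t - s * Y / X * (z' - z)) with
      (s * (V t' - V t - Y * (t' - t)) - (s * Y / X) * (z' - z - X * (t' - t))) by (field; auto).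
    eapply Rle_trans; [apply Rabs_triang|]. rewrite Rabs_Ropp, Hsabs, (Rabs_mult (s * Y / X)).
    assert (Rabs (s * Y / X) * Rabs (z' - z - X * (t' - t)) <= M / c * (e1 * Rabs (t' - t))).
    { apply Rmult_le_compat; auto; apply Rabs_pos. }
    assert (Ee : e1 * (1 + M / c) = eps * c) by (unfold e1; field; lra).
    apply Rle_trans with ((e1 * (1 + M / c)) * Rabs (t' - t)); [lra|].
    rewrite Ee, Rmult_assoc. apply Rmult_le_compat_l; lra.
  - intros z Hz. rewrite <- (proj1 Hlo0). unfold eta. f_equal. f_equal. f_equal.
    unfold clamp, Rmax, Rmin. repeat destruct (Rle_dec _ _); lra.
  - intros z Hz. rewrite <- (proj2 Hlo0). unfold eta. f_equal. f_equal. f_equal.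
    unfold clamp, Rmax, Rmin. repeat destruct (Rle_dec _ _); lra.
Qed.

(** Arcs followed backward in time are reduced to forward ones by exchanging the end points. *)
Lemma arc_graph s g f r c M x x' T U V :
  side s -> side g -> 0 < c -> 0 <= M ->
  (forall a b, in_box r a b -> c <= g * vX f a b /\ Rabs (vY f a b) <= M) ->
  return_arc s f x x' T U V -> arc_in_box r T U V ->
  exists eta, graph_arc (slope s f) r (Rmin x x') (Rmax x x') eta /\
    (forall t, between T t -> Rmin x x' <= U t <= Rmax x x' /\ s * V t = eta (U t)) /\
    (forall z, Rmin x x' <= z <= Rmax x x' -> exists t, between T t /\ U t = z) /\
    0 < g * T * (x' - x).
Proof.
  intros Hs Hg Hc HM HXY HA HB.
  destruct (Rlt_le_dec 0 T) as [HT|HT].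
  - destruct (arc_graph_pos s g f r c M x x' T U V) as (eta & H1 & H2 & H3 & H4); auto.
    exists eta. split; auto. split; [|split].
    + intros t Ht; apply H2, between_pos; auto.
    + intros z Hz. destruct (H3 z Hz) as (t & Ht & E). exists t; split; auto. apply between_pos; auto.
    + assert (0 < c * T) by (apply Rmult_lt_0_compat; auto). nra.
  - assert (HT' : T < 0) by (destruct HA; lra).
    destruct (arc_graph_pos s g f r c M x' x (- T) (fun t => U (t + T)) (fun t => V (t + T)))
      as (eta & H1 & H2 & H3 & H4); auto.
    + lra.
    + apply return_arc_swap; auto.
    + apply arc_in_box_swap; auto.
    + rewrite (Rmin_comm x' x), (Rmax_comm x' x) in *.
      exists eta. split; auto. split; [|split].
      * intros t Ht. apply between_neg in Ht; auto. specialize (H2 (t - T) ltac:(lra)).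
        replace (t - T + T) with t in H2 by ring. auto.
      * intros z Hz. destruct (H3 z Hz) as (t & Ht & E). exists (t + T); split; auto. apply between_neg; lra.
      * assert (0 < c * - T) by (apply Rmult_lt_0_compat; lra). nra.
Qed.

Definition lip_y (F : R -> R -> R) (r L : R) : Prop := 0 <= L /\ forall x y y',
  Rabs x < r -> Rabs y < r -> Rabs y' < r -> Rabs (F x y - F x y') <= L * Rabs (y - y').

Section Nest.
Variables (F : R -> R -> R) (r L : R).
Hypothesis HF : lip_y F r L.

Lemma ga_seg lo hi eta a b : graph_arc F r lo hi eta -> cont_seg eta a b.
Proof. intros H. apply continuity_pt_seg. intros; apply H. Qed.

Lemma ga_nonneg lo hi eta x : graph_arc F r lo hi eta -> 0 <= eta x.
Proof.
  intros H. destruct (Rle_dec x lo); [rewrite (ga_left H); auto; lra|].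
  destruct (Rle_dec hi x); [rewrite (ga_right H); auto; lra|].
  apply Rlt_le, (ga_pos H); lra.
Qed.

Lemma ga_diff lo hi eta lo' hi' eta' x : graph_arc F r lo hi eta -> graph_arc F r lo' hi' eta' ->
  lo < x < hi -> lo' < x < hi' ->
  exists l : R, is_derive (fun t => eta t - eta' t) x l /\ Rabs l <= L * Rabs (eta x - eta' x).
Proof.
  intros H H' Hx Hx'. exists (F x (eta x) - F x (eta' x)). split.
  - apply is_derive_Rminus; [apply (ga_ode H)|apply (ga_ode H')]; auto.
  - pose proof (ga_pos H x Hx). pose proof (ga_pos H' x Hx').
    pose proof (ga_lo H). pose proof (ga_hi H).
    apply HF; apply Rabs_def1; lra.
Qed.

(** Two arcs never cross: the difference of two solutions keeps its sign and grows at most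
    exponentially. So the arc that starts further to the left ends further to the right. *)
Lemma nest lo hi eta lo' hi' eta' : graph_arc F r lo hi eta -> graph_arc F r lo' hi' eta' ->
  lo < lo' < hi ->
  hi' < hi /\ forall x, lo' <= x <= hi' ->
    0 < eta x - eta' x <= eta lo' * exp (L * (x - lo')).
Proof.
  intros H H' Hl.
  set (m := Rmin hi hi').
  pose proof (ga_lt H'). pose proof (ga_lt H).
  assert (Hm : lo' < m) by (apply Rmin_glb_lt; lra).
  assert (Hm1 : m <= hi) by apply Rmin_l. assert (Hm2 : m <= hi') by apply Rmin_r.
  assert (E0 : eta' lo' = 0) by (apply (ga_left H'); lra).
  assert (Hp0 : 0 < eta lo') by (apply (ga_pos H); lra).
  assert (HL : 0 <= L) by apply HF.
  assert (Hw : forall x, lo' <= x <= m -> 0 < eta x - eta' x <= eta lo' * exp (L * (x - lo'))).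
  { intros x Hx.
    assert (Hc : cont_seg (fun t => eta t - eta' t) lo' x).
    { apply cont_seg_minus; [lra| |]; eapply ga_seg; eauto. }
    assert (Hd : forall t, lo' < t < x -> exists l : R, is_derive (fun t => eta t - eta' t) t l /\
        Rabs l <= L * Rabs (eta t - eta' t)).
    { intros t Ht. eapply ga_diff; eauto; lra. }
    assert (P : 0 < eta x - eta' x).
    { apply (pos_persist (fun t => eta t - eta' t) L lo' x); auto; lra. }
    split; auto.
    destruct (abs_growth (fun t => eta t - eta' t) L lo' x HL ltac:(lra) Hc Hd) as [G _].
    rewrite E0, Rminus_0_r in G. rewrite !Rabs_pos_eq in G by lra. exact G. }
  assert (Hhi : hi' < hi).
  { destruct (Rlt_le_dec hi' hi) as [|Hle]; auto. exfalso.
    assert (m = hi) by (apply Rmin_left; auto).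
    specialize (Hw hi ltac:(lra)). rewrite (ga_right H hi) in Hw by lra.
    pose proof (ga_nonneg _ _ _ hi H'). lra. }
  split; auto. intros x Hx. apply Hw. assert (m = hi') by (apply Rmin_right; lra). lra.
Qed.

(** Same estimate, from equal heights at the common left end. *)
Lemma arc_unique lo hi eta hi' eta' : graph_arc F r lo hi eta -> graph_arc F r lo hi' eta' ->
  hi = hi' /\ forall x, eta x = eta' x.
Proof.
  assert (Hgen : forall hi eta hi' eta', graph_arc F r lo hi eta -> graph_arc F r lo hi' eta' -> hi <= hi' ->
     hi = hi' /\ forall x, eta x = eta' x).
  { clear hi eta hi' eta'. intros hi eta hi' eta' H H' Hle.
    pose proof (ga_lt H'). pose proof (ga_lt H).
    assert (HL : 0 <= L) by apply HF.
    assert (Hw : forall x, lo <= x <= hi -> eta x = eta' x).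
    { intros x Hx.
      destruct (abs_growth (fun t => eta t - eta' t) L lo x HL ltac:(lra)) as [G _].
      - apply cont_seg_minus; [lra| |]; eapply ga_seg; eauto.
      - intros t Ht. eapply ga_diff; eauto; lra.
      - rewrite (ga_left H lo), (ga_left H' lo) in G by lra.
        rewrite Rminus_0_r, Rabs_R0, Rmult_0_l in G.
        pose proof (Rabs_pos (eta x - eta' x)).
        destruct (Req_dec (eta x - eta' x) 0); [lra|]. pose proof (Rabs_pos_lt _ H3). lra. }
    assert (E : hi = hi').
    { destruct (Req_dec hi hi') as [|Hn]; auto. exfalso.
      specialize (Hw hi ltac:(lra)). rewrite (ga_right H hi) in Hw by lra.
      pose proof (ga_pos H' hi ltac:(lra)). lra. }
    split; auto. intros x. destruct (Rle_dec x lo).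
    - rewrite (ga_left H), (ga_left H'); auto.
    - destruct (Rle_dec hi x).
      + rewrite (ga_right H), (ga_right H'); auto; lra.
      + apply Hw; lra. }
  intros H H'. destruct (Rle_dec hi hi').
  - apply Hgen; auto.
  - destruct (Hgen hi' eta' hi eta H' H ltac:(lra)) as [E1 E2]. split; auto.
Qed.

(** The right end determines the order of the left ends; the arcs are assumed to overlap, as
    disjoint ones are not comparable. *)
Lemma nest_rev lo hi eta lo' hi' eta' : graph_arc F r lo hi eta -> graph_arc F r lo' hi' eta' ->
  lo < hi' -> lo' < hi -> (lo < lo' <-> hi' < hi).
Proof.
  intros H H' H1 H2. split.
  - intros Hlt. apply (nest lo hi eta lo' hi' eta'); auto.
  - intros Hlt. destruct (Rtotal_order lo lo') as [|[E|Hgt]]; auto.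
    + subst lo'. destruct (arc_unique _ _ _ _ _ H H'). lra.
    + destruct (nest lo' hi' eta' lo hi eta H' H); lra.
Qed.
End Nest.

(** * Half-return maps: monotonicity and first variation *)

Lemma antiderivative_exists (g : R -> R) : (forall x, continuity_pt g x) ->
  exists G : R -> R, forall x, is_derive G x (g x).
Proof.
  intros Hg. exists (fun x => RInt g 0 x). intros x.
  assert (Hc : forall y, continuous g y) by (intros; apply continuity_pt_filterlim, Hg).
  apply (is_derive_RInt g (fun x => RInt g 0 x) 0 x); auto.
  apply filter_forall. intros y. apply (RInt_correct (V:=R_CompleteNormedModule) g 0 y). apply (ex_RInt_continuous (V:=R_CompleteNormedModule)). auto.
Qed.

Lemma exp_le_mono x y : x <= y -> exp x <= exp y.
Proof. intros [H| ->]; [left; apply exp_increasing; auto|lra]. Qed.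

Lemma exp_lip m x y : x <= m -> y <= m -> Rabs (exp x - exp y) <= exp m * Rabs (x - y).
Proof.
  intros Hx Hy. apply derive_lip. intros z Hz. exists (exp z). split; [apply is_derive_exp|].
  rewrite Rabs_pos_eq by (left; apply exp_pos). apply exp_le_mono. pose proof (Rmax_lub x y m Hx Hy). lra.
Qed.

(** The equation dy / dx = F (x, y) of the orbits on one side of the unshifted line: F is C^1 in y
    in the quantitative sense of hs_taylor (Fy is its partial derivative, Lipschitz in both
    variables), and on the line it behaves like - x^n with n odd, which is the invisible
    tangency of order n + 1. *)
Record half_system (F Fy : R -> R -> R) (r L : R) (n : nat) (f : R -> R) (c0 : R) : Prop := {
  hs_r : 0 < r;
  hs_L : 1 <= L;
  hs_lip : lip_on r L F;
  hs_lipy : lip_on r L Fy;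
  hs_bound : forall x y, in_box r x y -> Rabs (F x y) <= L /\ Rabs (Fy x y) <= L;
  hs_taylor : forall x y y', in_box r x y -> in_box r x y' ->
     Rabs (F x y' - F x y - Fy x y * (y' - y)) <= L * (y' - y) ^ 2;
  hs_odd : Nat.Odd n;
  hs_lead : forall x, Rabs x < r -> F x 0 = x ^ n * f x;
  hs_f : forall x x', Rabs x < r -> Rabs x' < r -> Rabs (f x - f x') <= L * Rabs (x - x');
  hs_c0 : 0 < c0;
  hs_neg : forall x, Rabs x < r -> f x <= - c0 }.
Arguments hs_r {F Fy r L n f c0}.
Arguments hs_L {F Fy r L n f c0}.
Arguments hs_lip {F Fy r L n f c0}.
Arguments hs_lipy {F Fy r L n f c0}.
Arguments hs_bound {F Fy r L n f c0}.
Arguments hs_taylor {F Fy r L n f c0}.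
Arguments hs_odd {F Fy r L n f c0}.
Arguments hs_lead {F Fy r L n f c0}.
Arguments hs_f {F Fy r L n f c0}.
Arguments hs_c0 {F Fy r L n f c0}.
Arguments hs_neg {F Fy r L n f c0}.

(** phi is the half-return map read from left to right, with its arcs as graphs. *)
Record arc_family (F : R -> R -> R) (r rho : R) (phi : R -> R) (eta : R -> R -> R) : Prop := {
  af_rho : 0 < rho <= r;
  af_arc : forall a, - rho < a < 0 -> graph_arc F r a (phi a) (eta a);
  af_pos : forall a, - rho < a < 0 -> 0 < phi a;
  af_small : forall e, 0 < e -> exists d, 0 < d /\ forall a, - d < a < 0 -> phi a < e }.
Arguments af_rho {F r rho phi eta}.
Arguments af_arc {F r rho phi eta}.
Arguments af_pos {F r rho phi eta}.
Arguments af_small {F r rho phi eta}.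

Section HalfReturn.
Variables (F Fy : R -> R -> R) (r L : R) (n : nat) (f : R -> R) (c0 : R).
Hypothesis HS : half_system F Fy r L n f c0.
Variables (rho : R) (phi : R -> R) (eta : R -> R -> R).
Hypothesis AF : arc_family F r rho phi eta.

Let HL : 1 <= L := hs_L HS.
Let Hr : 0 < r := hs_r HS.

Lemma hs_lip_y : lip_y F r L.
Proof.
  split; [lra|]. intros x y y' Hx Hy Hy'.
  eapply Rle_trans; [apply (hs_lip HS); split; auto|].
  replace (x - x) with 0 by ring. rewrite Rabs_R0. lra.
Qed.

Lemma arc_box a x : - rho < a < 0 -> a <= x <= phi a -> in_box r x (eta a x).
Proof.
  intros Ha Hx. pose proof (af_arc AF a Ha) as H.
  pose proof (ga_lo H). pose proof (ga_hi H).
  split; [apply Rabs_def1; lra|].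
  destruct (Req_dec x a) as [->|]; [rewrite (ga_left H) by lra; rewrite Rabs_R0; lra|].
  destruct (Req_dec x (phi a)) as [->|]; [rewrite (ga_right H) by lra; rewrite Rabs_R0; lra|].
  pose proof (ga_pos H x ltac:(lra)). rewrite Rabs_pos_eq; lra.
Qed.

Lemma box0 x : Rabs x < r -> in_box r x 0.
Proof. intros; split; auto; rewrite Rabs_R0; auto. Qed.

Lemma eta_slope a x y : - rho < a < 0 -> a <= x -> x <= y -> y <= phi a ->
  Rabs (eta a y - eta a x) <= L * (y - x).
Proof.
  intros Ha Hx Hxy Hy. pose proof (af_arc AF a Ha) as H.
  apply seg_abs; auto.
  - eapply ga_seg; eauto.
  - intros z Hz. eexists; split; [apply (ga_ode H); lra|].
    apply (hs_bound HS). apply arc_box; auto; lra.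
Qed.

Lemma eta_left_bound a x : - rho < a < 0 -> a <= x <= phi a -> 0 <= eta a x <= L * (x - a).
Proof.
  intros Ha Hx. pose proof (af_arc AF a Ha) as H.
  split; [eapply ga_nonneg; eauto|].
  pose proof (eta_slope a a x Ha ltac:(lra) ltac:(lra) ltac:(lra)) as E.
  rewrite (ga_left H a) in E by lra. rewrite Rminus_0_r in E.
  eapply Rle_trans; [apply Rle_abs|exact E].
Qed.

Lemma eta_right_bound a x : - rho < a < 0 -> a <= x <= phi a -> 0 <= eta a x <= L * (phi a - x).
Proof.
  intros Ha Hx. pose proof (af_arc AF a Ha) as H.
  split; [eapply ga_nonneg; eauto|].
  pose proof (eta_slope a x (phi a) Ha ltac:(lra) ltac:(lra) ltac:(lra)) as E.
  rewrite (ga_right H (phi a)) in E by lra.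
  rewrite Rminus_0_l, Rabs_Ropp in E.
  eapply Rle_trans; [apply Rle_abs|exact E].
Qed.

Lemma phi_range a : - rho < a < 0 -> 0 < phi a < r.
Proof.
  intros Ha. split; [apply (af_pos AF); auto|].
  apply (ga_hi (af_arc AF a Ha)).
Qed.

Let B : R := exp (8 * L * r).

Lemma B_ge z : z <= 8 * L * r -> exp z <= B.
Proof. apply exp_le_mono. Qed.

Lemma Lr_pos : 0 < L * r.
Proof. apply Rmult_lt_0_compat; lra. Qed.

Lemma B_one : 1 <= B.
Proof. pose proof Lr_pos. rewrite <- exp_0. apply B_ge. lra. Qed.

(** Nested arcs are at distance O (a' - a), uniformly. *)
Lemma arc_pair a a' : - rho < a -> a < a' -> a' < 0 ->
  phi a' < phi a /\ forall x, a' <= x <= phi a' -> 0 < eta a x - eta a' x <= L * B * (a' - a).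
Proof.
  intros H1 H2 H3.
  pose proof (phi_range a ltac:(lra)) as P1. pose proof (phi_range a' ltac:(lra)) as P2.
  destruct (nest F r L hs_lip_y a (phi a) (eta a) a' (phi a') (eta a')
    (af_arc AF a ltac:(lra)) (af_arc AF a' ltac:(lra)) ltac:(lra)) as [N1 N2].
  split; auto. intros x Hx. destruct (N2 x Hx) as [N3 N4]. split; auto.
  eapply Rle_trans; [exact N4|].
  pose proof (af_rho AF).
  assert (exp (L * (x - a')) <= B). { apply B_ge. pose proof Lr_pos. nra. }
  pose proof (eta_left_bound a a' ltac:(lra) ltac:(lra)) as [E1 E2].
  pose proof (exp_pos (L * (x - a'))).
  apply Rle_trans with (L * (a' - a) * B); [|right; ring].
  apply Rmult_le_compat; auto; lra.
Qed.

Lemma pow_neg_odd x : x < 0 -> x ^ n < 0.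
Proof.
  intros Hx. destruct (hs_odd HS) as [m ->]. rewrite pow_add, pow_mult, pow_1.
  assert (0 < (x ^ 2) ^ m) by (apply pow_lt; nra). nra.
Qed.

(** Below x = phi a' the exterior arc is at height O (a' - a), and from there on it descends with
    slope at most - c0 (phi a')^n, up to the factor exp (L x) that absorbs its dependence on the
    height. *)
Lemma phi_lip a a' : - rho < a -> a < a' -> a' < 0 ->
  0 < phi a - phi a' <= L * B * B / (c0 * phi a' ^ n) * (a' - a).
Proof.
  intros H1 H2 H3. destruct (arc_pair a a' H1 H2 H3) as [Hphi Hw]. split; [lra|].
  pose proof (phi_range a ltac:(lra)) as P1. pose proof (phi_range a' ltac:(lra)) as P2.
  pose proof (af_arc AF a ltac:(lra)) as HA. pose proof (af_arc AF a' ltac:(lra)) as HA'.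
  pose proof (hs_c0 HS) as Hc0.
  set (m := c0 * phi a' ^ n).
  assert (Hm : 0 < m) by (apply Rmult_lt_0_compat; auto; apply pow_lt; lra).
  pose proof Lr_pos as HLr. pose proof B_one as HB1.
  assert (HG : (fun x => eta a x * exp (- L * x)) (phi a) - (fun x => eta a x * exp (- L * x)) (phi a')
     <= (- m * / B) * (phi a - phi a')).
  { apply (seg_le (fun x => eta a x * exp (- L * x))); [lra| |].
    - apply (cont_seg_mult (eta a) (fun x => exp (- L * x))); [lra|eapply ga_seg; eauto|apply cont_seg_exp].
    - intros x Hx. exists ((F x (eta a x) - L * eta a x) * exp (- L * x)). split.
      + eapply is_derive_eq.
        * apply is_derive_Rmult; [apply (ga_ode HA); lra|apply is_derive_exp_lin].
        * simpl; ring.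
      + assert (Bx : in_box r x (eta a x)) by (apply arc_box; lra).
        pose proof (eta_left_bound a x ltac:(lra) ltac:(lra)) as [E1 _].
        pose proof (proj2 hs_lip_y x (eta a x) 0 (proj1 Bx) (proj2 Bx) ltac:(rewrite Rabs_R0; auto)) as HF.
        rewrite Rminus_0_r, (Rabs_pos_eq (eta a x)) in HF by auto. apply Rabs_le_between in HF.
        assert (F x 0 <= - m).
        { rewrite (hs_lead HS x (proj1 Bx)).
          pose proof (hs_neg HS x (proj1 Bx)).
          assert (phi a' ^ n <= x ^ n) by (apply pow_incr; lra).
          assert (0 < x ^ n) by (apply pow_lt; lra).
          unfold m. nra. }
        assert (HeB : / B <= exp (- L * x)).
        { unfold B. rewrite <- exp_Ropp. apply exp_le_mono.
          assert (L * x <= L * r) by (apply Rmult_le_compat_l; lra). lra. }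
        assert (0 < / B) by (apply Rinv_0_lt_compat; lra). nra. }
  simpl in HG. rewrite (ga_right HA (phi a)) in HG by lra.
  assert (Hc' : eta a (phi a') * exp (- L * phi a') <= L * B * (a' - a)).
  { specialize (Hw (phi a') ltac:(lra)). rewrite (ga_right HA' (phi a')) in Hw by lra.
    assert (exp (- L * phi a') <= 1).
    { rewrite <- exp_0. apply exp_le_mono. assert (0 < L * phi a') by (apply Rmult_lt_0_compat; lra). lra. }
    pose proof (exp_pos (- L * phi a')). nra. }
  assert (Hfin : m * / B * (phi a - phi a') <= L * B * (a' - a)) by lra.
  apply Rmult_le_reg_l with (m * / B).
  - apply Rmult_lt_0_compat; auto. apply Rinv_0_lt_compat; lra.
  - replace (m * / B * (L * B * B / m * (a' - a))) with (L * B * (a' - a)) by (field; lra). auto.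
Qed.

Lemma phi_decr a a' : - rho < a -> a < a' -> a' < 0 -> phi a' < phi a.
Proof. intros. apply arc_pair; auto. Qed.

Lemma phi_cont a : - rho < a < 0 -> continuity_pt phi a.
Proof.
  intros Ha. apply continuity_pt_eps. intros e He.
  set (a2 := a / 2). assert (Ha2 : a < a2 < 0) by (unfold a2; lra).
  pose proof (phi_range a2 ltac:(lra)) as P2.
  set (K := L * B * B / (c0 * phi a2 ^ n)).
  assert (Hden : 0 < c0 * phi a2 ^ n).
  { apply Rmult_lt_0_compat; [apply HS|apply pow_lt; lra]. }
  pose proof B_one.
  assert (HLBB : 0 < L * B * B) by (repeat apply Rmult_lt_0_compat; lra).
  assert (HK : 0 < K) by (apply Rdiv_lt_0_compat; auto).
  assert (Hgen : forall x y, - rho < x -> x < y -> y < a2 -> 0 < phi x - phi y <= K * (y - x)).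
  { intros x y Hx Hxy Hy. destruct (phi_lip x y Hx Hxy ltac:(lra)) as [G1 G2]. split; auto.
    eapply Rle_trans; [exact G2|]. apply Rmult_le_compat_r; [lra|]. unfold K, Rdiv.
    apply Rmult_le_compat_l; [lra|]. apply Rinv_le_contravar; auto.
    apply Rmult_le_compat_l; [left; apply HS|]. apply pow_incr.
    pose proof (phi_decr y a2 ltac:(lra) ltac:(lra) ltac:(lra)). lra. }
  exists (Rmin (e / K) (Rmin (a + rho) (a2 - a))).
  split; [repeat apply Rmin_pos; try lra; apply Rdiv_lt_0_compat; auto|].
  intros y Hy.
  Rmin_bounds (e / K) (Rmin (a + rho) (a2 - a)).
  Rmin_bounds (a + rho) (a2 - a).
  assert (HKe : K * Rabs (y - a) < e).
  { replace e with (K * (e / K)) by (field; lra). apply Rmult_lt_compat_l; lra. }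
  destruct (Rtotal_order y a) as [Hlt|[->|Hgt]].
  - rewrite Rabs_left in Hy, HKe by lra. destruct (Hgen y a ltac:(lra) Hlt ltac:(lra)).
    rewrite Rabs_pos_eq; lra.
  - unfold Rminus. rewrite Rplus_opp_r, Rabs_R0; auto.
  - rewrite Rabs_pos_eq in Hy, HKe by lra. destruct (Hgen a y ltac:(lra) Hgt ltac:(lra)).
    rewrite Rabs_minus_sym, Rabs_pos_eq; lra.
Qed.

(** An antiderivative of Fy along the arc, whose exponential is the factor by which a small vertical
    displacement grows. Clamping makes the integrand continuous on the line. *)
Definition is_log_gain (a : R) (G : R -> R) : Prop :=
  forall x, is_derive G x (Fy (clamp a (phi a) x) (eta a (clamp a (phi a) x))).

Lemma log_gain_exists a : - rho < a < 0 -> exists G, is_log_gain a G.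
Proof.
  intros Ha. apply antiderivative_exists. intros x.
  pose proof (phi_range a Ha) as P. pose proof (af_arc AF a Ha) as HA.
  assert (Hin : forall x, a <= clamp a (phi a) x <= phi a) by (intros; apply clamp_in; lra).
  apply lip_continuity_pt with (L * (1 + L)); [nra|]. intros y.
  eapply Rle_trans; [apply (hs_lipy HS); apply arc_box; auto|].
  set (p := clamp a (phi a) y) in *. set (q := clamp a (phi a) x) in *.
  assert (Hpq : Rabs (p - q) <= Rabs (y - x)) by apply clamp_lip.
  assert (Heta : Rabs (eta a p - eta a q) <= L * Rabs (p - q)).
  { destruct (Rle_dec p q).
    - rewrite (Rabs_minus_sym (eta a p)), (Rabs_minus_sym p), (Rabs_pos_eq (q - p)) by lra.
      apply eta_slope; auto; apply Hin.
    - rewrite (Rabs_pos_eq (p - q)) by lra. apply eta_slope; auto; try apply Hin; lra. }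
  pose proof (Rabs_pos (p - q)). rewrite Rmult_assoc. apply Rmult_le_compat_l; [lra|]. nra.
Qed.

Definition gain (a : R) : R -> R := epsilon (inhabits (fun _ => 0)) (is_log_gain a).

Lemma gain_spec a : - rho < a < 0 -> is_log_gain a (gain a).
Proof. intros Ha. apply (epsilon_spec (inhabits (fun _ : R => 0)) (is_log_gain a)). apply log_gain_exists; auto. Qed.

(** The integral of Fy along the whole arc. *)
Definition loggain (a : R) : R := gain a (phi a) - gain a a.

Lemma gain_lip a x y : - rho < a < 0 -> x <= y -> Rabs (gain a y - gain a x) <= L * (y - x).
Proof.
  intros Ha Hxy. pose proof (gain_spec a Ha) as HG. pose proof (phi_range a Ha).
  apply seg_abs; auto.
  - apply derive_seg. intros z _. eexists; apply HG.
  - intros z _. eexists; split; [apply HG|]. apply (hs_bound HS).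
    apply arc_box; auto. apply clamp_in; lra.
Qed.

Lemma loggain_bound a : - rho < a < 0 -> Rabs (loggain a) <= L * (phi a - a).
Proof. intros Ha. pose proof (phi_range a Ha). apply gain_lip; auto; lra. Qed.

Lemma loggain_lip a a' : - rho < a -> a < a' -> a' < 0 ->
  Rabs (loggain a - loggain a') <= (L * (2 * r) * (L * B) + L) * ((a' - a) + (phi a - phi a')).
Proof.
  intros H1 H2 H3. destruct (arc_pair a a' H1 H2 H3) as [Hphi Hw].
  pose proof (phi_range a ltac:(lra)) as P1. pose proof (phi_range a' ltac:(lra)) as P2.
  pose proof (gain_spec a ltac:(lra)) as HG. pose proof (gain_spec a' ltac:(lra)) as HG'.
  pose proof (af_rho AF).
  pose proof (gain_lip a (phi a') (phi a) ltac:(lra) ltac:(lra)) as K1.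
  pose proof (gain_lip a a a' ltac:(lra) ltac:(lra)) as K2.
  assert (K3 : Rabs ((fun x => gain a x - gain a' x) (phi a') - (fun x => gain a x - gain a' x) a')
     <= L * (L * B * (a' - a)) * (phi a' - a')).
  { apply (seg_abs (fun x => gain a x - gain a' x)); [lra| |].
    - apply cont_seg_minus; [lra| |]; apply derive_seg; intros z _; eexists; [apply HG|apply HG'].
    - intros x Hx. eexists. split; [apply is_derive_Rminus; [apply HG|apply HG']|].
      rewrite !clamp_id by lra.
      eapply Rle_trans; [apply (hs_lipy HS); apply arc_box; lra|].
      replace (x - x) with 0 by ring. rewrite Rabs_R0, Rplus_0_l.
      apply Rmult_le_compat_l; [lra|]. specialize (Hw x ltac:(lra)). rewrite Rabs_pos_eq; lra. }
  simpl in K3.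
  unfold loggain.
  replace (gain a (phi a) - gain a a - (gain a' (phi a') - gain a' a')) with
    ((gain a (phi a) - gain a (phi a')) + (gain a (phi a') - gain a' (phi a') - (gain a a' - gain a' a'))
       + (gain a a' - gain a a)) by ring.
  eapply Rle_trans; [apply Rabs_triang|].
  eapply Rle_trans; [apply Rplus_le_compat_r, Rabs_triang|].
  assert (L * (L * B * (a' - a)) * (phi a' - a') <= L * (2 * r) * (L * B) * (a' - a)).
  { pose proof B_one. replace (L * (2 * r) * (L * B) * (a' - a)) with (L * (L * B * (a' - a)) * (2 * r)) by ring.
    apply Rmult_le_compat_l; [|lra].
    repeat apply Rmult_le_pos; lra. }
  assert (0 <= L * (2 * r) * (L * B) * (phi a - phi a')).
  { pose proof B_one. repeat apply Rmult_le_pos; lra. }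
  nra.
Qed.

(** The differential relation between the two ends of an arc, with an error of second order. The
    difference w of the heights of two arcs satisfies the linearized equation w' = Fy w up to O
    (w^2), so w (x) exp (gain (phi a) - gain x) is constant up to O ((a' - a)^2) on their common
    domain. At its left end, w is approximately F (a, 0) (a' - a), at its right end - F (phi a, 0)
    (phi a - phi a'). *)
Lemma first_variation : exists K, 0 < K /\ forall a a', - rho < a -> a < a' -> a' < 0 ->
  Rabs (F a 0 * exp (loggain a) * (a' - a) + F (phi a) 0 * (phi a - phi a'))
    <= K * ((a' - a) ^ 2 + (phi a - phi a') ^ 2).
Proof.
  pose proof B_one as HB1. pose proof Lr_pos as HLr.
  set (K1 := L * (L * B) ^ 2 * B * (2 * r)).
  set (K2 := L * (1 + L) * B + L * (B * L)).
  assert (HK1 : 0 <= K1) by (unfold K1; repeat apply Rmult_le_pos; try lra; apply pow2_ge_0).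
  assert (HK2 : 0 < K2).
  { unfold K2. assert (0 < L * (1 + L) * B) by (repeat apply Rmult_lt_0_compat; lra).
    assert (0 < L * (B * L)) by (repeat apply Rmult_lt_0_compat; lra). lra. }
  exists (K1 + K2). split; [lra|]. intros a a' H1 H2 H3.
  destruct (arc_pair a a' H1 H2 H3) as [Hphi Hw].
  pose proof (phi_range a ltac:(lra)) as P1. pose proof (phi_range a' ltac:(lra)) as P2.
  pose proof (af_rho AF) as Hrho.
  pose proof (af_arc AF a ltac:(lra)) as HA. pose proof (af_arc AF a' ltac:(lra)) as HA'.
  pose proof (gain_spec a ltac:(lra)) as HG.
  set (c := phi a) in *. set (c' := phi a') in *.
  set (w := fun x => eta a x - eta a' x).
  assert (Hexp : forall x, a <= x <= c -> exp (gain a c - gain a x) <= B /\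
      Rabs (exp (gain a c - gain a x)) <= B).
  { intros x Hx. pose proof (gain_lip a x c ltac:(lra) ltac:(lra)) as E.
    assert (exp (gain a c - gain a x) <= B).
    { apply B_ge. pose proof (Rle_abs (gain a c - gain a x)).
      assert (L * (c - x) <= L * (2 * r)) by (apply Rmult_le_compat_l; lra). lra. }
    split; auto. rewrite Rabs_pos_eq; auto. left; apply exp_pos. }
  assert (HPsi : Rabs ((fun x => w x * exp (gain a c - gain a x)) c' -
                       (fun x => w x * exp (gain a c - gain a x)) a') <= K1 * (a' - a) ^ 2).
  { assert (Hs : Rabs ((fun x => w x * exp (gain a c - gain a x)) c' -
                       (fun x => w x * exp (gain a c - gain a x)) a')
        <= (L * (L * B * (a' - a)) ^ 2 * B) * (c' - a')).
    { assert (Dexp : forall x, is_derive (fun x => exp (gain a c - gain a x)) x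
         (exp (gain a c - gain a x) * (0 - Fy (clamp a c x) (eta a (clamp a c x))))).
      { intros x. apply (is_derive_Rcomp exp (fun x => gain a c - gain a x)).
        - apply is_derive_exp.
        - apply is_derive_Rminus; [apply @is_derive_const|apply HG]. }
      apply (seg_abs (fun x => w x * exp (gain a c - gain a x))); [lra| |].
      - apply (cont_seg_mult w (fun x => exp (gain a c - gain a x))); [lra| |].
        + apply cont_seg_minus; [lra| |]; eapply ga_seg; eauto.
        + apply derive_seg. intros x _. eexists; apply Dexp.
      - intros x Hx.
        exists ((F x (eta a x) - F x (eta a' x) - Fy x (eta a x) * w x) * exp (gain a c - gain a x)). split.
        + eapply is_derive_eq.
          * apply is_derive_Rmult; [|apply Dexp].
            apply is_derive_Rminus; [apply (ga_ode HA)|apply (ga_ode HA')]; lra.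
          * rewrite clamp_id by lra. unfold w. simpl. ring.
        + rewrite Rabs_mult. apply Rmult_le_compat; try apply Rabs_pos; [|apply Hexp; lra].
          assert (B1 : in_box r x (eta a x)) by (apply arc_box; fold c; lra).
          assert (B2 : in_box r x (eta a' x)) by (apply arc_box; fold c'; lra).
          pose proof (hs_taylor HS x _ _ B1 B2) as HT.
          rewrite <- Rabs_Ropp in HT.
          replace (- (F x (eta a' x) - F x (eta a x) - Fy x (eta a x) * (eta a' x - eta a x))) with
            (F x (eta a x) - F x (eta a' x) - Fy x (eta a x) * w x) in HT by (unfold w; ring).
          eapply Rle_trans; [exact HT|]. apply Rmult_le_compat_l; [lra|].
          replace ((eta a' x - eta a x) ^ 2) with ((eta a x - eta a' x) ^ 2) by ring.
          apply pow_incr. specialize (Hw x ltac:(lra)). lra. }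
    eapply Rle_trans; [exact Hs|]. unfold K1.
    replace (L * (L * B) ^ 2 * B * (2 * r) * (a' - a) ^ 2) with ((L * (L * B * (a' - a)) ^ 2 * B) * (2 * r)) by ring.
    apply Rmult_le_compat_l; [|lra].
    repeat apply Rmult_le_pos; try lra; apply pow2_ge_0. }
  cbv beta in HPsi.
  assert (Ew1 : w c' = eta a c') by (unfold w; rewrite (ga_right HA' c') by lra; ring).
  assert (Ew2 : w a' = eta a a') by (unfold w; rewrite (ga_left HA' a') by lra; ring).
  rewrite Ew1, Ew2 in HPsi.
  assert (HLeft : Rabs (eta a a' * exp (gain a c - gain a a') - F a 0 * exp (loggain a) * (a' - a)) <= K2 * (a' - a) ^ 2).
  { destruct (seg_MVT (eta a) (fun x => F x (eta a x)) a a') as [x [Hx E]]; auto.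
    { eapply ga_seg; eauto. }
    { intros; apply (ga_ode HA); lra. }
    rewrite (ga_left HA a) in E by lra. rewrite Rminus_0_r in E.
    pose proof (eta_left_bound a x ltac:(lra) ltac:(fold c; lra)) as Ex.
    assert (Bx : in_box r x (eta a x)) by (apply arc_box; fold c; lra).
    assert (B0 : in_box r a 0) by (apply box0, Rabs_def1; lra).
    pose proof (hs_lip HS _ _ _ _ Bx B0) as HF.
    rewrite Rminus_0_r, (Rabs_pos_eq (eta a x)), (Rabs_pos_eq (x - a)) in HF by lra.
    assert (HF' : Rabs (F x (eta a x) - F a 0) <= L * (1 + L) * (a' - a)).
    { eapply Rle_trans; [exact HF|]. rewrite Rmult_assoc. apply Rmult_le_compat_l; [lra|]. nra. }
    pose proof (hs_bound HS _ _ B0) as [HF0 _].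
    pose proof (gain_lip a a a' ltac:(lra) ltac:(lra)) as Eg.
    assert (HE : Rabs (exp (gain a c - gain a a') - exp (loggain a)) <= B * (L * (a' - a))).
    { eapply Rle_trans; [apply (exp_lip (8 * L * r))|].
      - pose proof (gain_lip a a' c ltac:(lra) ltac:(lra)) as E2. pose proof (Rle_abs (gain a c - gain a a')).
        assert (L * (c - a') <= L * (2 * r)) by (apply Rmult_le_compat_l; lra). lra.
      - pose proof (loggain_bound a ltac:(lra)) as E2. pose proof (Rle_abs (loggain a)). fold c in E2.
        assert (L * (c - a) <= L * (2 * r)) by (apply Rmult_le_compat_l; lra). lra.
      - apply Rmult_le_compat_l; [left; apply exp_pos|]. unfold loggain. fold c.
        replace (gain a c - gain a a' - (gain a c - gain a a)) with (- (gain a a' - gain a a)) by ring.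
        rewrite Rabs_Ropp. auto. }
    rewrite E.
    replace (F x (eta a x) * (a' - a) * exp (gain a c - gain a a') - F a 0 * exp (loggain a) * (a' - a)) with
      ((a' - a) * ((F x (eta a x) - F a 0) * exp (gain a c - gain a a') +
         F a 0 * (exp (gain a c - gain a a') - exp (loggain a)))) by ring.
    rewrite Rabs_mult, (Rabs_pos_eq (a' - a)) by lra.
    replace (K2 * (a' - a) ^ 2) with ((a' - a) * (K2 * (a' - a))) by ring.
    apply Rmult_le_compat_l; [lra|]. eapply Rle_trans; [apply Rabs_triang|]. rewrite !Rabs_mult.
    replace (K2 * (a' - a)) with (L * (1 + L) * (a' - a) * B + L * (B * (L * (a' - a)))) by (unfold K2; ring).
    apply Rplus_le_compat; apply Rmult_le_compat; auto; try apply Rabs_pos. apply Hexp; lra. }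
  assert (HRight : Rabs (eta a c' * exp (gain a c - gain a c') + F c 0 * (c - c')) <= K2 * (c - c') ^ 2).
  { destruct (seg_MVT (eta a) (fun x => F x (eta a x)) c' c) as [x [Hx E]]; auto.
    { eapply ga_seg; eauto. }
    { intros; apply (ga_ode HA); fold c; lra. }
    rewrite (ga_right HA c) in E by (fold c; lra).
    assert (E' : eta a c' = - F x (eta a x) * (c - c')) by lra. clear E.
    pose proof (eta_right_bound a x ltac:(lra) ltac:(fold c; lra)) as Ex. fold c in Ex.
    assert (Bx : in_box r x (eta a x)) by (apply arc_box; fold c; lra).
    assert (B0 : in_box r c 0) by (apply box0, Rabs_def1; lra).
    pose proof (hs_lip HS _ _ _ _ Bx B0) as HF.
    rewrite Rminus_0_r, (Rabs_pos_eq (eta a x)), (Rabs_left (x - c)) in HF by lra.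
    assert (HF' : Rabs (F x (eta a x) - F c 0) <= L * (1 + L) * (c - c')).
    { eapply Rle_trans; [exact HF|]. rewrite Rmult_assoc. apply Rmult_le_compat_l; [lra|]. nra. }
    pose proof (hs_bound HS _ _ B0) as [HF0 _].
    pose proof (gain_lip a c' c ltac:(lra) ltac:(lra)) as Eg.
    assert (HE : Rabs (exp (gain a c - gain a c') - 1) <= B * (L * (c - c'))).
    { rewrite <- exp_0 at 1. eapply Rle_trans; [apply (exp_lip (8 * L * r))|].
      - pose proof (Rle_abs (gain a c - gain a c')).
        assert (L * (c - c') <= L * (2 * r)) by (apply Rmult_le_compat_l; lra). lra.
      - lra.
      - apply Rmult_le_compat_l; [left; apply exp_pos|]. rewrite Rminus_0_r. auto. }
    rewrite E'.
    replace (- F x (eta a x) * (c - c') * exp (gain a c - gain a c') + F c 0 * (c - c')) with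
      ((c - c') * (- ((F x (eta a x) - F c 0) * exp (gain a c - gain a c')) +
         - (F c 0 * (exp (gain a c - gain a c') - 1)))) by ring.
    rewrite Rabs_mult, (Rabs_pos_eq (c - c')) by lra.
    replace (K2 * (c - c') ^ 2) with ((c - c') * (K2 * (c - c'))) by ring.
    apply Rmult_le_compat_l; [lra|]. eapply Rle_trans; [apply Rabs_triang|]. rewrite !Rabs_Ropp, !Rabs_mult.
    replace (K2 * (c - c')) with (L * (1 + L) * (c - c') * B + L * (B * (L * (c - c')))) by (unfold K2; ring).
    apply Rplus_le_compat; apply Rmult_le_compat; auto; try apply Rabs_pos. apply Hexp; lra. }
  replace (F a 0 * exp (loggain a) * (a' - a) + F c 0 * (c - c')) with
    (- (eta a a' * exp (gain a c - gain a a') - F a 0 * exp (loggain a) * (a' - a)) +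
     (eta a c' * exp (gain a c - gain a c') + F c 0 * (c - c')) +
     - (eta a c' * exp (gain a c - gain a c') - eta a a' * exp (gain a c - gain a a'))) by ring.
  eapply Rle_trans; [apply Rabs_triang|].
  eapply Rle_trans; [apply Rplus_le_compat_r, Rabs_triang|]. rewrite !Rabs_Ropp.
  assert (0 <= (c - c') ^ 2) by apply pow2_ge_0. nra.
Qed.
End HalfReturn.

(** * The derivative of a half-return map near the fold *)

Lemma ex_derive_cont_pt (f : R -> R) (x : R) : ex_derive f x -> continuity_pt f x.
Proof.
  intros H. apply continuity_pt_filterlim.
  exact (ex_derive_continuous (K:=R_AbsRing) (V:=R_NormedModule) f x H).
Qed.

Lemma near_zero (h : R -> R) : continuity_pt h 0 -> 0 < h 0 ->
  exists d, 0 < d /\ forall x, Rabs x < d -> 0 < h x.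
Proof.
  intros Hc H0. destruct (proj1 (continuity_pt_eps h 0) Hc (h 0) H0) as [d [Hd H]].
  exists d; split; auto. intros x Hx. specialize (H x). rewrite Rminus_0_r in H.
  specialize (H Hx). apply Rabs_def2 in H. lra.
Qed.

Lemma pow_ge_self t N : (1 <= N)%nat -> 1 <= t -> t <= t ^ N.
Proof.
  intros HN Ht. destruct N; [lia|]. simpl. assert (1 <= t ^ N) by (apply pow_R1_Rle; auto). nra.
Qed.

Lemma pow_le_self t N : (1 <= N)%nat -> 0 <= t <= 1 -> t ^ N <= t.
Proof.
  intros HN Ht. destruct N; [lia|]. simpl. assert (t ^ N <= 1).
  { rewrite <- (pow1 N). apply pow_incr; lra. } nra.
Qed.

(** The factor m on both sides stands for an exponent n - 1, which would not make sense for n = 0. *)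
Lemma pow_lip n x y m : 0 <= m -> Rabs x <= m -> Rabs y <= m ->
  Rabs (x ^ n - y ^ n) * m <= INR n * m ^ n * Rabs (x - y).
Proof.
  intros Hm Hx Hy. induction n.
  - simpl. replace (1 - 1) with 0 by ring. rewrite Rabs_R0. lra.
  - rewrite S_INR. simpl.
    replace (x * x ^ n - y * y ^ n) with (x * (x ^ n - y ^ n) + y ^ n * (x - y)) by ring.
    assert (Hyn : Rabs (y ^ n) <= m ^ n) by (rewrite <- RPow_abs; apply pow_incr; split; auto; apply Rabs_pos).
    pose proof (Rabs_triang (x * (x ^ n - y ^ n)) (y ^ n * (x - y))) as HT. rewrite !Rabs_mult in HT.
    pose proof (Rabs_pos (x - y)). pose proof (Rabs_pos (x ^ n - y ^ n)).
    assert (Rabs x * (Rabs (x ^ n - y ^ n) * m) <= m * (INR n * m ^ n * Rabs (x - y))).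
    { apply Rmult_le_compat; auto; try apply Rabs_pos. apply Rmult_le_pos; auto. }
    assert (Rabs (y ^ n) * Rabs (x - y) * m <= m ^ n * Rabs (x - y) * m).
    { apply Rmult_le_compat_r; auto. apply Rmult_le_compat_r; auto. }
    apply Rle_trans with ((Rabs x * Rabs (x ^ n - y ^ n) + Rabs (y ^ n) * Rabs (x - y)) * m).
    + apply Rmult_le_compat_r; auto.
    + nra.
Qed.

Section Asymptotics.
Variables (F Fy : R -> R -> R) (r L : R) (n : nat) (f : R -> R) (c0 : R).
Hypothesis HS : half_system F Fy r L n f c0.
Variables (rho : R) (phi : R -> R) (eta : R -> R -> R).
Hypothesis AF : arc_family F r rho phi eta.

Let HL : 1 <= L := hs_L HS.
Let Hr : 0 < r := hs_r HS.
Let N : nat := S n.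

Let E := loggain Fy phi eta.

(** low d and upp d bound - f (x) exp (+- L x) for |x| < d; both tend to - f (0) > 0 as d tends to
    0. *)
Definition low (d : R) : R := (- f 0 - L * d) * exp (- L * d).
Definition upp (d : R) : R := (- f 0 + L * d) * exp (L * d).

Lemma N_even x : (- x) ^ N = x ^ N.
Proof.
  unfold N. destruct (hs_odd HS) as [m Hm].
  assert (Hm' : S n = (2 * (m + 1))%nat) by lia. rewrite Hm'.
  rewrite !pow_mult. f_equal. ring.
Qed.

Lemma is_derive_powN k x : is_derive (fun x => k * x ^ N / INR N) x (k * x ^ n).
Proof.
  assert (HN : INR N <> 0) by (apply not_0_INR; unfold N; lia).
  eapply is_derive_eq.
  - apply (is_derive_ext (fun x => (k / INR N) * x ^ N)); [intros t; simpl; field; auto|].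
    apply is_derive_Rscal. apply is_derive_pow. apply @is_derive_id.
  - unfold N at 2 3. simpl Nat.pred. unfold one; simpl. fold N. field; auto.
Qed.

(** To leading order the orbits are y = (- f (0)) (h - x^N) / N with N = n + 1 even. The height at x
    = 0 is bounded in terms of a^N by the left half of the arc and in terms of (phi a)^N by the
    right half; the exponential factors absorb the dependence of F on the height, and make the
    comparison functions monotone. *)
Lemma height_bounds d a : 0 < d -> d <= r -> - rho < a < 0 -> - d < a -> phi a < d -> 0 < low d ->
  low d * a ^ N <= upp d * phi a ^ N /\ low d * phi a ^ N <= upp d * a ^ N.
Proof.
  intros Hd Hdr Ha Had Hpd Hlow.
  pose proof (af_arc AF a Ha) as HA. set (c := phi a) in *.
  pose proof (af_pos AF a Ha) as Hc. fold c in Hc.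
  assert (HN : 0 < INR N) by (apply lt_0_INR; unfold N; lia).
  assert (Hf0 : 0 < - f 0).
  { pose proof (hs_neg HS 0 ltac:(rewrite Rabs_R0; auto)). pose proof (hs_c0 HS). lra. }
  assert (Hf : forall x, Rabs x < d -> - f 0 - L * d <= - f x <= - f 0 + L * d).
  { intros x Hx. pose proof (hs_f HS x 0 ltac:(lra) ltac:(rewrite Rabs_R0; auto)) as H.
    rewrite Rminus_0_r in H. apply Rabs_le_between in H.
    assert (L * Rabs x <= L * d) by (apply Rmult_le_compat_l; lra). lra. }
  assert (Hlow' : 0 < - f 0 - L * d).
  { unfold low in Hlow. pose proof (exp_pos (- L * d)). nra. }
  assert (Hexp : forall x, Rabs x < d -> exp (- L * d) <= exp (L * x) <= exp (L * d) /\
       exp (- L * d) <= exp (- L * x) <= exp (L * d)).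
  { intros x Hx. apply Rabs_def2 in Hx.
    assert (L * x <= L * d) by (apply Rmult_le_compat_l; lra).
    assert (L * (- d) <= L * x) by (apply Rmult_le_compat_l; lra).
    repeat split; apply exp_le_mono; lra. }
  assert (Hode : forall x, a < x < c -> Rabs (F x (eta a x) - F x 0) <= L * eta a x).
  { intros x Hx. assert (Bx : in_box r x (eta a x)) by (apply (arc_box F Fy r L n f c0 HS rho phi eta AF); fold c; lra).
    pose proof (proj2 (hs_lip_y _ _ _ _ _ _ _ HS) x (eta a x) 0 (proj1 Bx) (proj2 Bx) ltac:(rewrite Rabs_R0; auto)) as HF.
    rewrite Rminus_0_r, (Rabs_pos_eq (eta a x)) in HF; auto. eapply ga_nonneg; eauto. }
  assert (HF0 : forall x, Rabs x < d -> F x 0 = x ^ n * f x) by (intros; apply (hs_lead HS); lra).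
  assert (Dgen : forall k lam x, a < x < c ->
    is_derive (fun x => eta a x * exp (lam * x) + k * x ^ N / INR N) x
      ((F x (eta a x) + lam * eta a x) * exp (lam * x) + k * x ^ n)).
  { intros k lam x Hx. apply is_derive_Rplus; [|apply is_derive_powN].
    eapply is_derive_eq; [apply is_derive_Rmult; [apply (ga_ode HA); auto|apply is_derive_exp_lin]|].
    simpl; ring. }
  assert (Cgen : forall k lam u v, u <= v -> cont_seg (fun x => eta a x * exp (lam * x) + k * x ^ N / INR N) u v).
  { intros k lam u v Huv.
    apply (cont_seg_plus (fun x => eta a x * exp (lam * x)) (fun x => k * x ^ N / INR N)); auto.
    - apply (cont_seg_mult (eta a) (fun x => exp (lam * x))); auto; [eapply ga_seg; eauto|apply cont_seg_exp].
    - apply derive_seg. intros x _. eexists; apply is_derive_powN. }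
  assert (Ea : eta a a = 0) by (apply (ga_left HA); lra).
  assert (Ec : eta a c = 0) by (apply (ga_right HA); lra).
  assert (E0N : 0 ^ N = 0) by (apply pow_i; unfold N; lia).
  assert (Hpn : forall x, 0 < x -> 0 < x ^ n) by (intros; apply pow_lt; auto).
  assert (Hnn : forall x, x < 0 -> x ^ n < 0) by (intros; eapply pow_neg_odd; eauto).
  assert (Hxd : forall x, a < x < c -> Rabs x < d) by (intros; apply Rabs_def1; lra).
  assert (Lp : forall x, a < x < c -> low d <= - f x * exp (L * x) <= upp d /\
     low d <= - f x * exp (- L * x) <= upp d).
  { intros x Hx. specialize (Hxd x Hx). specialize (Hf x Hxd). destruct (Hexp x Hxd).
    pose proof (exp_pos (- L * d)). unfold low, upp. repeat split; apply Rmult_le_compat; lra. }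
  assert (Hup : forall k u v, a <= u -> u <= v -> v <= c ->
     (forall x, u < x < v -> 0 <= x ^ n * (k - - f x * exp (L * x))) ->
     eta a u * exp (L * u) + k * u ^ N / INR N <= eta a v * exp (L * v) + k * v ^ N / INR N).
  { intros k u v Hu Huv Hv Hk.
    assert (H := seg_ge (fun x => eta a x * exp (L * x) + k * x ^ N / INR N) 0 u v Huv (Cgen k L u v Huv)).
    match type of H with ?P -> _ => cut P; [intros HP; specialize (H HP); cbv beta in H; lra|] end.
    intros x Hx. eexists; split; [apply Dgen; lra|]. specialize (Hk x Hx).
    specialize (Hode x ltac:(lra)). apply Rabs_le_between in Hode. rewrite (HF0 x (Hxd x ltac:(lra))) in Hode.
    pose proof (exp_pos (L * x)).
    assert (x ^ n * f x * exp (L * x) <= (F x (eta a x) + L * eta a x) * exp (L * x)) by (apply Rmult_le_compat_r; lra).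
    lra. }
  assert (Hdown : forall k u v, a <= u -> u <= v -> v <= c ->
     (forall x, u < x < v -> x ^ n * (k - - f x * exp (- L * x)) <= 0) ->
     eta a v * exp (- L * v) + k * v ^ N / INR N <= eta a u * exp (- L * u) + k * u ^ N / INR N).
  { intros k u v Hu Huv Hv Hk.
    assert (H := seg_le (fun x => eta a x * exp (- L * x) + k * x ^ N / INR N) 0 u v Huv (Cgen k (- L) u v Huv)).
    match type of H with ?P -> _ => cut P; [intros HP; specialize (H HP); cbv beta in H; lra|] end.
    intros x Hx. eexists; split; [apply Dgen; lra|]. specialize (Hk x Hx).
    specialize (Hode x ltac:(lra)). apply Rabs_le_between in Hode. rewrite (HF0 x (Hxd x ltac:(lra))) in Hode.
    pose proof (exp_pos (- L * x)).
    assert ((F x (eta a x) + - L * eta a x) * exp (- L * x) <= x ^ n * f x * exp (- L * x)) by (apply Rmult_le_compat_r; lra).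
    lra. }
  assert (H1 := Hup (low d) a 0 ltac:(lra) ltac:(lra) ltac:(lra)).
  assert (H2 := Hdown (upp d) a 0 ltac:(lra) ltac:(lra) ltac:(lra)).
  assert (H3 := Hup (upp d) 0 c ltac:(lra) ltac:(lra) ltac:(lra)).
  assert (H4 := Hdown (low d) 0 c ltac:(lra) ltac:(lra) ltac:(lra)).
  rewrite Ea, Rmult_0_r, exp_0, E0N in H1, H2. rewrite Ec, Rmult_0_r, exp_0, E0N in H3, H4.
  assert (K : (forall x, a < x < 0 -> 0 <= x ^ n * (low d - - f x * exp (L * x)) /\
                x ^ n * (upp d - - f x * exp (- L * x)) <= 0) /\
              (forall x, 0 < x < c -> 0 <= x ^ n * (upp d - - f x * exp (L * x)) /\
                x ^ n * (low d - - f x * exp (- L * x)) <= 0)).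
  { split; intros x Hx; destruct (Lp x ltac:(lra)); [specialize (Hnn x ltac:(lra))|specialize (Hpn x ltac:(lra))]; nra. }
  destruct K as [KL KR].
  specialize (H1 (fun x Hx => proj1 (KL x Hx))). specialize (H2 (fun x Hx => proj2 (KL x Hx))).
  specialize (H3 (fun x Hx => proj1 (KR x Hx))). specialize (H4 (fun x Hx => proj2 (KR x Hx))).
  split; apply Rmult_le_reg_r with (/ INR N); try (apply Rinv_0_lt_compat; auto); unfold Rdiv in *; lra.
Qed.

(** As low d / upp d tends to 1, (phi a)^N / a^N is close to 1 near 0. *)
Lemma ratio_limit e : 0 < e < 1 -> exists d, 0 < d /\ d <= rho /\ forall a, - d < a < 0 ->
  Rabs (phi a / a + 1) <= e.
Proof.
  intros He. pose proof (af_rho AF) as Hrho.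
  assert (Hf0 : 0 < - f 0).
  { pose proof (hs_neg HS 0 ltac:(rewrite Rabs_R0; auto)). pose proof (hs_c0 HS). lra. }
  destruct (near_zero (fun d => (1 + e) * low d - upp d)) as [d1 [Hd1 H1]].
  { apply ex_derive_cont_pt.
    unfold low, upp. auto_derive; auto. }
  { unfold low, upp. rewrite !Rmult_0_r, exp_0. nra. }
  destruct (near_zero low) as [d2 [Hd2 H2]].
  { apply ex_derive_cont_pt.
    unfold low. auto_derive; auto. }
  { unfold low. rewrite !Rmult_0_r, exp_0. lra. }
  set (d := Rmin (Rmin d1 d2) rho / 2).
  assert (Hd : 0 < d /\ d < d1 /\ d < d2 /\ d < rho).
  { assert (0 < Rmin (Rmin d1 d2) rho) by (repeat apply Rmin_pos; lra).
    Rmin_bounds (Rmin d1 d2) rho.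
    Rmin_bounds d1 d2. unfold d. lra. }
  destruct (af_small AF d (proj1 Hd)) as [d3 [Hd3 H3]].
  exists (Rmin d d3). split; [apply Rmin_pos; lra|].
  Rmin_bounds d d3. split; [lra|]. intros a Ha.
  assert (Hdd : Rabs d = d) by (apply Rabs_pos_eq; lra).
  specialize (H1 d ltac:(lra)). specialize (H2 d ltac:(lra)). cbv beta in H1.
  destruct (height_bounds d a ltac:(lra) ltac:(lra) ltac:(lra) ltac:(lra) (H3 a ltac:(lra)) H2) as [K1 K2].
  pose proof (af_pos AF a ltac:(lra)) as Hc. set (c := phi a) in *.
  rewrite <- (N_even a) in K1, K2.
  assert (HaN : 0 < (- a) ^ N) by (apply pow_lt; lra). assert (HcN : 0 < c ^ N) by (apply pow_lt; lra).
  set (t := c / - a). assert (Ht : 0 < t) by (apply Rdiv_lt_0_compat; lra).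
  assert (EtN : t ^ N * (- a) ^ N = c ^ N).
  { rewrite <- Rpow_mult_distr. f_equal. unfold t. field; lra. }
  assert (T1 : t ^ N <= 1 + e).
  { apply Rmult_le_reg_r with ((- a) ^ N); auto. rewrite EtN. apply Rmult_le_reg_l with (low d); auto.
    assert (upp d * (- a) ^ N <= (1 + e) * low d * (- a) ^ N) by (apply Rmult_le_compat_r; lra). lra. }
  assert (T2 : 1 <= (1 + e) * t ^ N).
  { apply Rmult_le_reg_r with ((- a) ^ N); auto. rewrite Rmult_assoc, EtN. apply Rmult_le_reg_l with (low d); auto.
    assert (upp d * c ^ N <= (1 + e) * low d * c ^ N) by (apply Rmult_le_compat_r; lra). lra. }
  assert (HN1 : (1 <= N)%nat) by (unfold N; lia).
  assert (Et : c / a + 1 = 1 - t) by (unfold t; field; lra).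
  rewrite Et. apply Rabs_le. destruct (Rle_dec 1 t).
  - pose proof (pow_ge_self t N HN1 r0). lra.
  - pose proof (pow_le_self t N HN1 ltac:(lra)). split; [lra|].
    assert (1 <= (1 + e) * t) by nra. nra.
  Unshelve. all: exact 0.
Qed.

(** The derivative F (a, 0) exp (loggain a) / F (phi a, 0) of the return map splits into the
    singular power (a / phi a)^n and a factor rfac that is Lipschitz up to the fold. *)
Definition rfac (a : R) : R := f a * exp (E a) / f (phi a).
Definition dphi (a : R) : R := (a / phi a) ^ n * rfac a.

Lemma f_neg x : Rabs x < r -> f x < 0.
Proof.
  intros Hx. pose proof (hs_neg HS x Hx). pose proof (hs_c0 HS). lra.
Qed.

Lemma phi_abs a : - rho < a < 0 -> Rabs (phi a) < r /\ Rabs a < r.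
Proof.
  intros Ha. pose proof (phi_range _ _ _ _ _ AF a Ha). pose proof (af_rho AF).
  split; apply Rabs_def1; lra.
Qed.

Lemma dphi_eq a : - rho < a < 0 -> dphi a = F a 0 * exp (E a) / F (phi a) 0.
Proof.
  intros Ha. destruct (phi_abs a Ha) as [H1 H2]. unfold dphi, rfac.
  rewrite !(hs_lead HS) by auto. pose proof (f_neg _ H1).
  pose proof (phi_range _ _ _ _ _ AF a Ha). unfold Rdiv.
  rewrite Rpow_mult_distr, pow_inv. field. split; [lra|]. apply pow_nonzero; lra.
Qed.

Lemma rfac_lip : exists K, 0 < K /\ forall a a', - rho < a -> a < a' -> a' < 0 ->
  Rabs (rfac a - rfac a') <= K * ((a' - a) + (phi a - phi a')).
Proof.
  set (m := 8 * L * r). set (KE := L * (2 * r) * (L * exp m) + L).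
  pose proof (hs_c0 HS) as Hc0. pose proof (exp_pos m) as Hem.
  assert (HLr : 0 < L * r) by (apply Rmult_lt_0_compat; lra).
  assert (HKE : 0 < KE).
  { unfold KE. assert (0 < L * (2 * r) * (L * exp m)) by (repeat apply Rmult_lt_0_compat; lra). lra. }
  set (Fm := - f 0 + L * r).
  assert (Hf0 : 0 < - f 0) by (pose proof (f_neg 0 ltac:(rewrite Rabs_R0; auto)); lra).
  set (K := exp m / c0 * L + Fm / c0 * (exp m * KE) + Fm * exp m * L / (c0 * c0)).
  assert (HFm : 0 < Fm) by (unfold Fm; lra).
  assert (Hec : 0 < exp m / c0) by (apply Rdiv_lt_0_compat; auto).
  assert (Hfc : 0 < Fm / c0) by (apply Rdiv_lt_0_compat; auto).
  assert (Hcc : 0 < Fm * exp m * L / (c0 * c0)).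
  { apply Rdiv_lt_0_compat; repeat apply Rmult_lt_0_compat; lra. }
  assert (HK : 0 < K).
  { unfold K. assert (0 < exp m / c0 * L) by (apply Rmult_lt_0_compat; lra).
    assert (0 < Fm / c0 * (exp m * KE)) by (apply Rmult_lt_0_compat; [auto|apply Rmult_lt_0_compat; auto]). lra. }
  exists K. split; auto. intros a a' H1 H2 H3.
  destruct (phi_abs a ltac:(lra)) as [A1 A2]. destruct (phi_abs a' ltac:(lra)) as [A1' A2'].
  pose proof (phi_decr F Fy r L n f c0 HS rho phi eta AF a a' H1 H2 H3) as Hdec.
  assert (Fb : forall x, Rabs x < r -> c0 <= - f x <= Fm).
  { intros x Hx. split; [pose proof (hs_neg HS x Hx); lra|].
    pose proof (hs_f HS x 0 Hx ltac:(rewrite Rabs_R0; auto)) as H. rewrite Rminus_0_r in H.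
    assert (L * Rabs x <= L * r) by (apply Rmult_le_compat_l; lra). apply Rabs_le_between in H. unfold Fm; lra. }
  assert (Eb : forall a, - rho < a < 0 -> E a <= m).
  { intros b Hb. pose proof (loggain_bound F Fy r L n f c0 HS rho phi eta AF b Hb) as H. fold E in H.
    pose proof (phi_range _ _ _ _ _ AF b Hb). pose proof (af_rho AF).
    assert (L * (phi b - b) <= L * (2 * r)) by (apply Rmult_le_compat_l; lra).
    pose proof (Rle_abs (E b)). unfold m. lra. }
  set (D := (a' - a) + (phi a - phi a')) in *. assert (HD : 0 < D) by (unfold D; lra).
  assert (Ef : Rabs (f a - f a') <= L * D).
  { eapply Rle_trans; [apply (hs_f HS); auto|]. apply Rmult_le_compat_l; [lra|].
    rewrite Rabs_left by lra. unfold D; lra. }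
  assert (Efp : Rabs (f (phi a) - f (phi a')) <= L * D).
  { eapply Rle_trans; [apply (hs_f HS); auto|]. apply Rmult_le_compat_l; [lra|].
    rewrite Rabs_pos_eq by lra. unfold D; lra. }
  assert (Ee : Rabs (exp (E a) - exp (E a')) <= exp m * (KE * D)).
  { eapply Rle_trans; [apply (exp_lip m); apply Eb; lra|]. apply Rmult_le_compat_l; [lra|].
    exact (loggain_lip F Fy r L n f c0 HS rho phi eta AF a a' H1 H2 H3). }
  pose proof (Fb _ A1) as B1. pose proof (Fb _ A1') as B1'. pose proof (Fb _ A2) as B2. pose proof (Fb _ A2') as B2'.
  assert (Hea : exp (E a) <= exp m) by (apply exp_le_mono, Eb; lra).
  assert (Hea' : exp (E a') <= exp m) by (apply exp_le_mono, Eb; lra).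
  pose proof (exp_pos (E a)). pose proof (exp_pos (E a')).
  assert (Hinv : forall x, c0 <= - f x -> Rabs (/ f x) <= / c0).
  { intros x Hx. rewrite Rabs_inv. apply Rinv_le_contravar; auto. rewrite Rabs_left; lra. }
  unfold rfac.
  replace (f a * exp (E a) / f (phi a) - f a' * exp (E a') / f (phi a')) with
    ((f a - f a') * (exp (E a) * / f (phi a)) + (f a' * / f (phi a)) * (exp (E a) - exp (E a'))
      + (f a' * exp (E a')) * (- (f (phi a) - f (phi a')) * (/ f (phi a) * / f (phi a')))) by (field; lra).
  eapply Rle_trans; [apply Rabs_triang|]. eapply Rle_trans; [apply Rplus_le_compat_r, Rabs_triang|].
  rewrite !Rabs_mult, Rabs_Ropp, (Rabs_pos_eq (exp (E a))), (Rabs_pos_eq (exp (E a'))) by lra.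
  replace (K * D) with ((L * D) * (exp m * / c0) + (Fm * / c0) * (exp m * (KE * D))
     + (Fm * exp m) * ((L * D) * (/ c0 * / c0))) by (unfold K; field; lra).
  assert (Fa : Rabs (f a') <= Fm) by (rewrite Rabs_left; lra).
  assert (0 < / c0) by (apply Rinv_0_lt_compat; auto).
  repeat apply Rplus_le_compat; repeat apply Rmult_le_compat; auto; try apply Rabs_pos; try lra;
    repeat apply Rmult_le_pos; try apply Rabs_pos; try lra; try (apply Hinv; lra).
Qed.

Lemma phi_cont' a : - rho < a < 0 -> continuity_pt phi a.
Proof. apply (phi_cont F Fy r L n f c0 HS rho phi eta AF). Qed.

Lemma rfac_cont a : - rho < a < 0 -> continuity_pt rfac a.
Proof.
  intros Ha. destruct rfac_lip as [K [HK H]]. apply continuity_pt_eps. intros e He.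
  destruct (proj1 (continuity_pt_eps phi a) (phi_cont' a Ha) (e / (2 * K))) as [d [Hd Hphi]].
  { apply Rdiv_lt_0_compat; lra. }
  assert (HeK : 0 < e / (2 * K)) by (apply Rdiv_lt_0_compat; lra).
  assert (EK : K * (e / (2 * K) + e / (2 * K)) = e) by (field; lra).
  exists (Rmin (Rmin d (e / (2 * K))) (Rmin (a + rho) (- a))).
  split; [repeat apply Rmin_pos; lra|]. intros y Hy.
  Rmin_bounds (Rmin d (e / (2 * K))) (Rmin (a + rho) (- a)).
  Rmin_bounds d (e / (2 * K)).
  Rmin_bounds (a + rho) (- a).
  specialize (Hphi y ltac:(lra)).
  assert (Hlt : K * (Rabs (y - a) + Rabs (phi y - phi a)) < e).
  { rewrite <- EK. apply Rmult_lt_compat_l; lra. }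
  eapply Rle_lt_trans; [|exact Hlt].
  assert (Hyd := Rabs_def2 _ _ Hy).
  destruct (Rtotal_order y a) as [Hl|[->|Hg]].
  - eapply Rle_trans; [apply H; lra|]. apply Rmult_le_compat_l; [lra|].
    rewrite (Rabs_left (y - a)) by lra. pose proof (Rle_abs (phi y - phi a)). lra.
  - unfold Rminus. rewrite !Rplus_opp_r, Rabs_R0. lra.
  - rewrite Rabs_minus_sym. eapply Rle_trans; [apply H; lra|]. apply Rmult_le_compat_l; [lra|].
    rewrite (Rabs_pos_eq (y - a)) by lra. rewrite (Rabs_minus_sym (phi y)). pose proof (Rle_abs (phi a - phi y)). lra.
Qed.

Lemma dphi_cont a : - rho < a < 0 -> continuity_pt dphi a.
Proof.
  intros Ha. apply (continuity_pt_mult (fun a => (a / phi a) ^ n) rfac); [|apply rfac_cont; auto].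
  pose proof (phi_range _ _ _ _ _ AF a Ha).
  apply (continuity_pt_comp (fun a => a / phi a) (fun q => q ^ n)).
  - apply (continuity_pt_div (fun a => a) phi); [apply continuity_pt_id|apply phi_cont'; auto|lra].
  - apply derivable_continuous_pt, derivable_pt_pow.
Qed.

(** first_variation solved for phi a - phi a'. Away from the fold F (phi a, 0) is bounded below and
    phi is Lipschitz, so both error terms are O ((a' - a)^2). *)
Lemma phi_quadratic a1 a2 : - rho < a1 -> a1 < a2 -> a2 < 0 -> exists K, 0 < K /\
  forall a a', a1 < a -> a < a' -> a' < a2 ->
    Rabs (phi a' - phi a - dphi a * (a' - a)) <= K * (a' - a) ^ 2.
Proof.
  intros H1 H2 H3. destruct (first_variation F Fy r L n f c0 HS rho phi eta AF) as [K0 [HK0 HV]].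
  pose proof (phi_range _ _ _ _ _ AF a2 ltac:(lra)) as P2.
  pose proof (hs_c0 HS) as Hc0.
  set (m := c0 * phi a2 ^ n). assert (Hm : 0 < m) by (apply Rmult_lt_0_compat; auto; apply pow_lt; lra).
  set (KI := L * exp (8 * L * r) * exp (8 * L * r) / m).
  exists (K0 * (1 + KI ^ 2) / m + 1). split.
  { assert (0 <= KI ^ 2) by apply pow2_ge_0.
    assert (0 < K0 * (1 + KI ^ 2) / m) by (apply Rdiv_lt_0_compat; [apply Rmult_lt_0_compat; lra|auto]). lra. }
  intros a a' Ha1 Haa Ha2.
  pose proof (phi_lip F Fy r L n f c0 HS rho phi eta AF a a' ltac:(lra) Haa ltac:(lra)) as [PL1 PL2].
  pose proof (phi_decr F Fy r L n f c0 HS rho phi eta AF a a2 ltac:(lra) ltac:(lra) ltac:(lra)) as PD.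
  pose proof (phi_decr F Fy r L n f c0 HS rho phi eta AF a' a2 ltac:(lra) ltac:(lra) ltac:(lra)) as PD'.
  assert (PL3 : phi a - phi a' <= KI * (a' - a)).
  { eapply Rle_trans; [exact PL2|]. apply Rmult_le_compat_r; [lra|]. unfold KI, Rdiv.
    apply Rmult_le_compat_l.
    - pose proof (exp_pos (8 * L * r)). repeat apply Rmult_le_pos; lra.
    - apply Rinv_le_contravar; auto. apply Rmult_le_compat_l; [lra|]. apply pow_incr; lra. }
  specialize (HV a a' ltac:(lra) Haa ltac:(lra)). fold E in HV.
  destruct (phi_abs a ltac:(lra)) as [A1 A2].
  assert (HFc : F (phi a) 0 <= - m).
  { rewrite (hs_lead HS) by auto. pose proof (hs_neg HS _ A1).
    assert (phi a2 ^ n <= phi a ^ n) by (apply pow_incr; lra).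
    assert (0 < phi a2 ^ n) by (apply pow_lt; lra). unfold m. nra. }
  rewrite dphi_eq by lra.
  set (Fc := F (phi a) 0) in *. set (Fa := F a 0 * exp (E a)) in *.
  replace (phi a' - phi a - Fa / Fc * (a' - a)) with
    (- (/ Fc) * (Fa * (a' - a) + Fc * (phi a - phi a'))) by (field; lra).
  rewrite Rabs_mult, Rabs_Ropp, Rabs_inv, (Rabs_left Fc) by lra.
  assert (Hinv : / - Fc <= / m) by (apply Rinv_le_contravar; lra).
  assert (0 < / - Fc) by (apply Rinv_0_lt_compat; lra).
  assert (Hsq : (phi a - phi a') ^ 2 <= (KI * (a' - a)) ^ 2) by (apply pow_incr; lra).
  assert (Hsq2 : 0 < (a' - a) ^ 2) by (apply pow_lt; lra).
  apply Rle_trans with (/ m * (K0 * ((a' - a) ^ 2 + (KI * (a' - a)) ^ 2))).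
  - apply Rmult_le_compat; auto; [lra|apply Rabs_pos|]. eapply Rle_trans; [exact HV|].
    apply Rmult_le_compat_l; lra.
  - apply Rle_trans with (K0 * (1 + KI ^ 2) / m * (a' - a) ^ 2); [right; field; lra|]. nra.
Qed.

(** The quadratic estimate concerns only one order of the two points; continuity of dphi covers the
    other. *)
Lemma phi_derive a : - rho < a < 0 -> is_derive phi a (dphi a).
Proof.
  intros Ha. set (a1 := (a - rho) / 2). set (a2 := a / 2).
  destruct (phi_quadratic a1 a2) as [K [HK HQ]]; try (unfold a1, a2; lra).
  apply is_derive_eps. intros e He.
  destruct (proj1 (continuity_pt_eps dphi a) (dphi_cont a Ha) (e / 2) ltac:(lra)) as [d [Hd Hg]].
  assert (HeK : 0 < e / (2 * K)) by (apply Rdiv_lt_0_compat; lra).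
  assert (EK : K * (e / (2 * K)) = e / 2) by (field; lra).
  exists (Rmin (Rmin d (e / (2 * K))) (Rmin (a - a1) (a2 - a))).
  split; [repeat apply Rmin_pos; unfold a1, a2; lra|]. intros y Hy.
  Rmin_bounds (Rmin d (e / (2 * K))) (Rmin (a - a1) (a2 - a)).
  Rmin_bounds d (e / (2 * K)).
  Rmin_bounds (a - a1) (a2 - a).
  specialize (Hg y ltac:(lra)). assert (Hyd := Rabs_def2 _ _ Hy).
  assert (HKy : K * Rabs (y - a) <= e / 2).
  { rewrite <- EK. apply Rmult_le_compat_l; lra. }
  destruct (Rtotal_order y a) as [Hl|[->|Hgt]].
  - specialize (HQ y a ltac:(lra) Hl ltac:(lra)). rewrite (Rabs_left (y - a)) in * by lra.
    replace (phi y - phi a - dphi a * (y - a)) with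
      (- (phi a - phi y - dphi y * (a - y)) + - ((dphi y - dphi a) * (a - y))) by ring.
    eapply Rle_trans; [apply Rabs_triang|]. rewrite !Rabs_Ropp, Rabs_mult, (Rabs_pos_eq (a - y)) by lra.
    assert (Rabs (dphi y - dphi a) * (a - y) <= e / 2 * (a - y)) by (apply Rmult_le_compat_r; lra).
    assert (K * (a - y) ^ 2 <= e / 2 * (a - y)).
    { simpl. rewrite Rmult_1_r, <- Rmult_assoc. apply Rmult_le_compat_r; lra. }
    lra.
  - replace (phi a - phi a - dphi a * (a - a)) with 0 by ring. replace (a - a) with 0 by ring. rewrite Rabs_R0; lra.
  - specialize (HQ a y ltac:(lra) Hgt ltac:(lra)). rewrite (Rabs_pos_eq (y - a)) in * by lra.
    assert (K * (y - a) ^ 2 <= e / 2 * (y - a)).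
    { simpl. rewrite Rmult_1_r, <- Rmult_assoc. apply Rmult_le_compat_r; lra. }
    assert (0 <= e / 2 * (y - a)) by (apply Rmult_le_pos; lra). lra.
Qed.

(** At the fold both ends of the arc coincide, and the gain is 0. *)
Lemma rfac_limit : exists K, 0 < K /\ forall a, - rho < a < 0 -> Rabs (rfac a - 1) <= K * (phi a - a).
Proof.
  set (m := 8 * L * r). pose proof (hs_c0 HS) as Hc0. pose proof (exp_pos m) as Hem.
  assert (HLr : 0 < L * r) by (apply Rmult_lt_0_compat; lra).
  exists (L * (exp m / c0) + exp m * L). split.
  { assert (0 < L * (exp m / c0)) by (apply Rmult_lt_0_compat; [lra|apply Rdiv_lt_0_compat; auto]).
    assert (0 < exp m * L) by (apply Rmult_lt_0_compat; lra). lra. }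
  intros a Ha. destruct (phi_abs a Ha) as [A1 A2].
  pose proof (phi_range _ _ _ _ _ AF a Ha) as P. pose proof (af_rho AF) as Hrho.
  pose proof (loggain_bound F Fy r L n f c0 HS rho phi eta AF a Ha) as HE. fold E in HE.
  assert (HEm : E a <= m).
  { assert (L * (phi a - a) <= L * (2 * r)) by (apply Rmult_le_compat_l; lra).
    pose proof (Rle_abs (E a)). unfold m. lra. }
  assert (H1 : Rabs (exp (E a) - 1) <= exp m * L * (phi a - a)).
  { rewrite <- exp_0 at 1. eapply Rle_trans; [apply (exp_lip m); auto; unfold m; lra|].
    rewrite Rminus_0_r, Rmult_assoc. apply Rmult_le_compat_l; lra. }
  pose proof (hs_neg HS _ A1) as Hn.
  pose proof (hs_f HS a (phi a) A2 A1) as Hf. rewrite (Rabs_left (a - phi a)) in Hf by lra.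
  unfold rfac.
  replace (f a * exp (E a) / f (phi a) - 1) with
    ((f a - f (phi a)) * (exp (E a) * / f (phi a)) + (exp (E a) - 1)) by (field; lra).
  eapply Rle_trans; [apply Rabs_triang|]. rewrite Rmult_plus_distr_r. apply Rplus_le_compat; auto.
  rewrite !Rabs_mult, Rabs_inv, (Rabs_pos_eq (exp _)), (Rabs_left (f (phi a))) by (try lra; left; apply exp_pos).
  replace (L * (exp m / c0) * (phi a - a)) with ((L * - (a - phi a)) * (exp m * / c0)) by (field; lra).
  assert (0 < / - f (phi a)) by (apply Rinv_0_lt_compat; lra).
  assert (exp (E a) <= exp m) by (apply exp_le_mono; auto).
  pose proof (exp_pos (E a)).
  apply Rmult_le_compat; auto; try apply Rabs_pos; [apply Rmult_le_pos; lra|].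
  apply Rmult_le_compat; auto; try lra. apply Rinv_le_contravar; lra.
Qed.

(** phi a / a tends to - 1 and rfac a to 1, and n is odd. *)
Lemma near_reflection e : 0 < e < 1 -> exists d, 0 < d /\ d <= rho /\ forall a, - d < a < 0 ->
  Rabs (phi a / a + 1) <= e /\ Rabs (dphi a + 1) <= e /\ Rabs (a / phi a) <= 2 /\ Rabs (rfac a) <= 2.
Proof.
  intros He. destruct rfac_limit as [K [HK HR]].
  set (Q := INR n * 2 ^ n + 1).
  assert (HQ : 1 <= Q).
  { unfold Q. assert (0 <= INR n * 2 ^ n) by (apply Rmult_le_pos; [apply pos_INR|apply pow_le; lra]). lra. }
  set (e1 := e / (8 * Q)).
  assert (He1 : 0 < e1 <= e / 8).
  { split; [apply Rdiv_lt_0_compat; lra|]. unfold e1, Rdiv. apply Rmult_le_compat_l; [lra|].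
    apply Rinv_le_contravar; lra. }
  assert (E1 : e1 * Q = e / 8) by (unfold e1; field; lra).
  destruct (ratio_limit e1 ltac:(lra)) as (d1 & Hd1 & Hd1r & H1).
  set (d2 := e / (8 * K)). assert (Hd2 : 0 < d2) by (apply Rdiv_lt_0_compat; lra).
  assert (E2 : K * d2 = e / 8) by (unfold d2; field; lra).
  exists (Rmin d1 d2). split; [apply Rmin_pos; auto|].
  Rmin_bounds d1 d2. split; [lra|]. intros a Ha.
  specialize (H1 a ltac:(lra)). pose proof (phi_range _ _ _ _ _ AF a ltac:(lra)) as P.
  set (th := - (phi a / a + 1)) in *.
  assert (Hth : Rabs th <= e1) by (unfold th; rewrite Rabs_Ropp; auto). apply Rabs_le_between in Hth.
  assert (Ephi : phi a = (1 + th) * - a) by (unfold th; field; lra).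
  assert (Hq1 : a / phi a + 1 = th / (1 + th)) by (rewrite Ephi; field; lra).
  assert (Hinv : 0 < / (1 + th) <= 2).
  { split; [apply Rinv_0_lt_compat; lra|]. replace 2 with (/ (1 / 2)) by field. apply Rinv_le_contravar; lra. }
  assert (Hq : Rabs (a / phi a + 1) <= 2 * e1).
  { rewrite Hq1. unfold Rdiv. rewrite Rabs_mult, (Rabs_pos_eq (/ _)) by lra.
    rewrite Rmult_comm. apply Rmult_le_compat; try lra; [apply Rabs_pos|]. apply Rabs_le; lra. }
  assert (Hq2 : Rabs (a / phi a) <= 2) by (apply Rabs_le_between in Hq; apply Rabs_le; lra).
  assert (Hw : Rabs (rfac a - 1) <= 3 * e / 8).
  { eapply Rle_trans; [apply HR; lra|].
    apply Rle_trans with (K * (3 * d2)); [|lra]. apply Rmult_le_compat_l; [lra|]. rewrite Ephi.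
    assert (- a <= d2) by lra. nra. }
  assert (Hw2 : Rabs (rfac a) <= 2) by (apply Rabs_le_between in Hw; apply Rabs_le; lra).
  split; [lra|]. split; [|split; auto].
  assert (Em : (-1) ^ n = -1).
  { destruct (hs_odd HS) as [k ->]. rewrite pow_add, pow_mult. replace ((-1) ^ 2) with 1 by ring.
    rewrite pow1. ring. }
  unfold dphi.
  replace ((a / phi a) ^ n * rfac a + 1) with (((a / phi a) ^ n - (-1) ^ n) * rfac a + - (rfac a - 1)) by (rewrite Em; ring).
  eapply Rle_trans; [apply Rabs_triang|]. rewrite Rabs_mult, Rabs_Ropp.
  pose proof (pow_lip n (a / phi a) (-1) 2 ltac:(lra) Hq2 ltac:(rewrite Rabs_left; lra)) as HP.
  replace (a / phi a - -1) with (a / phi a + 1) in HP by ring.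
  assert (INR n * 2 ^ n * Rabs (a / phi a + 1) <= Q * (2 * e1)).
  { apply Rmult_le_compat; try lra; [|apply Rabs_pos|unfold Q; lra].
    apply Rmult_le_pos; [apply pos_INR|apply pow_le; lra]. }
  assert (Rabs ((a / phi a) ^ n - (-1) ^ n) * Rabs (rfac a) <= Rabs ((a / phi a) ^ n - (-1) ^ n) * 2)
    by (apply Rmult_le_compat_l; [apply Rabs_pos|auto]).
  lra.
Qed.

(** The derivative of the return map varies slowly compared with the distance to the fold. This is
    all that the study of shifted displacements requires of it, and it avoids the analyticity of
    half-return maps. The ratio a / phi a has derivative (phi - a phi') / phi^2, which by
    near_reflection is small compared with 1 / |a|; the other factor is Lipschitz. *)
Lemma dphi_modulus : exists d, 0 < d /\ d <= rho /\ forall a a', - d < a -> a < a' -> a' < 0 ->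
  Rabs (dphi a - dphi a') <= 1 / 8 / (- a') * (a' - a).
Proof.
  destruct rfac_lip as [K [HK HR]].
  set (Q := INR n * 2 ^ n + 1).
  assert (HQ : 1 <= Q).
  { unfold Q. assert (0 <= INR n * 2 ^ n) by (apply Rmult_le_pos; [apply pos_INR|apply pow_le; lra]). lra. }
  (* The two terms of the product rule get 1 / 16 each: the first is 2 Q 8 e1 / |a'|, the second 3 K
     2^n. *)
  set (e1 := / (256 * Q)).
  assert (He1 : 0 < e1 <= 1 / 256).
  { split; [apply Rinv_0_lt_compat; lra|]. unfold e1. replace (1 / 256) with (/ 256) by field. apply Rinv_le_contravar; lra. }
  assert (E1 : 256 * (e1 * Q) = 1) by (unfold e1; field; lra).
  destruct (near_reflection e1 ltac:(lra)) as (d1 & Hd1 & Hd1r & H1).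
  assert (H2n : 0 < 2 ^ n) by (apply pow_lt; lra).
  assert (HKn : 0 < K * 2 ^ n) by (apply Rmult_lt_0_compat; auto).
  set (d2 := / (64 * (K * 2 ^ n))).
  assert (Hd2 : 0 < d2) by (apply Rinv_0_lt_compat; lra).
  assert (E2 : 64 * (K * 2 ^ n) * d2 = 1) by (unfold d2; field; split; lra).
  exists (Rmin d1 d2). split; [apply Rmin_pos; auto|].
  Rmin_bounds d1 d2. split; [lra|].
  intros a a' Ha Haa Ha'.
  assert (Hphi : Rabs (phi a' - phi a) <= 2 * (a' - a)).
  { apply seg_abs; [lra| |].
    - apply derive_seg. intros x Hx. eexists; apply phi_derive; lra.
    - intros x Hx. exists (dphi x). split; [apply phi_derive; lra|].
      destruct (H1 x ltac:(lra)) as (_ & K1 & _). apply Rabs_le_between in K1. apply Rabs_le. lra. }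
  assert (Hq : Rabs (a' / phi a' - a / phi a) <= (8 * e1 / (- a')) * (a' - a)).
  { assert (Dq : forall x, a <= x <= a' -> is_derive (fun x => x / phi x) x ((phi x - x * dphi x) / (phi x * phi x))).
    { intros x Hx. pose proof (phi_range _ _ _ _ _ AF x ltac:(lra)).
      pose proof (phi_derive x ltac:(lra)) as D. eapply is_derive_eq.
      - apply (is_derive_div (fun x => x) phi x 1 (dphi x)); [apply @is_derive_id|exact D|lra].
      - unfold minus, plus, opp, scal, mult; simpl. unfold mult; simpl. field; lra. }
    apply (seg_abs (fun x => x / phi x)); [lra| |].
    - apply derive_seg. intros x Hx. eexists; apply Dq; auto.
    - intros x Hx. eexists; split; [apply Dq; lra|].
      pose proof (phi_range _ _ _ _ _ AF x ltac:(lra)) as P.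
      destruct (H1 x ltac:(lra)) as (K1 & K2 & _).
      assert (Hphx : phi x >= - x / 2).
      { apply Rabs_le_between in K1. assert (phi x / x <= - / 2) by lra.
        assert (phi x / x * - x <= - / 2 * - x) by (apply Rmult_le_compat_r; lra).
        replace (phi x / x * - x) with (- phi x) in H3 by (field; lra). lra. }
      replace ((phi x - x * dphi x) / (phi x * phi x)) with
        ((x * / (phi x * phi x)) * ((phi x / x + 1) - (dphi x + 1))) by (field; lra).
      rewrite Rabs_mult.
      assert (HA : Rabs (x * / (phi x * phi x)) <= 4 / - a').
      { rewrite Rabs_mult, Rabs_inv, (Rabs_pos_eq (phi x * phi x)), Rabs_left by nra.
        assert (Hpp : x * x / 4 <= phi x * phi x) by nra.
        assert (0 < x * x / 4) by nra.
        apply Rle_trans with (- x * / (x * x / 4)).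
        - apply Rmult_le_compat_l; [lra|]. apply Rinv_le_contravar; lra.
        - replace (- x * / (x * x / 4)) with (4 * / - x) by (field; lra). unfold Rdiv.
          apply Rmult_le_compat_l; [lra|]. apply Rinv_le_contravar; lra. }
      assert (HB : Rabs (phi x / x + 1 - (dphi x + 1)) <= 2 * e1).
      { apply Rabs_le_between in K1. apply Rabs_le_between in K2. apply Rabs_le; lra. }
      replace (8 * e1 / - a') with (4 / - a' * (2 * e1)) by (field; lra).
      apply Rmult_le_compat; auto; apply Rabs_pos. }
  destruct (H1 a ltac:(lra)) as (_ & _ & Q1 & W1). destruct (H1 a' ltac:(lra)) as (_ & _ & Q2 & W2).
  specialize (HR a a' ltac:(lra) Haa Ha').
  unfold dphi.
  replace ((a / phi a) ^ n * rfac a - (a' / phi a') ^ n * rfac a') with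
    (- ((a' / phi a') ^ n - (a / phi a) ^ n) * rfac a + (a' / phi a') ^ n * (rfac a - rfac a')) by ring.
  eapply Rle_trans; [apply Rabs_triang|]. rewrite !Rabs_mult, Rabs_Ropp.
  pose proof (pow_lip n (a' / phi a') (a / phi a) 2 ltac:(lra) Q2 Q1) as HP.
  assert (Hi : 0 < / - a') by (apply Rinv_0_lt_compat; lra).
  assert (T1 : Rabs ((a' / phi a') ^ n - (a / phi a) ^ n) * Rabs (rfac a) <= 1 / 16 / - a' * (a' - a)).
  { apply Rle_trans with (Rabs ((a' / phi a') ^ n - (a / phi a) ^ n) * 2); [apply Rmult_le_compat_l; [apply Rabs_pos|auto]|].
    eapply Rle_trans; [exact HP|].
    apply Rle_trans with (Q * ((8 * e1 / (- a')) * (a' - a))).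
    - apply Rmult_le_compat; auto; [|apply Rabs_pos|unfold Q; lra].
      apply Rmult_le_pos; [apply pos_INR|lra].
    - unfold Rdiv. replace (Q * (8 * e1 * / - a' * (a' - a))) with ((8 * (e1 * Q)) * / - a' * (a' - a)) by ring.
      apply Rmult_le_compat_r; [lra|]. apply Rmult_le_compat_r; lra. }
  assert (T2 : Rabs ((a' / phi a') ^ n) * Rabs (rfac a - rfac a') <= 1 / 16 / - a' * (a' - a)).
  { assert (Hpw : Rabs ((a' / phi a') ^ n) <= 2 ^ n).
    { rewrite <- RPow_abs. apply pow_incr; split; auto; apply Rabs_pos. }
    apply Rle_trans with (2 ^ n * (K * (3 * (a' - a)))).
    - apply Rmult_le_compat; auto; try apply Rabs_pos. eapply Rle_trans; [exact HR|].
      apply Rmult_le_compat_l; [lra|]. apply Rabs_le_between in Hphi. lra.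
    - replace (2 ^ n * (K * (3 * (a' - a)))) with (3 * (K * 2 ^ n) * (a' - a)) by ring.
      apply Rmult_le_compat_r; [lra|].
      apply Rmult_le_reg_r with (- a'); [lra|]. replace (1 / 16 / - a' * - a') with (1 / 16) by (field; lra).
      assert (3 * (K * 2 ^ n) * - a' <= 3 * (K * 2 ^ n) * d2) by (apply Rmult_le_compat_l; lra). lra. }
  replace (1 / 8 / - a' * (a' - a)) with (1 / 16 / - a' * (a' - a) + 1 / 16 / - a' * (a' - a)) by (field; lra).
  apply Rplus_le_compat; auto.
Qed.
End Asymptotics.

(** * Displacement functions *)

Lemma radius_of_ex (a : nat -> R) r : (forall y, Rabs y < r -> ex_pseries a y) ->
  forall x, Rabs x < r -> Rbar_lt (Rabs x) (CV_radius a).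
Proof.
  intros H x Hx. set (y := (Rabs x + r) / 2).
  assert (Hxp := Rabs_pos x).
  assert (Hy : Rabs y = y) by (apply Rabs_pos_eq; unfold y; lra).
  assert (Hyr : Rabs y < r) by (rewrite Hy; unfold y; lra).
  apply Rbar_lt_le_trans with (Finite (Rabs y)); [simpl; rewrite Hy; unfold y; lra|].
  apply Rbar_not_lt_le. intros Hlt. apply (CV_disk_outside a y Hlt).
  apply ex_series_lim_0. apply ex_pseries_R. auto.
Qed.

(** A convergent power series starting at order n is x^n times another one, whose derivative is
    bounded near 0. *)
Lemma pseries_leading (a : nat -> R) n (h : R -> R) r : 0 < r -> (forall x, Rabs x < r -> is_pseries a x (h x)) ->
  (forall i, (i < n)%nat -> a i = 0) ->
  exists k : R -> R, (forall x, Rabs x < r -> h x = x ^ n * k x) /\ k 0 = a n /\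
    exists K r1, 0 < r1 <= r /\ 0 <= K /\
      forall x, Rabs x < r1 -> exists l : R, is_derive k x l /\ Rabs l <= K.
Proof.
  intros Hr Hh Ha. set (b := PS_decr_n a n). exists (PSeries b).
  assert (Hb : forall y, Rabs y < r -> ex_pseries b y).
  { intros y Hy. apply ex_pseries_decr_n; [|exists (h y); apply Hh; auto].
    destruct (Req_dec y 0) as [->|Hn]; [left; reflexivity|right]. exists (/ y).
    unfold mult, one; simpl. simpl. field. auto. }
  pose proof (radius_of_ex b r Hb) as Hrad.
  split; [|split].
  - intros x Hx. rewrite <- (is_pseries_unique _ _ _ (Hh x Hx)). apply PSeries_decr_n_aux; auto.
  - rewrite PSeries_0. unfold b, PS_decr_n. f_equal; lia.
  - set (D := PSeries (PS_derive b)).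
    assert (HD : forall x, Rabs x < r -> is_derive (PSeries b) x (D x)) by (intros; apply is_derive_PSeries; auto).
    assert (Hc : continuity_pt D 0).
    { apply PSeries_continuity. apply radius_of_ex with r; [|rewrite Rabs_R0; auto].
      intros; apply ex_pseries_derive; auto. }
    destruct (proj1 (continuity_pt_eps D 0) Hc 1 ltac:(lra)) as [d [Hd H]].
    exists (Rabs (D 0) + 1), (Rmin d r).
    split; [split; [apply Rmin_pos; auto|apply Rmin_r]|]. split; [pose proof (Rabs_pos (D 0)); lra|].
    intros x Hx. Rmin_bounds d r.
    exists (D x). split; [apply HD; lra|]. specialize (H x). rewrite Rminus_0_r in H. specialize (H ltac:(lra)).
    pose proof (Rabs_triang (D x - D 0) (D 0)). replace (D x - D 0 + D 0) with (D x) in H2 by ring. lra.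
Qed.

(** What is used of a displacement function with first Taylor coefficient v of even order m, on the
    left of 0. *)
Record even_leading (D : R -> R) (rho v : R) (m : nat) : Prop := {
  el_sign : forall x, - rho < x < 0 -> 0 < v * D x;
  el_bound : forall x, - rho < x < 0 -> Rabs (D x) <= 2 * Rabs v * Rabs x ^ m;
  el_deriv : forall x, - rho < x < 0 -> exists l : R, is_derive D x l /\
     v * l < 0 /\ Rabs v * Rabs x ^ (m - 1) <= Rabs l }.
Arguments el_sign {D rho v m}.
Arguments el_bound {D rho v m}.
Arguments el_deriv {D rho v m}.

Lemma pseries_even_leading (V : nat -> R) (D : R -> R) r l : 0 < r -> (forall x, Rabs x < r -> is_pseries V x (D x)) ->
  (1 <= l)%nat -> (forall i, (i < 2 * l)%nat -> V i = 0) -> V (2 * l)%nat <> 0 ->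
  exists rho, 0 < rho <= r /\ even_leading D rho (V (2 * l)%nat) (2 * l).
Proof.
  intros Hr HD Hl HV Hv. set (m := (2 * l)%nat) in *. set (v := V m) in *.
  destruct (pseries_leading V m D r Hr HD HV) as (k & Hk & Hk0 & K & r1 & Hr1 & HK & Hkd).
  fold v in Hk0.
  assert (Hva : 0 < Rabs v) by (apply Rabs_pos_lt; auto).
  (* On this scale the cofactor k differs from v by at most |v| / 4. *)
  set (rho := Rmin (Rmin r1 1) (Rabs v / (4 * (K + 1)))).
  assert (Hq : 0 < Rabs v / (4 * (K + 1))) by (apply Rdiv_lt_0_compat; lra).
  assert (Hrho : 0 < rho /\ rho <= r1 /\ rho <= 1 /\ K * rho <= Rabs v / 4).
  { assert (rho <= Rabs v / (4 * (K + 1))) by apply Rmin_r.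
    assert (rho <= Rmin r1 1) by apply Rmin_l. Rmin_bounds r1 1.
    split; [unfold rho; repeat apply Rmin_pos; lra|]. split; [lra|]. split; [lra|].
    apply Rle_trans with (K * (Rabs v / (4 * (K + 1)))); [apply Rmult_le_compat_l; lra|].
    apply Rmult_le_reg_r with (4 * (K + 1)); [lra|].
    replace (K * (Rabs v / (4 * (K + 1))) * (4 * (K + 1))) with (K * Rabs v) by (field; lra). lra. }
  exists rho. split; [lra|].
  assert (Hkx : forall x, - rho < x < 0 -> Rabs (k x - v) <= Rabs v / 4).
  { intros x Hx. replace (k x - v) with (- (k 0 - k x)) by (rewrite Hk0; ring). rewrite Rabs_Ropp. eapply Rle_trans.
    - apply (seg_abs k K x 0); [lra| |].
      + apply derive_seg. intros z Hz. destruct (Hkd z) as [dl [H _]]; [apply Rabs_def1; lra|]. exists dl; auto.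
      + intros z Hz. apply Hkd. apply Rabs_def1; lra.
    - apply Rle_trans with (K * rho); [apply Rmult_le_compat_l; lra|lra]. }
  assert (Hxm : forall x, x < 0 -> 0 < x ^ m /\ x ^ m = Rabs x ^ m).
  { intros x Hx. unfold m. rewrite !pow_mult. assert (x ^ 2 = Rabs x ^ 2) by (rewrite Rabs_left by lra; ring).
    rewrite H. split; auto. apply pow_lt, pow_lt, Rabs_pos_lt; lra. }
  assert (Hvk : forall x, - rho < x < 0 -> 0 < v * k x /\ Rabs (k x) <= 2 * Rabs v).
  { intros x Hx. specialize (Hkx x Hx). apply Rabs_le_between in Hkx.
    unfold Rabs in *. destruct (Rcase_abs v); destruct (Rcase_abs (k x)); split; try lra; nra. }
  constructor.
  - intros x Hx. rewrite Hk by (apply Rabs_def1; lra). destruct (Hxm x ltac:(lra)) as [H1 _].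
    destruct (Hvk x Hx) as [H2 _]. replace (v * (x ^ m * k x)) with (x ^ m * (v * k x)) by ring.
    apply Rmult_lt_0_compat; auto.
  - intros x Hx. rewrite Hk by (apply Rabs_def1; lra). destruct (Hxm x ltac:(lra)) as [H1 H2].
    rewrite Rabs_mult, H2, Rabs_pos_eq, Rmult_comm by (rewrite <- H2; lra).
    apply Rmult_le_compat_r; [rewrite <- H2; lra|]. apply Hvk; auto.
  - intros x Hx. destruct (Hkd x) as [kl [Hkl HklK]]; [apply Rabs_def1; lra|].
    set (L := x ^ (m - 1) * (INR m * k x + x * kl)).
    exists L. split.
    + apply (is_derive_ext_loc (fun x => x ^ m * k x)).
      * assert (He : 0 < r - Rabs x) by (rewrite Rabs_left; lra). exists (mkposreal _ He).
        intros y Hy. assert (Hy' : Rabs (y - x) < r - Rabs x) by exact Hy.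
        symmetry. apply Hk. pose proof (Rabs_triang_inv y x). lra.
      * eapply is_derive_eq.
        -- apply is_derive_Rmult; [|exact Hkl]. apply is_derive_pow. apply @is_derive_id.
        -- unfold L, one; simpl. replace m with (S (m - 1)) at 3 by (unfold m; lia).
           replace (Nat.pred m) with (m - 1)%nat by lia. simpl. ring.
    + set (q := INR m * k x + x * kl).
      assert (Hm2 : 2 <= INR m) by (apply (le_INR 2); unfold m; lia).
      specialize (Hkx x Hx). apply Rabs_le_between in Hkx.
      assert (Hxk : Rabs (x * kl) <= Rabs v / 4).
      { rewrite Rabs_mult. apply Rle_trans with (rho * K); [|lra].
        apply Rmult_le_compat; auto; try apply Rabs_pos. rewrite Rabs_left; lra. }
      apply Rabs_le_between in Hxk.
      assert (Hqv : Rabs v * Rabs v <= v * q).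
      { unfold q. unfold Rabs in *. destruct (Rcase_abs v) as [Hv0|Hv0].
        - assert (INR m * k x <= 2 * (3 / 4 * v)).
          { assert (k x <= 3 / 4 * v) by lra. nra. }
          nra.
        - assert (2 * (3 / 4 * v) <= INR m * k x).
          { assert (3 / 4 * v <= k x) by lra. nra. }
          nra. }
      assert (Hp : x ^ (m - 1) < 0).
      { replace (m - 1)%nat with (1 + 2 * (l - 1))%nat by (unfold m; lia).
        rewrite pow_add, pow_1, pow_mult. assert (0 < (x ^ 2) ^ (l - 1)) by (apply pow_lt; nra). nra. }
      assert (Hvv : 0 < Rabs v * Rabs v) by (apply Rmult_lt_0_compat; auto).
      unfold L. fold q. split.
      * replace (v * (x ^ (m - 1) * q)) with (x ^ (m - 1) * (v * q)) by ring. nra.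
      * rewrite Rabs_mult, <- RPow_abs, Rmult_comm. apply Rmult_le_compat_l.
        { apply pow_le, Rabs_pos. }
        apply Rmult_le_reg_l with (Rabs v); auto. rewrite <- (Rabs_mult v q).
        eapply Rle_trans; [exact Hqv|apply Rle_abs].
Qed.

Section Displacement.
Variables (phi g D : R -> R) (rho v : R) (m : nat).
Hypothesis Hrho : 0 < rho.
Hypothesis Hm : (2 <= m)%nat.
Hypothesis Hv : v <> 0.
Hypothesis phi_d : forall a, - rho < a < 0 -> is_derive phi a (g a).
Hypothesis phi_dec : forall a a', - rho < a -> a < a' -> a' < 0 -> phi a' < phi a.
Hypothesis g_mod : forall a a', - rho < a -> a < a' -> a' < 0 ->
  Rabs (g a - g a') <= 1 / 8 / (- a') * (a' - a).
Hypothesis HD : even_leading D rho v m.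

(** Displacement of the system whose upper field, with half-return map phi, is shifted by b; D is the
    displacement for b = 0. *)
Definition shifted (b x : R) : R := D x + (phi (x - b) + b - phi x).

Let av : 0 < Rabs v.
Proof. apply Rabs_pos_lt; auto. Qed.

(** The correction phi (x - b) + b - phi x is at least |b| in absolute value and has the sign of b,
    because phi is decreasing. *)
Lemma shift_gain b x : - rho < x < 0 -> - rho < x - b < 0 -> b <> 0 ->
  0 <= b * (phi (x - b) - phi x).
Proof.
  intros Hx Hxb Hb. destruct (Rlt_le_dec 0 b).
  - pose proof (phi_dec (x - b) x ltac:(lra) ltac:(lra) ltac:(lra)). nra.
  - pose proof (phi_dec x (x - b) ltac:(lra) ltac:(lra) ltac:(lra)). nra.
Qed.

(** D and the correction due to the shift have the same sign. *)
Lemma shifted_same_sign b x : 0 < b * v -> - rho < x < 0 -> - rho < x - b < 0 -> 0 < v * shifted b x.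
Proof.
  intros Hbv Hx Hxb. assert (Hb : b <> 0) by (intros ->; lra).
  pose proof (shift_gain b x Hx Hxb Hb) as H1. pose proof (el_sign HD x Hx) as H2.
  unfold shifted. set (p := phi (x - b) - phi x) in *.
  replace (v * (D x + (phi (x - b) + b - phi x))) with (v * D x + (b * v) * (1 + p / b)).
  - assert (0 <= p / b).
    { replace (p / b) with ((b * p) / (b * b)) by (field; auto). apply Rmult_le_pos; auto.
      left; apply Rinv_0_lt_compat. nra. }
    nra.
  - unfold p. field; auto.
Qed.

(** Where the shift does not reverse the sign of D, it is bounded by D. *)
Lemma shift_dominated b x : b * v < 0 -> - rho < x < 0 -> - rho < x - b < 0 -> 0 <= v * shifted b x ->
  Rabs b <= 2 * Rabs v * Rabs x ^ m.
Proof.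
  intros Hbv Hx Hxb H. assert (Hb : b <> 0) by (intros ->; lra).
  pose proof (shift_gain b x Hx Hxb Hb) as H1.
  apply Rle_trans with (Rabs (D x)); [|apply (el_bound HD); auto].
  pose proof (el_sign HD x Hx) as H2. unfold shifted in H.
  unfold Rabs. destruct (Rcase_abs b); destruct (Rcase_abs (D x)); nra.
Qed.

(** On this scale 2 |v| |x|^m <= |x| / 2. *)
Definition small_rho (rho' : R) : Prop := 0 < rho' /\ 2 * rho' <= rho /\ 4 * Rabs v * rho' <= 1 /\ rho' <= 1.

Lemma small_pow x rho' : small_rho rho' -> - rho' < x < 0 -> 2 * Rabs v * Rabs x ^ m <= Rabs x / 2.
Proof.
  intros (R1 & R2 & R3 & R4) Hx. assert (Rx : 0 < Rabs x < rho') by (rewrite Rabs_left; lra).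
  replace m with (S (S (m - 2))) by lia. simpl.
  assert (Rabs x ^ (m - 2) <= 1) by (rewrite <- (pow1 (m - 2)); apply pow_incr; lra).
  assert (0 < Rabs x ^ (m - 2)) by (apply pow_lt; lra).
  assert (Rabs x * Rabs x ^ (m - 2) <= rho' * 1) by (apply Rmult_le_compat; lra).
  assert (2 * Rabs v * (Rabs x * Rabs x ^ (m - 2)) <= 1 / 2) by nra.
  nra.
Qed.

(** By the modulus of continuity g_mod, the derivative of the correction is at most |b| / (4 |x|).
    Where the shift is dominated by D, this is at most |v| |x|^(m - 1) / 2, half of the lower
    bound for the derivative of D. So the shifted displacement is strictly monotone there, in
    particular at its zeros. *)
Lemma shifted_decreasing b x rho' : small_rho rho' -> b <> 0 -> - rho' < x < 0 ->
  Rabs b <= 2 * Rabs v * Rabs x ^ m ->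
  exists l : R, is_derive (shifted b) x l /\ v * l < 0.
Proof.
  intros Hs Hb Hx Hbx. pose proof (small_pow x rho' Hs Hx) as Hsp. destruct Hs as (R1 & R2 & R3 & R4).
  assert (Hb2 : Rabs b <= Rabs x / 2) by lra.
  destruct (el_deriv HD x ltac:(lra)) as (dl & Hdl & Hs1 & Hs2).
  assert (Hxn : Rabs x = - x) by (apply Rabs_left; lra).
  assert (Hbb := proj1 (Rabs_le_between b (Rabs x / 2)) Hb2). rewrite Hxn in Hbb.
  assert (Hxb : - rho < x - b < 0) by lra.
  exists (dl + (g (x - b) - g x)). split.
  - unfold shifted. apply (is_derive_Rplus D); auto.
    apply (is_derive_Rminus (fun x => phi (x - b) + b) phi); [|apply phi_d; lra].
    eapply is_derive_eq.
    + apply is_derive_Rplus; [|apply @is_derive_const].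
      apply (is_derive_shift phi (- b)). apply phi_d. lra.
    + unfold zero; simpl. replace (x + - b) with (x - b) by ring. ring.
  - assert (Hg : Rabs (g (x - b) - g x) <= 1 / 4 / - x * Rabs b).
    { assert (Hi : 0 < / - x) by (apply Rinv_0_lt_compat; lra).
      destruct (Rlt_le_dec 0 b).
      - rewrite (Rabs_pos_eq b) by lra. eapply Rle_trans; [apply g_mod; lra|].
        replace (x - (x - b)) with b by ring. apply Rmult_le_compat_r; [lra|]. unfold Rdiv in *. nra.
      - rewrite (Rabs_left b), Rabs_minus_sym by lra. eapply Rle_trans; [apply g_mod; lra|].
        replace (x - b - x) with (- b) by ring. apply Rmult_le_compat_r; [lra|].
        assert (/ - (x - b) <= / ((- x) / 2)) by (apply Rinv_le_contravar; lra).
        replace (/ (- x / 2)) with (2 * / - x) in H by (field; lra). unfold Rdiv in *. nra. }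
    assert (Hpow : Rabs x ^ m = - x * Rabs x ^ (m - 1)).
    { replace m with (S (m - 1)) at 1 by lia. simpl. rewrite Hxn at 1. auto. }
    set (P := Rabs x ^ (m - 1)) in *. assert (HP : 0 < P) by (apply pow_lt; lra).
    assert (Hg2 : Rabs (g (x - b) - g x) <= Rabs v * P / 2).
    { eapply Rle_trans; [exact Hg|]. apply Rle_trans with (1 / 4 / - x * (2 * Rabs v * (- x * P))).
      - apply Rmult_le_compat_l; [|rewrite <- Hpow; auto].
        unfold Rdiv. assert (0 < / - x) by (apply Rinv_0_lt_compat; lra). nra.
      - right. field. lra. }
    apply Rabs_le_between in Hg2. assert (0 < Rabs v * P) by (apply Rmult_lt_0_compat; auto).
    unfold Rabs in Hs2, Hg2, H. clear - Hs1 Hs2 Hg2 H Hv. destruct (Rcase_abs v); destruct (Rcase_abs dl); nra.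
Qed.

Lemma shifted_cont b u w : - rho < u -> w < 0 -> - rho < u - b -> w - b < 0 -> u <= w -> cont_seg (shifted b) u w.
Proof.
  intros H1 H2 H3 H4 H5. apply derive_seg. intros x Hx.
  destruct (el_deriv HD x ltac:(lra)) as (dl & Hdl & _).
  eexists. unfold shifted. apply (is_derive_Rplus D); [exact Hdl|].
  apply (is_derive_Rminus (fun x => phi (x - b) + b) phi); [|apply phi_d; lra].
  apply is_derive_Rplus; [|apply @is_derive_const].
  apply (is_derive_shift phi (- b)). apply phi_d. lra.
Qed.

Lemma pow_abs_mono x y : x <= y -> y < 0 -> Rabs y ^ m <= Rabs x ^ m.
Proof. intros. apply pow_incr. rewrite !Rabs_left by lra. lra. Qed.


(** The region in which the shift is dominated extends to the left. So the shifted displacement is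
    strictly monotone to the left of every point at which it has not the sign of - v. *)
Lemma shifted_gt rho' b x y : small_rho rho' -> Rabs b <= rho' -> b * v < 0 -> - rho' < x -> x < y -> y < 0 -> y < b ->
  0 <= v * shifted b y -> v * shifted b y < v * shifted b x.
Proof.
  intros Hs Hbr Hbv Hx Hxy Hy Hyb Hge. pose proof Hs as (R1 & R2 & R3 & R4).
  assert (Hb : b <> 0) by (intros ->; lra).
  apply Rabs_le_between in Hbr.
  assert (Hdom : forall z, - rho' < z <= y -> Rabs b <= 2 * Rabs v * Rabs z ^ m).
  { intros z Hz. eapply Rle_trans; [apply (shift_dominated b y); auto; lra|].
    apply Rmult_le_compat_l; [lra|]. apply pow_abs_mono; lra. }
  destruct (seg_MVT (fun x => v * shifted b x) (Derive (fun x => v * shifted b x)) x y) as [z [Hz E]]; auto.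
  - apply cont_seg_scal; [lra|]. apply shifted_cont; lra.
  - intros z Hz. destruct (shifted_decreasing b z rho' Hs Hb ltac:(lra) (Hdom z ltac:(lra))) as (l & Hl & _).
    apply Derive_correct. exists (v * l). apply is_derive_Rscal; exact Hl.
  - destruct (shifted_decreasing b z rho' Hs Hb ltac:(lra) (Hdom z ltac:(lra))) as (l & Hl & Hneg).
    assert (Hd : Derive (fun x => v * shifted b x) z = v * l) by (apply is_derive_unique, is_derive_Rscal; exact Hl).
    rewrite Hd in E. nra.
Qed.

(** Intermediate values between a fixed point p, where D outweighs a small shift, and q = - 2 |b|,
    where D = O (b^2) does not. *)
Lemma shifted_zero_exists rho' r' : small_rho rho' -> 0 < r' -> exists b1, 0 < b1 /\
  forall b, 0 < Rabs b < b1 -> b * v < 0 ->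
  exists x0, - r' < x0 /\ - rho' < x0 < 0 /\ x0 < b /\ shifted b x0 = 0.
Proof.
  intros Hs Hr'. pose proof Hs as (R1 & R2 & R3 & R4).
  set (p := - Rmin r' rho' / 2).
  assert (Hp : - r' < p /\ - rho' < p /\ p < 0).
  { assert (0 < Rmin r' rho') by (apply Rmin_pos; auto). Rmin_bounds r' rho'.
    unfold p. lra. }
  assert (HDp : 0 < Rabs (D p)).
  { pose proof (el_sign HD p ltac:(lra)). apply Rabs_pos_lt. intros E0. rewrite E0 in H. lra. }
  assert (Hphic : continuity_pt phi p).
  { apply ex_derive_cont_pt. exists (g p). apply phi_d; lra. }
  destruct (proj1 (continuity_pt_eps phi p) Hphic (Rabs (D p) / 2) ltac:(lra)) as [d [Hd Hc]].
  set (b1 := Rmin (Rmin d (Rabs (D p) / 2)) (Rmin (- p / 4) (Rmin (1 / 2) (/ (8 * Rabs v + 1))))).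
  assert (Hi : 0 < / (8 * Rabs v + 1)) by (apply Rinv_0_lt_compat; lra).
  assert (Hb1 : 0 < b1 /\ b1 <= d /\ b1 <= Rabs (D p) / 2 /\ b1 <= - p / 4 /\ b1 <= 1 / 2 /\ b1 <= / (8 * Rabs v + 1)).
  { split; [unfold b1; repeat apply Rmin_pos; lra|].
    split; [eapply Rle_trans; [apply Rmin_l|apply Rmin_l]|].
    split; [eapply Rle_trans; [apply Rmin_l|apply Rmin_r]|].
    split; [eapply Rle_trans; [apply Rmin_r|apply Rmin_l]|].
    split; (eapply Rle_trans; [apply Rmin_r|]); (eapply Rle_trans; [apply Rmin_r|]); [apply Rmin_l|apply Rmin_r]. }
  exists b1. split; [lra|]. intros b Hb Hbv.
  assert (Hb0 : b <> 0) by (intros ->; lra).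
  set (q := - (2 * Rabs b)).
  assert (Hqp : p < q < 0) by (unfold q; lra).
  assert (Hbb := proj1 (Rabs_le_between b (Rabs b)) (Rle_refl _)).
  assert (Hsp : 0 < v * shifted b p).
  { specialize (Hc (p - b)). replace (p - b - p) with (- b) in Hc by ring. rewrite Rabs_Ropp in Hc.
    specialize (Hc ltac:(lra)). apply Rabs_def2 in Hc. pose proof (el_sign HD p ltac:(lra)) as Hsg.
    unfold shifted. set (w := phi (p - b) + b - phi p).
    assert (Hw : - Rabs (D p) < w < Rabs (D p)) by (unfold w; lra).
    unfold Rabs in Hw. destruct (Rcase_abs (D p)); nra. }
  assert (Hsq : v * shifted b q < 0).
  { destruct (Rlt_le_dec (v * shifted b q) 0) as [|Hge]; auto. exfalso.
    pose proof (shift_dominated b q Hbv ltac:(lra) ltac:(unfold q; lra) Hge) as HB.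
    assert (Hq1 : Rabs q ^ m <= (2 * Rabs b) ^ 2).
    { unfold q. rewrite Rabs_Ropp, Rabs_pos_eq by lra. replace m with (2 + (m - 2))%nat by lia. rewrite pow_add.
      assert ((2 * Rabs b) ^ (m - 2) <= 1) by (rewrite <- (pow1 (m - 2)); apply pow_incr; lra).
      assert (0 <= (2 * Rabs b) ^ 2) by apply pow2_ge_0. nra. }
    assert (HBB : Rabs b <= 2 * Rabs v * (2 * Rabs b) ^ 2).
    { eapply Rle_trans; [exact HB|]. apply Rmult_le_compat_l; lra. }
    assert (Hlt : Rabs b * (8 * Rabs v + 1) < 1).
    { apply Rmult_lt_reg_r with (/ (8 * Rabs v + 1)); auto. rewrite Rmult_assoc, Rinv_r by lra. lra. }
    assert (Rabs b * (8 * Rabs v * Rabs b) < Rabs b * 1) by (apply Rmult_lt_compat_l; lra).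
    lra. }
  destruct (seg_IVT (fun x => v * shifted b x) p q 0) as [x0 [Hx0 Ez]]; [lra| | |].
  - apply cont_seg_scal; [lra|]. apply shifted_cont; unfold q in *; lra.
  - rewrite Rmin_right, Rmax_left by lra. lra.
  - exists x0. assert (x0 <> q) by (intros ->; lra). repeat split; try lra.
    + unfold q in *. lra.
    + apply Rmult_integral in Ez. tauto.
Qed.

Lemma shifted_zero_unique rho' b x0 : small_rho rho' -> Rabs b <= rho' -> b * v < 0 ->
  - rho' < x0 < 0 -> x0 < b -> shifted b x0 = 0 ->
  (exists l : R, is_derive (shifted b) x0 l /\ l <> 0) /\
  (forall x, - rho' < x < x0 -> 0 < v * shifted b x) /\
  (forall x, x0 < x < 0 -> x < b -> v * shifted b x < 0).
Proof.
  intros Hs Hbr Hbv Hx0 Hxb Hz. pose proof Hs as (R1 & R2 & R3 & R4).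
  assert (Hb : b <> 0) by (intros ->; lra).
  split; [|split].
  - destruct (shifted_decreasing b x0 rho' Hs Hb Hx0) as (l & Hl & Hn).
    + apply Rabs_le_between in Hbr. apply (shift_dominated b x0); auto; try lra. rewrite Hz; lra.
    + exists l. split; auto. intros ->; lra.
  - intros x Hx. pose proof (shifted_gt rho' b x x0 Hs Hbr Hbv ltac:(lra) ltac:(lra) ltac:(lra) Hxb) as H.
    rewrite Hz, Rmult_0_r in H. apply H; lra.
  - intros x Hx Hxb'. destruct (Rlt_le_dec (v * shifted b x) 0) as [|Hge]; auto. exfalso.
    pose proof (shifted_gt rho' b x0 x Hs Hbr Hbv ltac:(lra) ltac:(lra) ltac:(lra) Hxb' Hge) as H.
    rewrite Hz, Rmult_0_r in H. lra.
Qed.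

Lemma small_rho_exists r' : 0 < r' -> exists rho', small_rho rho' /\ rho' <= r'.
Proof.
  intros Hr'. exists (Rmin (Rmin r' (rho / 2)) (Rmin 1 (/ (4 * Rabs v)))).
  assert (Hi : 0 < / (4 * Rabs v)) by (apply Rinv_0_lt_compat; lra).
  set (q := Rmin (Rmin r' (rho / 2)) (Rmin 1 (/ (4 * Rabs v)))).
  assert (q <= Rmin r' (rho / 2)) by apply Rmin_l. assert (q <= Rmin 1 (/ (4 * Rabs v))) by apply Rmin_r.
  Rmin_bounds r' (rho / 2).
  Rmin_bounds 1 (/ (4 * Rabs v)).
  assert (0 < q) by (unfold q; repeat apply Rmin_pos; lra).
  split; [|lra]. repeat split; try lra.
  replace 1 with (4 * Rabs v * / (4 * Rabs v)) by (field; lra). apply Rmult_le_compat_l; lra.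
Qed.
End Displacement.

(** * Regularity of analytic fields *)

(** f has the partial derivative g in y, quantitatively. This class is stable under products and
    inverses, with explicit constants; beyond the power series along the line, it is all that is
    used of analyticity. *)
Record lip_deriv (f g : R -> R -> R) (r L : R) : Prop := {
  ld_L : 1 <= L;
  ld_lip : lip_on r L f;
  ld_lipy : lip_on r L g;
  ld_bound : forall x y, in_box r x y -> Rabs (f x y) <= L /\ Rabs (g x y) <= L;
  ld_taylor : forall x y y', in_box r x y -> in_box r x y' ->
     Rabs (f x y' - f x y - g x y * (y' - y)) <= L * (y' - y) ^ 2 }.
Arguments ld_L {f g r L}.
Arguments ld_lip {f g r L}.
Arguments ld_lipy {f g r L}.
Arguments ld_bound {f g r L}.
Arguments ld_taylor {f g r L}.

Lemma in_box_sub r r' x y : r' <= r -> in_box r' x y -> in_box r x y.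
Proof. intros H [H1 H2]; split; lra. Qed.

Lemma lip_on_sub r r' L L' f : r' <= r -> L <= L' -> lip_on r L f -> lip_on r' L' f.
Proof.
  intros Hr HL H x y x' y' B B'. eapply Rle_trans; [apply H; eapply in_box_sub; eauto|].
  apply Rmult_le_compat_r; auto. pose proof (Rabs_pos (x - x')). pose proof (Rabs_pos (y - y')). lra.
Qed.

Lemma lip_deriv_sub f g r r' L L' : r' <= r -> L <= L' -> lip_deriv f g r L -> lip_deriv f g r' L'.
Proof.
  intros Hr HL [H1 H2 H3 H4 H5]. constructor.
  - lra.
  - eapply lip_on_sub; eauto.
  - eapply lip_on_sub; eauto.
  - intros x y B. destruct (H4 x y); [eapply in_box_sub; eauto|]. split; lra.
  - intros x y y' B B'. eapply Rle_trans; [apply H5; eapply in_box_sub; eauto|].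
    apply Rmult_le_compat_r; auto. apply pow2_ge_0.
Qed.

Lemma lip_deriv_mult f1 g1 f2 g2 r L : lip_deriv f1 g1 r L -> lip_deriv f2 g2 r L ->
  lip_deriv (fun x y => f1 x y * f2 x y) (fun x y => g1 x y * f2 x y + f1 x y * g2 x y) r (4 * L * L).
Proof.
  intros [A1 A2 A3 A4 A5] [B1 B2 B3 B4 B5].
  assert (Hprod : forall p q p' q' D, 0 <= D -> Rabs p <= L -> Rabs q' <= L -> Rabs (p - p') <= L * D ->
     Rabs (q - q') <= L * D -> Rabs (p * q - p' * q') <= 2 * L * L * D).
  { intros p q p' q' D HD H1 H2 H3 H4. replace (p * q - p' * q') with (p * (q - q') + (p - p') * q') by ring.
    eapply Rle_trans; [apply Rabs_triang|]. rewrite !Rabs_mult.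
    assert (Rabs p * Rabs (q - q') <= L * (L * D)) by (apply Rmult_le_compat; auto; apply Rabs_pos).
    assert (Rabs (p - p') * Rabs q' <= (L * D) * L) by (apply Rmult_le_compat; auto; apply Rabs_pos). lra. }
  assert (HD : forall x y x' y' : R, 0 <= Rabs (x - x') + Rabs (y - y')).
  { intros. pose proof (Rabs_pos (x - x')). pose proof (Rabs_pos (y - y')). lra. }
  constructor.
  - nra.
  - intros x y x' y' B B'. specialize (HD x y x' y').
    eapply Rle_trans; [apply (Hprod _ _ _ _ (Rabs (x - x') + Rabs (y - y'))); auto;
      try (apply A4; auto); try (apply B4; auto)|].
    apply Rmult_le_compat_r; auto; nra.
  - intros x y x' y' B B'. specialize (HD x y x' y').
    replace (g1 x y * f2 x y + f1 x y * g2 x y - (g1 x' y' * f2 x' y' + f1 x' y' * g2 x' y')) with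
      ((g1 x y * f2 x y - g1 x' y' * f2 x' y') + (f1 x y * g2 x y - f1 x' y' * g2 x' y')) by ring.
    eapply Rle_trans; [apply Rabs_triang|].
    pose proof (Hprod (g1 x y) (f2 x y) (g1 x' y') (f2 x' y') _ HD (proj2 (A4 _ _ B)) (proj1 (B4 _ _ B'))
      (A3 _ _ _ _ B B') (B2 _ _ _ _ B B')).
    pose proof (Hprod (f1 x y) (g2 x y) (f1 x' y') (g2 x' y') _ HD (proj1 (A4 _ _ B)) (proj2 (B4 _ _ B'))
      (A2 _ _ _ _ B B') (B3 _ _ _ _ B B')). lra.
  - intros x y B. destruct (A4 x y B) as [F1 G1]. destruct (B4 x y B) as [F2 G2].
    assert (Rabs (f1 x y) * Rabs (f2 x y) <= L * L) by (apply Rmult_le_compat; auto; apply Rabs_pos).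
    assert (Rabs (g1 x y) * Rabs (f2 x y) <= L * L) by (apply Rmult_le_compat; auto; apply Rabs_pos).
    assert (Rabs (f1 x y) * Rabs (g2 x y) <= L * L) by (apply Rmult_le_compat; auto; apply Rabs_pos).
    assert (0 <= L * L) by nra.
    rewrite Rabs_mult. split; [lra|]. eapply Rle_trans; [apply Rabs_triang|]. rewrite !Rabs_mult. lra.
  - intros x y y' B B'. destruct (A4 x y B) as [F1 G1]. destruct (B4 x y' B') as [F2 _].
    pose proof (A5 x y y' B B') as T1. pose proof (B5 x y y' B B') as T2.
    pose proof (B2 x y' x y B' B) as LL. replace (x - x) with 0 in LL by ring. rewrite Rabs_R0, Rplus_0_l in LL.
    set (d := y' - y) in *.
    replace (f1 x y' * f2 x y' - f1 x y * f2 x y - (g1 x y * f2 x y + f1 x y * g2 x y) * d) with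
      ((f1 x y' - f1 x y - g1 x y * d) * f2 x y' + f1 x y * (f2 x y' - f2 x y - g2 x y * d)
        + g1 x y * d * (f2 x y' - f2 x y)) by ring.
    eapply Rle_trans; [apply Rabs_triang|]. eapply Rle_trans; [apply Rplus_le_compat_r, Rabs_triang|].
    rewrite !Rabs_mult.
    assert (Ed : d ^ 2 = Rabs d * Rabs d) by (rewrite <- Rabs_mult, Rabs_pos_eq; [ring|apply Rle_0_sqr]).
    pose proof (pow2_ge_0 d).
    assert (Rabs (f1 x y' - f1 x y - g1 x y * d) * Rabs (f2 x y') <= L * d ^ 2 * L) by (apply Rmult_le_compat; auto; apply Rabs_pos).
    assert (Rabs (f1 x y) * Rabs (f2 x y' - f2 x y - g2 x y * d) <= L * (L * d ^ 2)) by (apply Rmult_le_compat; auto; apply Rabs_pos).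
    assert (Rabs (g1 x y) * Rabs d * Rabs (f2 x y' - f2 x y) <= L * Rabs d * (L * Rabs d)).
    { apply Rmult_le_compat; auto; try apply Rabs_pos; [apply Rmult_le_pos; apply Rabs_pos|].
      apply Rmult_le_compat_r; auto; apply Rabs_pos. }
    assert (L * Rabs d * (L * Rabs d) = L * L * d ^ 2) by (rewrite Ed; ring).
    assert (0 <= L * L * d ^ 2) by (apply Rmult_le_pos; nra). lra.
Qed.

Lemma lip_deriv_inv f g r L c : 0 < c <= 1 -> lip_deriv f g r L ->
  (forall x y, in_box r x y -> c <= Rabs (f x y)) ->
  lip_deriv (fun x y => / f x y) (fun x y => - g x y * (/ f x y * / f x y)) r (4 * L * L / (c * c * c)).
Proof.
  intros Hc [A1 A2 A3 A4 A5] Hf.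
  set (k := / c). assert (Hk : 1 <= k) by (unfold k; rewrite <- Rinv_1; apply Rinv_le_contravar; lra).
  assert (EK : 4 * L * L / (c * c * c) = 4 * L * L * (k * k * k)) by (unfold k; field; lra).
  rewrite EK. clear EK.
  assert (Hn : forall x y, in_box r x y -> f x y <> 0).
  { intros x y B E. specialize (Hf x y B). rewrite E, Rabs_R0 in Hf. lra. }
  assert (Hi : forall x y, in_box r x y -> Rabs (/ f x y) <= k).
  { intros x y B. rewrite Rabs_inv. apply Rinv_le_contravar; [lra|auto]. }
  assert (Hii : forall x y x' y', in_box r x y -> in_box r x' y' -> Rabs (/ f x y * / f x' y') <= k * k).
  { intros. rewrite Rabs_mult. apply Rmult_le_compat; auto; apply Rabs_pos. }
  assert (Hkk : 1 <= k * k) by nra. assert (Hkkk : k * k <= k * k * k) by nra.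
  assert (HLL : 1 <= L * L) by nra. assert (HL2 : L <= L * L) by nra.
  assert (Hbig : forall t, 0 <= t -> L * t * (k * k) <= L * L * (k * k * k) * t).
  { intros t Ht. assert (L * (k * k) <= L * L * (k * k * k)) by (apply Rmult_le_compat; lra). nra. }
  assert (Hpos3 : 0 < L * L * (k * k * k)) by (apply Rmult_lt_0_compat; lra).
  assert (HD : forall x y x' y' : R, 0 <= Rabs (x - x') + Rabs (y - y')).
  { intros. pose proof (Rabs_pos (x - x')). pose proof (Rabs_pos (y - y')). lra. }
  assert (Hlip : forall x y x' y', in_box r x y -> in_box r x' y' ->
     Rabs (/ f x y - / f x' y') <= L * (Rabs (x - x') + Rabs (y - y')) * (k * k)).
  { intros x y x' y' B B'. replace (/ f x y - / f x' y') with (- (f x y - f x' y') * (/ f x y * / f x' y'))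
      by (field; auto). rewrite Rabs_mult, Rabs_Ropp. apply Rmult_le_compat; auto; apply Rabs_pos. }
  constructor.
  - nra.
  - intros x y x' y' B B'. eapply Rle_trans; [apply Hlip; auto|].
    eapply Rle_trans; [apply Hbig; auto|]. specialize (HD x y x' y'). nra.
  - intros x y x' y' B B'. set (D := Rabs (x - x') + Rabs (y - y')) in *.
    assert (HD' : 0 <= D) by apply HD.
    replace (- g x y * (/ f x y * / f x y) - - g x' y' * (/ f x' y' * / f x' y')) with
      (- ((g x y - g x' y') * (/ f x y * / f x y)) + - (g x' y' * (/ f x y + / f x' y') * (/ f x y - / f x' y'))) by ring.
    eapply Rle_trans; [apply Rabs_triang|]. rewrite !Rabs_Ropp, !(Rabs_mult _ (_ * _)), !(Rabs_mult _ (_ - _)), (Rabs_mult (g x' y')).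
    assert (T1 : Rabs (g x y - g x' y') * Rabs (/ f x y * / f x y) <= L * D * (k * k)).
    { apply Rmult_le_compat; auto; try apply Rabs_pos. }
    assert (T2 : Rabs (g x' y') * Rabs (/ f x y + / f x' y') * Rabs (/ f x y - / f x' y') <= L * (2 * k) * (L * D * (k * k))).
    { apply Rmult_le_compat; try apply Rabs_pos; [apply Rmult_le_pos; apply Rabs_pos| |apply Hlip; auto].
      apply Rmult_le_compat; try apply Rabs_pos; [apply A4; auto|].
      eapply Rle_trans; [apply Rabs_triang|]. pose proof (Hi x y B). pose proof (Hi x' y' B'). lra. }
    pose proof (Hbig D HD'). replace (L * (2 * k) * (L * D * (k * k))) with (2 * (L * L * (k * k * k) * D)) in T2 by ring.
    assert (0 <= L * L * (k * k * k) * D) by (apply Rmult_le_pos; lra). lra.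
  - intros x y B. split.
    + eapply Rle_trans; [apply Hi; auto|]. nra.
    + rewrite Rabs_mult, Rabs_Ropp.
      assert (Rabs (g x y) * Rabs (/ f x y * / f x y) <= L * (k * k)).
      { apply Rmult_le_compat; auto; try apply Rabs_pos. apply A4; auto. }
      pose proof (Hbig 1 ltac:(lra)). lra.
  - intros x y y' B B'. set (d := y' - y) in *.
    pose proof (A5 x y y' B B') as T. fold d in T.
    pose proof (A2 x y' x y B' B) as LL. replace (x - x) with 0 in LL by ring. rewrite Rabs_R0, Rplus_0_l in LL. fold d in LL.
    replace (/ f x y' - / f x y - - g x y * (/ f x y * / f x y) * d) with
      (- ((f x y' - f x y - g x y * d) * (/ f x y * / f x y')) + (g x y * d * (f x y' - f x y)) * (/ f x y * / f x y * / f x y'))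
      by (field; auto).
    assert (Ed : d ^ 2 = Rabs d * Rabs d) by (rewrite <- Rabs_mult, Rabs_pos_eq; [ring|apply Rle_0_sqr]).
    pose proof (pow2_ge_0 d) as Hd2.
    eapply Rle_trans; [apply Rabs_triang|]. rewrite Rabs_Ropp, (Rabs_mult _ (/ f x y * / f x y')), (Rabs_mult _ (_ * _ * _)).
    assert (T1 : Rabs (f x y' - f x y - g x y * d) * Rabs (/ f x y * / f x y') <= L * d ^ 2 * (k * k)).
    { apply Rmult_le_compat; auto; apply Rabs_pos. }
    assert (T2 : Rabs (g x y * d * (f x y' - f x y)) * Rabs (/ f x y * / f x y * / f x y') <= L * L * d ^ 2 * (k * k * k)).
    { apply Rmult_le_compat; try apply Rabs_pos.
      - rewrite !Rabs_mult, Ed. replace (L * L * (Rabs d * Rabs d)) with (L * Rabs d * (L * Rabs d)) by ring.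
        apply Rmult_le_compat; auto; try apply Rabs_pos; [apply Rmult_le_pos; apply Rabs_pos|].
        apply Rmult_le_compat_r; [apply Rabs_pos|]. apply A4; auto.
      - rewrite Rabs_mult. apply Rmult_le_compat; auto; apply Rabs_pos. }
    pose proof (Hbig (d ^ 2) Hd2).
    assert (0 <= L * L * (k * k * k) * d ^ 2) by (apply Rmult_le_pos; lra). lra.
Qed.

Definition mono (x y : R) (i j : nat) : R := x ^ i * y ^ j.
Definition mono_dy (x y : R) (i j : nat) : R := x ^ i * (INR j * y ^ (pred j)).

Section Monomials.
Variable q : R.
Hypothesis Hq : 0 < q.

Lemma pow_abs_le x i : Rabs x <= q -> Rabs (x ^ i) <= q ^ i.
Proof. intros. rewrite <- RPow_abs. apply pow_incr; split; auto; apply Rabs_pos. Qed.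

Lemma dpow_le y j : Rabs y <= q -> q * Rabs (INR j * y ^ (pred j)) <= INR j * q ^ j.
Proof.
  intros Hy. destruct j; [simpl; rewrite Rmult_0_l, Rabs_R0; lra|].
  rewrite Rabs_mult, (Rabs_pos_eq (INR _)) by apply pos_INR. simpl pred.
  pose proof (pow_abs_le y j Hy). pose proof (pos_INR (S j)).
  replace (INR (S j) * q ^ S j) with (q * (INR (S j) * q ^ j)) by (rewrite <- (tech_pow_Rmult q j); ring).
  apply Rmult_le_compat_l; [lra|]. apply Rmult_le_compat_l; auto.
Qed.

Lemma mono_diff x y x' y' i j : Rabs x <= q -> Rabs y <= q -> Rabs x' <= q -> Rabs y' <= q ->
  q * Rabs (mono x y i j - mono x' y' i j) <= INR (i + j) * q ^ (i + j) * (Rabs (x - x') + Rabs (y - y')).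
Proof.
  intros. unfold mono. replace (x ^ i * y ^ j - x' ^ i * y' ^ j) with
    ((x ^ i - x' ^ i) * y ^ j + x' ^ i * (y ^ j - y' ^ j)) by ring.
  pose proof (pow_lip i x x' q ltac:(lra) H H1) as P1. pose proof (pow_lip j y y' q ltac:(lra) H0 H2) as P2.
  pose proof (pow_abs_le y j H0) as Q1. pose proof (pow_abs_le x' i H1) as Q2.
  apply Rle_trans with (q * (Rabs (x ^ i - x' ^ i) * Rabs (y ^ j) + Rabs (x' ^ i) * Rabs (y ^ j - y' ^ j))).
  { apply Rmult_le_compat_l; [lra|]. eapply Rle_trans; [apply Rabs_triang|]. rewrite !Rabs_mult. lra. }
  assert (A1 : Rabs (x ^ i - x' ^ i) * q * Rabs (y ^ j) <= INR i * q ^ i * Rabs (x - x') * q ^ j).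
  { apply Rmult_le_compat; auto; try apply Rabs_pos. apply Rmult_le_pos; [apply Rabs_pos|lra]. }
  assert (A2 : Rabs (x' ^ i) * (Rabs (y ^ j - y' ^ j) * q) <= q ^ i * (INR j * q ^ j * Rabs (y - y'))).
  { apply Rmult_le_compat; auto; try apply Rabs_pos. apply Rmult_le_pos; [apply Rabs_pos|lra]. }
  rewrite pow_add, plus_INR.
  pose proof (Rabs_pos (x - x')). pose proof (Rabs_pos (y - y')). pose proof (pos_INR i). pose proof (pos_INR j).
  assert (0 < q ^ i * q ^ j) by (apply Rmult_lt_0_compat; apply pow_lt; auto).
  assert (0 <= INR j * (q ^ i * q ^ j) * Rabs (x - x')) by (apply Rmult_le_pos; [apply Rmult_le_pos; auto; lra|auto]).
  assert (0 <= INR i * (q ^ i * q ^ j) * Rabs (y - y')) by (apply Rmult_le_pos; [apply Rmult_le_pos; auto; lra|auto]).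
  lra.
Qed.

Lemma mono_dy_le x y i j : Rabs x <= q -> Rabs y <= q ->
  q * Rabs (mono_dy x y i j) <= INR (i + j) * q ^ (i + j).
Proof.
  intros. unfold mono_dy. rewrite Rabs_mult, pow_add, plus_INR.
  pose proof (pow_abs_le x i H). pose proof (dpow_le y j H0).
  assert (Rabs (x ^ i) * (q * Rabs (INR j * y ^ pred j)) <= q ^ i * (INR j * q ^ j)).
  { apply Rmult_le_compat; auto; try apply Rabs_pos. apply Rmult_le_pos; [lra|apply Rabs_pos]. }
  assert (0 < q ^ i * q ^ j) by (apply Rmult_lt_0_compat; apply pow_lt; auto).
  pose proof (pos_INR i). assert (0 <= INR i * (q ^ i * q ^ j)) by (apply Rmult_le_pos; lra). lra.
Qed.

Lemma mono_dy_diff x y x' y' i j : Rabs x <= q -> Rabs y <= q -> Rabs x' <= q -> Rabs y' <= q ->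
  q ^ 2 * Rabs (mono_dy x y i j - mono_dy x' y' i j) <= INR (i + j) ^ 2 * q ^ (i + j) * (Rabs (x - x') + Rabs (y - y')).
Proof.
  intros. unfold mono_dy.
  set (dx := Rabs (x - x')). set (dy := Rabs (y - y')).
  assert (Hdx : 0 <= dx) by apply Rabs_pos. assert (Hdy : 0 <= dy) by apply Rabs_pos.
  pose proof (pos_INR i) as Hi. pose proof (pos_INR j) as Hj.
  replace (x ^ i * (INR j * y ^ pred j) - x' ^ i * (INR j * y' ^ pred j)) with
    ((x ^ i - x' ^ i) * (INR j * y ^ pred j) + x' ^ i * (INR j * (y ^ pred j - y' ^ pred j))) by ring.
  pose proof (pow_lip i x x' q ltac:(lra) H H1) as P1. fold dx in P1.
  pose proof (dpow_le y j H0) as P2. pose proof (pow_abs_le x' i H1) as P3.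
  assert (P4 : q ^ 2 * Rabs (INR j * (y ^ pred j - y' ^ pred j)) <= INR j ^ 2 * q ^ j * dy).
  { destruct j; [simpl; rewrite !Rmult_0_l, Rabs_R0; lra|].
    pose proof (pow_lip j y y' q ltac:(lra) H0 H2) as PL. fold dy in PL. simpl pred.
    rewrite Rabs_mult, (Rabs_pos_eq (INR _)) by auto.
    assert (INR j <= INR (S j)) by (apply le_INR; lia). pose proof (pos_INR j).
    assert (0 < q ^ j) by (apply pow_lt; auto).
    replace (q ^ 2 * (INR (S j) * Rabs (y ^ j - y' ^ j))) with (INR (S j) * q * (Rabs (y ^ j - y' ^ j) * q)) by ring.
    apply Rle_trans with (INR (S j) * q * (INR j * q ^ j * dy)).
    - apply Rmult_le_compat_l; auto. apply Rmult_le_pos; lra.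
    - replace (INR (S j) ^ 2 * q ^ S j * dy) with (INR (S j) * q * (INR (S j) * q ^ j * dy)) by (rewrite <- (tech_pow_Rmult q j); ring).
      apply Rmult_le_compat_l; [apply Rmult_le_pos; lra|]. apply Rmult_le_compat_r; auto.
      apply Rmult_le_compat_r; lra. }
  apply Rle_trans with ((Rabs (x ^ i - x' ^ i) * q) * (q * Rabs (INR j * y ^ pred j)) +
      Rabs (x' ^ i) * (q ^ 2 * Rabs (INR j * (y ^ pred j - y' ^ pred j)))).
  { eapply Rle_trans; [apply Rmult_le_compat_l; [apply pow2_ge_0|apply Rabs_triang]|].
    rewrite (Rabs_mult (x ^ i - x' ^ i)), (Rabs_mult (x' ^ i)). right; ring. }
  assert (A1 : (Rabs (x ^ i - x' ^ i) * q) * (q * Rabs (INR j * y ^ pred j)) <= (INR i * q ^ i * dx) * (INR j * q ^ j)).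
  { apply Rmult_le_compat; auto; apply Rmult_le_pos; try apply Rabs_pos; lra. }
  assert (A2 : Rabs (x' ^ i) * (q ^ 2 * Rabs (INR j * (y ^ pred j - y' ^ pred j))) <= q ^ i * (INR j ^ 2 * q ^ j * dy)).
  { apply Rmult_le_compat; auto; try apply Rabs_pos. apply Rmult_le_pos; [apply pow2_ge_0|apply Rabs_pos]. }
  rewrite pow_add, plus_INR. set (Q := q ^ i * q ^ j) in *.
  assert (HQ : 0 < Q) by (apply Rmult_lt_0_compat; apply pow_lt; auto).
  apply Rle_trans with (INR i * INR j * (Q * dx) + INR j ^ 2 * (Q * dy)); [unfold Q; lra|].
  assert (0 <= Q * dx) by (apply Rmult_le_pos; lra). assert (0 <= Q * dy) by (apply Rmult_le_pos; lra).
  replace ((INR i + INR j) ^ 2 * Q * (dx + dy)) with ((INR i + INR j) ^ 2 * (Q * dx) + (INR i + INR j) ^ 2 * (Q * dy)) by ring.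
  assert (0 <= INR i * INR j) by (apply Rmult_le_pos; auto).
  apply Rplus_le_compat; apply Rmult_le_compat_r; auto; nra.
Qed.

Lemma pow_taylor y y' j : Rabs y <= q -> Rabs y' <= q ->
  q ^ 2 * Rabs (y' ^ j - y ^ j - INR j * y ^ pred j * (y' - y)) <= INR j ^ 2 * q ^ j * (y' - y) ^ 2.
Proof.
  intros Hy Hy'. pose proof (pow2_ge_0 (y' - y)) as Hd. induction j.
  - simpl. replace (1 - 1 - 0 * 1 * (y' - y)) with 0 by ring. rewrite Rabs_R0. lra.
  - set (e := y' ^ j - y ^ j - INR j * y ^ pred j * (y' - y)) in *.
    assert (E : y' ^ S j - y ^ S j - INR (S j) * y ^ pred (S j) * (y' - y) = y' * e + INR j * y ^ pred j * (y' - y) ^ 2).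
    { unfold e. rewrite S_INR. simpl pred. destruct j; simpl; ring. }
    rewrite E. pose proof (dpow_le y j Hy) as P. pose proof (pos_INR j).
    assert (A1 : Rabs y' * (q ^ 2 * Rabs e) <= q * (INR j ^ 2 * q ^ j * (y' - y) ^ 2)).
    { apply Rmult_le_compat; auto; try apply Rabs_pos. apply Rmult_le_pos; [apply pow2_ge_0|apply Rabs_pos]. }
    apply Rle_trans with (Rabs y' * (q ^ 2 * Rabs e) + q * (q * Rabs (INR j * y ^ pred j)) * (y' - y) ^ 2).
    { eapply Rle_trans; [apply Rmult_le_compat_l; [apply pow2_ge_0|apply Rabs_triang]|].
      rewrite (Rabs_mult y' e), (Rabs_mult _ ((y' - y) ^ 2)), (Rabs_pos_eq ((y' - y) ^ 2)) by auto. right; ring. }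
    assert (A2 : q * (q * Rabs (INR j * y ^ pred j)) * (y' - y) ^ 2 <= q * (INR j * q ^ j) * (y' - y) ^ 2).
    { apply Rmult_le_compat_r; auto. apply Rmult_le_compat_l; lra. }
    rewrite S_INR, <- (tech_pow_Rmult q j). assert (HQ : 0 < q ^ j) by (apply pow_lt; auto).
    assert (0 <= q * q ^ j * (y' - y) ^ 2) by (apply Rmult_le_pos; [apply Rmult_le_pos; lra|auto]).
    replace ((INR j + 1) ^ 2 * (q * q ^ j) * (y' - y) ^ 2) with
      (q * (INR j ^ 2 * q ^ j * (y' - y) ^ 2) + q * (INR j * q ^ j) * (y' - y) ^ 2 + (INR j + 1) * (q * q ^ j * (y' - y) ^ 2)) by ring.
    assert (0 <= (INR j + 1) * (q * q ^ j * (y' - y) ^ 2)) by (apply Rmult_le_pos; lra). lra.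
Qed.

Lemma mono_taylor x y y' i j : Rabs x <= q -> Rabs y <= q -> Rabs y' <= q ->
  q ^ 2 * Rabs (mono x y' i j - mono x y i j - mono_dy x y i j * (y' - y)) <= INR (i + j) ^ 2 * q ^ (i + j) * (y' - y) ^ 2.
Proof.
  intros. unfold mono, mono_dy.
  replace (x ^ i * y' ^ j - x ^ i * y ^ j - x ^ i * (INR j * y ^ pred j) * (y' - y)) with
    (x ^ i * (y' ^ j - y ^ j - INR j * y ^ pred j * (y' - y))) by ring.
  pose proof (pow_taylor y y' j H0 H1) as P. pose proof (pow_abs_le x i H) as P'.
  rewrite Rabs_mult. set (e := Rabs (y' ^ j - y ^ j - INR j * y ^ pred j * (y' - y))) in *.
  assert (He : 0 <= e) by apply Rabs_pos.
  apply Rle_trans with (q ^ i * (INR j ^ 2 * q ^ j * (y' - y) ^ 2)).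
  - replace (q ^ 2 * (Rabs (x ^ i) * e)) with (Rabs (x ^ i) * (q ^ 2 * e)) by ring.
    apply Rmult_le_compat; auto; try apply Rabs_pos. apply Rmult_le_pos; auto; apply pow2_ge_0.
  - rewrite pow_add, plus_INR. pose proof (pos_INR i). pose proof (pos_INR j).
    replace (q ^ i * (INR j ^ 2 * q ^ j * (y' - y) ^ 2)) with (INR j ^ 2 * (q ^ i * q ^ j * (y' - y) ^ 2)) by ring.
    replace ((INR i + INR j) ^ 2 * (q ^ i * q ^ j) * (y' - y) ^ 2) with
      ((INR i + INR j) ^ 2 * (q ^ i * q ^ j * (y' - y) ^ 2)) by ring.
    apply Rmult_le_compat_r.
    + apply Rmult_le_pos; [apply Rmult_le_pos; apply pow_le; lra|apply pow2_ge_0].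
    + apply pow_incr; lra.
Qed.
End Monomials.

(** The diagonals of the double series with coefficients a and terms T i j: values, derivatives, or
    differences of these, of monomials. *)
Definition diag (a T : nat -> nat -> R) (n : nat) : R := sum_f_R0 (fun i => a i (n - i)%nat * T i (n - i)%nat) n.

Lemma diag_minus a T T' n : diag a (fun i j => T i j - T' i j) n = diag a T n - diag a T' n.
Proof.
  unfold diag. rewrite <- minus_sum. apply sum_eq. intros; ring.
Qed.

Lemma diag_scal a T c n : diag a (fun i j => T i j * c) n = diag a T n * c.
Proof.
  unfold diag. rewrite (Rmult_comm _ c), scal_sum. apply sum_eq. intros; ring.
Qed.

Lemma sum_abs_bound (c t : nat -> R) B n : (forall i, (i <= n)%nat -> Rabs (t i) <= B) ->
  Rabs (sum_f_R0 (fun i => c i * t i) n) <= sum_f_R0 (fun i => Rabs (c i)) n * B.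
Proof.
  intros H. eapply Rle_trans; [apply Rsum_abs|]. rewrite Rmult_comm, scal_sum. apply sum_Rle.
  intros i Hi. rewrite Rabs_mult. apply Rmult_le_compat_l; [apply Rabs_pos|auto].
Qed.

Lemma sq_le_pow4 n : INR n ^ 2 <= 4 ^ n.
Proof.
  assert (H : INR n <= 2 ^ n).
  { induction n; [simpl; lra|]. rewrite S_INR. simpl pow. assert (1 <= 2 ^ n) by (apply pow_R1_Rle; lra). lra. }
  replace 4 with (2 ^ 2) by ring. rewrite <- pow_mult, Nat.mul_comm, pow_mult.
  apply pow_incr. split; [apply pos_INR|auto].
Qed.

Section DoubleSeries.
Variables (a : nat -> nat -> R) (p M : R).
Hypothesis Hp : 0 < p.
Hypothesis Ha : forall n, sum_f_R0 (fun i => Rabs (a i (n - i)%nat)) n * p ^ n <= M.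

Let q : R := p / 8.

(** Differentiating a monomial twice costs a factor of at most n^2 <= 4^n, which is absorbed by
    passing from the radius p to q = p / 8; a geometric series is left. *)
Lemma diag_bound T C n : 0 <= C -> (forall i j, Rabs (T i j) <= C * (INR (i + j) ^ 2 * q ^ (i + j))) ->
  Rabs (diag a T n) <= C * M * (1 / 2) ^ n.
Proof.
  intros HC HT. unfold diag.
  eapply Rle_trans; [apply (sum_abs_bound _ _ (C * (INR n ^ 2 * q ^ n)))|].
  - intros i Hi. eapply Rle_trans; [apply HT|]. replace (i + (n - i))%nat with n by lia. lra.
  - assert (E : q ^ n * (4 ^ n) = p ^ n * (1 / 2) ^ n).
    { rewrite <- !Rpow_mult_distr. f_equal. unfold q. field. }
    set (S := sum_f_R0 (fun i => Rabs (a i (n - i)%nat)) n) in *.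
    assert (HS : 0 <= S) by (apply cond_pos_sum; intros; apply Rabs_pos).
    assert (Hqn : 0 < q ^ n) by (apply pow_lt; unfold q; lra).
    assert (Hh : 0 < (1 / 2) ^ n) by (apply pow_lt; lra).
    apply Rle_trans with (S * (C * (4 ^ n * q ^ n))).
    + apply Rmult_le_compat_l; auto. apply Rmult_le_compat_l; auto. apply Rmult_le_compat_r; [lra|]. apply sq_le_pow4.
    + replace (4 ^ n * q ^ n) with (p ^ n * (1 / 2) ^ n) by lra.
      replace (S * (C * (p ^ n * (1 / 2) ^ n))) with (C * (S * p ^ n) * (1 / 2) ^ n) by ring.
      apply Rmult_le_compat_r; [lra|]. apply Rmult_le_compat_l; auto. apply Ha.
Qed.

Lemma geom_half K : is_series (fun n => K * (1 / 2) ^ n) (2 * K).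
Proof.
  replace (2 * K) with (scal K (/ (1 - 1 / 2))) by (unfold scal; simpl; unfold mult; simpl; field).
  apply (is_series_scal_l K (fun n => (1 / 2) ^ n)). apply is_series_geom. rewrite Rabs_pos_eq; lra.
Qed.

Lemma diag_ex T C : 0 <= C -> (forall i j, Rabs (T i j) <= C * (INR (i + j) ^ 2 * q ^ (i + j))) ->
  ex_series (diag a T).
Proof.
  intros HC HT. apply (ex_series_le (K:=R_AbsRing) (V:=R_CompleteNormedModule) _ (fun n => (C * M) * (1 / 2) ^ n)).
  - intros n. apply (diag_bound T C n HC HT).
  - eexists; apply geom_half.
Qed.

Lemma diag_series_bound T C U : 0 <= C -> (forall i j, Rabs (T i j) <= C * (INR (i + j) ^ 2 * q ^ (i + j))) ->
  is_series (diag a T) U -> Rabs U <= 2 * M * C.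
Proof.
  intros HC HT HU.
  pose proof (geom_half (C * M)) as HG.
  assert (Habs : ex_series (fun n => Rabs (diag a T n))).
  { apply (ex_series_le (K:=R_AbsRing) (V:=R_CompleteNormedModule) _ (fun n => (C * M) * (1 / 2) ^ n)).
    - intros n. unfold norm; simpl. unfold abs; simpl. rewrite Rabs_Rabsolu. apply (diag_bound T C n HC HT).
    - eexists; apply HG. }
  rewrite <- (is_series_unique _ _ HU).
  eapply Rle_trans; [apply Series_Rabs; auto|].
  replace (2 * M * C) with (2 * (C * M)) by ring. rewrite <- (is_series_unique _ _ HG).
  apply Series_le; [|eexists; apply HG]. intros n. split; [apply Rabs_pos|apply (diag_bound T C n HC HT)].
Qed.
End DoubleSeries.

Lemma nat_le_sq n : INR n <= INR n ^ 2.
Proof.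
  destruct n; [simpl; lra|]. assert (1 <= INR (S n)) by (apply (le_INR 1); lia). nra.
Qed.

(** The series is differentiated term by term on a box of one sixteenth of the radius of
    convergence; every estimate on monomials passes to sums by diag_series_bound. The
    coefficients of pure powers of x give the power series along the line. *)
Lemma analytic_lip_deriv (f : R -> R -> R) : analytic_at f 0 0 -> exists (g : R -> R -> R) r L,
  0 < r /\ lip_deriv f g r L /\ exists a : nat -> R, forall x, Rabs x < r -> is_pseries a x (f x 0).
Proof.
  intros (a & r0 & Hser). set (p := r0 / 2). assert (Hr0 := cond_pos r0). assert (Hp : 0 < p < r0) by (unfold p; lra).
  assert (HM : exists M, 0 < M /\ forall n, sum_f_R0 (fun i => Rabs (a i (n - i)%nat)) n * p ^ n <= M).
  { destruct (Hser p p) as [Hex _]; try (rewrite Rabs_pos_eq; lra).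
    assert (Hle : forall n, sum_f_R0 (fun i => Rabs (a i (n - i)%nat)) n * p ^ n =
       sum_f_R0 (fun i => Rabs (a i (n - i)%nat * p ^ i * p ^ (n - i))) n).
    { intros n. rewrite Rmult_comm, scal_sum. apply sum_eq. intros i Hi. rewrite Rmult_assoc, <- pow_add.
      replace (i + (n - i))%nat with n by lia. rewrite Rabs_mult, (Rabs_pos_eq (p ^ n)); [ring|]. apply pow_le; lra. }
    exists (Series (fun n => sum_f_R0 (fun i => Rabs (a i (n - i)%nat * p ^ i * p ^ (n - i))) n) + 1).
    assert (Hg : forall n, sum_f_R0 (fun i => Rabs (a i (n - i)%nat * p ^ i * p ^ (n - i))) n <=
       Series (fun n => sum_f_R0 (fun i => Rabs (a i (n - i)%nat * p ^ i * p ^ (n - i))) n)).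
    { intros n. apply (series_ge_term (fun n => sum_f_R0 (fun i => Rabs (a i (n - i)%nat * p ^ i * p ^ (n - i))) n)); auto.
      intros k. apply cond_pos_sum. intros; apply Rabs_pos. }
    split.
    - assert (0 <= sum_f_R0 (fun i => Rabs (a i (0 - i)%nat * p ^ i * p ^ (0 - i))) 0) by (apply cond_pos_sum; intros; apply Rabs_pos).
      specialize (Hg 0%nat). lra.
    - intros n. rewrite Hle. specialize (Hg n). lra. }
  destruct HM as (M & HM0 & HM).
  set (q := p / 8). assert (Hq : 0 < q) by (unfold q; lra).
  assert (Hf : forall x y, in_box q x y -> is_series (diag a (mono x y)) (f x y)).
  { intros x y [B1 B2]. destruct (Hser x y) as [_ H]; [unfold q in *; lra|unfold q in *; lra|].
    rewrite !Rplus_0_l in H. eapply is_series_ext; [|exact H].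
    intros n. apply sum_eq. intros; unfold mono; ring. }
  set (g := fun x y => Series (diag a (mono_dy x y))).
  assert (Hb : forall x y, in_box q x y -> Rabs x <= q /\ Rabs y <= q) by (intros x y [B1 B2]; lra).
  assert (Hiq : 0 < / q) by (apply Rinv_0_lt_compat; auto).
  assert (Hdyb : forall x y, in_box q x y -> forall i j, Rabs (mono_dy x y i j) <= / q * (INR (i + j) ^ 2 * q ^ (i + j))).
  { intros x y B i j. destruct (Hb x y B). pose proof (mono_dy_le q Hq x y i j H H0) as P.
    apply Rmult_le_reg_l with q; auto. rewrite <- Rmult_assoc, Rinv_r, Rmult_1_l by lra.
    eapply Rle_trans; [exact P|]. apply Rmult_le_compat_r; [apply pow_le; lra|apply nat_le_sq]. }
  assert (Hg : forall x y, in_box q x y -> is_series (diag a (mono_dy x y)) (g x y)).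
  { intros x y B. apply Series_correct. apply (diag_ex a p M ltac:(lra) HM _ (/ q)); [lra|]. apply Hdyb; auto. }
  set (K := 2 * M * / q + 2 * M * / q * / q).
  assert (HK1 : 0 < 2 * M * / q) by (apply Rmult_lt_0_compat; lra).
  assert (HK2 : 0 < 2 * M * / q * / q) by (apply Rmult_lt_0_compat; lra).
  assert (Lf : lip_on q K f).
  { intros x y x' y' B B'. destruct (Hb _ _ B). destruct (Hb _ _ B').
    set (D := Rabs (x - x') + Rabs (y - y')). assert (HD : 0 <= D).
    { unfold D. pose proof (Rabs_pos (x - x')). pose proof (Rabs_pos (y - y')). lra. }
    apply Rle_trans with (2 * M * (/ q * D)).
    - apply (diag_series_bound a p M ltac:(lra) HM (fun i j => mono x y i j - mono x' y' i j)).
      + apply Rmult_le_pos; lra.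
      + intros i j. fold q. pose proof (mono_diff q Hq x y x' y' i j H H0 H1 H2) as P. fold D in P.
        apply Rmult_le_reg_l with q; auto. eapply Rle_trans; [exact P|].
        replace (q * (/ q * D * (INR (i + j) ^ 2 * q ^ (i + j)))) with (INR (i + j) ^ 2 * (q ^ (i + j) * D)) by (field; lra).
        rewrite Rmult_assoc. apply Rmult_le_compat_r; [apply Rmult_le_pos; auto; apply pow_le; lra|apply nat_le_sq].
      + eapply is_series_ext; [intros n; symmetry; apply diag_minus|].
        apply (is_series_minus (diag a (mono x y)) (diag a (mono x' y'))); apply Hf; auto.
    - replace (2 * M * (/ q * D)) with (2 * M * / q * D) by ring. apply Rmult_le_compat_r; auto. unfold K. lra. }
  assert (Lg : lip_on q K g).
  { intros x y x' y' B B'. destruct (Hb _ _ B). destruct (Hb _ _ B').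
    set (D := Rabs (x - x') + Rabs (y - y')). assert (HD : 0 <= D).
    { unfold D. pose proof (Rabs_pos (x - x')). pose proof (Rabs_pos (y - y')). lra. }
    apply Rle_trans with (2 * M * (/ q * / q * D)).
    - apply (diag_series_bound a p M ltac:(lra) HM (fun i j => mono_dy x y i j - mono_dy x' y' i j)).
      + repeat apply Rmult_le_pos; lra.
      + intros i j. fold q. pose proof (mono_dy_diff q Hq x y x' y' i j H H0 H1 H2) as P. fold D in P.
        apply Rmult_le_reg_l with (q ^ 2); [apply pow_lt; auto|]. eapply Rle_trans; [exact P|].
        right. field. lra.
      + eapply is_series_ext; [intros n; symmetry; apply diag_minus|].
        apply (is_series_minus (diag a (mono_dy x y)) (diag a (mono_dy x' y'))); apply Hg; auto.
    - replace (2 * M * (/ q * / q * D)) with (2 * M * / q * / q * D) by ring. apply Rmult_le_compat_r; auto. unfold K. lra. }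
  set (L := K + Rabs (f 0 0) + Rabs (g 0 0) + K * (2 * q) + 1).
  assert (HKp : 0 < K) by (unfold K; lra). assert (HKq : 0 < K * (2 * q)) by (apply Rmult_lt_0_compat; lra).
  pose proof (Rabs_pos (f 0 0)). pose proof (Rabs_pos (g 0 0)).
  exists g, q, L. split; auto. split.
  - constructor.
    + unfold L. lra.
    + eapply lip_on_sub; [| |exact Lf]; unfold L; lra.
    + eapply lip_on_sub; [| |exact Lg]; unfold L; lra.
    + intros x y B. assert (B0 : in_box q 0 0) by (split; rewrite Rabs_R0; auto).
      specialize (Lf x y 0 0 B B0). specialize (Lg x y 0 0 B B0). rewrite !Rminus_0_r in Lf, Lg.
      assert (K * (Rabs x + Rabs y) <= K * (2 * q)) by (apply Rmult_le_compat_l; destruct B; lra).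
      pose proof (Rabs_triang (f x y - f 0 0) (f 0 0)) as T1. pose proof (Rabs_triang (g x y - g 0 0) (g 0 0)) as T2.
      replace (f x y - f 0 0 + f 0 0) with (f x y) in T1 by ring. replace (g x y - g 0 0 + g 0 0) with (g x y) in T2 by ring.
      unfold L. lra.
    + intros x y y' B B'. destruct (Hb _ _ B). destruct (Hb _ _ B'). pose proof (pow2_ge_0 (y' - y)) as Hd2.
      apply Rle_trans with (2 * M * (/ q * / q * (y' - y) ^ 2)).
      * apply (diag_series_bound a p M ltac:(lra) HM (fun i j => mono x y' i j - mono x y i j - mono_dy x y i j * (y' - y))).
        -- apply Rmult_le_pos; [apply Rmult_le_pos; lra|auto].
        -- intros i j. fold q. pose proof (mono_taylor q Hq x y y' i j H1 H2 H4) as P.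
           apply Rmult_le_reg_l with (q ^ 2); [apply pow_lt; auto|]. eapply Rle_trans; [exact P|].
           right. field. lra.
        -- eapply is_series_ext; [intros n; symmetry; apply (diag_minus a (fun i j => mono x y' i j - mono x y i j) (fun i j => mono_dy x y i j * (y' - y)))|].
           apply (is_series_minus (diag a (fun i j => mono x y' i j - mono x y i j)) (diag a (fun i j => mono_dy x y i j * (y' - y)))).
           ++ eapply is_series_ext; [intros n; symmetry; apply diag_minus|].
              apply (is_series_minus (diag a (mono x y')) (diag a (mono x y))); apply Hf; auto.
           ++ eapply is_series_ext; [intros n; symmetry; apply diag_scal|].
              apply (is_series_scal_r (y' - y) (diag a (mono_dy x y))). apply Hg; auto.
      * replace (2 * M * (/ q * / q * (y' - y) ^ 2)) with (2 * M * / q * / q * (y' - y) ^ 2) by ring.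
        apply Rmult_le_compat_r; auto. unfold L, K in *. lra.
  - exists (fun n => a n 0%nat). intros x Hx.
    assert (B : in_box q x 0) by (split; auto; rewrite Rabs_R0; auto).
    apply is_pseries_R. eapply is_series_ext; [|apply (Hf x 0 B)].
    intros n. unfold diag, mono. destruct n; [simpl; ring|].
    rewrite tech5. rewrite (sum_eq_R0 _ n).
    + rewrite Nat.sub_diag. simpl. ring.
    + intros i Hi. replace (S n - i)%nat with (S (n - i)) by lia. simpl. ring.
Qed.

(** * Periodic orbits meet both half-return maps *)

Lemma chart_bounds W d r L c beta : chart W d r L c beta -> exists M, 0 < M /\
  forall s x y, side s -> in_box r x y -> Rabs (vX (fld W s) x y) <= M /\ Rabs (vY (fld W s) x y) <= M.
Proof.
  intros HC. destruct (ch_lip HC) as (Hr & HL & Hl).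
  assert (Hone : forall f, lip_on r L f -> exists M, 0 <= M /\ forall x y, in_box r x y -> Rabs (f x y) <= M).
  { intros f Hf. pose proof (Rabs_pos (f 0 0)). assert (0 <= L * (2 * r)) by (apply Rmult_le_pos; lra).
    exists (Rabs (f 0 0) + L * (2 * r)). split; [lra|].
    intros x y B. assert (B0 : in_box r 0 0) by (split; rewrite Rabs_R0; auto).
    specialize (Hf x y 0 0 B B0). rewrite !Rminus_0_r in Hf.
    assert (L * (Rabs x + Rabs y) <= L * (2 * r)) by (apply Rmult_le_compat_l; destruct B; lra).
    pose proof (Rabs_triang (f x y - f 0 0) (f 0 0)). replace (f x y - f 0 0 + f 0 0) with (f x y) in H2 by ring. lra. }
  destruct (Hl 1 side_p) as [A1 A2]. destruct (Hl (-1) side_m) as [A3 A4].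
  destruct (Hone _ A1) as (M1 & P1 & Q1). destruct (Hone _ A2) as (M2 & P2 & Q2).
  destruct (Hone _ A3) as (M3 & P3 & Q3). destruct (Hone _ A4) as (M4 & P4 & Q4).
  exists (M1 + M2 + M3 + M4 + 1). split; [lra|]. intros s x y [-> | ->] B.
  - specialize (Q1 x y B). specialize (Q2 x y B). lra.
  - specialize (Q3 x y B). specialize (Q4 x y B). lra.
Qed.
Arguments chart_bounds {W d r L c beta}.

Lemma slope_bound W d r L c beta : chart W d r L c beta -> exists L', forall s, side s ->
  lip_y (slope s (fld W s)) r L' /\ forall x y, in_box r x y -> Rabs (slope s (fld W s) x y) <= L'.
Proof.
  intros HC. destruct (chart_bounds HC) as (M & HM & HB).
  destruct (ch_lip HC) as (Hr & HL & Hl). pose proof (ch_c HC) as Hc.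
  set (k := / c). assert (Hk : 0 < k) by (apply Rinv_0_lt_compat; auto).
  exists (L * k + M * L * (k * k) + M * k). intros s Hs.
  assert (HX : forall x y, in_box r x y -> vX (fld W s) x y <> 0 /\ Rabs (/ vX (fld W s) x y) <= k).
  { intros x y B. pose proof (ch_dir HC s x y Hs B) as H. split; [intros E; rewrite E in H; lra|].
    assert (Hx : c <= Rabs (vX (fld W s) x y)).
    { rewrite <- (side_abs (s * d)) by (apply side_mult; [auto|apply HC]). eapply Rle_trans; [exact H|apply Rle_abs]. }
    rewrite Rabs_inv. apply Rinv_le_contravar; auto. }
  assert (0 <= L * k) by (apply Rmult_le_pos; lra). assert (0 <= M * k) by (apply Rmult_le_pos; lra).
  assert (0 <= M * L * (k * k)) by (repeat apply Rmult_le_pos; lra).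
  assert (Hbs : forall x y, in_box r x y -> in_box r x (s * y)).
  { intros x y [B1 B2]. split; auto. rewrite side_abs; auto. }
  split; [split; [lra|]|].
  - intros x y y' Hx Hy Hy'. assert (B := Hbs x y (conj Hx Hy)). assert (B' := Hbs x y' (conj Hx Hy')).
    unfold slope. set (X := vX (fld W s) x (s * y)). set (X' := vX (fld W s) x (s * y')).
    set (Y := vY (fld W s) x (s * y)). set (Y' := vY (fld W s) x (s * y')).
    destruct (HX _ _ B) as [N1 K1]. destruct (HX _ _ B') as [N2 K2]. fold X in N1, K1. fold X' in N2, K2.
    destruct (Hl s Hs) as [LX LY]. specialize (LX _ _ _ _ B B'). specialize (LY _ _ _ _ B B').
    fold X X' in LX. fold Y Y' in LY. replace (x - x) with 0 in LX, LY by ring.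
    rewrite Rabs_R0, Rplus_0_l, <- Rmult_minus_distr_l, side_abs in LX, LY by auto.
    destruct (HB s _ _ Hs B') as [_ BY]. fold Y' in BY.
    replace (s * Y / X - s * Y' / X') with (s * ((Y - Y') * / X + - (Y' * (X - X') * (/ X * / X')))) by (field; auto).
    rewrite side_abs by auto. eapply Rle_trans; [apply Rabs_triang|].
    rewrite Rabs_Ropp, (Rabs_mult (Y - Y')), (Rabs_mult (Y' * (X - X'))), (Rabs_mult Y'), (Rabs_mult (/ X)).
    assert (Rabs (Y - Y') * Rabs (/ X) <= L * Rabs (y - y') * k) by (apply Rmult_le_compat; auto; apply Rabs_pos).
    assert (Rabs Y' * Rabs (X - X') * (Rabs (/ X) * Rabs (/ X')) <= M * (L * Rabs (y - y')) * (k * k)).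
    { apply Rmult_le_compat; try (apply Rmult_le_pos; apply Rabs_pos); apply Rmult_le_compat; auto; apply Rabs_pos. }
    pose proof (Rabs_pos (y - y')). assert (0 <= M * k * Rabs (y - y')) by (apply Rmult_le_pos; auto). lra.
  - intros x y B. specialize (Hbs x y B). unfold slope, Rdiv. rewrite Rabs_mult, side_abs by auto.
    destruct (HX _ _ Hbs) as [_ K]. destruct (HB s _ _ Hs Hbs) as [_ BY].
    assert (Rabs (vY (fld W s) x (s * y)) * Rabs (/ vX (fld W s) x (s * y)) <= M * k)
      by (apply Rmult_le_compat; auto; apply Rabs_pos). lra.
Qed.
Arguments slope_bound {W d r L c beta}.

Lemma graph_of_arc W d r L c beta s x x' T U V : chart W d r L c beta -> side s ->
  return_arc s (fld W s) x x' T U V -> arc_in_box r T U V ->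
  exists eta, graph_arc (slope s (fld W s)) r (Rmin x x') (Rmax x x') eta /\
    (forall t, between T t -> Rmin x x' <= U t <= Rmax x x' /\ s * V t = eta (U t)) /\
    (forall z, Rmin x x' <= z <= Rmax x x' -> exists t, between T t /\ U t = z) /\
    0 < s * d * T * (x' - x).
Proof.
  intros HC Hs HA HB. destruct (chart_bounds HC) as (M & HM & HBd).
  apply (arc_graph s (s * d) (fld W s) r c M x x' T U V); auto.
  - apply side_mult; auto; apply HC.
  - apply HC.
  - lra.
  - intros a b B. split; [apply (ch_dir HC); auto|apply HBd; auto].
Qed.
Arguments graph_of_arc {W d r L c beta s x x' T U V}.

Lemma side_two s s' : side s -> side s' -> s' = s \/ s' = - s.
Proof. intros [-> | ->] [-> | ->]; [left|right|right|left]; lra. Qed.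

(** A chart with half-return maps on both sides, defined at distance less than rho from the fold of
    the side; their arcs stay in the box of the chart. All statements on orbits are made for
    such systems, which include the reversed ones. *)
Record system (W : filippov) (d r L c : R) (beta : R -> R) (rho : R) (phi : R -> R -> R) : Prop := {
  sy_chart : chart W d r L c beta;
  sy_rho : 0 < rho;
  sy_arc : forall s x, side s -> 0 < Rabs (x - beta s) < rho ->
    (x - beta s) * (phi s x - beta s) < 0 /\
    exists T U V, return_arc s (fld W s) x (phi s x) T U V /\ arc_in_box r T U V;
  sy_cont : forall s x, side s -> beta s - rho < x < beta s -> continuity_pt (phi s) x }.
Arguments sy_chart {W d r L c beta rho phi}.
Arguments sy_rho {W d r L c beta rho phi}.
Arguments sy_arc {W d r L c beta rho phi}.
Arguments sy_cont {W d r L c beta rho phi}.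

Lemma system_rev W d r L c beta rho phi : system W d r L c beta rho phi ->
  system (time_reversal W) (- d) r L c beta rho phi.
Proof.
  intros [H1 H2 H3 H4]. constructor; auto.
  - apply chart_rev; auto.
  - intros s x Hs Hx. destruct (H3 s x Hs Hx) as [K (T & U & V & HA & HB)]. split; auto.
    exists (- T), (fun t => U (- t)), (fun t => V (- t)). rewrite fld_rev. split.
    + apply return_arc_rev; auto.
    + apply arc_in_box_rev; auto.
Qed.

Lemma is_derive_const_ext (v : R -> R) k : (forall t, v t = k) -> forall t, is_derive v t 0.
Proof.
  intros H t. apply (is_derive_ext (fun _ => k)); [intros; auto|]. apply @is_derive_const.
Qed.

Lemma derive_extremum (f : R -> R) t l e : side e -> is_derive f t l -> (forall y, e * f y <= e * f t) -> l = 0.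
Proof.
  intros He Hd Hm. assert (D := is_derive_Rscal e f t l Hd). apply is_derive_Reals in D.
  assert (E : e * l = 0).
  { apply (deriv_maximum (fun y => e * f y) (t - 1) (t + 1) t (exist _ (e * l) D)); [lra|lra|auto]. }
  destruct He as [-> | ->]; lra.
Qed.

Lemma periodic_INR (f : R -> R) T : (forall t, f (t + T) = f t) -> forall n t, f (t + INR n * T) = f t.
Proof.
  intros H n. induction n; intros t.
  - simpl. f_equal; ring.
  - rewrite S_INR. replace (t + (INR n + 1) * T) with ((t + INR n * T) + T) by ring. rewrite H. auto.
Qed.

Lemma periodic_IZR (f : R -> R) T : (forall t, f (t + T) = f t) -> forall k t, f (t + IZR k * T) = f t.
Proof.
  intros H k t. destruct (Z_le_gt_dec 0 k).
  - rewrite <- (Z2Nat.id k) by lia. rewrite <- INR_IZR_INZ. apply periodic_INR; auto.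
  - replace k with (- Z.of_nat (Z.to_nat (- k)))%Z by lia. rewrite opp_IZR, <- INR_IZR_INZ.
    set (n := Z.to_nat (- k)). rewrite <- (periodic_INR f T H n (t + - INR n * T)). f_equal; ring.
Qed.

Definition frac (P t : R) : R := t - IZR (Int_part (t / P)) * P.

Lemma frac_bounds P t : 0 < P -> 0 <= frac P t < P.
Proof.
  intros HP. unfold frac. destruct (base_Int_part (t / P)) as [H1 H2].
  set (k := IZR (Int_part (t / P))) in *. assert (E : t = t / P * P) by (field; lra). split; nra.
Qed.

Lemma reduce_period T t : 0 < T -> exists k : Z, 0 <= t + IZR k * T < T.
Proof.
  intros HT. exists (- Int_part (t / T))%Z. pose proof (frac_bounds T t HT) as H. unfold frac in H.
  rewrite opp_IZR. lra.
Qed.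

Section PeriodicOrbits.
Variables (W : filippov) (d r L c : R) (beta : R -> R).
Hypothesis HC : chart W d r L c beta.
Variables (u v : R -> R) (T : R).
Hypothesis HT : 0 < T.
Hypothesis Htraj : forall a b : R, a < b -> trajectory_on W u v a b.
Hypothesis Hper : forall t, u (t + T) = u t /\ v (t + T) = v t.
Hypothesis Hbox : forall t, in_box r (u t) (v t).
Hypothesis Hnc : exists t, (u t, v t) <> (u 0, v 0).
Hypothesis Hbeta : beta 1 <> beta (-1).

Lemma orbit_motion a b : a < b -> motion W r u v a b.
Proof. intros Hab. apply traj_motion with L; [apply HC|auto]. Qed.

Lemma orbit_cross q t : v t = 0 -> same_sign_at W q (u t) ->
  exists e, 0 < e /\ forall t', Rabs (t' - t) < e -> t' <> t -> 0 < q * v t' * (t' - t).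
Proof.
  intros Hv Hq. destruct (mo_cross (orbit_motion (t - 1) (t + 1) ltac:(lra)) q t) as [e [He H]]; auto; try lra.
  { apply Hbox. }
  exists (Rmin e 1). split; [apply Rmin_pos; lra|]. intros t' Ht' Hn.
  Rmin_bounds e 1. apply H; auto; [|lra].
  assert (Rabs (t' - t) < 1) by lra. apply Rabs_def2 in H2. lra.
Qed.

(** Crossing the line takes the orbit to both sides. *)
Lemma both_signs q t : v t = 0 -> same_sign_at W q (u t) -> forall s, side s -> exists t', 0 < s * v t'.
Proof.
  intros Hv Hq s Hs. destruct (orbit_cross q t Hv Hq) as [e [He H]]. destruct Hq as [Hq _].
  exists (t + s * q * (e / 2)). specialize (H (t + s * q * (e / 2))).
  replace (t + s * q * (e / 2) - t) with (s * q * (e / 2)) in H by ring.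
  assert (Hsq : side (s * q)) by (apply side_mult; auto).
  rewrite side_abs, Rabs_pos_eq in H by (auto; lra). specialize (H ltac:(lra)).
  assert (Hne : t + s * q * (e / 2) <> t) by (destruct Hsq as [E|E]; rewrite E; lra).
  specialize (H Hne).
  replace (q * v (t + s * q * (e / 2)) * (s * q * (e / 2))) with
    ((q * q) * (e / 2) * (s * v (t + s * q * (e / 2)))) in H by ring.
  rewrite (side_sq q Hq) in H. nra.
Qed.

Lemma global_extremum e : side e -> exists t, forall t', e * u t' <= e * u t.
Proof.
  intros He.
  destruct (seg_max (fun t => e * u t) 0 T) as [t [Ht H]]; [lra| |].
  - apply cont_seg_scal; [lra|]. apply (mo_u (orbit_motion 0 T HT)).
  - exists t. intros t'. destruct (reduce_period T t' HT) as [k Hk].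
    rewrite <- (periodic_IZR u T (fun t => proj1 (Hper t)) k t'). apply H. lra.
Qed.

(** Off the line the horizontal speed is not zero. *)
Lemma extremum_on_line e t : side e -> (forall t', e * u t' <= e * u t) -> v t = 0.
Proof.
  intros He Hm. destruct (Req_dec (v t) 0) as [|Hn]; auto. exfalso.
  assert (exists s, side s /\ 0 < s * v t) as (s & Hs & Hp).
  { destruct (Rlt_le_dec 0 (v t)); [exists 1; split; [left; auto|lra]|exists (-1); split; [right; auto|lra]]. }
  destruct (mo_side (orbit_motion (t - 1) (t + 1) ltac:(lra)) s t Hs ltac:(lra) (Hbox t) Hp) as [Du _].
  pose proof (derive_extremum u t _ e He Du Hm) as E.
  pose proof (ch_dir HC s _ _ Hs (Hbox t)) as Hd. rewrite E in Hd. pose proof (ch_c HC). lra.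
Qed.

(** By exit_forward and exit_backward, an orbit that visits a side meets the line beyond the fold of
    that side, in the future and in the past, at opposite ends. *)
Lemma visit_extends s tl tr : side s -> (exists t, 0 < s * v t) ->
  (forall t, u tl <= u t <= u tr) -> u tl < beta s < u tr.
Proof.
  intros Hs [t Ht] Hm.
  pose proof (ch_c HC) as Hc. destruct (ch_lip HC) as [Hr _].
  assert (Hk : 0 < 2 * r / c) by (apply Rdiv_lt_0_compat; lra).
  set (K := 2 * r / c + 1).
  assert (HM : motion W r u v (t - K) (t + K)) by (apply orbit_motion; unfold K; lra).
  destruct (exit_forward W d r L c beta s u v (t - K) (t + K) t) as (t1 & _ & _ & H1); auto; try (unfold K; lra).
  destruct (exit_backward W d r L c beta s u v (t - K) (t + K) t) as (t2 & _ & _ & H2); auto; try (unfold K; lra).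
  pose proof (Hm t1) as M1. pose proof (Hm t2) as M2.
  assert (Hsd : side (s * d)) by (apply side_mult; auto; apply HC).
  destruct Hsd as [E|E]; rewrite E in H1, H2; lra.
Qed.

Let lo := Rmin (beta 1) (beta (-1)).
Let hi := Rmax (beta 1) (beta (-1)).

Lemma beta_between s : side s -> lo <= beta s <= hi.
Proof.
  intros [-> | ->]; unfold lo, hi; split;
  first [apply Rmin_l | apply Rmin_r | apply Rmax_l | apply Rmax_r].
Qed.

Lemma lo_hi : lo < hi.
Proof. unfold lo, hi, Rmin, Rmax. destruct (Rle_dec _ _); lra. Qed.

Lemma outside_same_sign x : Rabs x < r -> x < lo \/ hi < x -> exists q, same_sign_at W q x.
Proof.
  intros Hx [H|H].
  - exists d. apply (same_sign_left W d r L c beta); auto. intros s Hs. pose proof (beta_between s Hs). lra.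
  - exists (- d). apply (same_sign_right W d r L c beta); auto. intros s Hs. pose proof (beta_between s Hs). lra.
Qed.

(** Between the folds the vertical components have opposite signs, and at a fold only one of them
    vanishes. *)
Lemma sliding_gap x : lo <= x <= hi ->
  vY (Zp W) x 0 - vY (Zm W) x 0 <> 0.
Proof.
  intros Hx. rewrite <- fld_p, <- fld_m.
  destruct (ch_fold0 HC 1 side_p) as [B1 Z1].
  destruct (ch_fold0 HC (-1) side_m) as [B2 Z2].
  assert (Hb : Rabs x < r).
  { apply Rabs_def2 in B1. apply Rabs_def2 in B2. apply Rabs_def1; unfold lo, hi, Rmin, Rmax in Hx; destruct (Rle_dec _ _); lra. }
  pose proof (ch_fold HC 1 x side_p Hb) as F1.
  pose proof (ch_fold HC (-1) x side_m Hb) as F2.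
  pose proof (ch_side HC) as Hd.
  unfold lo, hi, Rmin, Rmax in Hx.
  destruct (Req_dec x (beta 1)) as [E1|E1].
  - rewrite E1, Z1 in *. specialize (F2 Hbeta). intros E. assert (E' : vY (fld W (-1)) (beta 1) 0 = 0) by lra.
    rewrite E' in F2. lra.
  - specialize (F1 E1). destruct (Req_dec x (beta (-1))) as [E2|E2].
    + rewrite E2, Z2 in *. intros E. assert (E' : vY (fld W 1) (beta (-1)) 0 = 0) by lra. rewrite E' in F1. lra.
    + specialize (F2 E2). intros E. assert (E' : vY (fld W 1) x 0 = vY (fld W (-1)) x 0) by lra.
      rewrite E' in F1. set (y := d * vY (fld W (-1)) x 0) in *.
      destruct (Rle_dec (beta 1) (beta (-1))); nra.
Qed.

(** The horizontal component of the only convex combination of the two fields that is tangent to the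
    line. *)
Definition sliding_speed (x : R) : R :=
  (vX (Zm W) x 0 * vY (Zp W) x 0 - vX (Zp W) x 0 * vY (Zm W) x 0) / (vY (Zp W) x 0 - vY (Zm W) x 0).

Lemma field_cont_seg f : lip_on r L f -> cont_seg (fun x => f x 0) lo hi.
Proof.
  intros Hf. pose proof lo_hi. destruct (ch_lip HC) as (Hr & HL & _).
  assert (Hb : forall x, lo <= x <= hi -> in_box r x 0).
  { destruct (ch_fold0 HC 1 side_p) as [B1 _]. destruct (ch_fold0 HC (-1) side_m) as [B2 _].
    intros x Hx. apply Rabs_def2 in B1. apply Rabs_def2 in B2.
    split; [apply Rabs_def1; unfold lo, hi, Rmin, Rmax in Hx; destruct (Rle_dec _ _); lra|rewrite Rabs_R0; auto]. }
  apply lip_cont_seg with L; [auto|lra|]. intros x y Hx Hy. eapply Rle_trans; [apply Hf; apply Hb; auto|].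
  rewrite Rminus_diag, Rabs_R0, Rplus_0_r. lra.
Qed.

Lemma sliding_speed_cont : cont_seg sliding_speed lo hi.
Proof.
  pose proof lo_hi as Hlh.
  destruct (ch_lip HC) as (Hr & HL & Hl).
  destruct (Hl 1 side_p) as [A1 A2]. destruct (Hl (-1) side_m) as [A3 A4].
  rewrite fld_p in A1, A2. rewrite fld_m in A3, A4.
  apply field_cont_seg in A1. apply field_cont_seg in A2. apply field_cont_seg in A3. apply field_cont_seg in A4.
  apply cont_seg_of_clamp; [lra|]. intros x.
  apply (continuity_pt_div
    (fun t => vX (Zm W) (clamp lo hi t) 0 * vY (Zp W) (clamp lo hi t) 0 - vX (Zp W) (clamp lo hi t) 0 * vY (Zm W) (clamp lo hi t) 0)
    (fun t => vY (Zp W) (clamp lo hi t) 0 - vY (Zm W) (clamp lo hi t) 0)).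
  - apply (seg_clamp (fun t => vX (Zm W) t 0 * vY (Zp W) t 0 - vX (Zp W) t 0 * vY (Zm W) t 0)); [lra|].
    apply cont_seg_minus; [lra| |].
    + apply (cont_seg_mult (fun t => vX (Zm W) t 0) (fun t => vY (Zp W) t 0)); auto; lra.
    + apply (cont_seg_mult (fun t => vX (Zp W) t 0) (fun t => vY (Zm W) t 0)); auto; lra.
  - apply (seg_clamp (fun t => vY (Zp W) t 0 - vY (Zm W) t 0)); [lra|]. apply cont_seg_minus; auto; lra.
  - apply sliding_gap. apply clamp_in; lra.
Qed.

(** A periodic orbit does not lie in the line. It would lie between the folds, since elsewhere it
    crosses the line, and follow the sliding speed almost everywhere. The latter has a primitive
    Gm, and Gm (u) has the derivative sliding_speed (u)^2 >= 0; by periodicity it is constant,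
    so u has derivative 0 and is constant as well. *)
Lemma leaves_line : exists t, v t <> 0.
Proof.
  destruct (excluded_middle_informative (exists t, v t <> 0)) as [|Hno]; auto. exfalso.
  assert (Hv : forall t, v t = 0).
  { intros t. destruct (Req_dec (v t) 0); auto. exfalso; apply Hno; eauto. }
  pose proof lo_hi as Hlh.
  assert (Hin : forall t, lo <= u t <= hi).
  { intros t. destruct (Rlt_le_dec (u t) lo) as [H1|H1]; [|destruct (Rlt_le_dec hi (u t)) as [H2|H2]; [|lra]].
    - exfalso. destruct (outside_same_sign (u t) (proj1 (Hbox t)) (or_introl H1)) as [q Hq].
      destruct (both_signs q t (Hv t) Hq 1 side_p) as [t' Ht']. rewrite Hv in Ht'. lra.
    - exfalso. destruct (outside_same_sign (u t) (proj1 (Hbox t)) (or_intror H2)) as [q Hq].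
      destruct (both_signs q t (Hv t) Hq 1 side_p) as [t' Ht']. rewrite Hv in Ht'. lra. }
  destruct (antiderivative_exists (fun x => sliding_speed (clamp lo hi x))) as [Gm HGm].
  { apply seg_clamp; [lra|apply sliding_speed_cont]. }
  assert (HK : exists K, 0 <= K /\ forall x, Rabs (sliding_speed (clamp lo hi x)) <= K).
  { destruct (seg_max sliding_speed lo hi ltac:(lra) sliding_speed_cont) as [x1 [_ H1]].
    destruct (seg_min sliding_speed lo hi ltac:(lra) sliding_speed_cont) as [x2 [_ H2]].
    exists (Rabs (sliding_speed x1) + Rabs (sliding_speed x2)).
    pose proof (Rabs_pos (sliding_speed x1)). pose proof (Rabs_pos (sliding_speed x2)). split; [lra|].
    intros x. pose proof (clamp_in lo hi x ltac:(lra)) as Hc. specialize (H1 _ Hc). specialize (H2 _ Hc).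
    pose proof (Rle_abs (sliding_speed x1)). pose proof (Rle_abs (- sliding_speed x2)) as Hn. rewrite Rabs_Ropp in Hn.
    apply Rabs_le. lra. }
  destruct HK as (K & HK0 & HK).
  assert (HGl : forall x y, Rabs (Gm x - Gm y) <= K * Rabs (x - y)).
  { intros x y. apply derive_lip. intros z _. eexists; split; [apply HGm|apply HK]. }
  pose proof (Htraj 0 T HT) as HTr. destruct (traj_alt _ _ _ _ _ HTr) as (N & HN & Halt).
  destruct HTr as (Hac & _ & _).
  assert (Halt' : forall t, 0 < t < T -> N t \/ is_derive u t (sliding_speed (u t))).
  { intros t Ht. destruct (Halt t Ht) as [|(p & q & Hp & Hq & _ & _ & H0)]; [left; auto|right].
    destruct (H0 (Hv t)) as (l & Hl & Ep & Eq). rewrite Hv in *.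
    assert (Eq0 : q = 0).
    { rewrite <- (is_derive_unique _ _ _ Hq). apply is_derive_unique. apply (is_derive_const_ext v 0 Hv). }
    replace (sliding_speed (u t)) with p; auto.
    pose proof (sliding_gap (u t) (Hin t)) as Hg. unfold sliding_speed.
    apply Rmult_eq_reg_r with (vY (Zp W) (u t) 0 - vY (Zm W) (u t) 0); auto.
    unfold Rdiv. rewrite Rmult_assoc, Rinv_l, Rmult_1_r by auto. rewrite Ep.
    assert (E : l * vY (Zp W) (u t) 0 = - ((1 - l) * vY (Zm W) (u t) 0)) by lra.
    set (Xp := vX (Zp W) (u t) 0) in *. set (Xm := vX (Zm W) (u t) 0) in *.
    set (Yp := vY (Zp W) (u t) 0) in *. set (Ym := vY (Zm W) (u t) 0) in *.
    replace ((l * Xp + (1 - l) * Xm) * (Yp - Ym)) with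
      (Xp * (l * Yp) - l * Xp * Ym + Xm * Yp - Xm * (l * Yp) - (1 - l) * Xm * Ym) by ring.
    rewrite E. ring. }
  assert (DG : forall t, is_derive u t (sliding_speed (u t)) ->
     is_derive (fun t => Gm (u t)) t (sliding_speed (u t) * sliding_speed (u t))).
  { intros t Hd. apply is_derive_Rcomp; auto. pose proof (HGm (u t)) as H. cbv beta in H. rewrite clamp_id in H by auto. exact H. }
  assert (HacG : abs_continuous_on (fun t => Gm (u t)) 0 T).
  { apply ac_lip_comp with u K; auto. }
  assert (Hmono : forall t1 t2, 0 <= t1 -> t1 <= t2 -> t2 <= T -> Gm (u t1) <= Gm (u t2)).
  { intros t1 t2 H1 H12 H2. cut (0 * (t2 - t1) <= Gm (u t2) - Gm (u t1)); [lra|].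
    apply (ac_ge (fun t => Gm (u t)) 0 t1 t2 N); auto; [eapply ac_sub; [| |exact HacG]; lra|].
    intros t Ht. destruct (Halt' t ltac:(lra)) as [|Hd]; [left; auto|right].
    eexists; split; [apply DG; exact Hd|apply Rle_0_sqr]. }
  assert (Hconst : forall t, 0 <= t <= T -> Gm (u t) = Gm (u 0)).
  { intros t Ht. pose proof (Hmono 0 t ltac:(lra) ltac:(lra) ltac:(lra)). pose proof (Hmono t T ltac:(lra) ltac:(lra) ltac:(lra)).
    pose proof (proj1 (Hper 0)) as E. rewrite Rplus_0_l in E. rewrite E in H0. lra. }
  assert (Hu0 : forall t, 0 < t < T -> N t \/ is_derive u t 0).
  { intros t Ht. destruct (Halt' t Ht) as [|Hd]; [left; auto|right].
    assert (E : sliding_speed (u t) * sliding_speed (u t) = 0).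
    { rewrite <- (is_derive_unique _ _ _ (DG t Hd)). apply is_derive_unique.
      apply (is_derive_ext_loc (fun _ => Gm (u 0))); [|apply @is_derive_const].
      assert (He : 0 < Rmin t (T - t)) by (apply Rmin_pos; lra). exists (mkposreal _ He). intros y Hy.
      assert (Hy' : Rabs (y - t) < Rmin t (T - t)) by exact Hy. Rmin_bounds t (T - t).
      apply Rabs_def2 in Hy'. symmetry; apply Hconst; lra. }
    apply Rmult_integral in E. replace 0 with (sliding_speed (u t)) by tauto. auto. }
  assert (Huc : forall t, 0 <= t <= T -> u t = u 0).
  { intros t Ht. assert (Hac' := ac_sub u 0 T 0 t ltac:(lra) ltac:(lra) Hac).
    assert (0 * (t - 0) <= u t - u 0).
    { apply (ac_ge u 0 0 t N); auto; [lra|]. intros z Hz. destruct (Hu0 z ltac:(lra)); [left; auto|right; exists 0; split; auto; lra]. }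
    assert (u t - u 0 <= 0 * (t - 0)).
    { apply (ac_le u 0 0 t N); auto; [lra|]. intros z Hz. destruct (Hu0 z ltac:(lra)); [left; auto|right; exists 0; split; auto; lra]. }
    lra. }
  destruct Hnc as [t Ht]. apply Ht. rewrite !Hv. f_equal.
  destruct (reduce_period T t HT) as [k Hk]. rewrite <- (periodic_IZR u T (fun t => proj1 (Hper t)) k t).
  apply Huc; lra.
Qed.

(** The leftmost and the rightmost points lie on the line. The orbit visits one side, hence passes
    the fold of this side in both directions; beyond the fold that is extremal on one end it
    crosses the line, and so visits the other side. *)
Lemma periodic_extremes : exists tl tr, v tl = 0 /\ v tr = 0 /\ (forall t, u tl <= u t <= u tr) /\
  forall s, side s -> u tl < beta s < u tr.
Proof.
  destruct (global_extremum (-1) side_m) as [tl Hl].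
  destruct (global_extremum 1 side_p) as [tr Hr].
  pose proof (extremum_on_line (-1) tl side_m Hl) as Vl.
  pose proof (extremum_on_line 1 tr side_p Hr) as Vr.
  assert (Hm : forall t, u tl <= u t <= u tr).
  { intros t. specialize (Hl t). specialize (Hr t). lra. }
  exists tl, tr. split; auto. split; auto. split; auto.
  assert (exists s, side s /\ exists t, 0 < s * v t) as (s & Hs & Hvis).
  { destruct leaves_line as [t Ht]. destruct (Rlt_le_dec 0 (v t)).
    - exists 1. split; [left; auto|exists t; lra].
    - exists (-1). split; [right; auto|exists t; lra]. }
  pose proof (visit_extends s tl tr Hs Hvis Hm) as Es.
  assert (Hcrossing : exists q t, v t = 0 /\ same_sign_at W q (u t)).
  { destruct (Rlt_le_dec (beta s) (beta (- s))) as [Hb|Hb].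
    - exists d, tl. split; auto. apply (same_sign_left W d r L c beta); auto; [apply Hbox|].
      intros s' Hs'; destruct (side_two s s' Hs Hs') as [-> | ->]; lra.
    - exists (- d), tr. split; auto. apply (same_sign_right W d r L c beta); auto; [apply Hbox|].
      intros s' Hs'; destruct (side_two s s' Hs Hs') as [-> | ->]; lra. }
  destruct Hcrossing as (q & t & Hvt & Hq). intros s' Hs'.
  apply visit_extends; auto. apply (both_signs q t); auto.
Qed.
End PeriodicOrbits.

(** Through the leftmost point the orbit follows an arc on each side, to a point not further right
    than the rightmost point xr. The arcs ending at xr likewise do not start further left than
    the leftmost point. As arcs are nested, each of them joins the two. *)
Lemma periodic_returns W d r L c beta rho phi u v T :
  system W d r L c beta rho phi -> beta 1 <> beta (-1) -> 0 < T ->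
  (forall a b : R, a < b -> trajectory_on W u v a b) ->
  (forall t, u (t + T) = u t /\ v (t + T) = v t) ->
  (forall t, in_box r (u t) (v t) /\ forall s, side s -> Rabs (u t - beta s) < rho) ->
  (exists t, (u t, v t) <> (u 0, v 0)) ->
  exists tl xr, v tl = 0 /\ (forall s, side s -> u tl < beta s < xr) /\ forall s, side s -> phi s (u tl) = xr.
Proof.
  intros HS Hb HT Htr Hper Hbox Hnc. pose proof (sy_chart HS) as HC.
  destruct (periodic_extremes W d r L c beta HC u v T HT Htr Hper (fun t => proj1 (Hbox t)) Hnc Hb)
    as (tl & tr & Vl & Vr & Hm & He).
  exists tl, (u tr). split; auto. split; auto. intros s Hs.
  destruct (He s Hs) as [E1 E2].
  assert (Hmot : forall a b, a < b -> motion W r u v a b) by (intros; apply traj_motion with L; [apply HC|auto]).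
  assert (Hend : forall t q, v t = 0 -> u t <> beta s -> same_sign_at W q (u t) -> exists t', u t' = phi s (u t)).
  { intros t q Vt Hne Hq. destruct (sy_arc HS s (u t) Hs) as [_ (T' & U & V & HA & HB)].
    { split; [apply Rabs_pos_lt; lra|apply Hbox; auto]. }
    pose proof (between_ends T') as [_ Hbt].
    set (K := Rabs T' + 1). pose proof (Rabs_pos T'). pose proof (Rle_abs T'). pose proof (Rle_abs (- T')) as Hn. rewrite Rabs_Ropp in Hn.
    destruct (follow_return W r L s (u t) (phi s (u t)) T' U V u v (t - K) (t + K) t q (ch_lip HC)
      Hs HA HB Hq (Hmot (t - K) (t + K) ltac:(unfold K; lra)) ltac:(unfold K; lra) eq_refl Vt T' Hbt ltac:(unfold K; lra)) as [E _].
    exists (t + T'). rewrite E. apply HA. }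
  assert (SL : same_sign_at W d (u tl)).
  { apply (same_sign_left W d r L c beta); auto; [apply Hbox|]. intros s' Hs'. apply He; auto. }
  assert (SR : same_sign_at W (- d) (u tr)).
  { apply (same_sign_right W d r L c beta); auto; [apply Hbox|]. intros s' Hs'. apply He; auto. }
  destruct (Hend tl d Vl ltac:(lra) SL) as [t1 Ht1]. destruct (Hend tr (- d) Vr ltac:(lra) SR) as [t2 Ht2].
  pose proof (Hm t1) as M1. pose proof (Hm t2) as M2. rewrite Ht1 in M1. rewrite Ht2 in M2.
  destruct (sy_arc HS s (u tl) Hs) as [S1 (T1 & U1 & V1 & A1 & B1)].
  { split; [apply Rabs_pos_lt; lra|apply Hbox; auto]. }
  destruct (sy_arc HS s (u tr) Hs) as [S2 (T2 & U2 & V2 & A2 & B2)].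
  { split; [apply Rabs_pos_lt; lra|apply Hbox; auto]. }
  destruct (graph_of_arc HC Hs A1 B1) as (e1 & G1 & _).
  destruct (graph_of_arc HC Hs A2 B2) as (e2 & G2 & _).
  assert (P1 : beta s < phi s (u tl)) by nra. assert (P2 : phi s (u tr) < beta s) by nra.
  rewrite Rmin_left, Rmax_right in G1 by lra. rewrite Rmin_right, Rmax_left in G2 by lra.
  destruct (slope_bound HC) as [L' HL']. destruct (HL' s Hs) as [Hlip _].
  destruct (Rle_lt_or_eq_dec _ _ (proj1 M2)) as [Hlt|Heq].
  - destruct (nest _ _ _ Hlip _ _ _ _ _ _ G1 G2 ltac:(lra)). lra.
  - rewrite <- Heq in G2. destruct (arc_unique _ _ _ Hlip _ _ _ _ _ G1 G2). auto.
Qed.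

(** * Loops formed by two arcs *)

(** Some parametrization is quantified over, so that being on an arc does not depend on the
    direction in which it is traversed; on_arc_spec shows that all parametrizations agree. *)
Definition on_arc (W : filippov) (r s x x' : R) (p : R * R) : Prop :=
  exists T U V tau, return_arc s (fld W s) x x' T U V /\ arc_in_box r T U V /\
    between T tau /\ p = (U tau, V tau).

Lemma on_arc_swap W r s x x' p : on_arc W r s x x' p -> on_arc W r s x' x p.
Proof.
  intros (T & U & V & tau & HA & HB & Ht & ->).
  exists (- T), (fun t => U (t + T)), (fun t => V (t + T)), (tau - T).
  split; [apply return_arc_swap; auto|]. split; [apply arc_in_box_swap; auto|].
  split; [apply between_swap; replace (T + (tau - T)) with tau by ring; auto|].
  f_equal; f_equal; ring.
Qed.

Lemma on_graph_of_arc W d r L c beta s x x' p eta hi : chart W d r L c beta -> side s ->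
  graph_arc (slope s (fld W s)) r (Rmin x x') hi eta -> on_arc W r s x x' p ->
  hi = Rmax x x' /\ Rmin x x' <= fst p <= Rmax x x' /\ s * snd p = eta (fst p).
Proof.
  intros HC Hs HG (T & U & V & tau & HA & HB & Ht & ->). simpl.
  destruct (graph_of_arc HC Hs HA HB) as (e & G & H1 & H2 & H3).
  destruct (slope_bound HC) as [L' HL']. destruct (HL' s Hs) as [Hlip _].
  destruct (arc_unique _ _ _ Hlip _ _ _ _ _ HG G) as [E1 E2]. split; auto.
  destruct (H1 tau Ht) as [K1 K2]. split; auto. rewrite E2. auto.
Qed.
Arguments on_graph_of_arc {W d r L c beta s x x' p eta hi}.

Lemma arc_of_graph W d r L c beta s x x' z y T U V eta hi : chart W d r L c beta -> side s ->
  return_arc s (fld W s) x x' T U V -> arc_in_box r T U V ->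
  graph_arc (slope s (fld W s)) r (Rmin x x') hi eta ->
  Rmin x x' <= z <= Rmax x x' -> s * y = eta z -> exists t, between T t /\ (z, y) = (U t, V t).
Proof.
  intros HC Hs HA HB HG Hz Hy.
  destruct (graph_of_arc HC Hs HA HB) as (e & G & H1 & H2 & H3).
  destruct (slope_bound HC) as [L' HL']. destruct (HL' s Hs) as [Hlip _].
  destruct (arc_unique _ _ _ Hlip _ _ _ _ _ HG G) as [_ E2].
  destruct (H2 z Hz) as (t & Ht & Ez). exists t. split; auto. destruct (H1 t Ht) as [_ K].
  rewrite Ez, <- E2, <- Hy in K. f_equal; auto. destruct Hs as [-> | ->]; lra.
Qed.

(** The arc is determined by its graph, and the graph by its left end. *)
Lemma on_arc_spec W d r L c beta s x x' T U V p : chart W d r L c beta -> side s ->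
  return_arc s (fld W s) x x' T U V -> arc_in_box r T U V -> on_arc W r s x x' p ->
  exists t, between T t /\ p = (U t, V t).
Proof.
  intros HC Hs HA HB Hp.
  destruct (graph_of_arc HC Hs HA HB) as (e & G & _).
  destruct (on_graph_of_arc HC Hs G Hp) as (_ & H1 & H2).
  destruct p as [z y]. apply (arc_of_graph W d r L c beta s x x' z y T U V e (Rmax x x')); auto.
Qed.
Arguments on_arc_spec {W d r L c beta s x x' T U V p}.

Lemma arc_time_sign W d r L c beta s x x' T U V : chart W d r L c beta -> side s ->
  return_arc s (fld W s) x x' T U V -> arc_in_box r T U V -> 0 < s * d * (x' - x) -> 0 < T.
Proof.
  intros HC Hs HA HB Hd. destruct (graph_of_arc HC Hs HA HB) as (_ & _ & _ & _ & H).
  replace (s * d * T * (x' - x)) with (T * (s * d * (x' - x))) in H by ring. nra.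
Qed.

(** A motion on an arc traversed forward stays on it until the end of the arc, which it reaches in
    time if the motion lasts long enough. The time T depends only on the starting point, and a
    full arc takes at least its width divided by the maximal horizontal speed M. *)
Lemma leg W d r L c beta s x x' q u v a t0 M : chart W d r L c beta -> side s ->
  (forall y z, in_box r y z -> Rabs (vX (fld W s) y z) <= M) ->
  0 < s * d * (x' - x) -> same_sign_at W q x -> a <= t0 ->
  on_arc W r s x x' (u t0, v t0) ->
  exists T, 0 <= T /\ ((u t0, v t0) = (x, 0) -> Rabs (x' - x) <= M * T) /\
    forall b, t0 <= b -> motion W r u v a b ->
    (forall t, t0 <= t <= b -> t <= t0 + T -> on_arc W r s x x' (u t, v t)) /\
    (t0 + T <= b -> u (t0 + T) = x' /\ v (t0 + T) = 0).
Proof.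
  intros HC Hs HM Hd Hq Ha (T & U & V & tau & HA & HB & Htau & Ep).
  pose proof (arc_time_sign _ _ _ _ _ _ _ _ _ _ _ _ HC Hs HA HB Hd) as HT.
  apply between_pos in Htau; auto. injection Ep as Eu Ev.
  pose proof HA as (_ & HO & U0 & V0 & UT & VT & Hin). rewrite Rmin_left, Rmax_right in Hin by lra.
  assert (Hlen : Rabs (x' - x) <= M * T).
  { rewrite <- U0, <- UT. replace (M * T) with (M * (T - 0)) by ring. apply seg_abs; [lra| |].
    - apply (return_arc_cont _ _ _ _ _ _ _ 0 T HA); apply between_ends.
    - intros t Ht. eexists. split; [apply HO, between_pos; auto; lra|]. apply HM, HB, between_pos; auto; lra. }
  assert (Hxx : x' <> x) by (intros ->; replace (x - x) with 0 in Hd by ring; lra).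
  destruct (Req_dec tau T) as [->|Hne].
  - exists 0. split; [lra|]. rewrite Rplus_0_r. split; [|intros b Hb Hmo; split].
    + intros E. injection E as E1 E2. rewrite Eu, UT in E1. contradiction.
    + intros t Ht1 Ht2. replace t with t0 by lra. exists T, U, V, T. rewrite Eu, Ev. split; auto. split; auto.
      split; [apply between_ends|auto].
    + intros _. rewrite Eu, Ev. auto.
  - exists (T - tau). split; [lra|].
    assert (Hq' : tau = 0 -> v t0 = 0 /\ same_sign_at W s (u t0)).
    { intros ->. rewrite Eu, Ev, U0, V0. split; auto.
      assert (q = s) by (apply (arc_start_sign _ _ _ _ _ _ _ q HA); auto; apply Hq; auto). subst q. auto. }
    split; [|intros b Hb Hmo].
    { intros E. injection E as E1 E2. destruct (Req_dec tau 0) as [->|Hn]; [rewrite Rminus_0_r; auto|].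
      exfalso. specialize (Hin tau ltac:(lra)). rewrite <- Ev, E2 in Hin. destruct Hs as [-> | ->]; lra. }
    assert (HF : forall t, t0 <= t <= b -> t - t0 + tau <= T -> u t = U (t + (tau - t0)) /\ v t = V (t + (tau - t0))).
    { apply (follow W r L s T U V u v a b t0 tau); auto; try lra; [apply HC|apply return_forward with x x'; auto]. }
    split.
    + intros t Ht1 Ht2. destruct (HF t Ht1 ltac:(lra)) as [E1 E2]. exists T, U, V, (t + (tau - t0)).
      split; auto. split; auto. split; [apply between_pos; auto; lra|]. rewrite E1, E2; auto.
    + intros Hb'. destruct (HF (t0 + (T - tau)) ltac:(lra) ltac:(lra)) as [E1 E2]. rewrite E1, E2.
      replace (t0 + (T - tau) + (tau - t0)) with T by ring. auto.
Qed.

Lemma arc_start_on W d r L c beta rho phi s x : system W d r L c beta rho phi -> side s ->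
  0 < Rabs (x - beta s) < rho -> on_arc W r s x (phi s x) (x, 0).
Proof.
  intros HS Hs Hx. destruct (sy_arc HS s x Hs Hx) as [_ (T & U & V & HA & HB)].
  exists T, U, V, 0. split; auto. split; auto. split; [apply between_ends|].
  destruct HA as (_ & _ & -> & -> & _). auto.
Qed.

(** A full turn around both folds starts at (a, 0): along the arc of the side d to phi d a, and back
    along the arc of the side - d. *)
Definition label_ok (d : R) (beta : R -> R) (rho : R) (phi : R -> R -> R) (a : R) : Prop :=
  forall s, side s -> beta s - rho < a < beta s /\ beta s < phi d a < beta s + rho.

Definition on_cycle (W : filippov) (r d : R) (phi : R -> R -> R) (a : R) (p : R * R) : Prop :=
  on_arc W r d a (phi d a) p \/ on_arc W r (- d) (phi d a) (phi (- d) (phi d a)) p.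

Section Cycle.
Variables (W : filippov) (d r L c : R) (beta : R -> R) (rho : R) (phi : R -> R -> R).
Hypothesis HS : system W d r L c beta rho phi.

Let HC : chart W d r L c beta := sy_chart HS.

Lemma in_r s x : side s -> on_arc W r s x (phi s x) (x, 0) -> Rabs x < r /\ Rabs (phi s x) < r.
Proof.
  intros Hs (T & U & V & tau & HA & HB & _).
  pose proof (HB 0 (proj1 (between_ends T))) as [B1 _]. pose proof (HB T (proj2 (between_ends T))) as [B2 _].
  destruct HA as (_ & _ & E1 & _ & E2 & _). rewrite E1 in B1. rewrite E2 in B2. auto.
Qed.

Lemma label_facts a : label_ok d beta rho phi a ->
  on_arc W r d a (phi d a) (a, 0) /\ same_sign_at W d a /\
  on_arc W r (- d) (phi d a) (phi (- d) (phi d a)) (phi d a, 0) /\ same_sign_at W (- d) (phi d a) /\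
  0 < d * d * (phi d a - a) /\ 0 < - d * d * (phi (- d) (phi d a) - phi d a).
Proof.
  intros Hl. pose proof (ch_side HC) as Hd. pose proof (side_opp d Hd) as Hd'.
  destruct (Hl d Hd) as [A1 A2]. destruct (Hl (- d) Hd') as [A3 A4].
  assert (O1 : on_arc W r d a (phi d a) (a, 0)).
  { apply (arc_start_on W d r L c beta rho phi); auto. rewrite Rabs_left; lra. }
  assert (O2 : on_arc W r (- d) (phi d a) (phi (- d) (phi d a)) (phi d a, 0)).
  { apply (arc_start_on W d r L c beta rho phi); auto. rewrite Rabs_pos_eq; lra. }
  destruct (in_r d a Hd O1) as [B1 B2].
  split; auto. split.
  { apply (same_sign_left W d r L c beta); auto. intros s Hs. apply Hl; auto. }
  split; auto. split.
  { apply (same_sign_right W d r L c beta); auto. intros s Hs. apply Hl; auto. }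
  rewrite Ropp_mult_distr_l_reverse, (side_sq d Hd). split; [lra|].
  destruct (sy_arc HS (- d) (phi d a) Hd') as [K _]; [rewrite Rabs_pos_eq; lra|]. nra.
Qed.

(** Motions that start on the line at a label in Lam, a set of labels stable under full turns,
    remain on the cycles of labels in Lam. Each turn takes at least the time P / M, so finitely
    many cover [t0, b]. *)
Lemma cycle_stay (Lam : R -> Prop) P u v a b : 0 < P ->
  (forall z, Lam z -> label_ok d beta rho phi z /\ Lam (phi (- d) (phi d z)) /\ P <= phi d z - z) ->
  motion W r u v a b ->
  forall t0, a <= t0 <= b -> Lam (u t0) -> v t0 = 0 ->
  forall t, t0 <= t <= b -> exists z, Lam z /\ on_cycle W r d phi z (u t, v t).
Proof.
  intros HP HL Hmo. destruct (chart_bounds HC) as (M & HM & HB).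
  pose proof (ch_side HC) as Hd. pose proof (side_opp d Hd) as Hd'.
  assert (Hgen : forall n t0, a <= t0 <= b -> b - t0 <= INR n * (P / M) -> Lam (u t0) -> v t0 = 0 ->
     forall t, t0 <= t <= b -> exists z, Lam z /\ on_cycle W r d phi z (u t, v t)).
  { induction n; intros t0 Ht0 Hn HLam Hv t Ht; destruct (HL _ HLam) as (Hok & HLam' & HPz);
      destruct (label_facts _ Hok) as (O1 & S1 & O2 & S2 & D1 & D2).
    - simpl in Hn. rewrite Rmult_0_l in Hn. assert (t = t0) by lra. subst t.
      exists (u t0). split; auto. left. rewrite Hv. auto.
    - destruct (leg W d r L c beta d (u t0) (phi d (u t0)) d u v a t0 M HC Hd ltac:(intros; apply HB; auto) D1 S1 (proj1 Ht0))
        as (T1 & HT1 & K3 & K); [rewrite Hv; auto|]. destruct (K b (proj2 Ht0) Hmo) as [K1 K2].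
      rewrite Hv in K3. specialize (K3 eq_refl).
      destruct (Rle_dec t (t0 + T1)) as [Hle|Hgt].
      { exists (u t0). split; auto. left. apply K1; auto. }
      destruct (K2 ltac:(lra)) as [E1 E2].
      destruct (leg W d r L c beta (- d) (phi d (u t0)) (phi (- d) (phi d (u t0))) (- d) u v a (t0 + T1) M HC Hd'
        ltac:(intros; apply HB; auto) D2 S2 ltac:(lra)) as (T2 & HT2 & _ & K').
      { rewrite E1, E2. auto. }
      destruct (K' b ltac:(lra) Hmo) as [K4 K5].
      destruct (Rle_dec t (t0 + T1 + T2)) as [Hle|Hgt'].
      { exists (u t0). split; auto. right. apply K4; auto; lra. }
      destruct (K5 ltac:(lra)) as [E3 E4].
      apply (IHn (t0 + T1 + T2)); try lra; [|rewrite E3; auto].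
      rewrite S_INR in Hn.
      assert (P / M <= T1).
      { apply Rmult_le_reg_r with M; auto. replace (P / M * M) with P by (field; lra).
        rewrite Rabs_pos_eq in K3 by lra. lra. }
      lra. }
  intros t0 Ht0 HLam Hv.
  assert (HPM : 0 < P / M) by (apply Rdiv_lt_0_compat; auto).
  destruct (INR_archimed (P / M) (b - t0) HPM) as [n Hn].
  apply (Hgen n t0); auto; lra.
Qed.

(** Both half-return maps take x0 to x1: the zeros of the displacement. *)
Definition matched (x0 x1 : R) : Prop := (forall s, side s -> phi s x0 = x1) /\
  forall s, side s -> beta s - rho < x0 < beta s /\ beta s < x1 < beta s + rho.

Lemma left_graph s x : side s -> beta s - rho < x < beta s ->
  beta s < phi s x /\ exists eta, graph_arc (slope s (fld W s)) r x (phi s x) eta.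
Proof.
  intros Hs Hx. destruct (sy_arc HS s x Hs) as [K (T & U & V & HA & HB)]; [rewrite Rabs_left; lra|].
  assert (beta s < phi s x) by nra. split; auto.
  destruct (graph_of_arc HC Hs HA HB) as (e & G & _).
  rewrite Rmin_left, Rmax_right in G by lra. exists e; auto.
Qed.

Lemma right_graph s x : side s -> beta s < x < beta s + rho ->
  phi s x < beta s /\ exists eta, graph_arc (slope s (fld W s)) r (phi s x) x eta.
Proof.
  intros Hs Hx. destruct (sy_arc HS s x Hs) as [K (T & U & V & HA & HB)]; [rewrite Rabs_pos_eq; lra|].
  assert (phi s x < beta s) by nra. split; auto.
  destruct (graph_of_arc HC Hs HA HB) as (e & G & _).
  rewrite Rmin_right, Rmax_left in G by lra. exists e; auto.
Qed.

(** Nesting of the arc that ends at y and the arc that starts at x. *)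
Lemma return_order s x y : side s -> beta s - rho < x < beta s -> beta s < y < beta s + rho ->
  (phi s y < x <-> phi s x < y) /\ (x < phi s y <-> y < phi s x).
Proof.
  intros Hs Hx Hy. destruct (left_graph s x Hs Hx) as [P1 (e1 & G1)]. destruct (right_graph s y Hs Hy) as [P2 (e2 & G2)].
  destruct (slope_bound HC) as [L' HL']. destruct (HL' s Hs) as [Hlip _].
  split.
  - apply (nest_rev _ _ _ Hlip _ _ _ _ _ _ G2 G1); lra.
  - apply (nest_rev _ _ _ Hlip _ _ _ _ _ _ G1 G2); lra.
Qed.

Lemma return_involutive s x : side s -> beta s - rho < x < beta s -> phi s x < beta s + rho -> phi s (phi s x) = x.
Proof.
  intros Hs Hx Hp. destruct (left_graph s x Hs Hx) as [P1 _].
  destruct (return_order s x (phi s x) Hs Hx ltac:(lra)) as [K1 K2].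
  destruct (Rtotal_order (phi s (phi s x)) x) as [H|[H|H]]; auto; exfalso.
  - apply K1 in H. lra.
  - apply K2 in H. lra.
Qed.

Lemma return_decr s x y : side s -> beta s - rho < x -> x < y -> y < beta s -> phi s y < phi s x.
Proof.
  intros Hs H1 H2 H3. destruct (left_graph s x Hs ltac:(lra)) as [P1 (e1 & G1)].
  destruct (left_graph s y Hs ltac:(lra)) as [P2 (e2 & G2)].
  destruct (slope_bound HC) as [L' HL']. destruct (HL' s Hs) as [Hlip _].
  apply (nest _ _ _ Hlip _ _ _ _ _ _ G1 G2). lra.
Qed.

Lemma matched_back x0 x1 s : matched x0 x1 -> side s -> phi s x1 = x0.
Proof.
  intros [H1 H2] Hs. rewrite <- (H1 s Hs). destruct (H2 s Hs). apply return_involutive; auto. rewrite H1; tauto.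
Qed.

Lemma matched_label x0 x1 : matched x0 x1 -> label_ok d beta rho phi x0.
Proof.
  intros [H1 H2] s Hs. rewrite (H1 d (ch_side HC)). apply H2; auto.
Qed.

(** The closed curve formed by the two arcs between x0 and x1. *)
Definition loop (x0 x1 : R) (p : R * R) : Prop := exists s, side s /\ on_arc W r s x0 x1 p.

Lemma cycle_loop x0 x1 p : matched x0 x1 -> on_cycle W r d phi x0 p <-> loop x0 x1 p.
Proof.
  intros HM. pose proof (ch_side HC) as Hd. pose proof (side_opp d Hd) as Hd'.
  unfold on_cycle. rewrite (proj1 HM d Hd), (matched_back x0 x1 (- d) HM Hd').
  split.
  - intros [H|H]; [exists d|exists (- d)]; split; auto. apply on_arc_swap; auto.
  - intros (s & Hs & H). destruct (side_two d s Hd Hs) as [-> | ->]; [left|right; apply on_arc_swap]; auto.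
Qed.

(** An orbit through (x0, 0) is confined to the loop by cycle_stay, and covers it since it follows
    both arcs. *)
Lemma orbit_is_loop u v T x0 x1 tl : matched x0 x1 -> 0 < T ->
  (forall a b : R, a < b -> trajectory_on W u v a b) ->
  (forall t, u (t + T) = u t /\ v (t + T) = v t) -> u tl = x0 -> v tl = 0 ->
  forall p, (exists t, p = (u t, v t)) <-> loop x0 x1 p.
Proof.
  intros HM HT Htr Hper Eu Ev p.
  assert (Hmot : forall a b, a < b -> motion W r u v a b) by (intros; apply traj_motion with L; [apply HC|auto]).
  pose proof (ch_side HC) as Hd. pose proof (side_opp d Hd) as Hd'.
  split.
  - intros [t ->]. destruct (reduce_period T (t - tl) HT) as [k Hk].
    rewrite <- (periodic_IZR u T (fun t => proj1 (Hper t)) k t), <- (periodic_IZR v T (fun t => proj2 (Hper t)) k t).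
    set (t' := t + IZR k * T) in *.
    destruct (cycle_stay (fun z => z = x0) (x1 - x0) u v tl (t' + 1)) with (t0 := tl) (t := t') as (z & -> & Hz).
    + destruct (proj2 HM d Hd). lra.
    + intros z ->. split; [apply (matched_label x0 x1 HM)|]. rewrite (proj1 HM d Hd).
      split; [apply (matched_back x0 x1 (- d) HM Hd')|lra].
    + apply Hmot. unfold t'; lra.
    + unfold t'; lra.
    + auto.
    + auto.
    + unfold t'; lra.
    + apply (cycle_loop x0 x1); auto.
  - intros (s & Hs & T' & U & V & tau & HA & HB & Ht & ->).
    destruct (label_facts x0 (matched_label x0 x1 HM)) as (_ & S1 & _).
    exists (tl + tau).
    set (K := Rabs tau + 1). pose proof (Rabs_pos tau). pose proof (Rle_abs tau). pose proof (Rle_abs (- tau)) as Hn. rewrite Rabs_Ropp in Hn.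
    destruct (follow_return W r L s x0 x1 T' U V u v (tl - K) (tl + K) tl d (ch_lip HC)
      Hs HA HB S1 (Hmot (tl - K) (tl + K) ltac:(unfold K; lra)) ltac:(unfold K; lra) Eu Ev tau Ht ltac:(unfold K; lra)) as [E1 E2].
    rewrite E1, E2. auto.
Qed.
End Cycle.

(** * Loops are hyperbolic periodic orbits around the sliding segment *)

Lemma frac_unique P t k : 0 < P -> 0 <= t - IZR k * P < P -> frac P t = t - IZR k * P.
Proof.
  intros HP H. unfold frac. replace (Int_part (t / P)) with k; auto.
  apply Int_part_spec. assert (E : t = t / P * P) by (field; lra).
  split; apply Rmult_lt_reg_r with P || apply Rmult_le_reg_r with P; auto; nra.
Qed.

Lemma frac_periodic P t : 0 < P -> frac P (t + P) = frac P t.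
Proof.
  intros HP. pose proof (frac_bounds P t HP) as H. unfold frac in H.
  rewrite (frac_unique P (t + P) (Int_part (t / P) + 1) HP); rewrite plus_IZR; unfold frac; [ring|].
  replace (t + P - (IZR (Int_part (t / P)) + 1) * P) with (t - IZR (Int_part (t / P)) * P) by ring. auto.
Qed.

(** Within one period this is the hypothesis; otherwise the path from s to t is cut at a multiple of
    P, where h takes a single value. *)
Lemma periodize_lip (h : R -> R) P M : 0 < P -> 0 <= M -> h 0 = h P ->
  (forall s t, 0 <= s <= P -> 0 <= t <= P -> Rabs (h s - h t) <= M * Rabs (s - t)) ->
  forall s t, Rabs (h (frac P s) - h (frac P t)) <= M * Rabs (s - t).
Proof.
  intros HP HM Hh Hl.
  assert (Hgen : forall s t, s <= t -> Rabs (h (frac P s) - h (frac P t)) <= M * (t - s)).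
  { intros s t Hst. pose proof (frac_bounds P s HP) as B1. pose proof (frac_bounds P t HP) as B2.
    set (k := Int_part (s / P)). set (k' := Int_part (t / P)).
    assert (E1 : frac P s = s - IZR k * P) by reflexivity. assert (E2 : frac P t = t - IZR k' * P) by reflexivity.
    destruct (Z.lt_trichotomy k k') as [Hk|[Hk|Hk]].
    - assert (IZR k + 1 <= IZR k') by (rewrite <- plus_IZR; apply IZR_le; lia).
      assert ((IZR k + 1) * P <= IZR k' * P) by (apply Rmult_le_compat_r; lra).
      pose proof (Hl (frac P s) P ltac:(lra) ltac:(lra)) as L1. pose proof (Hl 0 (frac P t) ltac:(lra) ltac:(lra)) as L2.
      rewrite <- Hh in L1. rewrite (Rabs_left1 (frac P s - P)) in L1 by lra. rewrite (Rabs_left1 (0 - frac P t)) in L2 by lra.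
      pose proof (Rabs_triang (h (frac P s) - h 0) (h 0 - h (frac P t))) as TR.
      replace (h (frac P s) - h 0 + (h 0 - h (frac P t))) with (h (frac P s) - h (frac P t)) in TR by ring.
      assert (M * (P - frac P s + frac P t) <= M * (t - s)) by (apply Rmult_le_compat_l; lra). lra.
    - pose proof (Hl (frac P s) (frac P t) ltac:(lra) ltac:(lra)) as L1. rewrite Hk in E1.
      replace (frac P s - frac P t) with (- (t - s)) in L1 by lra. rewrite Rabs_Ropp, (Rabs_pos_eq (t - s)) in L1 by lra. auto.
    - exfalso. assert (IZR k' + 1 <= IZR k) by (rewrite <- plus_IZR; apply IZR_le; lia).
      assert ((IZR k' + 1) * P <= IZR k * P) by (apply Rmult_le_compat_r; lra). lra. }
  intros s t. destruct (Rle_dec s t).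
  - rewrite (Rabs_minus_sym s), (Rabs_pos_eq (t - s)) by lra. auto.
  - rewrite (Rabs_pos_eq (s - t)), Rabs_minus_sym by lra. apply Hgen; lra.
Qed.

Lemma periodize_derive (h : R -> R) P t l : 0 < P -> 0 < frac P t -> is_derive h (frac P t) l ->
  is_derive (fun t => h (frac P t)) t l.
Proof.
  intros HP H0 Hd. pose proof (frac_bounds P t HP) as B.
  set (k := Int_part (t / P)) in *. assert (E1 : frac P t = t - IZR k * P) by reflexivity.
  apply (is_derive_ext_loc (fun t => h (t + - (IZR k * P)))).
  - assert (He : 0 < Rmin (frac P t) (P - frac P t)) by (apply Rmin_pos; lra).
    exists (mkposreal _ He). intros y Hy. assert (Hy' : Rabs (y - t) < Rmin (frac P t) (P - frac P t)) by exact Hy.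
    Rmin_bounds (frac P t) (P - frac P t).
    apply Rabs_def2 in Hy'. rewrite (frac_unique P y k HP) by lra. f_equal.
  - apply is_derive_shift. rewrite E1 in Hd. exact Hd.
Qed.

(** The n-th point is covered by an interval of length eps / (4 2^n). *)
Lemma null_countable (N : R -> Prop) (e : nat -> R) : (forall t, N t -> exists n, t = e n) -> lebesgue_null N.
Proof.
  intros HN eps. assert (He := cond_pos eps).
  exists (fun n => e n - eps / 8 * (1 / 2) ^ n), (fun n => e n + eps / 8 * (1 / 2) ^ n), (eps / 2).
  assert (Hp : forall n, 0 < eps / 8 * (1 / 2) ^ n).
  { intros n. apply Rmult_lt_0_compat; [lra|apply pow_lt; lra]. }
  split; [|split; [|split]].
  - intros n. specialize (Hp n). lra.
  - intros t Ht. destruct (HN t Ht) as [n ->]. exists n. specialize (Hp n). lra.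
  - apply (is_series_ext (fun n => eps / 4 * (1 / 2) ^ n)); [intros n; simpl; field|].
    replace (eps / 2) with (2 * (eps / 4)) by field. apply geom_half.
  - lra.
Qed.

Lemma rhs_of_side W s x y : side s -> 0 < s * y -> filippov_rhs W x y (vX (fld W s) x y) (vY (fld W s) x y).
Proof.
  intros [-> | ->] H; repeat split; intros; try lra; rewrite ?fld_p, ?fld_m; auto; exfalso; lra.
Qed.

Section Loop.
Variables (W : filippov) (d r L c : R) (beta : R -> R) (rho : R) (phi : R -> R -> R).
Hypothesis HS : system W d r L c beta rho phi.
Variables (x0 x1 : R).
Hypothesis HM : matched beta rho phi x0 x1.

Let HC : chart W d r L c beta := sy_chart HS.

Lemma matched_lt : x0 < x1.
Proof. destruct (proj2 HM d (ch_side HC)). lra. Qed.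

(** The sign of the duration tells that one arc is run from left to right and the other one from
    right to left. *)
Lemma loop_arcs s : side s -> exists T U V, return_arc s (fld W s) x0 x1 T U V /\ arc_in_box r T U V /\ 0 < s * d * T.
Proof.
  intros Hs. destruct (proj2 HM s Hs) as [A1 A2].
  destruct (sy_arc HS s x0 Hs) as [_ (T & U & V & HA & HB)]; [rewrite Rabs_left; lra|].
  rewrite (proj1 HM s Hs) in HA. exists T, U, V. split; auto. split; auto.
  destruct (graph_of_arc HC Hs HA HB) as (_ & _ & _ & _ & H). nra.
Qed.

Lemma arc_lip s x x' T U V M : return_arc s (fld W s) x x' T U V -> arc_in_box r T U V -> 0 < T -> side s ->
  (forall s x y, side s -> in_box r x y -> Rabs (vX (fld W s) x y) <= M /\ Rabs (vY (fld W s) x y) <= M) ->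
  forall t t', 0 <= t <= T -> 0 <= t' <= T ->
    Rabs (U t - U t') <= M * Rabs (t - t') /\ Rabs (V t - V t') <= M * Rabs (t - t').
Proof.
  intros HA HB HT Hs HMb t t' Ht Ht'. destruct HA as (_ & HO & _).
  assert (Hin : forall z, Rmin t t' <= z <= Rmax t t' -> between T z).
  { intros z Hz. apply between_pos; auto. revert Hz. unfold Rmin, Rmax. destruct (Rle_dec t t'); lra. }
  split; apply derive_lip; intros z Hz; specialize (Hin z Hz); eexists; (split; [apply HO; auto|apply HMb; auto]).
Qed.

(** The concatenation of the two arcs, the second one reversed, is periodized. It is Lipschitz,
    hence absolutely continuous, and solves the equation of one side except at the countably
    many times at which it is on the line. *)
Lemma loop_periodic G : (forall p, G p <-> loop W r x0 x1 p) -> periodic_orbit W G.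
Proof.
  intros HG. pose proof (ch_side HC) as Hd. pose proof (side_opp d Hd) as Hd'.
  destruct (chart_bounds HC) as (M & HM0 & HMb).
  destruct (loop_arcs d Hd) as (T1 & U1 & V1 & A1 & B1 & P1). rewrite (side_sq d Hd) in P1.
  destruct (loop_arcs (- d) Hd') as (T2' & U2' & V2' & A2' & B2' & P2). rewrite Ropp_mult_distr_l_reverse, (side_sq d Hd) in P2.
  apply return_arc_swap in A2'. apply arc_in_box_swap in B2'.
  set (T2 := - T2') in *. set (U2 := fun t => U2' (t + T2')) in *. set (V2 := fun t => V2' (t + T2')) in *.
  assert (HT1 : 0 < T1) by lra. assert (HT2 : 0 < T2) by (unfold T2; lra).
  rename A2' into A2. rename B2' into B2.
  set (P := T1 + T2). assert (HP : 0 < P) by (unfold P; lra).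
  set (hu := fun t => if Rle_dec t T1 then U1 t else U2 (t - T1)).
  set (hv := fun t => if Rle_dec t T1 then V1 t else V2 (t - T1)).
  pose proof A1 as (_ & O1 & U10 & V10 & U1T & V1T & S1). pose proof A2 as (_ & O2 & U20 & V20 & U2T & V2T & S2).
  rewrite Rmin_left, Rmax_right in S1, S2 by lra.
  assert (Elo : forall t, t <= T1 -> hu t = U1 t /\ hv t = V1 t).
  { intros t Ht. unfold hu, hv. destruct (Rle_dec t T1); [auto|lra]. }
  assert (Ehi : forall t, T1 <= t -> hu t = U2 (t - T1) /\ hv t = V2 (t - T1)).
  { intros t Ht. unfold hu, hv. destruct (Rle_dec t T1); auto. replace t with T1 by lra.
    replace (T1 - T1) with 0 by ring. rewrite U1T, V1T, U20, V20. auto. }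
  assert (Hper : hu 0 = hu P /\ hv 0 = hv P).
  { destruct (Elo 0 ltac:(lra)) as [-> ->]. destruct (Ehi P ltac:(unfold P; lra)) as [-> ->].
    replace (P - T1) with T2 by (unfold P; ring). rewrite U10, V10, U2T, V2T. auto. }
  pose proof (arc_lip _ _ _ _ _ _ M A1 B1 HT1 Hd HMb) as L1.
  pose proof (arc_lip _ _ _ _ _ _ M A2 B2 HT2 Hd' HMb) as L2.
  assert (Hlip : forall s t, 0 <= s <= P -> 0 <= t <= P ->
     Rabs (hu s - hu t) <= M * Rabs (s - t) /\ Rabs (hv s - hv t) <= M * Rabs (s - t)).
  { assert (Hgen : forall s t, 0 <= s -> s <= t -> t <= P ->
      Rabs (hu s - hu t) <= M * Rabs (s - t) /\ Rabs (hv s - hv t) <= M * Rabs (s - t)).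
    { intros s t Hs Hst Ht. unfold P in Ht. destruct (Rle_dec t T1) as [Ht1|Ht1].
      - destruct (Elo s ltac:(lra)) as [-> ->]. destruct (Elo t ltac:(lra)) as [-> ->]. apply L1; lra.
      - destruct (Ehi t ltac:(lra)) as [-> ->]. destruct (Rle_dec T1 s) as [Hs1|Hs1].
        + destruct (Ehi s ltac:(lra)) as [-> ->]. replace (s - t) with ((s - T1) - (t - T1)) by ring. apply L2; lra.
        + destruct (Elo s ltac:(lra)) as [-> ->].
          destruct (L1 s T1 ltac:(lra) ltac:(lra)) as [K1 K2]. destruct (L2 0 (t - T1) ltac:(lra) ltac:(lra)) as [K3 K4].
          rewrite U1T in K1. rewrite V1T in K2. rewrite U20 in K3. rewrite V20 in K4.
          rewrite (Rabs_left1 (s - T1)) in K1, K2 by lra. rewrite (Rabs_left1 (0 - (t - T1))) in K3, K4 by lra.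
          rewrite (Rabs_left1 (s - t)) by lra.
          pose proof (Rabs_triang (U1 s - x1) (x1 - U2 (t - T1))) as R1. pose proof (Rabs_triang (V1 s - 0) (0 - V2 (t - T1))) as R2.
          replace (U1 s - x1 + (x1 - U2 (t - T1))) with (U1 s - U2 (t - T1)) in R1 by ring.
          replace (V1 s - 0 + (0 - V2 (t - T1))) with (V1 s - V2 (t - T1)) in R2 by ring. lra. }
    intros s t Hs Ht. destruct (Rle_dec s t); [apply Hgen; lra|].
    rewrite (Rabs_minus_sym s), (Rabs_minus_sym (hu s)), (Rabs_minus_sym (hv s)). apply Hgen; lra. }
  set (u := fun t => hu (frac P t)). set (v := fun t => hv (frac P t)).
  assert (Lu : forall s t, Rabs (u s - u t) <= M * Rabs (s - t)).
  { apply periodize_lip; auto; [lra|apply Hper|intros; apply Hlip; auto]. }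
  assert (Lv : forall s t, Rabs (v s - v t) <= M * Rabs (s - t)).
  { apply periodize_lip; auto; [lra|apply Hper|intros; apply Hlip; auto]. }
  assert (Hfid : forall t, 0 <= t < P -> frac P t = t).
  { intros t Ht. rewrite (frac_unique P t 0 HP); lra. }
  exists u, v, P. split; auto. split; [|split; [|split]].
  - intros a b Hab. split; [apply ac_lip with M; [lra|auto]|]. split; [apply ac_lip with M; [lra|auto]|].
    set (K0 := Int_part (a / P)).
    (* Even indices enumerate the passages at x0, odd ones those at x1, from the first period on. *)
    apply (null_countable _ (fun n => IZR (K0 + Z.of_nat (Nat.div2 n)) * P + (if Nat.even n then 0 else T1))).
    intros t [Ht Hn].
    assert (Hf : frac P t = 0 \/ frac P t = T1).
    { destruct (Req_dec (frac P t) 0) as [|N0]; auto. destruct (Req_dec (frac P t) T1) as [|N1]; auto.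
      exfalso. apply Hn. pose proof (frac_bounds P t HP) as FB. set (f := frac P t) in *.
      destruct (Rlt_le_dec f T1) as [Hl|Hl].
      - destruct (O1 f) as [D1 D2]; [apply between_pos; lra|]. destruct (Elo f ltac:(lra)) as [E1 E2].
        exists (vX (fld W d) (U1 f) (V1 f)), (vY (fld W d) (U1 f) (V1 f)). split; [|split].
        + apply periodize_derive; auto; [fold f; lra|]. fold f. apply (is_derive_ext_loc U1); auto.
          assert (He : 0 < T1 - f) by lra. exists (mkposreal _ He). intros y Hy.
          assert (Hy' : Rabs (y - f) < T1 - f) by exact Hy. apply Rabs_def2 in Hy'. symmetry; apply Elo; lra.
        + apply periodize_derive; auto; [fold f; lra|]. fold f. apply (is_derive_ext_loc V1); auto.
          assert (He : 0 < T1 - f) by lra. exists (mkposreal _ He). intros y Hy.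
          assert (Hy' : Rabs (y - f) < T1 - f) by exact Hy. apply Rabs_def2 in Hy'. symmetry; apply Elo; lra.
        + unfold u, v. fold f. rewrite E1, E2. apply rhs_of_side; auto. apply S1; lra.
      - destruct (O2 (f - T1)) as [D1 D2]; [apply between_pos; unfold P in FB; lra|].
        destruct (Ehi f ltac:(lra)) as [E1 E2].
        exists (vX (fld W (- d)) (U2 (f - T1)) (V2 (f - T1))), (vY (fld W (- d)) (U2 (f - T1)) (V2 (f - T1))). split; [|split].
        + apply periodize_derive; auto; [fold f; lra|]. fold f. apply (is_derive_ext_loc (fun t => U2 (t + - T1))).
          * assert (He : 0 < f - T1) by lra. exists (mkposreal _ He). intros y Hy.
            assert (Hy' : Rabs (y - f) < f - T1) by exact Hy. apply Rabs_def2 in Hy'. symmetry; apply Ehi; lra.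
          * apply (is_derive_shift U2). exact D1.
        + apply periodize_derive; auto; [fold f; lra|]. fold f. apply (is_derive_ext_loc (fun t => V2 (t + - T1))).
          * assert (He : 0 < f - T1) by lra. exists (mkposreal _ He). intros y Hy.
            assert (Hy' : Rabs (y - f) < f - T1) by exact Hy. apply Rabs_def2 in Hy'. symmetry; apply Ehi; lra.
          * apply (is_derive_shift V2). exact D2.
        + unfold u, v. fold f. rewrite E1, E2. apply rhs_of_side; auto. apply S2; unfold P in FB; lra. }
    assert (Hk : (K0 <= Int_part (t / P))%Z).
    { destruct (base_Int_part (a / P)) as [I1 I2]. destruct (base_Int_part (t / P)) as [I3 I4]. fold K0 in I1, I2.
      apply Z.lt_succ_r. apply lt_IZR. unfold Z.succ. rewrite plus_IZR.
      assert (a / P < t / P) by (apply Rmult_lt_compat_r; [apply Rinv_0_lt_compat; auto|lra]). lra. }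
    set (j := Z.to_nat (Int_part (t / P) - K0)).
    assert (Ej : (K0 + Z.of_nat j = Int_part (t / P))%Z) by (unfold j; lia).
    destruct Hf as [Hf|Hf]; unfold frac in Hf.
    + exists (2 * j)%nat. rewrite Nat.div2_double, Nat.even_mul, Ej. simpl. lra.
    + exists (S (2 * j)). rewrite Nat.div2_succ_double, Nat.even_succ, Ej.
      replace (Nat.odd (2 * j)) with false by (symmetry; rewrite Nat.odd_mul; auto). lra.
  - intros t. unfold u, v. rewrite frac_periodic; auto.
  - exists T1. intros E. injection E as E1 E2. unfold u in E1. rewrite !Hfid in E1 by (unfold P; lra).
    destruct (Elo T1 ltac:(lra)) as [E3 _]. destruct (Elo 0 ltac:(lra)) as [E4 _].
    rewrite E3, E4, U1T, U10 in E1. pose proof matched_lt. lra.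
  - intros p. rewrite HG. split.
    + intros (s & Hs & Hp). destruct (side_two d s Hd Hs) as [-> | ->].
      * destruct (on_arc_spec HC Hd A1 B1 Hp) as (t & Ht & ->).
        apply between_pos in Ht; auto. exists t. unfold u, v. rewrite Hfid by (unfold P; lra).
        destruct (Elo t ltac:(lra)) as [-> ->]. auto.
      * apply on_arc_swap in Hp. destruct (on_arc_spec HC Hd' A2 B2 Hp) as (t & Ht & ->).
        apply between_pos in Ht; auto. destruct (Req_dec t T2) as [->|Hn].
        -- exists 0. unfold u, v. rewrite Hfid by lra. destruct (Elo 0 ltac:(lra)) as [-> ->].
           rewrite U10, V10, U2T, V2T. auto.
        -- exists (t + T1). unfold u, v. rewrite Hfid by (unfold P; lra). destruct (Ehi (t + T1) ltac:(lra)) as [-> ->].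
           replace (t + T1 - T1) with t by ring. auto.
    + intros [t ->]. pose proof (frac_bounds P t HP) as FB. unfold u, v. set (f := frac P t) in *.
      destruct (Rle_dec f T1) as [Hl|Hl].
      * exists d. split; auto. exists T1, U1, V1, f. split; auto. split; auto. split; [apply between_pos; lra|].
        destruct (Elo f Hl) as [-> ->]. auto.
      * exists (- d). split; auto. apply on_arc_swap. exists T2, U2, V2, (f - T1). split; auto. split; auto.
        split; [apply between_pos; unfold P in FB; lra|]. destruct (Ehi f ltac:(lra)) as [-> ->]. auto.
Qed.

Lemma loop_ends_same_sign : same_sign_at W d x0 /\ same_sign_at W (- d) x1.
Proof.
  destruct (label_facts W d r L c beta rho phi HS x0 (matched_label W d r L c beta rho phi HS x0 x1 HM))
    as (_ & S1 & _ & S2 & _). rewrite (proj1 HM d (ch_side HC)) in S2. auto.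
Qed.

Lemma loop_line x : loop W r x0 x1 (x, 0) -> x = x0 \/ x = x1.
Proof.
  intros (s & Hs & T & U & V & tau & HA & HB & Ht & E). injection E as E1 E2.
  destruct HA as (HT & _ & U0 & V0 & UT & VT & Hin). subst x.
  destruct (Req_dec tau 0) as [->|N0]; [left; auto|]. destruct (Req_dec tau T) as [->|N1]; [right; auto|].
  exfalso. assert (Hlt : Rmin 0 T < tau < Rmax 0 T).
  { unfold between in Ht. revert Ht. unfold Rmin, Rmax. destruct (Rle_dec 0 T); lra. }
  specialize (Hin tau Hlt). rewrite <- E2 in Hin. lra.
Qed.

Lemma same_sign_crossing q x : same_sign_at W q x -> crossing W x.
Proof.
  intros [Hq H]. unfold crossing. specialize (H 1 side_p) as H1. specialize (H (-1) side_m) as H2.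
  rewrite fld_p in H1. rewrite fld_m in H2. destruct Hq as [-> | ->]; nra.
Qed.

Lemma loop_hyperbolic l : is_derive (fun x => phi 1 x - phi (-1) x) x0 l -> l <> 0 ->
  delta W <> 0 -> hyperbolic W (loop W r x0 x1).
Proof.
  intros Hd Hl Hdel. destruct loop_ends_same_sign as [S1 S2]. split.
  - intros x Hx. destruct (loop_line x Hx) as [-> | ->]; eapply same_sign_crossing; eauto.
  - pose proof (proj2 HM 1 side_p) as M1. pose proof (proj2 HM (-1) side_m) as M2.
    set (e := Rmin (Rmin (x0 - (beta 1 - rho)) (beta 1 - x0)) (Rmin (x0 - (beta (-1) - rho)) (beta (-1) - x0))).
    assert (He : 0 < e) by (unfold e; repeat apply Rmin_pos; lra).
    assert (He' : e <= x0 - (beta 1 - rho) /\ e <= beta 1 - x0 /\ e <= x0 - (beta (-1) - rho) /\ e <= beta (-1) - x0).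
    { unfold e. split; [|split; [|split]].
      - eapply Rle_trans; [apply Rmin_l|apply Rmin_l].
      - eapply Rle_trans; [apply Rmin_l|apply Rmin_r].
      - eapply Rle_trans; [apply Rmin_r|apply Rmin_l].
      - eapply Rle_trans; [apply Rmin_r|apply Rmin_r]. }
    exists x0, (phi 1), (phi (-1)), (mkposreal e He). split; [|split; [|split]].
    + intros x Hx. simpl in Hx. apply Rabs_def2 in Hx. rewrite <- fld_p, <- fld_m. split.
      * destruct (sy_arc HS 1 x side_p) as [_ (T & U & V & HA & _)]; [rewrite Rabs_left; lra|].
        exists T, U, V. auto.
      * destruct (sy_arc HS (-1) x side_m) as [_ (T & U & V & HA & _)]; [rewrite Rabs_left; lra|].
        exists T, U, V. auto.
    + destruct (loop_arcs 1 side_p) as (T1 & U1 & V1 & A1 & B1 & _).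
      destruct (loop_arcs (-1) side_m) as (T2 & U2 & V2 & A2 & B2 & _).
      exists T1, U1, V1, T2, U2, V2.
      rewrite (proj1 HM 1 side_p), (proj1 HM (-1) side_m).
      split; [rewrite <- fld_p; auto|]. split; [rewrite <- fld_m; auto|]. intros p. split.
      * intros (s & [-> | ->] & Hp); [left|right].
        -- apply (on_arc_spec HC side_p A1 B1 Hp).
        -- apply (on_arc_spec HC side_m A2 B2 Hp).
      * intros [(t & Ht & ->)|(t & Ht & ->)].
        -- exists 1. split; [left; auto|]. exists T1, U1, V1, t. auto.
        -- exists (-1). split; [right; auto|]. exists T2, U2, V2, t. auto.
    + unfold displacement. rewrite (proj1 HM 1 side_p), (proj1 HM (-1) side_m). ring.
    + exists (delta W * l). split; [|apply Rmult_integral_contrapositive; auto].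
      unfold displacement. apply (is_derive_Rscal (delta W) (fun x => phi 1 x - phi (-1) x)). exact Hd.
Qed.

(** The sliding segment is the one between the folds: it cannot be longer, as the points of the line
    between a fold and the next end of the loop are crossing points. A path that starts on it is
    trapped because a continuous function D, positive inside the loop and zero only on it,
    cannot change sign without the path meeting the loop. *)
Lemma loop_surrounds : beta 1 <> beta (-1) -> surrounds_sliding_segment W (loop W r x0 x1).
Proof.
  intros Hb. set (lo := Rmin (beta 1) (beta (-1))). set (hi := Rmax (beta 1) (beta (-1))).
  assert (Hlh : lo < hi) by (unfold lo, hi, Rmin, Rmax; destruct (Rle_dec _ _); lra).
  pose proof (proj2 HM 1 side_p) as M1. pose proof (proj2 HM (-1) side_m) as M2.
  assert (Hlo : x0 < lo) by (unfold lo, Rmin; destruct (Rle_dec _ _); lra).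
  assert (Hhi : hi < x1) by (unfold hi, Rmax; destruct (Rle_dec _ _); lra).
  assert (Hbox : forall x, x0 <= x <= x1 -> Rabs x < r).
  { destruct (loop_arcs 1 side_p) as (T & U & V & HA & HB & _).
    pose proof (HB 0 (proj1 (between_ends T))) as [B1 _]. pose proof (HB T (proj2 (between_ends T))) as [B2 _].
    destruct HA as (_ & _ & E1 & _ & E2 & _). rewrite E1 in B1. rewrite E2 in B2.
    apply Rabs_def2 in B1. apply Rabs_def2 in B2. intros; apply Rabs_def1; lra. }
  assert (Hgr : forall s, side s -> exists e, graph_arc (slope s (fld W s)) r x0 x1 e).
  { intros s Hs. destruct (left_graph W d r L c beta rho phi HS s x0 Hs) as [_ [e He]]; [destruct (proj2 HM s Hs); tauto|].
    rewrite (proj1 HM s Hs) in He. exists e; auto. }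
  exists lo, hi. split.
  - split; auto. split.
    + intros x Hx. unfold sliding. rewrite <- fld_p, <- fld_m.
      pose proof (ch_fold HC 1 x side_p (Hbox x ltac:(lra))) as F1.
      pose proof (ch_fold HC (-1) x side_m (Hbox x ltac:(lra))) as F2.
      assert (N : x <> beta 1 /\ x <> beta (-1)) by (unfold lo, hi, Rmin, Rmax in Hx; destruct (Rle_dec _ _); lra).
      specialize (F1 (proj1 N)). specialize (F2 (proj2 N)).
      set (y1 := vY (fld W 1) x 0) in *. set (y2 := vY (fld W (-1)) x 0) in *.
      assert (Hprod : (x - beta 1) * (x - beta (-1)) < 0).
      { unfold lo, hi, Rmin, Rmax in Hx; destruct (Rle_dec _ _); nra. }
      assert (Hpp : 0 < (d * y1 * (x - beta 1)) * (d * y2 * (x - beta (-1)))) by nra.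
      replace ((d * y1 * (x - beta 1)) * (d * y2 * (x - beta (-1)))) with
        ((d * d) * (y1 * y2) * ((x - beta 1) * (x - beta (-1)))) in Hpp by ring.
      rewrite (side_sq d (ch_side HC)) in Hpp. nra.
    + intros a' c' Ha Hc Hsl.
      assert (Hno : forall x q, same_sign_at W q x -> ~ sliding W x).
      { intros x q Hq Hsd. apply same_sign_crossing in Hq. unfold crossing, sliding in *. lra. }
      split.
      * destruct (Req_dec a' lo) as [|Hn]; auto. exfalso.
        set (x := Rmax ((a' + lo) / 2) x0).
        assert (Hx : a' < x < lo /\ x0 <= x).
        { unfold x. pose proof (Rmax_l ((a' + lo) / 2) x0). pose proof (Rmax_r ((a' + lo) / 2) x0).
          assert (Rmax ((a' + lo) / 2) x0 < lo) by (apply Rmax_lub_lt; lra). lra. }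
        apply (Hno x d); [|apply Hsl; lra]. apply (same_sign_left W d r L c beta); auto; [apply Hbox; lra|].
        intros s [-> | ->]; [pose proof (Rmin_l (beta 1) (beta (-1)))|pose proof (Rmin_r (beta 1) (beta (-1)))]; fold lo in H; lra.
      * destruct (Req_dec c' hi) as [|Hn]; auto. exfalso.
        set (x := Rmin ((c' + hi) / 2) x1).
        assert (Hx : hi < x < c' /\ x <= x1).
        { unfold x. Rmin_bounds ((c' + hi) / 2) x1.
          assert (hi < Rmin ((c' + hi) / 2) x1) by (apply Rmin_glb_lt; lra). lra. }
        apply (Hno x (- d)); [|apply Hsl; lra]. apply (same_sign_right W d r L c beta); auto; [apply Hbox; lra|].
        intros s [-> | ->]; [pose proof (Rmax_l (beta 1) (beta (-1)))|pose proof (Rmax_r (beta 1) (beta (-1)))]; fold hi in H; lra.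
  - intros x Hx. destruct (Hgr 1 side_p) as [e1 G1]. destruct (Hgr (-1) side_m) as [e2 G2].
    pose proof matched_lt as Hlt.
    split.
    { intros HL. apply loop_line in HL. lra. }
    set (D := fun p : R * R => Rmin (Rmin (fst p - x0) (x1 - fst p)) (Rmin (e1 (fst p) - snd p) (e2 (fst p) + snd p))).
    exists (Rabs x0 + Rabs x1 + r + 1). intros g Hg Hg0 Hav.
    assert (HDL : forall p, D p = 0 -> loop W r x0 x1 p).
    { intros [z y] Hz. unfold D in Hz. simpl in Hz.
      assert (Hin : 0 <= z - x0 /\ 0 <= x1 - z /\ 0 <= e1 z - y /\ 0 <= e2 z + y /\
         (z - x0 = 0 \/ x1 - z = 0 \/ e1 z - y = 0 \/ e2 z + y = 0)).
      { unfold Rmin in Hz. repeat destruct (Rle_dec _ _); lra. }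
      destruct Hin as (I1 & I2 & I3 & I4 & Hor).
      assert (Hor' : 1 * y = e1 z \/ -1 * y = e2 z).
      { destruct Hor as [H|[H|[H|H]]]; try lra.
        - rewrite (ga_left G1 z), (ga_left G2 z) in * by lra. lra.
        - rewrite (ga_right G1 z), (ga_right G2 z) in * by lra. lra. }
      destruct Hor' as [H|H]; [exists 1; split; [left; auto|]|exists (-1); split; [right; auto|]].
      - destruct (loop_arcs 1 side_p) as (T & U & V & HA & HB & _).
        destruct (arc_of_graph W d r L c beta 1 x0 x1 z y T U V e1 x1 HC side_p HA HB) as (t & Ht & E); auto;
          rewrite ?Rmin_left, ?Rmax_right by lra; auto; try lra.
        exists T, U, V, t. auto.
      - destruct (loop_arcs (-1) side_m) as (T & U & V & HA & HB & _).
        destruct (arc_of_graph W d r L c beta (-1) x0 x1 z y T U V e2 x1 HC side_m HA HB) as (t & Ht & E); auto;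
          rewrite ?Rmin_left, ?Rmax_right by lra; auto; try lra.
        exists T, U, V, t. auto. }
    assert (HD0 : 0 < D (g 0)).
    { rewrite Hg0. unfold D. simpl. pose proof (ga_pos G1 x ltac:(lra)). pose proof (ga_pos G2 x ltac:(lra)).
      repeat apply Rmin_pos; lra. }
    assert (HDc : forall t, continuity_pt (fun t => D (g t)) t).
    { intros t. pose proof (Hg t) as Ht.
      assert (C1 : continuity_pt (fun t => fst (g t)) t).
      { apply continuity_pt_filterlim. apply (continuous_comp g fst); [exact Ht|apply continuous_fst]. }
      assert (C2 : continuity_pt (fun t => snd (g t)) t).
      { apply continuity_pt_filterlim. apply (continuous_comp g snd); [exact Ht|apply continuous_snd]. }
      assert (Cmin : forall f h, continuity_pt f t -> continuity_pt h t -> continuity_pt (fun t => Rmin (f t) (h t)) t).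
      { intros f h Hf Hh. apply continuity_pt_eps. intros eps He.
        destruct (proj1 (continuity_pt_eps f t) Hf eps He) as [d1 [Hd1 K1]].
        destruct (proj1 (continuity_pt_eps h t) Hh eps He) as [d2 [Hd2 K2]].
        exists (Rmin d1 d2). split; [apply Rmin_pos; auto|]. intros y Hy. Rmin_bounds d1 d2.
        specialize (K1 y ltac:(lra)). specialize (K2 y ltac:(lra)). apply Rabs_def2 in K1. apply Rabs_def2 in K2.
        unfold Rmin. apply Rabs_def1; repeat destruct (Rle_dec _ _); lra. }
      assert (Ce : forall e F lo' hi', graph_arc F r lo' hi' e -> continuity_pt (fun t => e (fst (g t))) t).
      { intros e F lo' hi' Ge. apply (continuity_pt_comp (fun t => fst (g t)) e); auto. apply Ge. }
      unfold D. apply Cmin; apply Cmin.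
      - apply (continuity_pt_minus (fun t => fst (g t)) (fun _ => x0)); auto. apply continuity_pt_const. intros ? ?; auto.
      - apply (continuity_pt_minus (fun _ => x1) (fun t => fst (g t))); auto. apply continuity_pt_const. intros ? ?; auto.
      - apply (continuity_pt_minus (fun t => e1 (fst (g t))) (fun t => snd (g t))); auto. eapply Ce; eauto.
      - apply (continuity_pt_plus (fun t => e2 (fst (g t))) (fun t => snd (g t))); auto. eapply Ce; eauto. }
    assert (HD1 : 0 < D (g 1)).
    { destruct (Rlt_le_dec 0 (D (g 1))) as [|Hle]; auto. exfalso.
      destruct (seg_IVT (fun t => D (g t)) 0 1 0) as [t [Ht E]]; [lra| | |].
      - apply continuity_pt_seg. auto.
      - rewrite Rmin_right, Rmax_left by lra. lra.
      - apply (Hav t Ht). apply HDL. auto. }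
    destruct (g 1) as [z y]. unfold D in HD1. simpl in HD1.
    assert (Hin : x0 < z < x1 /\ y < e1 z /\ - e2 z < y).
    { unfold Rmin in HD1. repeat destruct (Rle_dec _ _); lra. }
    pose proof (ga_pos G1 z ltac:(lra)). pose proof (ga_pos G2 z ltac:(lra)).
    pose proof (Rabs_pos x0). pose proof (Rabs_pos x1).
    pose proof (Rle_abs x1). pose proof (Rle_abs (- x0)) as Hn. rewrite Rabs_Ropp in Hn.
    split; simpl; unfold ball; simpl; unfold AbsRing_ball, abs, minus, plus, opp; simpl; apply Rabs_def1; lra.
Qed.
End Loop.

(** * Stability of loops *)

Lemma ga_lip F r lo hi eta K : graph_arc F r lo hi eta -> 0 <= K ->
  (forall x y, in_box r x y -> Rabs (F x y) <= K) ->
  forall x y, Rabs (eta x - eta y) <= K * Rabs (x - y).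
Proof.
  intros HG HK HF. pose proof (ga_lt HG) as Hlt.
  assert (Hcl : forall x, eta x = eta (clamp lo hi x)).
  { intros x. destruct (Rle_dec x lo).
    - rewrite (ga_left HG x) by auto. symmetry. apply (ga_left HG).
      unfold clamp, Rmax, Rmin. repeat destruct (Rle_dec _ _); lra.
    - destruct (Rle_dec hi x).
      + rewrite (ga_right HG x) by auto. symmetry. apply (ga_right HG).
        unfold clamp, Rmax, Rmin. repeat destruct (Rle_dec _ _); lra.
      + rewrite clamp_id; auto; lra. }
  assert (Hgen : forall x y, lo <= x -> x <= y -> y <= hi -> Rabs (eta y - eta x) <= K * (y - x)).
  { intros x y Hx Hxy Hy. apply seg_abs; auto.
    - eapply ga_seg; eauto.
    - intros z Hz. eexists; split; [apply (ga_ode HG); lra|].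
      pose proof (ga_lo HG). pose proof (ga_hi HG). pose proof (ga_pos HG z ltac:(lra)).
      apply HF. split; apply Rabs_def1; lra. }
  intros x y. rewrite (Hcl x), (Hcl y).
  pose proof (clamp_in lo hi x ltac:(lra)) as B1. pose proof (clamp_in lo hi y ltac:(lra)) as B2.
  apply Rle_trans with (K * Rabs (clamp lo hi x - clamp lo hi y)); [|apply Rmult_le_compat_l; auto; apply clamp_lip].
  destruct (Rle_dec (clamp lo hi x) (clamp lo hi y)).
  - rewrite Rabs_minus_sym, (Rabs_minus_sym (clamp lo hi x)), (Rabs_pos_eq (clamp lo hi y - _)) by lra. apply Hgen; lra.
  - rewrite (Rabs_pos_eq (clamp lo hi x - _)) by lra. apply Hgen; lra.
Qed.

(** The profile of an arc, continued by minus the distance to its base. In this way arcs with nested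
    bases have comparable profiles on the whole line. *)
Definition extend (lo hi : R) (eta : R -> R) (x : R) : R := eta x - Rmax 0 (lo - x) - Rmax 0 (x - hi).

Section Extended.
Variables (F : R -> R -> R) (r K : R).
Hypothesis HK : 0 <= K.
Hypothesis HF : forall x y, in_box r x y -> Rabs (F x y) <= K.
Hypothesis HL : lip_y F r K.

Lemma extend_nonneg lo hi eta x : graph_arc F r lo hi eta -> 0 <= extend lo hi eta x ->
  lo <= x <= hi /\ extend lo hi eta x = eta x.
Proof.
  intros HG H. unfold extend in *. pose proof (ga_lt HG).
  assert (lo <= x).
  { destruct (Rle_dec lo x); auto. exfalso. rewrite (ga_left HG x) in H by lra.
    rewrite (Rmax_right 0 (lo - x)) in H by lra. pose proof (Rmax_l 0 (x - hi)). lra. }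
  assert (x <= hi).
  { destruct (Rle_dec x hi); auto. exfalso. rewrite (ga_right HG x) in H by lra.
    rewrite (Rmax_right 0 (x - hi)) in H by lra. pose proof (Rmax_l 0 (lo - x)). lra. }
  split; auto. rewrite !Rmax_left by lra. ring.
Qed.

Lemma extend_in lo hi eta x : lo <= x <= hi -> extend lo hi eta x = eta x.
Proof. intros H. unfold extend. rewrite !Rmax_left by lra. ring. Qed.

Lemma extend_lip lo hi eta x y : graph_arc F r lo hi eta ->
  Rabs (extend lo hi eta x - extend lo hi eta y) <= (K + 2) * Rabs (x - y).
Proof.
  intros HG. pose proof (ga_lip _ _ _ _ _ _ HG HK HF x y) as H1. unfold extend.
  assert (Hm : forall p q, Rabs (Rmax 0 p - Rmax 0 q) <= Rabs (p - q)).
  { intros p q. unfold Rmax, Rabs. repeat destruct (Rle_dec _ _); repeat destruct (Rcase_abs _); lra. }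
  pose proof (Hm (lo - x) (lo - y)) as H2. pose proof (Hm (x - hi) (y - hi)) as H3.
  replace (lo - x - (lo - y)) with (- (x - y)) in H2 by ring. rewrite Rabs_Ropp in H2.
  replace (x - hi - (y - hi)) with (x - y) in H3 by ring.
  apply Rabs_le_between in H1. apply Rabs_le_between in H2. apply Rabs_le_between in H3. apply Rabs_le. lra.
Qed.

(** Nested arcs: strict order of the profiles everywhere, and a bound for their distance by that of
    the ends. *)
Lemma extend_order lo hi eta lo' hi' eta' x : graph_arc F r lo hi eta -> graph_arc F r lo' hi' eta' ->
  lo < lo' < hi ->
  0 < extend lo hi eta x - extend lo' hi' eta' x <=
    (K * exp (K * (2 * r)) + K + 1) * ((lo' - lo) + (hi - hi')).
Proof.
  intros HG HG' Hl. destruct (nest F r K HL _ _ _ _ _ _ HG HG' Hl) as [Hh Hn].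
  pose proof (ga_lt HG') as Q1. pose proof (ga_lo HG) as Q2. pose proof (ga_hi HG) as Q3.
  pose proof (exp_pos (K * (2 * r))) as He.
  assert (HKe : 0 <= K * exp (K * (2 * r))) by (apply Rmult_le_pos; lra).
  set (D := (lo' - lo) + (hi - hi')). assert (HD : 0 < D) by (unfold D; lra).
  assert (HKD : 0 <= K * exp (K * (2 * r)) * D) by (apply Rmult_le_pos; lra).
  assert (HKD' : 0 <= K * D) by (apply Rmult_le_pos; lra).
  assert (Hlip : forall z, Rabs (eta z) <= K * Rabs (z - lo) /\ Rabs (eta z) <= K * Rabs (z - hi)).
  { intros z. pose proof (ga_lip _ _ _ _ _ _ HG HK HF z lo) as P1. pose proof (ga_lip _ _ _ _ _ _ HG HK HF z hi) as P2.
    rewrite (ga_left HG lo), Rminus_0_r in P1 by lra. rewrite (ga_right HG hi), Rminus_0_r in P2 by lra. auto. }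
  pose proof (ga_nonneg _ _ _ _ _ x HG) as Hx0.
  destruct (Rlt_le_dec x lo') as [H1|H1].
  - assert (EB : extend lo' hi' eta' x = x - lo').
    { unfold extend. rewrite (ga_left HG' x), (Rmax_right 0 (lo' - x)), (Rmax_left 0 (x - hi')) by lra. ring. }
    rewrite EB. destruct (Rlt_le_dec x lo) as [H2|H2].
    + unfold extend. rewrite (ga_left HG x), (Rmax_right 0 (lo - x)), (Rmax_left 0 (x - hi)) by lra.
      unfold D in *. split; lra.
    + rewrite extend_in by lra. destruct (Hlip x) as [P _]. rewrite (Rabs_pos_eq (eta x)), (Rabs_pos_eq (x - lo)) in P by lra.
      assert (K * (x - lo) <= K * D) by (apply Rmult_le_compat_l; unfold D; lra). unfold D in *. split; lra.
  - destruct (Rlt_le_dec hi' x) as [H2|H2].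
    + assert (EB : extend lo' hi' eta' x = hi' - x).
      { unfold extend. rewrite (ga_right HG' x), (Rmax_left 0 (lo' - x)), (Rmax_right 0 (x - hi')) by lra. ring. }
      rewrite EB. destruct (Rlt_le_dec hi x) as [H3|H3].
      * unfold extend. rewrite (ga_right HG x), (Rmax_left 0 (lo - x)), (Rmax_right 0 (x - hi)) by lra.
        unfold D in *. split; lra.
      * rewrite extend_in by lra. destruct (Hlip x) as [_ P]. rewrite (Rabs_pos_eq (eta x)), (Rabs_left1 (x - hi)) in P by lra.
        assert (K * - (x - hi) <= K * D) by (apply Rmult_le_compat_l; unfold D; lra). unfold D in *. split; lra.
    + rewrite !extend_in by lra. destruct (Hn x ltac:(lra)) as [N1 N2]. split; auto.
      destruct (Hlip lo') as [P _]. pose proof (ga_nonneg _ _ _ _ _ lo' HG) as P0.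
      rewrite (Rabs_pos_eq (eta lo')), (Rabs_pos_eq (lo' - lo)) in P by lra.
      assert (Hexp : exp (K * (x - lo')) <= exp (K * (2 * r))).
      { apply exp_le_mono. apply Rmult_le_compat_l; lra. }
      pose proof (exp_pos (K * (x - lo'))).
      assert (eta lo' * exp (K * (x - lo')) <= K * (lo' - lo) * exp (K * (2 * r))) by (apply Rmult_le_compat; lra).
      assert (K * exp (K * (2 * r)) * (lo' - lo) <= K * exp (K * (2 * r)) * D) by (apply Rmult_le_compat_l; unfold D; lra).
      lra.
Qed.
End Extended.

Lemma tube_near G eps p q : G q -> Rabs (fst p - fst q) < eps -> Rabs (snd p - snd q) < eps -> tube G eps p.
Proof.
  intros HG H1 H2. exists q. split; auto. destruct p, q. split; simpl in *;
  unfold ball; simpl; unfold AbsRing_ball, abs, minus, plus, opp; simpl; auto.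
Qed.

Lemma tube_dist G eps p : tube G eps p -> exists q, G q /\ Rabs (fst p - fst q) < eps /\ Rabs (snd p - snd q) < eps.
Proof.
  intros [q [HG [H1 H2]]]. exists q. auto.
Qed.

Section Stability.
Variables (W : filippov) (d r L c : R) (beta : R -> R) (rho : R) (phi : R -> R -> R).
Hypothesis HS : system W d r L c beta rho phi.
Variables (x0 x1 sigma : R).
Hypothesis HM : matched beta rho phi x0 x1.
Hypothesis Hsigma : 0 < sigma.
Hypothesis Hleft : forall x, x0 - sigma < x < x0 -> phi d x < phi (- d) x.
Hypothesis Hright : forall x, x0 < x < x0 + sigma -> phi (- d) x < phi d x.

Let HC : chart W d r L c beta := sy_chart HS.
Let Hd : side d := ch_side HC.
Let Hd' : side (- d) := side_opp d Hd.

(** Labels a near x0 for which the arcs of both sides start left of both folds, end right of both,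
    and lie in the domain of the half-return maps. *)
Definition good_range (w : R) : Prop := 0 < w < sigma /\ forall a, Rabs (a - x0) <= w ->
  forall s, side s -> beta s - rho < a < beta s /\ forall s', side s' -> beta s < phi s' a < beta s + rho.

Lemma good_range_exists : exists w, good_range w.
Proof.
  destruct HM as [HM1 HM2].
  assert (Hs : forall s s', side s -> side s' -> exists w, 0 < w /\ forall a, Rabs (a - x0) < w ->
     beta s - rho < a < beta s /\ beta s < phi s' a < beta s + rho).
  { intros s s' Hs Hs'. destruct (HM2 s Hs) as [B1 B2]. destruct (HM2 s' Hs') as [B1' B2'].
    set (e := Rmin (x1 - beta s) (beta s + rho - x1)).
    assert (He : 0 < e) by (unfold e; apply Rmin_pos; lra).
    pose proof (sy_cont HS s' x0 Hs' B1') as Hc.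
    destruct (proj1 (continuity_pt_eps (phi s') x0) Hc e He) as [w1 [Hw1 H1]].
    exists (Rmin w1 (Rmin (x0 - (beta s - rho)) (beta s - x0))). split; [repeat apply Rmin_pos; lra|].
    intros a Ha. Rmin_bounds w1 (Rmin (x0 - (beta s - rho)) (beta s - x0)).
    Rmin_bounds (x0 - (beta s - rho)) (beta s - x0).
    specialize (H1 a ltac:(lra)). rewrite (HM1 s' Hs') in H1.
    Rmin_bounds (x1 - beta s) (beta s + rho - x1). fold e in H4, H5.
    apply Rabs_def2 in H1. apply Rabs_def2 in Ha. lra. }
  pose proof side_p as S1. pose proof side_m as S2.
  destruct (Hs 1 1 S1 S1) as (w1 & W1 & H1). destruct (Hs 1 (-1) S1 S2) as (w2 & W2 & H2).
  destruct (Hs (-1) 1 S2 S1) as (w3 & W3 & H3). destruct (Hs (-1) (-1) S2 S2) as (w4 & W4 & H4).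
  set (w := Rmin (Rmin (Rmin w1 w2) (Rmin w3 w4)) sigma / 2).
  assert (Hw : 0 < w /\ w < w1 /\ w < w2 /\ w < w3 /\ w < w4 /\ w < sigma).
  { Rmin_bounds (Rmin (Rmin w1 w2) (Rmin w3 w4)) sigma.
    Rmin_bounds (Rmin w1 w2) (Rmin w3 w4).
    Rmin_bounds w1 w2. Rmin_bounds w3 w4.
    assert (0 < Rmin (Rmin (Rmin w1 w2) (Rmin w3 w4)) sigma) by (repeat apply Rmin_pos; auto). unfold w. lra. }
  exists w. split; [lra|]. intros a Ha s [-> | ->].
  - destruct (H1 a ltac:(lra)) as [K1 K2]. destruct (H2 a ltac:(lra)) as [_ K3]. split; auto. intros s' [-> | ->]; auto.
  - destruct (H3 a ltac:(lra)) as [K1 K2]. destruct (H4 a ltac:(lra)) as [_ K3]. split; auto. intros s' [-> | ->]; auto.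
Qed.

Definition w0 : R := epsilon (inhabits 0) good_range.
Lemma w0_spec : good_range w0.
Proof. apply (epsilon_spec (inhabits 0) good_range). apply good_range_exists. Qed.

Lemma label_in a : Rabs (a - x0) <= w0 -> label_ok d beta rho phi a.
Proof. intros Ha s Hs. destruct (proj2 w0_spec a Ha s Hs) as [K1 K2]. split; auto. Qed.

Lemma label_side a s : Rabs (a - x0) <= w0 -> side s -> beta s - rho < a < beta s /\ beta s < phi s a < beta s + rho.
Proof. intros Ha Hs. destruct (proj2 w0_spec a Ha s Hs) as [K1 K2]. split; auto. Qed.

Lemma x0_in : Rabs (x0 - x0) <= w0.
Proof. unfold Rminus; rewrite Rplus_opp_r, Rabs_R0. destruct w0_spec. lra. Qed.

(** Chosen for all labels at once, because heights are compared as functions of the label. *)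
Definition profile (s a : R) : R -> R := epsilon (inhabits (fun _ => 0))
  (fun e => graph_arc (slope s (fld W s)) r a (phi s a) e).

Lemma profile_spec s a : side s -> Rabs (a - x0) <= w0 ->
  graph_arc (slope s (fld W s)) r a (phi s a) (profile s a).
Proof.
  intros Hs Ha. apply (epsilon_spec (inhabits (fun _ : R => 0)) (fun e => graph_arc (slope s (fld W s)) r a (phi s a) e)).
  apply (left_graph W d r L c beta rho phi HS); auto. apply label_side; auto.
Qed.

(** For fixed x, the height of the arc labelled a is decreasing and continuous in a; so a point near
    the loop determines the arc through it. *)
Definition height (s a x : R) : R := extend a (phi s a) (profile s a) x.

Lemma slope_const : exists K, 0 <= K /\ forall s, side s ->
  lip_y (slope s (fld W s)) r K /\ forall x y, in_box r x y -> Rabs (slope s (fld W s) x y) <= K.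
Proof.
  destruct (slope_bound HC) as [K HK]. exists K. split; auto.
  destruct (HK 1 side_p) as [[H _] _]. auto.
Qed.

Lemma height_on_arc s a x y : side s -> Rabs (a - x0) <= w0 -> 0 <= s * y -> height s a x = s * y ->
  on_arc W r s a (phi s a) (x, y).
Proof.
  intros Hs Ha Hy E. pose proof (profile_spec s a Hs Ha) as HG. pose proof (ga_lt HG) as Hlt.
  destruct (label_side a s Ha Hs) as [B1 B2].
  destruct (extend_nonneg _ _ _ _ _ x HG ltac:(fold (height s a x); lra)) as [Hx Ex]. fold (height s a x) in Ex.
  destruct (sy_arc HS s a Hs) as [_ (T & U & V & HA & HB)]; [rewrite Rabs_left; lra|].
  destruct (arc_of_graph W d r L c beta s a (phi s a) x y T U V (profile s a) (phi s a) HC Hs HA HB) as (t & Ht & Et);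
    rewrite ?Rmin_left, ?Rmax_right by lra; auto; try lra.
  exists T, U, V, t. auto.
Qed.

Lemma arc_height s a p : side s -> Rabs (a - x0) <= w0 -> on_arc W r s a (phi s a) p ->
  a <= fst p <= phi s a /\ s * snd p = height s a (fst p).
Proof.
  intros Hs Ha Hp. pose proof (profile_spec s a Hs Ha) as HG. pose proof (ga_lt HG) as Hlt.
  assert (HG' := HG). rewrite <- (Rmin_left a (phi s a)) in HG' at 1 by lra.
  destruct (on_graph_of_arc HC Hs HG' Hp) as (_ & H1 & H2).
  rewrite Rmin_left, Rmax_right in H1 by lra. split; auto. unfold height. rewrite extend_in; auto.
Qed.

Lemma height_label : exists Q, 0 < Q /\ forall s a a' x, side s -> Rabs (a - x0) <= w0 -> Rabs (a' - x0) <= w0 ->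
  Rabs (height s a x - height s a' x) <= Q * (Rabs (a - a') + Rabs (phi s a - phi s a')).
Proof.
  destruct slope_const as (K & HK & HKs). set (Q := K * exp (K * (2 * r)) + K + 1).
  assert (HQ : 0 < Q).
  { unfold Q. pose proof (exp_pos (K * (2 * r))). assert (0 <= K * exp (K * (2 * r))) by (apply Rmult_le_pos; lra). lra. }
  exists Q. split; auto.
  assert (Hgen : forall s a a' x, side s -> Rabs (a - x0) <= w0 -> Rabs (a' - x0) <= w0 -> a < a' ->
     Rabs (height s a x - height s a' x) <= Q * (Rabs (a - a') + Rabs (phi s a - phi s a'))).
  { intros s a a' x Hs A1 A2 Hlt. destruct (HKs s Hs) as [HL HF].
    destruct (label_side a s A1 Hs). destruct (label_side a' s A2 Hs).
    destruct (extend_order _ r K HK HF HL _ _ _ _ _ _ x (profile_spec s a Hs A1) (profile_spec s a' Hs A2) ltac:(lra)) as [E1 E2].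
    fold (height s a x) (height s a' x) Q in E1, E2.
    rewrite Rabs_pos_eq by lra. eapply Rle_trans; [exact E2|]. apply Rmult_le_compat_l; [lra|].
    rewrite (Rabs_minus_sym a), (Rabs_pos_eq (a' - a)) by lra. pose proof (Rle_abs (phi s a - phi s a')). lra. }
  intros s a a' x Hs A1 A2. destruct (Rtotal_order a a') as [Hl|[->|Hg]]; auto.
  - rewrite !Rminus_diag, !Rabs_R0. lra.
  - rewrite (Rabs_minus_sym (height s a x)), (Rabs_minus_sym a), (Rabs_minus_sym (phi s a)). auto.
Qed.

Lemma height_cont s x : side s -> cont_seg (fun a => height s a x) (x0 - w0) (x0 + w0).
Proof.
  intros Hs. destruct height_label as (Q & HQ & HQl). intros a Ha eps He.
  assert (A : Rabs (a - x0) <= w0) by (apply Rabs_le; lra).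
  destruct (label_side a s A Hs) as [B _].
  pose proof (sy_cont HS s a Hs B) as Hc.
  assert (HeQ : 0 < eps / (2 * Q)) by (apply Rdiv_lt_0_compat; lra).
  assert (EQ : Q * (eps / (2 * Q) + eps / (2 * Q)) = eps) by (field; lra).
  destruct (proj1 (continuity_pt_eps (phi s) a) Hc _ HeQ) as [w1 [Hw1 H1]].
  exists (Rmin w1 (eps / (2 * Q))). split; [apply Rmin_pos; auto|]. intros a' Ha' Hd1.
  Rmin_bounds w1 (eps / (2 * Q)).
  specialize (H1 a' ltac:(lra)).
  eapply Rle_lt_trans; [apply HQl; auto; apply Rabs_le; lra|]. rewrite <- EQ. apply Rmult_lt_compat_l; lra.
Qed.

Lemma height_order s a a' x : side s -> Rabs (a - x0) <= w0 -> Rabs (a' - x0) <= w0 -> a < a' ->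
  height s a' x < height s a x.
Proof.
  intros Hs A1 A2 H. destruct slope_const as (K & HK & HKs). destruct (HKs s Hs) as [HL HF].
  destruct (label_side a s A1 Hs). destruct (label_side a' s A2 Hs).
  destruct (extend_order _ r K HK HF HL _ _ _ _ _ _ x (profile_spec s a Hs A1) (profile_spec s a' Hs A2) ltac:(lra)) as [E1 _].
  fold (height s a x) (height s a' x) in E1. lra.
Qed.

Lemma height_lip : exists K, 0 <= K /\ forall s a x y, side s -> Rabs (a - x0) <= w0 ->
  Rabs (height s a x - height s a y) <= K * Rabs (x - y).
Proof.
  destruct slope_const as (K & HK & HKs). exists (K + 2). split; [lra|]. intros s a x y Hs Ha.
  destruct (HKs s Hs) as [HL HF]. apply (extend_lip (slope s (fld W s)) r K HK HF). apply profile_spec; auto.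
Qed.

Lemma height_base s x : side s -> x0 <= x <= x1 ->
  0 <= height s x0 x /\ loop W r x0 x1 (x, s * height s x0 x) /\ (x0 < x < x1 -> 0 < height s x0 x).
Proof.
  intros Hs Hx. pose proof (profile_spec s x0 Hs x0_in) as HG. rewrite (proj1 HM s Hs) in HG.
  assert (E : height s x0 x = profile s x0 x). { unfold height. rewrite (proj1 HM s Hs). apply extend_in; auto. }
  assert (P : 0 <= height s x0 x) by (rewrite E; eapply ga_nonneg; eauto).
  assert (Es : s * (s * height s x0 x) = height s x0 x) by (rewrite <- Rmult_assoc, side_sq; auto; ring).
  split; auto. split.
  - exists s. split; auto. rewrite <- (proj1 HM s Hs). apply height_on_arc; auto; [apply x0_in|rewrite Es; auto].
  - intros Hi. rewrite E. apply (ga_pos HG); auto.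
Qed.

(** Heights depend continuously on the label, uniformly in x. *)
Lemma arcs_in_tube eps : 0 < eps -> exists w, 0 < w <= w0 /\ forall a s p, Rabs (a - x0) < w -> side s ->
  on_arc W r s a (phi s a) p -> tube (loop W r x0 x1) eps p.
Proof.
  intros He. destruct height_lip as (K & HK & HKl).
  assert (Hone : forall s, side s -> exists w, 0 < w <= w0 /\ forall a p, Rabs (a - x0) < w ->
    on_arc W r s a (phi s a) p -> tube (loop W r x0 x1) eps p).
  { intros s Hs. destruct height_label as (Q & HQ & HQl).
    set (Z := 2 * Q + 2 * K + 2). assert (HZ : 2 <= Z) by (unfold Z; lra).
    assert (HeZ : 0 < eps / (2 * Z)) by (apply Rdiv_lt_0_compat; lra).
    assert (EZ : Z * (eps / (2 * Z)) = eps / 2) by (field; lra).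
    destruct (label_side x0 s x0_in Hs) as [B0 _].
    pose proof (sy_cont HS s x0 Hs B0) as Hc.
    destruct (proj1 (continuity_pt_eps (phi s) x0) Hc _ HeZ) as [w1 [Hw1 H1]].
    pose proof (proj1 w0_spec) as Hw0.
    exists (Rmin w0 (Rmin w1 (eps / (2 * Z)))). split; [split; [repeat apply Rmin_pos; lra|apply Rmin_l]|].
    intros a p Ha Hp.
    Rmin_bounds w0 (Rmin w1 (eps / (2 * Z))).
    Rmin_bounds w1 (eps / (2 * Z)).
    specialize (H1 a ltac:(lra)). rewrite (proj1 HM s Hs) in H1.
    set (h := eps / (2 * Z)) in *.
    assert (A : Rabs (a - x0) <= w0) by lra.
    destruct (arc_height s a p Hs A Hp) as [Hx Hy]. destruct p as [x y]. simpl in Hx, Hy.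
    pose proof (matched_lt W d r L c beta rho phi HS x0 x1 HM) as H01.
    set (x' := clamp x0 x1 x).
    assert (Hx' : x0 <= x' <= x1) by (apply clamp_in; lra).
    assert (Hdx : Rabs (x - x') <= h).
    { assert (Ha' : Rabs (a - x0) < h) by lra. apply Rabs_def2 in Ha'. apply Rabs_def2 in H1.
      apply Rabs_le. unfold x', clamp, Rmax, Rmin. repeat destruct (Rle_dec _ _); lra. }
    destruct (height_base s x' Hs Hx') as (P1 & P2 & _).
    apply tube_near with (x', s * height s x0 x'); auto; simpl.
    - eapply Rle_lt_trans; [exact Hdx|]. nra.
    - assert (Ey : y = s * height s a x) by (rewrite <- Hy, <- Rmult_assoc, side_sq; auto; ring).
      rewrite Ey, <- Rmult_minus_distr_l, side_abs by auto.
      assert (G1 : Rabs (height s a x - height s x0 x) <= Q * (2 * h)).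
      { eapply Rle_trans; [apply HQl; auto; apply x0_in|]. apply Rmult_le_compat_l; [lra|].
        rewrite (proj1 HM s Hs). lra. }
      pose proof (HKl s x0 x x' Hs x0_in) as G2.
      assert (K * Rabs (x - x') <= K * h) by (apply Rmult_le_compat_l; auto).
      pose proof (Rabs_triang (height s a x - height s x0 x) (height s x0 x - height s x0 x')) as TR.
      replace (height s a x - height s x0 x + (height s x0 x - height s x0 x')) with (height s a x - height s x0 x') in TR by ring.
      assert (Z * h = 2 * Q * h + 2 * K * h + 2 * h) by (unfold Z; ring).
      assert (0 <= K * h) by (apply Rmult_le_pos; lra). lra. }
  destruct (Hone 1 side_p) as (w1 & W1 & H1). destruct (Hone (-1) side_m) as (w2 & W2 & H2).
  exists (Rmin w1 w2). Rmin_bounds w1 w2.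
  split; [split; [apply Rmin_pos; lra|lra]|].
  intros a s p Ha [-> | ->]; [apply H1; lra|apply H2; lra].
Qed.

(** Both profiles of the loop vanish exactly at its two ends. This handles points near the line,
    which may be on the other side than the point of the loop to which they are close. *)
Lemma heights_comparable s eps : side s -> 0 < eps -> exists m, 0 < m /\ forall x, x0 <= x <= x1 ->
  height (- s) x0 x < m -> height s x0 x < eps.
Proof.
  intros Hs He. destruct height_lip as (K & HK & HKl). pose proof (side_opp s Hs) as Hs'.
  set (h := eps / (2 * (K + 1))). assert (Hh : 0 < h) by (apply Rdiv_lt_0_compat; lra).
  assert (Eh : (K + 1) * h = eps / 2) by (unfold h; field; lra).
  pose proof (matched_lt W d r L c beta rho phi HS x0 x1 HM) as H01.
  assert (Hends : height s x0 x0 = 0 /\ height s x0 x1 = 0).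
  { pose proof (profile_spec s x0 Hs x0_in) as HG. rewrite (proj1 HM s Hs) in HG.
    unfold height. rewrite (proj1 HM s Hs). rewrite !extend_in by lra. split; [apply (ga_left HG)|apply (ga_right HG)]; lra. }
  assert (Hnear : forall x, x <= x0 + h \/ x1 - h <= x -> x0 <= x <= x1 -> height s x0 x < eps).
  { intros x Hx Hin. destruct (height_base s x Hs Hin) as [P _].
    assert (K * h <= (K + 1) * h) by (apply Rmult_le_compat_r; lra).
    destruct Hx as [Hx|Hx].
    - pose proof (HKl s x0 x x0 Hs x0_in) as E. rewrite (proj1 Hends), Rminus_0_r, !Rabs_pos_eq in E by lra.
      assert (K * (x - x0) <= K * h) by (apply Rmult_le_compat_l; lra). lra.
    - pose proof (HKl s x0 x x1 Hs x0_in) as E. rewrite (proj2 Hends), Rminus_0_r, (Rabs_pos_eq (height _ _ _)), (Rabs_left1 (x - x1)) in E by lra.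
      assert (K * - (x - x1) <= K * h) by (apply Rmult_le_compat_l; lra). lra. }
  destruct (Rle_dec (x0 + h) (x1 - h)) as [Hle|Hgt].
  - destruct (pos_lower_bound (height (- s) x0) (x0 + h) (x1 - h) Hle) as (m & Hm & Hlow).
    + apply lip_cont_seg with K; auto. intros y z _ _. apply HKl; auto. apply x0_in.
    + intros x Hx. apply height_base; auto; lra.
    + exists m. split; auto. intros x Hx Hlt. destruct (Rlt_le_dec x (x0 + h)); [apply Hnear; lra|].
      destruct (Rlt_le_dec (x1 - h) x); [apply Hnear; lra|]. specialize (Hlow x ltac:(lra)). lra.
  - exists 1. split; [lra|]. intros x Hx _. destruct (Rlt_le_dec x (x0 + h)); apply Hnear; lra.
Qed.

(** A neighbourhood of the loop is covered by arcs with labels near x0: at a point near the loop,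
    the heights of the labels x0 - w / 2 and x0 + w / 2 enclose its own, and intermediate values
    give a label in between. *)
Lemma tube_labels w : 0 < w <= w0 -> exists e, 0 < e /\ forall p, tube (loop W r x0 x1) e p ->
  exists s a, side s /\ Rabs (a - x0) < w /\ on_arc W r s a (phi s a) p.
Proof.
  intros Hw. destruct height_lip as (K & HK & HKl).
  pose proof (matched_lt W d r L c beta rho phi HS x0 x1 HM) as H01.
  set (p := x0 - w / 2). set (q := x0 + w / 2).
  assert (Ap : Rabs (p - x0) <= w0) by (unfold p; apply Rabs_le; lra).
  assert (Aq : Rabs (q - x0) <= w0) by (unfold q; apply Rabs_le; lra).
  assert (Hcs : forall s a a', side s -> Rabs (a - x0) <= w0 -> Rabs (a' - x0) <= w0 -> a < a' ->
    exists m, 0 < m /\ forall x, x0 <= x <= x1 -> m <= height s a x - height s a' x).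
  { intros s a a' Hs A1 A2 Haa. apply (pos_lower_bound (fun x => height s a x - height s a' x)); [lra| |].
    - assert (Hc : forall z, Rabs (z - x0) <= w0 -> cont_seg (height s z) x0 x1).
      { intros z Az. apply lip_cont_seg with K; [auto|lra|]. intros y y' _ _. apply HKl; auto. }
      apply cont_seg_minus; auto; lra.
    - intros x Hx. pose proof (height_order s a a' x Hs A1 A2 Haa). lra. }
  assert (Hone : forall s, side s -> exists e, 0 < e /\ forall x y, 0 <= s * y -> tube (loop W r x0 x1) e (x, y) ->
     exists a, Rabs (a - x0) < w /\ on_arc W r s a (phi s a) (x, y)).
  { intros s Hs. pose proof (side_opp s Hs) as Hs'.
    destruct (Hcs s p x0 Hs Ap x0_in ltac:(unfold p; lra)) as (m1 & Hm1 & L1).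
    destruct (Hcs s x0 q Hs x0_in Aq ltac:(unfold q; lra)) as (m2 & Hm2 & L2).
    set (e1 := Rmin m1 m2 / (2 * (K + 1))).
    assert (Hmm : 0 < Rmin m1 m2) by (apply Rmin_pos; auto). Rmin_bounds m1 m2.
    assert (He1 : 0 < e1) by (apply Rdiv_lt_0_compat; lra).
    assert (Ee1 : (K + 1) * e1 = Rmin m1 m2 / 2) by (unfold e1; field; lra).
    destruct (heights_comparable s e1 Hs He1) as (m3 & Hm3 & L3).
    exists (Rmin e1 m3). split; [apply Rmin_pos; auto|]. intros x y Hy Ht.
    Rmin_bounds e1 m3.
    assert (Hg : exists gx, x0 <= gx <= x1 /\ Rabs (x - gx) < e1 /\ Rabs (s * y - height s x0 gx) < e1).
    { destruct (tube_dist _ _ _ Ht) as ([gx gy] & (s' & Hs1 & Hgo) & D1 & D2). simpl in D1, D2.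
      rewrite <- (proj1 HM s' Hs1) in Hgo. destruct (arc_height s' x0 (gx, gy) Hs1 x0_in Hgo) as [G1 G2]. simpl in G1, G2.
      rewrite (proj1 HM s' Hs1) in G1.
      exists gx. split; auto. split; [lra|]. destruct (side_two s s' Hs Hs1) as [-> | ->].
      - rewrite <- G2, <- Rmult_minus_distr_l, side_abs by auto. lra.
      - destruct (height_base (- s) gx Hs' G1) as [P1 _]. destruct (height_base s gx Hs G1) as [P2 _].
        rewrite <- (side_abs s (y - gy)) in D2 by auto. rewrite Rmult_minus_distr_l in D2. apply Rabs_def2 in D2.
        assert (s * gy = - height (- s) x0 gx) by lra.
        specialize (L3 gx G1 ltac:(lra)). apply Rabs_def1; lra. }
    destruct Hg as (gx & G1 & G2 & G3). apply Rabs_def2 in G3.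
    specialize (L1 gx G1). specialize (L2 gx G1).
    pose proof (HKl s p x gx Hs Ap) as P1. pose proof (HKl s q x gx Hs Aq) as P2.
    apply Rabs_le_between in P1. apply Rabs_le_between in P2.
    assert (K * Rabs (x - gx) <= K * e1) by (apply Rmult_le_compat_l; lra).
    destruct (seg_IVT (fun a => height s a x) p q (s * y)) as [a [Ha E]]; [unfold p, q; lra| | |].
    - eapply cont_seg_sub; [| |apply (height_cont s x Hs)]; unfold p, q; lra.
    - rewrite Rmin_right, Rmax_left by lra. lra.
    - assert (Aa : Rabs (a - x0) < w) by (unfold p, q in Ha; apply Rabs_def1; lra).
      exists a. split; auto. apply height_on_arc; auto; lra. }
  destruct (Hone 1 side_p) as (e1 & He1 & H1). destruct (Hone (-1) side_m) as (e2 & He2 & H2).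
  exists (Rmin e1 e2). split; [apply Rmin_pos; auto|]. intros [x y] Ht.
  assert (Hsub : forall e, Rmin e1 e2 <= e -> tube (loop W r x0 x1) e (x, y)).
  { intros e Hle. destruct (tube_dist _ _ _ Ht) as (g & Hg & D1 & D2). apply tube_near with g; auto; lra. }
  destruct (Rle_dec 0 y).
  - destruct (H1 x y ltac:(lra) (Hsub _ (Rmin_l _ _))) as (a & Ha & Ho). exists 1, a. split; [left; auto|auto].
  - destruct (H2 x y ltac:(lra) (Hsub _ (Rmin_r _ _))) as (a & Ha & Ho). exists (-1), a. split; [right; auto|auto].
Qed.

(** The return map on the left of the folds. *)
Definition turn (a : R) : R := phi (- d) (phi d a).

(** The position of turn a relative to a and to x0 is read off from the order of the right ends,
    through return_order. *)
Lemma turn_between a : Rabs (a - x0) <= w0 ->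
  (x0 < a -> x0 < turn a < a) /\ (a < x0 -> a < turn a < x0) /\ (a = x0 -> turn a = x0).
Proof.
  intros Ha. pose proof (proj1 w0_spec) as Hw.
  destruct (proj2 w0_spec a Ha (- d) Hd') as [B1 B2]. specialize (B2 d Hd).
  destruct (proj2 w0_spec a Ha d Hd) as [B1' B2'].
  destruct (proj2 w0_spec x0 x0_in (- d) Hd') as [C1 _]. destruct (proj2 w0_spec x0 x0_in d Hd) as [C1' _].
  apply Rabs_le_between in Ha.
  destruct (return_order W d r L c beta rho phi HS (- d) a (phi d a) Hd' B1 B2) as [R1 R2].
  destruct (return_order W d r L c beta rho phi HS (- d) x0 (phi d a) Hd' C1 B2) as [R3 R4].
  rewrite (proj1 HM (- d) Hd') in R3, R4. unfold turn.
  split; [|split].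
  - intros Hlt. split; [apply R4; rewrite <- (proj1 HM d Hd)|apply R1, Hright; lra].
    apply (return_decr W d r L c beta rho phi HS); auto; lra.
  - intros Hlt. split; [apply R2, Hleft; lra|apply R3; rewrite <- (proj1 HM d Hd)].
    apply (return_decr W d r L c beta rho phi HS); auto; lra.
  - intros ->. rewrite (proj1 HM d Hd). apply (matched_back W d r L c beta rho phi HS x0 x1); auto.
Qed.

Lemma turn_closer a : Rabs (a - x0) <= w0 -> Rabs (turn a - x0) <= Rabs (a - x0).
Proof.
  intros Ha. destruct (turn_between a Ha) as (T1 & T2 & T3).
  destruct (Rtotal_order a x0) as [H|[H|H]].
  - specialize (T2 H). rewrite !Rabs_left by lra. lra.
  - rewrite (T3 H), H. lra.
  - specialize (T1 H). rewrite !Rabs_pos_eq by lra. lra.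
Qed.

Lemma turn_return a : Rabs (a - x0) <= w0 -> phi (- d) (turn a) = phi d a.
Proof.
  intros Ha. pose proof (turn_closer a Ha) as Ht.
  destruct (proj2 w0_spec (turn a) ltac:(lra) (- d) Hd') as [B1 _].
  destruct (proj2 w0_spec a Ha (- d) Hd') as [_ B2]. specialize (B2 d Hd).
  destruct (return_order W d r L c beta rho phi HS (- d) (turn a) (phi d a) Hd' B1 B2) as [R1 R2].
  destruct (Rtotal_order (phi (- d) (turn a)) (phi d a)) as [H|[H|H]]; auto; exfalso.
  - apply R1 in H. unfold turn in H. lra.
  - apply R2 in H. unfold turn in H. lra.
Qed.

Lemma cycle_in_tube eps w a p : (forall a s p, Rabs (a - x0) < w -> side s ->
  on_arc W r s a (phi s a) p -> tube (loop W r x0 x1) eps p) -> w <= w0 -> Rabs (a - x0) < w ->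
  on_cycle W r d phi a p -> tube (loop W r x0 x1) eps p.
Proof.
  intros Ht Hw Ha [H|H].
  - apply (Ht a d); auto.
  - apply (Ht (turn a) (- d)); auto.
    + eapply Rle_lt_trans; [apply turn_closer; lra|auto].
    + rewrite turn_return by lra. apply on_arc_swap. exact H.
Qed.

(** The narrowest arc is the innermost one. *)
Lemma min_length a : Rabs (a - x0) <= w0 -> phi d (x0 + w0) - (x0 + w0) <= phi d a - a.
Proof.
  intros Ha. pose proof (proj1 w0_spec) as Hw0.
  assert (A1 : Rabs (x0 + w0 - x0) <= w0) by (apply Rabs_le; lra).
  destruct (label_side _ d A1 Hd) as [B1 _]. destruct (label_side _ d Ha Hd) as [B2 _].
  apply Rabs_le_between in Ha. destruct (Req_dec a (x0 + w0)) as [->|Hn]; [lra|].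
  pose proof (return_decr W d r L c beta rho phi HS d a (x0 + w0) Hd ltac:(lra) ltac:(lra) ltac:(lra)). lra.
Qed.

Lemma stays_in_tube eps w u v b t0 : (forall a s p, Rabs (a - x0) < w -> side s ->
  on_arc W r s a (phi s a) p -> tube (loop W r x0 x1) eps p) -> w <= w0 -> motion W r u v 0 b ->
  0 <= t0 <= b -> v t0 = 0 -> Rabs (u t0 - x0) < w ->
  forall t, t0 <= t <= b -> tube (loop W r x0 x1) eps (u t, v t).
Proof.
  intros Ht Hw Hmo Ht0 Hv Hu t Htb. pose proof (proj1 w0_spec) as Hw0.
  assert (A1 : Rabs (x0 + w0 - x0) <= w0) by (apply Rabs_le; lra).
  destruct (cycle_stay W d r L c beta rho phi HS (fun a => Rabs (a - x0) < w) (phi d (x0 + w0) - (x0 + w0)) u v 0 b)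
    with (t0 := t0) (t := t) as (z & Hz & Hc); auto.
  - destruct (label_side _ d A1 Hd). lra.
  - intros z Hz. split; [apply label_in; lra|]. split; [eapply Rle_lt_trans; [apply turn_closer; lra|auto]|].
    apply min_length; lra.
  - apply (cycle_in_tube eps w z); auto.
Qed.

(** A motion that starts on a labelled arc stays on it until the line, and if this was the right
    end, on the next arc until the left end. The labels of both are at distance less than w from
    x0. *)
Lemma reaches_left s a u v w eps : (forall a s p, Rabs (a - x0) < w -> side s ->
  on_arc W r s a (phi s a) p -> tube (loop W r x0 x1) eps p) -> w <= w0 -> side s -> Rabs (a - x0) < w ->
  forall t0, 0 <= t0 -> on_arc W r s a (phi s a) (u t0, v t0) ->
  exists T, 0 <= T /\ forall b, t0 <= b -> motion W r u v 0 b ->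
    (forall t, t0 <= t <= b -> t <= t0 + T -> tube (loop W r x0 x1) eps (u t, v t)) /\
    (t0 + T <= b -> v (t0 + T) = 0 /\ (u (t0 + T) = a \/ u (t0 + T) = turn a)).
Proof.
  intros Ht Hw Hs Ha t0 Ht0 Ho. destruct (chart_bounds HC) as (M & HM0 & HMb).
  assert (HM' : forall s, side s -> forall y z, in_box r y z -> Rabs (vX (fld W s) y z) <= M) by (intros; apply HMb; auto).
  assert (Ha' : Rabs (a - x0) <= w0) by lra.
  destruct (label_facts W d r L c beta rho phi HS a (label_in a Ha')) as (O1 & S1 & O2 & S2 & D1 & D2).
  fold (turn a) in O2, D2.
  assert (Hta : Rabs (turn a - x0) < w) by (eapply Rle_lt_trans; [apply turn_closer; lra|auto]).
  assert (HB : forall a', Rabs (a' - x0) < w -> forall t1, 0 <= t1 -> on_arc W r (- d) (phi (- d) a') a' (u t1, v t1) ->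
    exists T, 0 <= T /\ forall b, t1 <= b -> motion W r u v 0 b ->
    (forall t, t1 <= t <= b -> t <= t1 + T -> tube (loop W r x0 x1) eps (u t, v t)) /\
    (t1 + T <= b -> u (t1 + T) = a' /\ v (t1 + T) = 0)).
  { intros a' Ha1 t1 Ht1 Ho1.
    destruct (label_side a' (- d) ltac:(lra) Hd') as [K1 K2].
    assert (K3 : same_sign_at W (- d) (phi (- d) a')).
    { destruct (in_r W r phi (- d) a' Hd') as [_ Hr].
      { apply (arc_start_on W d r L c beta rho phi); auto. rewrite Rabs_left; lra. }
      apply (same_sign_right W d r L c beta); auto. intros s' Hs'.
      destruct (proj2 w0_spec a' ltac:(lra) s' Hs') as [_ K]. specialize (K (- d) Hd'). lra. }
    destruct (leg W d r L c beta (- d) (phi (- d) a') a' (- d) u v 0 t1 M HC Hd' (HM' _ Hd')) as (T & HT & _ & HTb); auto.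
    { rewrite Ropp_mult_distr_l_reverse, (side_sq d Hd). lra. }
    exists T. split; auto. intros b Hb Hmo. destruct (HTb b Hb Hmo) as [L1 L2]. split; auto.
    intros t Htb Hle. apply (Ht a' (- d)); auto. apply on_arc_swap. auto. }
  destruct (side_two d s Hd Hs) as [-> | ->].
  - destruct (leg W d r L c beta d a (phi d a) d u v 0 t0 M HC Hd (HM' _ Hd) D1 S1 Ht0 Ho) as (T1 & HT1 & _ & K1).
    (* Otherwise the motion does not last until the end of the first leg. *)
    destruct (excluded_middle_informative (on_arc W r (- d) (phi (- d) (turn a)) (turn a) (u (t0 + T1), v (t0 + T1)))) as [Ho2|Hno].
    + destruct (HB (turn a) Hta (t0 + T1) ltac:(lra) Ho2) as (T2 & HT2 & K2).
      exists (T1 + T2). split; [lra|]. intros b Hb Hmo. destruct (K1 b Hb Hmo) as [K3 K4]. split.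
      * intros t Htb Hle. destruct (Rle_dec t (t0 + T1)) as [Hl|Hg].
        -- apply (Ht a d); auto.
        -- destruct (K2 b ltac:(lra) Hmo) as [K5 _]. apply K5; lra.
      * intros Hle. destruct (K2 b ltac:(lra) Hmo) as [_ K6]. rewrite <- Rplus_assoc. destruct (K6 ltac:(lra)). auto.
    + exists T1. split; auto. intros b Hb Hmo. destruct (K1 b Hb Hmo) as [K3 K4]. split.
      * intros t Htb Hle. apply (Ht a d); auto.
      * intros Hle. exfalso. destruct (K4 Hle) as [E1 E2]. apply Hno. rewrite E1, E2, turn_return by lra. exact O2.
  - destruct (HB a Ha t0 Ht0 (on_arc_swap _ _ _ _ _ _ Ho)) as (T & HT & K). exists T. split; auto.
    intros b Hb Hmo. destruct (K b Hb Hmo) as [K1 K2]. split; auto. intros Hle. destruct (K2 Hle); auto.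
Qed.

Fixpoint turns (n : nat) (a : R) : R := match n with O => a | S m => turn (turns m a) end.

Lemma turns_closer n a : Rabs (a - x0) <= w0 -> Rabs (turns n a - x0) <= Rabs (a - x0).
Proof.
  intros Ha. induction n; simpl; [lra|]. eapply Rle_trans; [apply turn_closer; lra|auto].
Qed.

Lemma turns_side n a e : side e -> Rabs (a - x0) <= w0 -> 0 <= e * (a - x0) ->
  0 <= e * (turns n a - x0) /\ e * (turns (S n) a - x0) <= e * (turns n a - x0).
Proof.
  intros He Ha Hs.
  assert (Hpos : 0 <= e * (turns n a - x0)).
  { induction n; simpl; auto. pose proof (turns_closer n a Ha) as Hc.
    destruct (turn_between (turns n a) ltac:(lra)) as (T1 & T2 & T3).
    destruct (Rtotal_order (turns n a) x0) as [H|[H|H]].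
    - specialize (T2 H). destruct He as [-> | ->]; lra.
    - rewrite (T3 H). lra.
    - specialize (T1 H). destruct He as [-> | ->]; lra. }
  split; auto. simpl. pose proof (turns_closer n a Ha) as Hc.
  destruct (turn_between (turns n a) ltac:(lra)) as (T1 & T2 & T3).
  destruct (Rtotal_order (turns n a) x0) as [H|[H|H]].
  - specialize (T2 H). destruct He as [-> | ->]; lra.
  - rewrite (T3 H), H. lra.
  - specialize (T1 H). destruct He as [-> | ->]; lra.
Qed.

(** The labels are monotone, and at their limit the two half-return maps agree; the only such point
    is x0. *)
Lemma turns_converge a : Rabs (a - x0) <= w0 -> forall w, 0 < w -> exists n, Rabs (turns n a - x0) < w.
Proof.
  intros Ha w Hw.
  assert (exists e, side e /\ 0 <= e * (a - x0)) as (e & He & Hea).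
  { destruct (Rle_dec x0 a); [exists 1; split; [left; auto|lra]|exists (-1); split; [right; auto|lra]]. }
  set (U := fun n => e * (turns n a - x0)).
  assert (HU0 : forall n, 0 <= U n) by (intros n; apply (turns_side n a e He Ha Hea)).
  assert (Hdec : Un_decreasing U) by (intros n; apply (turns_side n a e He Ha Hea)).
  destruct (decreasing_cv U Hdec) as [l Hl].
  { exists 0. intros z [n ->]. unfold opp_seq. specialize (HU0 n). lra. }
  assert (Hl0 : 0 <= l).
  { destruct (Rle_dec 0 l); auto. exfalso. destruct (Hl (- l) ltac:(lra)) as [n0 Hn]. specialize (Hn n0 (Nat.le_refl _)).
    unfold R_dist in Hn. specialize (HU0 n0). rewrite Rabs_pos_eq in Hn by lra. lra. }
  assert (HUa : forall n, U n <= Rabs (a - x0)).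
  { intros n. pose proof (turns_closer n a Ha). pose proof (Rle_abs (U n)). unfold U in *. rewrite side_abs in H0 by auto. lra. }
  assert (Hla : l <= Rabs (a - x0)).
  { destruct (Rle_dec l (Rabs (a - x0))); auto. exfalso. destruct (Hl (l - Rabs (a - x0)) ltac:(lra)) as [n0 Hn]. specialize (Hn n0 (Nat.le_refl _)).
    unfold R_dist in Hn. specialize (HUa n0). apply Rabs_def2 in Hn. lra. }
  set (y := x0 + e * l).
  assert (Hy : Rabs (y - x0) = l).
  { unfold y. replace (x0 + e * l - x0) with (e * l) by ring. rewrite side_abs, Rabs_pos_eq; auto. }
  assert (Hcv : Un_cv (fun n => turns n a) y).
  { intros eps Heps. destruct (Hl eps Heps) as [n0 Hn]. exists n0. intros n Hge. specialize (Hn n Hge). unfold R_dist in *.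
    unfold y. replace (turns n a - (x0 + e * l)) with (e * (U n - l)).
    - rewrite side_abs; auto.
    - unfold U. replace (e * (e * (turns n a - x0) - l)) with ((e * e) * (turns n a - x0) - e * l) by ring.
      rewrite (side_sq e He). ring. }
  assert (Hl00 : l = 0).
  { destruct (Req_dec l 0) as [|Hn0]; auto. exfalso.
    assert (Hyw : Rabs (y - x0) <= w0) by lra.
    destruct (label_side y d Hyw Hd) as [B1 _]. destruct (label_side y (- d) Hyw Hd') as [B2 _].
    pose proof (sy_cont HS d y Hd B1) as C1. pose proof (sy_cont HS (- d) y Hd' B2) as C2.
    assert (Hcv1 : Un_cv (fun n => turns (S n) a) y).
    { intros eps Heps. destruct (Hcv eps Heps) as [n0 Hn]. exists n0. intros n Hge. apply Hn. lia. }
    pose proof (continuity_seq (phi d) _ y C1 Hcv) as E1. pose proof (continuity_seq (phi (- d)) _ y C2 Hcv1) as E2.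
    assert (E : phi d y = phi (- d) y).
    { apply (UL_sequence (fun n => phi d (turns n a))); auto. intros eps Heps. destruct (E2 eps Heps) as [n0 Hn]. exists n0. intros n Hge.
      specialize (Hn n Hge). simpl in Hn. rewrite turn_return in Hn; auto. pose proof (turns_closer n a Ha). lra. }
    pose proof (proj1 w0_spec) as Hw0. destruct He as [-> | ->].
    - specialize (Hright y ltac:(unfold y; lra)). lra.
    - specialize (Hleft y ltac:(unfold y; lra)). lra. }
  destruct (Hl w Hw) as [n0 Hn]. exists n0. specialize (Hn n0 (Nat.le_refl _)). unfold R_dist in Hn. rewrite Hl00, Rminus_0_r in Hn.
  unfold U in Hn. rewrite side_abs in Hn; auto.
Qed.

(** A solution that starts near the loop lies on an arc with a label near x0; afterwards it makes
    full turns with labels that come closer to x0, by turn_closer, and converge to it. *)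
Lemma loop_stable : asymptotically_stable W (loop W r x0 x1).
Proof.
  pose proof (ch_lip HC) as HLip.
  split.
  - intros eps. destruct (arcs_in_tube eps (cond_pos eps)) as (w & Hw & Htube).
    destruct (tube_labels w Hw) as (e & He & Hlab). exists (mkposreal e He). intros u v T HT Htr Hin t Ht.
    simpl in Hin. pose proof (traj_motion W r L u v 0 T HLip Htr) as Hmo.
    destruct (Hlab _ Hin) as (s & a & Hs & Ha & Ho).
    destruct (reaches_left s a u v w eps Htube ltac:(lra) Hs Ha 0 ltac:(lra) Ho) as (T1 & HT1 & K).
    destruct (K T ltac:(lra) Hmo) as [K1 K2].
    destruct (Rle_dec t (0 + T1)) as [Hle|Hgt]; [apply K1; auto|].
    destruct (K2 ltac:(lra)) as [E1 E2].
    apply (stays_in_tube eps w u v T (0 + T1)); auto; try lra.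
    destruct E2 as [-> | ->]; auto. eapply Rle_lt_trans; [apply turn_closer; lra|auto].
  - destruct (arcs_in_tube 1 ltac:(lra)) as (w & Hw & Htube).
    destruct (tube_labels w Hw) as (e & He & Hlab). exists (mkposreal e He). intros u v Htr Hin eps. simpl in Hin.
    assert (Hmo : forall b, 0 < b -> motion W r u v 0 b) by (intros; apply traj_motion with L; auto).
    destruct (Hlab _ Hin) as (s & a & Hs & Ha & Ho).
    assert (Hstart : exists a0 t0, Rabs (a0 - x0) < w /\ 0 <= t0 /\ u t0 = a0 /\ v t0 = 0).
    { destruct (reaches_left s a u v w 1 Htube ltac:(lra) Hs Ha 0 ltac:(lra) Ho) as (T1 & HT1 & K).
      destruct (K (0 + T1 + 1) ltac:(lra) (Hmo (0 + T1 + 1) ltac:(lra))) as [_ K2]. destruct (K2 ltac:(lra)) as [E1 E2].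
      exists (u (0 + T1)), (0 + T1). split; [|split; [lra|split; auto]].
      destruct E2 as [-> | ->]; auto. eapply Rle_lt_trans; [apply turn_closer; lra|auto]. }
    destruct Hstart as (a0 & t0 & Ha0 & Ht0 & Eu & Ev).
    assert (Hn : forall n, exists tn, 0 <= tn /\ u tn = turns n a0 /\ v tn = 0).
    { induction n; [exists t0; auto|]. destruct IHn as (tn & Htn & En1 & En2).
      pose proof (turns_closer n a0 ltac:(lra)) as Hc. set (z := turns n a0) in *.
      destruct (label_facts W d r L c beta rho phi HS z (label_in z ltac:(lra))) as (O1 & S1 & O2 & S2 & D1 & D2).
      destruct (chart_bounds HC) as (M & HM0 & HMb).
      destruct (leg W d r L c beta d z (phi d z) d u v 0 tn M HC Hd ltac:(intros; apply HMb; auto) D1 S1 Htn) as (T1 & HT1 & _ & K1).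
      { rewrite En1, En2. auto. }
      destruct (K1 (tn + T1 + 1) ltac:(lra) (Hmo (tn + T1 + 1) ltac:(lra))) as [_ K2]. destruct (K2 ltac:(lra)) as [E1 E2].
      destruct (leg W d r L c beta (- d) (phi d z) (turn z) (- d) u v 0 (tn + T1) M HC Hd' ltac:(intros; apply HMb; auto) D2 S2 ltac:(lra))
        as (T2 & HT2 & _ & K3).
      { rewrite E1, E2. auto. }
      destruct (K3 (tn + T1 + T2 + 1) ltac:(lra) (Hmo (tn + T1 + T2 + 1) ltac:(lra))) as [_ K4]. destruct (K4 ltac:(lra)) as [E3 E4].
      exists (tn + T1 + T2). split; [lra|auto]. }
    destruct (arcs_in_tube eps (cond_pos eps)) as (w' & Hw' & Htube').
    destruct (turns_converge a0 ltac:(lra) w' ltac:(lra)) as [n Hnw].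
    destruct (Hn n) as (tn & Htn & En1 & En2). exists tn. intros t Ht1 Ht2.
    apply (stays_in_tube eps w' u v (t + 1) tn); auto; try lra; [apply Hmo; lra|rewrite En1; auto].
Qed.
End Stability.

(** * The unshifted system near the origin *)

(** Reflection of the lower half-plane, as in the definition of slope. *)
Lemma lip_deriv_reflect f g r L s : side s -> lip_deriv f g r L ->
  lip_deriv (fun x y => s * f x (s * y)) (fun x y => g x (s * y)) r L.
Proof.
  intros Hs [H1 H2 H3 H4 H5].
  assert (HB : forall x y, in_box r x y -> in_box r x (s * y)).
  { intros x y [B1 B2]. split; auto. rewrite side_abs; auto. }
  assert (Hd : forall y y', Rabs (s * y - s * y') = Rabs (y - y')).
  { intros. rewrite <- Rmult_minus_distr_l. apply side_abs; auto. }
  constructor; auto.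
  - intros x y x' y' B B'. rewrite <- Rmult_minus_distr_l, side_abs by auto.
    eapply Rle_trans; [apply H2; auto|]. rewrite Hd. lra.
  - intros x y x' y' B B'. eapply Rle_trans; [apply H3; auto|]. rewrite Hd. lra.
  - intros x y B. rewrite side_abs by auto. apply H4; auto.
  - intros x y y' B B'. pose proof (H5 x (s * y) (s * y') (HB _ _ B) (HB _ _ B')) as T.
    replace (s * f x (s * y') - s * f x (s * y) - g x (s * y) * (y' - y)) with
      (s * (f x (s * y') - f x (s * y) - g x (s * y) * (s * y' - s * y)) + (s * s - 1) * (g x (s * y) * (y' - y))) by ring.
    rewrite (side_sq s Hs), Rminus_diag, Rmult_0_l, Rplus_0_r, side_abs by auto.
    eapply Rle_trans; [exact T|]. replace ((s * y' - s * y) ^ 2) with (s * s * (y' - y) ^ 2) by ring.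
    rewrite (side_sq s Hs). lra.
Qed.

(** At a tangency of even order 2 k, vY = x^(2 k - 1) h (x) on the line, where h is C^1 and h (0)
    has the sign of the first non-vanishing derivative. This is the power series of vY along the
    line. *)
Lemma tangency_data f k : analytic_near_origin f -> (1 <= k)%nat -> tangency_order f k ->
  exists gX gY h r L K, 0 < r /\ lip_deriv (vX f) gX r L /\ lip_deriv (vY f) gY r L /\ 0 <= K /\
    (forall x, Rabs x < r -> vY f x 0 = x ^ (2 * k - 1) * h x) /\
    (forall x, Rabs x < r -> exists l : R, is_derive h x l /\ Rabs l <= K) /\
    (0 < h 0 * dxY f (2 * k - 1)).
Proof.
  intros Han Hk (HX0 & HY0 & Hder & Hlead).
  apply locally_singleton in Han. simpl in Han. destruct Han as [HaX HaY].
  destruct (analytic_lip_deriv _ HaX) as (gX & r1 & L1 & Hr1 & HX & _).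
  destruct (analytic_lip_deriv _ HaY) as (gY & r2 & L2 & Hr2 & HY & a & Ha).
  assert (Hrad : Rbar_lt 0 (CV_radius a)).
  { replace 0 with (Rabs 0) by apply Rabs_R0. apply (radius_of_ex a r2); [|rewrite Rabs_R0; auto].
    intros y Hy. eexists; apply Ha; auto. }
  assert (Hcoef : forall i, dxY f i = a i * INR (Factorial.fact i)).
  { intros i. unfold dxY. rewrite <- Derive_n_coef by auto. apply Derive_n_ext_loc.
    exists (mkposreal r2 Hr2). intros y Hy. assert (Hy' : Rabs (y - 0) < r2) by exact Hy. rewrite Rminus_0_r in Hy'.
    symmetry. apply is_pseries_unique. apply Ha; auto. }
  assert (Hfact : forall i, 0 < INR (Factorial.fact i)) by (intros; apply INR_fact_lt_0).
  assert (Hz : forall i, (i < 2 * k - 1)%nat -> a i = 0).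
  { intros i Hi. destruct i.
    - rewrite <- PSeries_0. rewrite (is_pseries_unique _ _ _ (Ha 0 ltac:(rewrite Rabs_R0; auto))). auto.
    - specialize (Hder (S i) ltac:(lia)). rewrite Hcoef in Hder. apply Rmult_integral in Hder.
      destruct Hder as [|E]; auto. specialize (Hfact (S i)). lra. }
  destruct (pseries_leading a (2 * k - 1) (fun x => vY f x 0) r2 Hr2 Ha Hz) as (h & Hh & Hh0 & K & r3 & Hr3 & HK & Hhd).
  set (r := Rmin r1 r3). assert (Hr : 0 < r /\ r <= r1 /\ r <= r3).
  { apply Rmin_pair; lra. }
  set (L := Rmax L1 L2).
  exists gX, gY, h, r, L, K. split; [lra|].
  split; [eapply lip_deriv_sub; [| |exact HX]; [lra|apply Rmax_l]|].
  split; [eapply lip_deriv_sub; [| |exact HY]; [lra|apply Rmax_r]|].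
  split; auto. split; [intros; apply Hh; lra|]. split; [intros; apply Hhd; lra|].
  rewrite Hcoef, Hh0. specialize (Hfact (2 * k - 1)%nat).
  assert (a (2 * k - 1)%nat <> 0). { intros E. apply Hlead. rewrite Hcoef, E. ring. }
  assert (0 < a (2 * k - 1)%nat * a (2 * k - 1)%nat) by (apply Rsqr_pos_lt; auto).
  rewrite <- Rmult_assoc. apply Rmult_lt_0_compat; auto.
Qed.

Lemma odd_minus_one k : (1 <= k)%nat -> Nat.Odd (2 * k - 1).
Proof. intros. exists (k - 1)%nat. lia. Qed.

(** Near the origin the horizontal component keeps away from 0, so that the slope is as regular as
    the field and behaves like x^(2 k - 1) h / vX on the line. The two signs of the hypothesis
    make the tangency invisible. The constants remain valid on smaller boxes, which lets both
    sides share one box. *)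
Lemma side_data f s d k : side s -> side d -> analytic_near_origin f -> (1 <= k)%nat -> tangency_order f k ->
  0 < s * d * vX f 0 0 -> d * dxY f (2 * k - 1) < 0 ->
  exists r0 c, 0 < r0 /\ 0 < c /\ forall r, 0 < r <= r0 -> exists L Fy h c0,
    (0 <= L /\ lip_on r L (vX f) /\ lip_on r L (vY f)) /\
    (forall x y, in_box r x y -> c <= s * d * vX f x y) /\ vY f 0 0 = 0 /\
    (forall x, Rabs x < r -> x <> 0 -> d * vY f x 0 * x < 0) /\
    half_system (slope s f) Fy r L (2 * k - 1) h c0.
Proof.
  intros Hs Hd Han Hk Htan HX HY.
  destruct (tangency_data f k Han Hk Htan) as (gX & gY & h & r1 & L & K & Hr1 & LX & LY & HK & Hh & Hhd & Hsgn).
  destruct Htan as (_ & HY0 & _).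
  assert (Hdh : d * h 0 < 0).
  { assert (0 < (d * d) * (h 0 * dxY f (2 * k - 1))) by (rewrite (side_sq d Hd); lra).
    replace ((d * d) * (h 0 * dxY f (2 * k - 1))) with ((d * h 0) * (d * dxY f (2 * k - 1))) in H by ring. nra. }
  set (X0 := s * d * vX f 0 0) in *. set (h0 := - (d * h 0)). assert (Hh0 : 0 < h0) by (unfold h0; lra).
  pose proof (ld_L LX) as HL1.
  set (c := Rmin (X0 / 2) 1). assert (Hc : 0 < c <= 1 /\ c <= X0 / 2).
  { split; [split; [apply Rmin_pos; lra|apply Rmin_r]|apply Rmin_l]. }
  set (r0 := Rmin r1 (Rmin (X0 / (4 * L)) (h0 / (2 * (K + 1))))).
  assert (A1 : 0 < X0 / (4 * L)) by (apply Rdiv_lt_0_compat; lra).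
  assert (A2 : 0 < h0 / (2 * (K + 1))) by (apply Rdiv_lt_0_compat; lra).
  assert (Hr0 : 0 < r0 /\ r0 <= r1 /\ r0 <= X0 / (4 * L) /\ r0 <= h0 / (2 * (K + 1))).
  { apply Rmin_triple; lra. }
  assert (B1 : L * (2 * r0) <= X0 / 2).
  { apply Rle_trans with (L * (2 * (X0 / (4 * L)))); [apply Rmult_le_compat_l; lra|right; field; lra]. }
  assert (B2 : K * r0 <= h0 / 2).
  { apply Rle_trans with ((K + 1) * (h0 / (2 * (K + 1)))); [|right; field; lra].
    apply Rmult_le_compat; lra. }
  exists r0, c. split; [lra|]. split; [lra|]. intros r Hr.
  assert (LX' := lip_deriv_sub _ _ r1 r L L ltac:(lra) (Rle_refl L) LX).
  assert (LY' := lip_deriv_sub _ _ r1 r L L ltac:(lra) (Rle_refl L) LY).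
  assert (Hsd : side (s * d)) by (apply side_mult; auto).
  assert (HXc : forall x y, in_box r x y -> c <= s * d * vX f x y).
  { intros x y B. assert (B0 : in_box r 0 0) by (split; rewrite Rabs_R0; lra).
    pose proof (ld_lip LX' x y 0 0 B B0) as Hl. rewrite !Rminus_0_r in Hl.
    assert (L * (Rabs x + Rabs y) <= L * (2 * r0)) by (apply Rmult_le_compat_l; destruct B; lra).
    rewrite <- (side_abs (s * d)) in Hl by auto. rewrite Rmult_minus_distr_l in Hl. fold X0 in Hl.
    apply Rabs_le_between in Hl. lra. }
  assert (HXa : forall x y, in_box r x y -> c <= Rabs (vX f x y)).
  { intros x y B. pose proof (HXc x y B) as H. rewrite <- (side_abs (s * d) (vX f x y) Hsd). pose proof (Rle_abs (s * d * vX f x y)). lra. }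
  assert (Hhlip : forall x x', Rabs x < r -> Rabs x' < r -> Rabs (h x - h x') <= K * Rabs (x - x')).
  { intros x x' Hx Hx'. apply derive_lip. intros z Hz. apply Hhd. apply Rabs_def2 in Hx, Hx'.
    apply Rabs_def1; revert Hz; unfold Rmin, Rmax; destruct (Rle_dec x x'); lra. }
  assert (Hhb : forall x, Rabs x < r -> h0 / 2 <= - (d * h x) <= 2 * h0).
  { intros x Hx. pose proof (Hhlip x 0 Hx ltac:(rewrite Rabs_R0; lra)) as Hl. rewrite Rminus_0_r in Hl.
    assert (K * Rabs x <= K * r0) by (apply Rmult_le_compat_l; lra).
    rewrite <- (side_abs d) in Hl by auto. rewrite Rmult_minus_distr_l in Hl. apply Rabs_le_between in Hl. unfold h0 in *. lra. }
  set (Li := 4 * L * L / (c * c * c)).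
  assert (LI := lip_deriv_inv (vX f) gX r L c (proj1 Hc) LX' HXa). fold Li in LI.
  set (Lm := Rmax L Li).
  assert (LQ := lip_deriv_mult _ _ _ _ r Lm (lip_deriv_sub _ _ r r L Lm (Rle_refl r) (Rmax_l _ _) LY')
     (lip_deriv_sub _ _ r r Li Lm (Rle_refl r) (Rmax_r _ _) LI)).
  pose proof (lip_deriv_reflect _ _ _ _ s Hs LQ) as LS.
  set (Q := 4 * Lm * Lm) in *.
  set (Lf := K / c + 2 * h0 * Li).
  assert (HLi : 1 <= Li) by (apply LI).
  assert (HLf : 0 <= Lf).
  { unfold Lf. assert (0 <= K / c) by (apply Rmult_le_pos; [auto|left; apply Rinv_0_lt_compat; lra]).
    assert (0 <= 2 * h0 * Li) by (apply Rmult_le_pos; lra). lra. }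
  set (LL := Q + Lf + L).
  assert (HQ1 : 1 <= Q) by (apply LS).
  assert (LS' := lip_deriv_sub _ _ r r Q LL (Rle_refl r) ltac:(unfold LL; lra) LS).
  eexists LL, _, (fun x => s * h x / vX f x 0), (h0 / (2 * L)).
  assert (Hbx : forall x, Rabs x < r -> in_box r x 0) by (intros; split; auto; rewrite Rabs_R0; lra).
  split; [|split; [exact HXc|split; [exact HY0|split]]].
  - split; [unfold LL; lra|]. split; (eapply lip_on_sub; [apply Rle_refl| |]); try apply LX'; try apply LY'; unfold LL; lra.
  - intros x Hx Hn. rewrite (Hh x ltac:(lra)). specialize (Hhb x Hx).
    replace (d * (x ^ (2 * k - 1) * h x) * x) with ((d * h x) * (x * x ^ (2 * k - 1))) by ring.
    assert (0 < x * x ^ (2 * k - 1)).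
    { rewrite tech_pow_Rmult. replace (S (2 * k - 1)) with (2 * k)%nat by lia. rewrite pow_mult. apply pow_lt.
      rewrite <- Rsqr_pow2. apply Rsqr_pos_lt; auto. }
    nra.
  - assert (Eslope : (fun x y => s * (vY f x (s * y) * / vX f x (s * y))) = slope s f).
    { apply functional_extensionality; intros x. apply functional_extensionality; intros y. unfold slope, Rdiv. ring. }
    cbv beta in LS'; rewrite Eslope in LS'. constructor.
    + lra.
    + exact (ld_L LS').
    + exact (ld_lip LS').
    + exact (ld_lipy LS').
    + exact (ld_bound LS').
    + exact (ld_taylor LS').
    + apply odd_minus_one; auto.
    + intros x Hx. unfold slope. rewrite Rmult_0_r, (Hh x ltac:(lra)). unfold Rdiv. ring.
    + intros x x' Hx Hx'.
      assert (NX : forall z, Rabs z < r -> vX f z 0 <> 0).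
      { intros z Hz E. specialize (HXa z 0 (Hbx z Hz)). rewrite E, Rabs_R0 in HXa. lra. }
      unfold Rdiv.
      replace (s * h x * / vX f x 0 - s * h x' * / vX f x' 0) with
        (s * ((h x - h x') * / vX f x 0 + h x' * (/ vX f x 0 - / vX f x' 0))) by ring.
      rewrite side_abs by auto. eapply Rle_trans; [apply Rabs_triang|]. rewrite !Rabs_mult.
      pose proof (ld_lip LI x 0 x' 0 (Hbx x Hx) (Hbx x' Hx')) as Hl. cbv beta in Hl.
      replace (0 - 0) with 0 in Hl by ring. rewrite Rabs_R0, Rplus_0_r in Hl.
      assert (T1 : Rabs (h x - h x') * Rabs (/ vX f x 0) <= K * Rabs (x - x') * / c).
      { apply Rmult_le_compat; try apply Rabs_pos; auto. rewrite Rabs_inv. apply Rinv_le_contravar; [lra|]. apply HXa; auto. }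
      assert (T2 : Rabs (h x') * Rabs (/ vX f x 0 - / vX f x' 0) <= 2 * h0 * (Li * Rabs (x - x'))).
      { apply Rmult_le_compat; try apply Rabs_pos; auto. rewrite <- (side_abs d) by auto.
        specialize (Hhb x' Hx'). rewrite Rabs_left; lra. }
      pose proof (Rabs_pos (x - x')).
      assert (0 <= (Q + L) * Rabs (x - x')) by (apply Rmult_le_pos; lra).
      unfold LL, Lf, Rdiv. lra.
    + apply Rdiv_lt_0_compat; lra.
    + intros x Hx. specialize (Hhb x Hx). specialize (HXc x 0 (Hbx x Hx)).
      destruct (ld_bound LX' x 0 (Hbx x Hx)) as [HXL _].
      assert (HXL' : s * d * vX f x 0 <= L).
      { rewrite <- (side_abs (s * d)) in HXL by auto. eapply Rle_trans; [apply Rle_abs|exact HXL]. }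
      set (Xx := s * d * vX f x 0) in *.
      assert (NX : vX f x 0 <> 0) by (intros E; unfold Xx in HXc; rewrite E in HXc; lra).
      assert (E : s * h x / vX f x 0 = - (- (d * h x) / Xx)).
      { unfold Xx. assert (Ess := side_sq s Hs). assert (Ns : s <> 0) by (intros E; rewrite E in Ess; lra).
        assert (Nd : d <> 0) by (intros E; pose proof (side_sq d Hd) as H; rewrite E in H; lra).
        apply Rmult_eq_reg_r with (s * d * vX f x 0); [|repeat apply Rmult_integral_contrapositive_currified; auto].
        field_simplify; auto. replace (s ^ 2) with (s * s) by ring. rewrite Ess. ring. }
      rewrite E. apply Ropp_le_contravar. unfold Rdiv.
      apply Rle_trans with (h0 / 2 * / L); [right; field; lra|].
      apply Rmult_le_compat; try lra; [left; apply Rinv_0_lt_compat; lra|apply Rinv_le_contravar; lra].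
Qed.

(** The unshifted system: both folds at 0, and the derivative g of the half-return map of the upper
    side with the estimate of dphi_modulus. Arcs stay in the box r / 4, which leaves room for
    shifts. *)
Record base (Z : filippov) (d r L c rho : R) (phi : R -> R -> R) (g : R -> R) : Prop := {
  bs_chart : chart Z d r L c (fun _ => 0);
  bs_rho : 0 < rho;
  bs_arc : forall s x, side s -> 0 < Rabs x < rho -> x * phi s x < 0 /\
    exists T U V, return_arc s (fld Z s) x (phi s x) T U V /\ arc_in_box (r / 4) T U V;
  bs_small : forall s e, side s -> 0 < e -> exists w, 0 < w /\ forall x, 0 < Rabs x < w ->
    exists T U V, return_arc s (fld Z s) x (phi s x) T U V /\ arc_in_box e T U V;
  bs_cont : forall s x, side s -> - rho < x < 0 -> continuity_pt (phi s) x;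
  bs_derive : forall x, - rho < x < 0 -> is_derive (phi 1) x (g x);
  bs_dec : forall a a', - rho < a -> a < a' -> a' < 0 -> phi 1 a' < phi 1 a;
  bs_mod : forall a a', - rho < a -> a < a' -> a' < 0 -> Rabs (g a - g a') <= 1 / 8 / (- a') * (a' - a) }.
Arguments bs_chart {Z d r L c rho phi g}.
Arguments bs_rho {Z d r L c rho phi g}.
Arguments bs_arc {Z d r L c rho phi g}.
Arguments bs_small {Z d r L c rho phi g}.
Arguments bs_cont {Z d r L c rho phi g}.
Arguments bs_derive {Z d r L c rho phi g}.
Arguments bs_dec {Z d r L c rho phi g}.
Arguments bs_mod {Z d r L c rho phi g}.

Lemma return_end s f x x' T U V e : return_arc s f x x' T U V -> arc_in_box e T U V -> Rabs x' < e.
Proof.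
  intros (_ & _ & _ & _ & E & _) HB. rewrite <- E. apply (HB T (proj2 (between_ends T))).
Qed.

Lemma arc_in_box_sub e r T U V : e <= r -> arc_in_box e T U V -> arc_in_box r T U V.
Proof. intros Hle HB t Ht. eapply in_box_sub; eauto. Qed.

(** Any half-return map in the sense of half_return_map satisfies the hypotheses of the quantitative
    study of arcs. *)
Lemma half_return_family Z d r L c s phi0 Fy n f c0 : chart Z d r L c (fun _ => 0) -> side s ->
  half_return_map s (fld Z s) phi0 ->
  half_system (slope s (fld Z s)) Fy r L n f c0 ->
  exists rho, 0 < rho /\
    (forall x, 0 < Rabs x < rho -> x * phi0 x < 0 /\
      exists T U V, return_arc s (fld Z s) x (phi0 x) T U V /\ arc_in_box (r / 4) T U V) /\
    exists eta, arc_family (slope s (fld Z s)) r rho phi0 eta.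
Proof.
  intros HC Hs [H0 Hret] HHS. pose proof (hs_r HHS) as Hr.
  assert (Hr4 : 0 < r / 4) by lra.
  destruct (Hret (mkposreal _ Hr4)) as [rho1 H1]. simpl in H1. pose proof (cond_pos rho1).
  set (rho := Rmin rho1 r). assert (Hrho : 0 < rho /\ rho <= rho1 /\ rho <= r).
  { apply Rmin_pair; lra. }
  exists rho. split; [lra|].
  assert (Harc : forall x, 0 < Rabs x < rho -> x * phi0 x < 0 /\
      exists T U V, return_arc s (fld Z s) x (phi0 x) T U V /\ arc_in_box (r / 4) T U V).
  { intros x Hx. destruct (H1 x ltac:(lra)) as [K (T & U & V & HA & HB)]. split; auto.
    exists T, U, V. split; auto. }
  split; auto.
  exists (fun a => epsilon (inhabits (fun _ => 0)) (fun e => graph_arc (slope s (fld Z s)) r a (phi0 a) e)).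
  constructor.
  - lra.
  - intros a Ha. apply (epsilon_spec (inhabits (fun _ : R => 0)) (fun e => graph_arc (slope s (fld Z s)) r a (phi0 a) e)).
    destruct (Harc a) as [K (T & U & V & HA & HB)]; [rewrite Rabs_left; lra|].
    assert (HB' : arc_in_box r T U V) by (eapply arc_in_box_sub; [|exact HB]; lra).
    destruct (graph_of_arc HC Hs HA HB') as (e & G & _).
    rewrite Rmin_left, Rmax_right in G by nra. exists e; auto.
  - intros a Ha. destruct (Harc a) as [K _]; [rewrite Rabs_left; lra|]. nra.
  - intros e He. destruct (Hret (mkposreal e He)) as [w Hw]. simpl in Hw. exists w. split; [apply cond_pos|].
    intros a Ha. destruct (Hw a) as [_ (T & U & V & HA & HB)]; [rewrite Rabs_left; lra|].
    pose proof (return_end _ _ _ _ _ _ _ _ HA HB). pose proof (Rle_abs (phi0 a)). lra.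
Qed.

Lemma sign_side x : x <> 0 -> side (sign x) /\ 0 < sign x * x.
Proof.
  intros Hx. destruct (Rlt_le_dec 0 x).
  - rewrite sign_eq_1 by auto. split; [left; auto|lra].
  - rewrite sign_eq_m1 by lra. split; [right; auto|lra].
Qed.

Lemma half_system_mono F Fy r L L' n f c0 : L <= L' -> half_system F Fy r L n f c0 -> half_system F Fy r L' n f c0.
Proof.
  intros HL [H1 H2 H3 H4 H5 H6 H7 H8 H9 H10 H11]. constructor; auto.
  - lra.
  - eapply lip_on_sub; [| |exact H3]; lra.
  - eapply lip_on_sub; [| |exact H4]; lra.
  - intros x y B. destruct (H5 x y B); split; lra.
  - intros x y y' B B'. eapply Rle_trans; [apply H6; auto|]. apply Rmult_le_compat_r; auto. apply pow2_ge_0.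
  - intros x x' Hx Hx'. eapply Rle_trans; [apply H9; auto|]. apply Rmult_le_compat_r; auto. apply Rabs_pos.
Qed.

Lemma base_exists Z kp km phip phim : analytic_near_origin (Zp Z) -> analytic_near_origin (Zm Z) ->
  monodromic_tangential Z kp km -> half_return_map 1 (Zp Z) phip -> half_return_map (-1) (Zm Z) phim ->
  exists r L c rho g, base Z (delta Z) r L c rho (fun s => if Rlt_dec 0 s then phip else phim) g.
Proof.
  intros Hanp Hanm (Hkp & Hkm & (Tp & Tm) & (C2p & C2m) & C3) Hp Hm.
  set (d := delta Z). destruct (sign_side (vX (Zp Z) 0 0) (proj1 Tp)) as [Hd HdX]. fold (delta Z) in Hd, HdX. fold d in Hd, HdX.
  pose proof side_p as S1. pose proof side_m as S2.
  destruct (side_data (Zp Z) 1 d kp S1 Hd Hanp Hkp Tp) as (rp & cp & Hrp & Hcp & Dp).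
  { lra. }
  { assert (0 < (d * vX (Zp Z) 0 0) * (- (d * dxY (Zp Z) (2 * kp - 1)))); [|nra].
    replace (d * vX (Zp Z) 0 0 * - (d * dxY (Zp Z) (2 * kp - 1))) with
      (- ((d * d) * (vX (Zp Z) 0 0 * dxY (Zp Z) (2 * kp - 1)))) by ring. rewrite (side_sq d Hd). lra. }
  assert (HdXm : 0 < -1 * d * vX (Zm Z) 0 0).
  { assert (0 < (d * vX (Zp Z) 0 0) * (-1 * d * vX (Zm Z) 0 0)); [|nra].
    replace (d * vX (Zp Z) 0 0 * (-1 * d * vX (Zm Z) 0 0)) with
      (- ((d * d) * (vX (Zp Z) 0 0 * vX (Zm Z) 0 0))) by ring. rewrite (side_sq d Hd). lra. }
  destruct (side_data (Zm Z) (-1) d km S2 Hd Hanm Hkm Tm HdXm) as (rm & cm & Hrm & Hcm & Dm).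
  { assert (0 < (-1 * d * vX (Zm Z) 0 0) * (- (d * dxY (Zm Z) (2 * km - 1)))); [|nra].
    replace (-1 * d * vX (Zm Z) 0 0 * - (d * dxY (Zm Z) (2 * km - 1))) with
      ((d * d) * (vX (Zm Z) 0 0 * dxY (Zm Z) (2 * km - 1))) by ring. rewrite (side_sq d Hd). lra. }
  set (r := Rmin rp rm). assert (Hr : 0 < r /\ r <= rp /\ r <= rm).
  { apply Rmin_pair; lra. }
  destruct (Dp r ltac:(lra)) as (Lp & Fyp & hp & c0p & (HLp & LXp & LYp) & HXp & HYp0 & HYp & HSp).
  destruct (Dm r ltac:(lra)) as (Lm & Fym & hm & c0m & (HLm & LXm & LYm) & HXm & HYm0 & HYm & HSm).
  set (L := Rmax Lp Lm). assert (HL : Lp <= L /\ Lm <= L) by (split; [apply Rmax_l|apply Rmax_r]).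
  set (c := Rmin cp cm). assert (Hc : 0 < c /\ c <= cp /\ c <= cm).
  { apply Rmin_pair; lra. }
  assert (HC : chart Z d r L c (fun _ => 0)).
  { constructor; auto.
    - split; [lra|]. split; [lra|]. intros s [-> | ->]; rewrite ?fld_p, ?fld_m; split;
      (eapply lip_on_sub; [apply Rle_refl| |]); eauto; lra.
    - lra.
    - intros s x y [-> | ->] B; rewrite ?fld_p, ?fld_m; [specialize (HXp x y B)|specialize (HXm x y B)]; lra.
    - intros s [-> | ->]; rewrite ?fld_p, ?fld_m, Rabs_R0; auto; split; auto; lra.
    - intros s x [-> | ->] Hx Hn; rewrite ?fld_p, ?fld_m, Rminus_0_r; auto. }
  pose proof (half_system_mono _ _ _ _ L _ _ _ (proj1 HL) HSp) as HSp'.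
  pose proof (half_system_mono _ _ _ _ L _ _ _ (proj2 HL) HSm) as HSm'.
  rewrite <- fld_p in Hp, HSp'. rewrite <- fld_m in Hm, HSm'.
  destruct (half_return_family Z d r L c 1 phip _ _ _ _ HC S1 Hp HSp') as (rhop & Hrhop & Ap & etap & AFp).
  destruct (half_return_family Z d r L c (-1) phim _ _ _ _ HC S2 Hm HSm') as (rhom & Hrhom & Am & etam & AFm).
  destruct (dphi_modulus _ _ _ _ _ _ _ HSp' _ _ _ AFp) as (w & Hw & Hwr & Hmod).
  set (rho := Rmin w rhom). assert (Hrho : 0 < rho /\ rho <= w /\ rho <= rhom).
  { apply Rmin_pair; lra. }
  set (phi := fun s => if Rlt_dec 0 s then phip else phim).
  assert (E1 : phi 1 = phip) by (unfold phi; destruct (Rlt_dec 0 1); [auto|lra]).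
  assert (E2 : phi (-1) = phim) by (unfold phi; destruct (Rlt_dec 0 (-1)); [lra|auto]).
  exists r, L, c, rho, (dphi Fyp (2 * kp - 1) hp phip etap). constructor; auto.
  - lra.
  - intros s x [-> | ->] Hx; [rewrite E1; apply Ap|rewrite E2; apply Am]; lra.
  - intros s e [-> | ->] He; [rewrite E1; destruct (proj2 Hp (mkposreal e He)) as [w1 Hw1]
      |rewrite E2; destruct (proj2 Hm (mkposreal e He)) as [w1 Hw1]]; simpl in Hw1; exists w1;
      (split; [apply cond_pos|]); intros x Hx; destruct (Hw1 x Hx) as [_ (T & U & V & HA & HB)]; exists T, U, V; auto.
  - intros s x [-> | ->] Hx; [rewrite E1; apply (phi_cont _ _ _ _ _ _ _ HSp' _ _ _ AFp)|
      rewrite E2; apply (phi_cont _ _ _ _ _ _ _ HSm' _ _ _ AFm)]; lra.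
  - intros x Hx. rewrite E1. apply (phi_derive _ _ _ _ _ _ _ HSp' _ _ _ AFp). lra.
  - intros a a' Ha1 Ha2 Ha3. rewrite E1. apply (phi_decr _ _ _ _ _ _ _ HSp' _ _ _ AFp); lra.
  - intros a a' Ha1 Ha2 Ha3. apply Hmod; lra.
Qed.

(** * The shifted family *)

Lemma even_leading_scal D rho v m e : side e -> even_leading D rho v m ->
  even_leading (fun x => e * D x) rho (e * v) m.
Proof.
  intros He [H1 H2 H3]. constructor; intros x Hx.
  - replace (e * v * (e * D x)) with ((e * e) * (v * D x)) by ring. rewrite side_sq, Rmult_1_l; auto.
  - rewrite !side_abs by auto. auto.
  - destruct (H3 x Hx) as (l & Hl & Hn & Hb). exists (e * l). split; [apply is_derive_Rscal; auto|].
    rewrite !side_abs by auto. split; auto.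
    replace (e * v * (e * l)) with ((e * e) * (v * l)) by ring. rewrite side_sq, Rmult_1_l; auto.
Qed.

Lemma even_leading_sub D rho rho' v m : rho' <= rho -> even_leading D rho v m -> even_leading D rho' v m.
Proof.
  intros Hle [H1 H2 H3]. constructor; intros x Hx; [apply H1|apply H2|apply H3]; lra.
Qed.

Lemma time_reversal_involutive W : time_reversal (time_reversal W) = W.
Proof.
  destruct W as [[X Y] [X' Y']]. unfold time_reversal, opposite_field. simpl.
  do 2 f_equal; do 2 (apply functional_extensionality; intro); ring.
Qed.

Lemma on_arc_rev W r s x x' p : on_arc W r s x x' p -> on_arc (time_reversal W) r s x x' p.
Proof.
  intros (T & U & V & tau & HA & HB & Ht & E).
  exists (- T), (fun t => U (- t)), (fun t => V (- t)), (- tau). rewrite fld_rev.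
  split; [apply return_arc_rev; auto|]. split; [apply arc_in_box_rev; auto|].
  rewrite Ropp_involutive. split; auto. apply between_opp. rewrite Ropp_involutive; auto.
Qed.

Lemma loop_rev W r x x' : loop (time_reversal W) r x x' = loop W r x x'.
Proof.
  apply functional_extensionality; intros p. apply propositional_extensionality.
  split; intros (s & Hs & Ha); exists s; split; auto.
  - rewrite <- (time_reversal_involutive W). apply on_arc_rev; auto.
  - apply on_arc_rev; auto.
Qed.

(** The inequalities on the displacement, with e the direction of the system, are those required by
    loop_stable. *)
Lemma loop_attracts W e r L c beta rho phi x0 x1 sigma : system W e r L c beta rho phi ->
  matched beta rho phi x0 x1 -> 0 < sigma ->
  (forall x, x0 - sigma < x < x0 -> e * (phi 1 x - phi (-1) x) < 0) ->
  (forall x, x0 < x < x0 + sigma -> 0 < e * (phi 1 x - phi (-1) x)) ->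
  asymptotically_stable W (loop W r x0 x1).
Proof.
  intros HS HM Hsig Hl Hr. apply (loop_stable _ _ _ _ _ _ _ _ HS x0 x1 sigma HM Hsig).
  - intros x Hx. specialize (Hl x Hx). destruct (ch_side (sy_chart HS)) as [-> | ->].
    + replace (- (1)) with (-1) by ring. lra.
    + replace (- -1) with 1 by ring. lra.
  - intros x Hx. specialize (Hr x Hx). destruct (ch_side (sy_chart HS)) as [-> | ->].
    + replace (- (1)) with (-1) by ring. lra.
    + replace (- -1) with 1 by ring. lra.
Qed.

(** The fold of the side s of the shifted family. *)
Definition fold_shift (b s : R) : R := if Rlt_dec 0 s then b else 0.

Lemma fold_shift_p b : fold_shift b 1 = b.
Proof. unfold fold_shift. destruct (Rlt_dec 0 1); [auto|lra]. Qed.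

Lemma fold_shift_m b : fold_shift b (-1) = 0.
Proof. unfold fold_shift. destruct (Rlt_dec 0 (-1)); [lra|auto]. Qed.

Lemma fold_shift_abs b s : Rabs (fold_shift b s) <= Rabs b.
Proof. unfold fold_shift. destruct (Rlt_dec 0 s); [lra|rewrite Rabs_R0; apply Rabs_pos]. Qed.

Lemma fld_shift Z b s x y : vX (fld (shift_family Z b) s) x y = vX (fld Z s) (x - fold_shift b s) y /\
  vY (fld (shift_family Z b) s) x y = vY (fld Z s) (x - fold_shift b s) y.
Proof. unfold fld, fold_shift. destruct (Rlt_dec 0 s); simpl; rewrite ?Rminus_0_r; auto. Qed.

Lemma chart_shift Z d r L c b : chart Z d r L c (fun _ => 0) -> Rabs b < r / 2 ->
  chart (shift_family Z b) d (r / 2) L c (fold_shift b).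
Proof.
  intros [H1 (Hr & HL & H2) H3 H4 H5 H6] Hb.
  assert (HB : forall s x y, in_box (r / 2) x y -> in_box r (x - fold_shift b s) y).
  { intros s x y [B1 B2]. split; [|lra]. pose proof (fold_shift_abs b s).
    pose proof (Rabs_triang x (- fold_shift b s)). rewrite Rabs_Ropp in H0. unfold Rminus. lra. }
  assert (H0 : forall x, Rabs x < r / 2 -> in_box (r / 2) x 0) by (intros x Hx; split; [auto|rewrite Rabs_R0; lra]).
  constructor; auto.
  - split; [lra|]. split; auto. intros s Hs. destruct (H2 s Hs) as [LX LY].
    split; intros x y x' y' B B'.
    + rewrite !(proj1 (fld_shift Z b s _ _)).
      replace (x - x') with ((x - fold_shift b s) - (x' - fold_shift b s)) by ring. apply LX; auto.
    + rewrite !(proj2 (fld_shift Z b s _ _)).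
      replace (x - x') with ((x - fold_shift b s) - (x' - fold_shift b s)) by ring. apply LY; auto.
  - intros s x y Hs B. rewrite (proj1 (fld_shift Z b s _ _)). apply H4; auto.
  - intros s Hs. split; [pose proof (fold_shift_abs b s); lra|].
    rewrite (proj2 (fld_shift Z b s _ _)), Rminus_diag. apply H5; auto.
  - intros s x Hs Hx Hn. rewrite (proj2 (fld_shift Z b s _ _)).
    pose proof (H6 s (x - fold_shift b s) Hs) as H. rewrite Rminus_0_r in H. apply H; [|lra].
    apply (HB s x 0). auto.
Qed.

Lemma return_arc_shift Z b s x x' T U V : return_arc s (fld Z s) (x - fold_shift b s) x' T U V ->
  return_arc s (fld (shift_family Z b) s) x (x' + fold_shift b s) T (fun t => U t + fold_shift b s) V.
Proof.
  intros (HT & Hd & E1 & E2 & E3 & E4 & Hp). split; auto. split.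
  - intros t Ht. rewrite (proj1 (fld_shift Z b s _ _)), (proj2 (fld_shift Z b s _ _)).
    replace (U t + fold_shift b s - fold_shift b s) with (U t) by ring. destruct (Hd t Ht). split; auto.
    eapply is_derive_eq; [apply is_derive_Rplus; [eassumption|apply @is_derive_const]|]. unfold zero; simpl; ring.
  - rewrite E1, E3. repeat split; auto. ring.
Qed.

Lemma arc_in_box_shift e b s T U V : arc_in_box e T U V ->
  arc_in_box (e + Rabs b) T (fun t => U t + fold_shift b s) V.
Proof.
  intros HB t Ht. destruct (HB t Ht) as [B1 B2]. pose proof (fold_shift_abs b s). pose proof (Rabs_pos b).
  split; [|lra]. eapply Rle_lt_trans; [apply Rabs_triang|]. lra.
Qed.

(** Only the upper side is shifted. *)
Definition shifted_return (phi : R -> R -> R) (b s x : R) : R := phi s (x - fold_shift b s) + fold_shift b s.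

Lemma system_shift Z d r L c rho phi g b : base Z d r L c rho phi g -> Rabs b < r / 4 ->
  system (shift_family Z b) d (r / 2) L c (fold_shift b) rho (shifted_return phi b).
Proof.
  intros [H1 H2 H3 _ H5 _ _ _] Hb. assert (Hr : 0 < r) by apply (ch_lip H1). constructor; auto.
  - apply chart_shift; auto. lra.
  - intros s x Hs Hx. destruct (H3 s _ Hs Hx) as [K (T & U & V & HA & HB)]. unfold shifted_return. split.
    + replace (phi s (x - fold_shift b s) + fold_shift b s - fold_shift b s) with (phi s (x - fold_shift b s)) by ring; auto.
    + exists T, (fun t => U t + fold_shift b s), V. split; [apply return_arc_shift; auto|].
      eapply arc_in_box_sub; [|apply arc_in_box_shift; exact HB]. lra.
  - intros s x Hs Hx. unfold shifted_return. apply (continuity_pt_plus (fun x => phi s (x - fold_shift b s)) (fun _ => fold_shift b s)).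
    + apply (continuity_pt_comp (fun x => x - fold_shift b s) (phi s)).
      * apply (continuity_pt_minus (fun x => x) (fun _ => fold_shift b s)); [apply continuity_pt_id|apply continuity_pt_const; intros ? ?; auto].
      * apply H5; auto; lra.
    + apply continuity_pt_const; intros ? ?; auto.
Qed.

Section ShiftedFamily.
Variables (Z : filippov) (d r L c rho : R) (phi : R -> R -> R) (g : R -> R).
Hypothesis HB : base Z d r L c rho phi g.
Variables (m : nat) (v rhoA : R).
Hypothesis Hm : (2 <= m)%nat.
Hypothesis Hv : v <> 0.
Hypothesis HrhoA : 0 < rhoA <= rho.
Hypothesis HD : even_leading (fun x => phi 1 x - phi (-1) x) rhoA v m.
Variable rho' : R.
Hypothesis Hs : small_rho rhoA v rho'.
Hypothesis Hsr : 4 * rho' <= r.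

Let D := fun x => phi 1 x - phi (-1) x.
Let sh := shifted (phi 1) D.

Let phi_d a : - rhoA < a < 0 -> is_derive (phi 1) a (g a).
Proof. intros. apply (bs_derive HB). lra. Qed.

Let phi_dec a a' : - rhoA < a -> a < a' -> a' < 0 -> phi 1 a' < phi 1 a.
Proof. intros. apply (bs_dec HB); lra. Qed.

Let g_mod a a' : - rhoA < a -> a < a' -> a' < 0 -> Rabs (g a - g a') <= 1 / 8 / (- a') * (a' - a).
Proof. intros. apply (bs_mod HB); lra. Qed.

Lemma shifted_displacement b x : sh b x = shifted_return phi b 1 x - shifted_return phi b (-1) x.
Proof. unfold sh, shifted, shifted_return, D. rewrite fold_shift_p, fold_shift_m, Rminus_0_r. ring. Qed.

Let Hr' : 0 < rho' /\ 2 * rho' <= rhoA.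
Proof. destruct Hs as (? & ? & _); auto. Qed.

Let HS b : Rabs b < rho' / 2 -> system (shift_family Z b) d (r / 2) L c (fold_shift b) rho (shifted_return phi b).
Proof. intros. apply system_shift with g; auto. lra. Qed.

(** The leftmost point of a small periodic orbit is a zero of the displacement. *)
Lemma orbit_zero b G u w T : 0 < Rabs b < rho' / 2 -> 0 < T ->
  (forall a b', a < b' -> trajectory_on (shift_family Z b) u w a b') ->
  (forall t, u (t + T) = u t /\ w (t + T) = w t) -> (exists t, (u t, w t) <> (u 0, w 0)) ->
  (forall p, G p <-> exists t, p = (u t, w t)) ->
  (forall x y, G (x, y) -> in_box (rho' / 2) x y) ->
  exists tl, w tl = 0 /\ - rho' / 2 < u tl < 0 /\ u tl < b /\ sh b (u tl) = 0.
Proof.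
  intros Hb HT Ht Hp Hn HG Hbox.
  assert (Hin : forall t, in_box (rho' / 2) (u t) (w t)) by (intros t; apply Hbox, HG; exists t; auto).
  assert (Hbeta : fold_shift b 1 <> fold_shift b (-1)).
  { rewrite fold_shift_p, fold_shift_m. intros E. rewrite E, Rabs_R0 in Hb. lra. }
  assert (Hclose : forall t s, Rabs (u t - fold_shift b s) < rho').
  { intros t s. destruct (Hin t) as [B1 _]. pose proof (fold_shift_abs b s).
    pose proof (Rabs_triang (u t) (- fold_shift b s)). rewrite Rabs_Ropp in H0. unfold Rminus. lra. }
  destruct (periodic_returns _ _ _ _ _ _ _ _ u w T (HS b ltac:(lra)) Hbeta HT Ht Hp) as (tl & xr & W0 & W1 & W2); auto.
  { intros t. split; [apply in_box_sub with (rho' / 2); [lra|apply Hin]|].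
    intros s Hs'. specialize (Hclose t s). lra. }
  exists tl. pose proof (W1 1 side_p) as Wp. pose proof (W1 (-1) side_m) as Wm.
  rewrite fold_shift_p in Wp. rewrite fold_shift_m in Wm.
  destruct (Hin tl) as [B1 _]. apply Rabs_def2 in B1.
  split; auto. split; [lra|]. split; [lra|].
  rewrite shifted_displacement, !W2; [ring|right; auto|left; auto].
Qed.

(** Here the shifted displacement has no zero, by shifted_same_sign. *)
Lemma no_orbit b G : 0 < b * v -> Rabs b < rho' / 2 -> periodic_orbit (shift_family Z b) G ->
  ~ forall x y, G (x, y) -> in_box (rho' / 2) x y.
Proof.
  intros Hbv Hb (u & w & T & HT & Ht & Hp & Hn & HG) Hbox.
  assert (Hb0 : 0 < Rabs b) by (apply Rabs_pos_lt; intros ->; lra).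
  destruct (orbit_zero b G u w T) as (tl & _ & H1 & H2 & H3); auto.
  apply Rabs_def2 in Hb.
  pose proof (shifted_same_sign (phi 1) D rhoA v m phi_dec HD b (u tl) Hbv ltac:(lra) ltac:(lra)) as H.
  fold sh in H. rewrite H3 in H. lra.
Qed.

Lemma on_loop_shift b x0 x1 p e : Rabs b < rho' / 2 -> e + Rabs b <= r / 2 ->
  (forall s, side s -> phi s (x0 - fold_shift b s) + fold_shift b s = x1 /\
    exists T U V, return_arc s (fld Z s) (x0 - fold_shift b s) (phi s (x0 - fold_shift b s)) T U V /\ arc_in_box e T U V) ->
  loop (shift_family Z b) (r / 2) x0 x1 p -> in_box (e + Rabs b) (fst p) (snd p).
Proof.
  intros Hb He Harcs (s & Hs' & Hp). destruct (Harcs s Hs') as [E (T & U & V & HA & HAB)].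
  apply return_arc_shift in HA. rewrite E in HA. apply (arc_in_box_shift e b s) in HAB.
  destruct (on_arc_spec (T := T) (U := fun t => U t + fold_shift b s) (V := V) (p := p)
    (sy_chart (HS b Hb)) Hs' HA) as (t & Ht & ->); auto.
  - eapply arc_in_box_sub; [|exact HAB]; auto.
  - apply HAB; auto.
Qed.

(** The zero x0 of the displacement can be chosen so close to the fold that both arcs from it are
    small. *)
Lemma loop_exists e : 0 < e -> exists b0, 0 < b0 /\ forall b, 0 < Rabs b < b0 -> b * v < 0 ->
  exists x0 x1, - rho' < x0 < 0 /\ x0 < b /\ sh b x0 = 0 /\
    matched (fold_shift b) rho (shifted_return phi b) x0 x1 /\
    forall p, loop (shift_family Z b) (r / 2) x0 x1 p -> in_box e (fst p) (snd p).
Proof.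
  intros He. set (e2 := Rmin (e / 2) (rho' / 2)).
  assert (He2 : 0 < e2 /\ e2 <= e / 2 /\ e2 <= rho' / 2).
  { apply Rmin_pair; lra. }
  destruct (bs_small HB 1 e2 side_p (proj1 He2)) as (w1 & Hw1 & A1).
  destruct (bs_small HB (-1) e2 side_m (proj1 He2)) as (w2 & Hw2 & A2).
  set (r' := Rmin (Rmin w1 w2) rho' / 2).
  assert (Hrr : 0 < r' /\ 2 * r' <= w1 /\ 2 * r' <= w2 /\ 2 * r' <= rho').
  { assert (0 < Rmin (Rmin w1 w2) rho') by (repeat apply Rmin_pos; lra).
    Rmin_bounds (Rmin w1 w2) rho'.
    Rmin_bounds w1 w2. unfold r'. lra. }
  destruct (shifted_zero_exists (phi 1) g D rhoA v m Hm Hv phi_d phi_dec HD rho' r' Hs (proj1 Hrr)) as (b1 & Hb1 & Hz).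
  set (b0 := Rmin b1 (Rmin r' e2)).
  assert (Hb0 : 0 < b0 /\ b0 <= b1 /\ b0 <= r' /\ b0 <= e2).
  { apply Rmin_triple; lra. }
  exists b0. split; [lra|]. intros b Hb Hbv.
  destruct (Hz b ltac:(lra) Hbv) as (x0 & X1 & X2 & X3 & X4). fold sh in X4.
  assert (Hneg : forall s, side s -> x0 < fold_shift b s).
  { intros s [-> | ->]; rewrite ?fold_shift_p, ?fold_shift_m; lra. }
  assert (Hclose : forall s, side s -> 0 < Rabs (x0 - fold_shift b s) < 2 * r').
  { intros s Hs'. pose proof (fold_shift_abs b s). pose proof (Rabs_maj2 (fold_shift b s)).
    pose proof (Rle_abs (fold_shift b s)). specialize (Hneg s Hs'). rewrite Rabs_left by lra. lra. }
  assert (Hret : forall s, side s -> shifted_return phi b s x0 = shifted_return phi b 1 x0).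
  { rewrite shifted_displacement in X4. intros s [-> | ->]; lra. }
  assert (Harcs : forall s, side s -> exists T U V,
    return_arc s (fld Z s) (x0 - fold_shift b s) (phi s (x0 - fold_shift b s)) T U V /\ arc_in_box e2 T U V).
  { intros s Hs'. specialize (Hclose s Hs'). destruct Hs' as [-> | ->]; [apply A1|apply A2]; lra. }
  exists x0, (shifted_return phi b 1 x0). split; [lra|]. split; auto. split; auto. split.
  - split; auto. intros s Hs'. specialize (Hneg s Hs'). specialize (Hclose s Hs'). rewrite Rabs_left in Hclose by lra.
    split; [lra|]. rewrite <- (Hret s Hs'). unfold shifted_return.
    destruct (bs_arc HB s (x0 - fold_shift b s) Hs') as [K _]; [rewrite Rabs_left; lra|].
    destruct (Harcs s Hs') as (T & U & V & HA & HAB). pose proof (return_end _ _ _ _ _ _ _ _ HA HAB) as Hend.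
    apply Rabs_def2 in Hend. split; [nra|lra].
  - intros p Hp. apply in_box_sub with (e2 + Rabs b); [lra|]. apply (on_loop_shift b x0 (shifted_return phi b 1 x0)); auto; try lra.
    intros s Hs'. split; auto. apply (Hret s Hs').
Qed.

Section Zero.
Variables (b x0 x1 : R).
Hypothesis Hb : 0 < Rabs b < rho' / 2.
Hypothesis Hbv : b * v < 0.
Hypothesis Hx0 : - rho' < x0 < 0.
Hypothesis Hx0b : x0 < b.
Hypothesis Hzero : sh b x0 = 0.
Hypothesis HM : matched (fold_shift b) rho (shifted_return phi b) x0 x1.

Let HSb := HS b (proj2 Hb).

Let Huniq := shifted_zero_unique (phi 1) g D rhoA v m (proj1 HrhoA) Hm Hv phi_d phi_dec g_mod HD rho' b x0 Hs
  ltac:(lra) Hbv Hx0 Hx0b Hzero.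

(** Any other periodic orbit near the loop gives a second zero of the displacement. *)
Lemma zero_limit_cycle : (forall p, loop (shift_family Z b) (r / 2) x0 x1 p -> in_box (rho' / 4) (fst p) (snd p)) ->
  limit_cycle (shift_family Z b) (loop (shift_family Z b) (r / 2) x0 x1).
Proof.
  intros Hsmall. split; [apply (loop_periodic _ _ _ _ _ _ _ _ HSb x0 x1 HM); tauto|].
  assert (He : 0 < rho' / 4) by lra. exists (mkposreal _ He). simpl.
  intros G' (u & w & T & HT & Ht & Hp & Hn & HG) Htube.
  assert (Hbox : forall x y, G' (x, y) -> in_box (rho' / 2) x y).
  { intros x y Hxy. destruct (tube_dist _ _ _ (Htube _ Hxy)) as (q & Hq & D1 & D2). simpl in D1, D2.
    destruct (Hsmall q Hq). pose proof (Rabs_triang_inv x (fst q)). pose proof (Rabs_triang_inv y (snd q)). split; lra. }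
  destruct (orbit_zero b G' u w T) as (tl & H0 & H1 & H2 & H3); auto.
  assert (E : u tl = x0).
  { destruct Huniq as (_ & U1 & U2). fold sh in U1, U2. destruct (Rtotal_order (u tl) x0) as [Hlt|[E|Hgt]]; auto; exfalso.
    - specialize (U1 (u tl) ltac:(lra)). rewrite H3 in U1. lra.
    - specialize (U2 (u tl) ltac:(lra) H2). rewrite H3 in U2. lra. }
  intros p. rewrite HG. apply (orbit_is_loop _ _ _ _ _ _ _ _ HSb u w T x0 x1 tl); auto.
Qed.

Lemma zero_hyperbolic : hyperbolic (shift_family Z b) (loop (shift_family Z b) (r / 2) x0 x1).
Proof.
  destruct Huniq as ((k & Hk & Hk0) & _). fold sh in Hk.
  apply (loop_hyperbolic _ _ _ _ _ _ _ _ HSb x0 x1 HM k); auto.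
  - eapply is_derive_ext; [|exact Hk]. intros x. apply shifted_displacement.
  - pose proof (sy_chart HSb) as HC.
    assert (Hr2 : 0 < r / 2) by apply (ch_lip HC).
    pose proof (ch_dir HC 1 0 0 side_p) as Hdir. rewrite fld_p in Hdir.
    specialize (Hdir ltac:(split; rewrite Rabs_R0; auto)). pose proof (ch_c HC).
    assert (Hn : vX (Zp (shift_family Z b)) 0 0 <> 0) by (intros E; rewrite E in Hdir; lra).
    unfold delta. destruct (sign_side _ Hn) as [Hsd _]. destruct Hsd as [-> | ->]; lra.
Qed.

Lemma zero_surrounds : surrounds_sliding_segment (shift_family Z b) (loop (shift_family Z b) (r / 2) x0 x1).
Proof.
  apply (loop_surrounds _ _ _ _ _ _ _ _ HSb x0 x1 HM). rewrite fold_shift_p, fold_shift_m.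
  intros E. pose proof Hb as Hb'. rewrite E, Rabs_R0 in Hb'. lra.
Qed.

Let sigma := Rmin (x0 + rho') (Rmin (- x0) (b - x0)).

Let Hsig : 0 < sigma /\ sigma <= x0 + rho' /\ sigma <= - x0 /\ sigma <= b - x0.
Proof.
  split; [unfold sigma; repeat apply Rmin_pos; lra|]. split; [apply Rmin_l|].
  split; (eapply Rle_trans; [apply Rmin_r|]); [apply Rmin_l|apply Rmin_r].
Qed.

Lemma zero_stable : d * v < 0 -> asymptotically_stable (shift_family Z b) (loop (shift_family Z b) (r / 2) x0 x1).
Proof.
  intros Hdv. destruct Huniq as (_ & U1 & U2). fold sh in U1, U2.
  assert (Hgen : forall y, (0 < v * y -> d * y < 0) /\ (v * y < 0 -> 0 < d * y)).
  { intros y. destruct (ch_side (sy_chart HSb)) as [-> | ->]; split; nra. }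
  apply (loop_attracts _ _ _ _ _ _ _ _ x0 x1 sigma HSb HM (proj1 Hsig)); intros x Hx; rewrite <- shifted_displacement;
    apply Hgen; [apply U1|apply U2]; lra.
Qed.

(** Reversing time preserves half-return maps and loops, and changes the sign of d. *)
Lemma zero_repelling : 0 < d * v -> repelling (shift_family Z b) (loop (shift_family Z b) (r / 2) x0 x1).
Proof.
  intros Hdv. destruct Huniq as (_ & U1 & U2). fold sh in U1, U2.
  assert (Hgen : forall y, (0 < v * y -> - d * y < 0) /\ (v * y < 0 -> 0 < - d * y)).
  { intros y. destruct (ch_side (sy_chart HSb)) as [-> | ->]; split; nra. }
  unfold repelling. rewrite <- loop_rev.
  apply (loop_attracts _ _ _ _ _ _ _ _ x0 x1 sigma (system_rev _ _ _ _ _ _ _ _ HSb) HM (proj1 Hsig)); intros x Hx;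
    rewrite <- shifted_displacement; apply Hgen; [apply U1|apply U2]; lra.
Qed.
End Zero.
End ShiftedFamily.

Lemma sign_neg_eq b x : x <> 0 -> sign b = - sign x -> b * x < 0.
Proof.
  intros Hx E. destruct (Rtotal_order b 0) as [Hb|[Hb|Hb]]; destruct (Rlt_le_dec 0 x) as [H|H];
    try rewrite (sign_eq_1 x) in E by lra; try rewrite (sign_eq_m1 x) in E by lra;
    [rewrite sign_eq_m1 in E by lra|rewrite sign_eq_m1 in E by lra|rewrite Hb, sign_0 in E|rewrite Hb, sign_0 in E|
     rewrite sign_eq_1 in E by lra|rewrite sign_eq_1 in E by lra]; nra.
Qed.

Lemma sign_eq_eq b x : x <> 0 -> sign b = sign x -> 0 < b * x.
Proof.
  intros Hx E. assert (0 < - (b * - x)); [|lra].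
  pose proof (sign_neg_eq b (- x) ltac:(lra)) as H. rewrite sign_opp, Ropp_involutive in H. specialize (H E). lra.
Qed.

Theorem proposition4 (Z : filippov) (kp km : nat) (V : nat -> R) (l : nat)
  (hanp : analytic_near_origin (Zp Z)) (hanm : analytic_near_origin (Zm Z))
  (hmono : monodromic_tangential Z kp km)
  (hV : lyapunov_coefficients Z V)
  (hl : (1 <= l)%nat) (hfirst : first_nonvanishing V (2 * l)) :
  exists U0 : R * R -> Prop, locally ((0, 0) : R * R) U0 /\
  forall U : R * R -> Prop, locally ((0, 0) : R * R) U ->
  exists I : R -> Prop, locally (0 : R) I /\
  forall b : R, I b ->
    (sign b = - sign (delta Z * V (2 * l)%nat) ->
       exists G : R * R -> Prop,
         (forall p, G p -> U p) /\
         limit_cycle (shift_family Z b) G /\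
         hyperbolic (shift_family Z b) G /\
         surrounds_sliding_segment (shift_family Z b) G /\
         (V (2 * l)%nat < 0 -> asymptotically_stable (shift_family Z b) G) /\
         (V (2 * l)%nat > 0 -> repelling (shift_family Z b) G)) /\
    (sign b = sign (delta Z * V (2 * l)%nat) ->
       (forall p, U p -> U0 p) ->
       ~ exists G : R * R -> Prop,
           (forall p, G p -> U p) /\ limit_cycle (shift_family Z b) G).
Proof.
  destruct hV as (phip & phim & Hp & Hm & rD & HDs). destruct hfirst as [Hz Hnz].
  destruct (base_exists Z kp km phip phim hanp hanm hmono Hp Hm) as (r & L & c & rho & g & HB).
  set (d := delta Z) in *. set (phi := fun s => if Rlt_dec 0 s then phip else phim) in *.
  assert (Hd : side d) by (apply (ch_side (bs_chart HB))).
  assert (E1 : phi 1 = phip) by (unfold phi; destruct (Rlt_dec 0 1); [auto|lra]).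
  assert (E2 : phi (-1) = phim) by (unfold phi; destruct (Rlt_dec 0 (-1)); [lra|auto]).
  assert (HV0 : V 0%nat = 0).
  { rewrite <- PSeries_0. rewrite (is_pseries_unique _ _ _ (HDs 0 ltac:(rewrite Rabs_R0; apply cond_pos))).
    unfold displacement. rewrite (proj1 Hp), (proj1 Hm). ring. }
  destruct (pseries_even_leading V _ rD l (cond_pos rD) HDs hl) as (rho2 & Hrho2 & HEL); auto.
  { intros i Hi. destruct i; [auto|apply Hz; lia]. }
  set (v := d * V (2 * l)%nat).
  assert (Hv : v <> 0) by (apply Rmult_integral_contrapositive_currified; auto; destruct Hd as [-> | ->]; lra).
  apply (even_leading_scal _ _ _ _ d Hd) in HEL. fold v in HEL.
  replace (fun x => d * displacement Z phip phim x) with (fun x => phi 1 x - phi (-1) x) in HEL.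
  2:{ apply functional_extensionality; intros x. rewrite E1, E2. unfold displacement. fold d.
      rewrite <- Rmult_assoc, side_sq by auto. ring. }
  pose proof (bs_rho HB) as Hrho.
  set (rhoA := Rmin rho rho2).
  assert (HrhoA : 0 < rhoA <= rho) by (split; [apply Rmin_pos; lra|apply Rmin_l]).
  assert (HELA := even_leading_sub _ rho2 rhoA _ _ (Rmin_r _ _) HEL).
  assert (Hr : 0 < r) by apply (ch_lip (bs_chart HB)).
  destruct (small_rho_exists rhoA v (proj1 HrhoA) Hv (r / 4) ltac:(lra)) as (rho' & Hs & Hsr).
  assert (Hsr' : 4 * rho' <= r) by lra.
  assert (Hr' : 0 < rho') by apply Hs.
  assert (Hm2 : (2 <= 2 * l)%nat) by lia.
  assert (Hq : 0 < rho' / 2) by lra.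
  exists (fun p => in_box (rho' / 2) (fst p) (snd p)). split.
  { exists (mkposreal _ Hq). intros [x y] [B1 B2].
    assert (B1' : Rabs (x - 0) < rho' / 2) by exact B1. assert (B2' : Rabs (y - 0) < rho' / 2) by exact B2.
    rewrite Rminus_0_r in B1', B2'. split; auto. }
  intros U [eU HU].
  set (e := Rmin eU (rho' / 4)).
  assert (He : 0 < e /\ e <= eU /\ e <= rho' / 4).
  { split; [apply Rmin_pos; [apply cond_pos|lra]|]. split; [apply Rmin_l|apply Rmin_r]. }
  destruct (loop_exists Z d r L c rho phi g HB (2 * l) v rhoA Hm2 Hv HrhoA HELA rho' Hs Hsr' e (proj1 He)) as (b0 & Hb0 & Hloop).
  set (bm := Rmin b0 (rho' / 2)).
  assert (Hbm : 0 < bm /\ bm <= b0 /\ bm <= rho' / 2).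
  { apply Rmin_pair; lra. }
  exists (fun b => Rabs b < bm). split.
  { exists (mkposreal _ (proj1 Hbm)). intros b Hb. assert (Hb' : Rabs (b - 0) < bm) by exact Hb.
    rewrite Rminus_0_r in Hb'; auto. }
  intros b Hb. split.
  - intros Hsg. apply sign_neg_eq in Hsg; auto. fold v in Hsg.
    assert (Hb1 : 0 < Rabs b) by (apply Rabs_pos_lt; intros ->; lra).
    destruct (Hloop b ltac:(lra) Hsg) as (x0 & x1 & X1 & X2 & X3 & HM & Hbox).
    assert (Hb2 : 0 < Rabs b < rho' / 2) by lra.
    exists (loop (shift_family Z b) (r / 2) x0 x1). split; [|split; [|split; [|split; [|split]]]].
    + intros [x y] Hxy. apply Hbox in Hxy. destruct Hxy as [B1 B2]. simpl in B1, B2. apply HU.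
      split; [change (Rabs (x - 0) < eU)|change (Rabs (y - 0) < eU)]; rewrite Rminus_0_r; lra.
    + eapply zero_limit_cycle; eauto. intros p Hp'. apply in_box_sub with e; [lra|auto].
    + eapply zero_hyperbolic; eauto.
    + eapply zero_surrounds; eauto.
    + intros HV. eapply zero_stable; eauto. unfold v. rewrite <- Rmult_assoc, side_sq by auto. lra.
    + intros HV. eapply zero_repelling; eauto. unfold v. rewrite <- Rmult_assoc, side_sq by auto. lra.
  - intros Hsg HU0 (G & HGU & HG & _). apply sign_eq_eq in Hsg; auto. fold v in Hsg.
    apply (no_orbit Z d r L c rho phi g HB (2 * l) v rhoA HrhoA HELA rho' Hs Hsr' b G); auto; [lra|].
    intros x y Hxy. apply (HU0 (x, y)). auto.
Qed.
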